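(* (Least squares method.) Let $\Omega\subseteq\mathbb{R}^2$ be a bounded simply connected domain with analytic boundary and regular analytic parametrization $\gamma$, and let $S_0$ be the modified Symm integral operator on $L^2(0,2\pi)$ associated with $\gamma$. Let $r\ge 0$. There exists $c>0$ such that the following holds. Let $g\in H^{r+1}(0,2\pi)$, let $\Psi^\dagger\in H^r(0,2\pi)$ be the unique solution of $S_0\Psi^\dagger=g$, let $\delta\ge0$, let $g^\delta\in L^2(0,2\pi)$ satisfy $\|g^\delta-g\|_{L^2}\le\delta$, and let $n\ge1$ and $X_n=\mathrm{span}\{e^{ikt}\}_{k=-n}^{n}$. Let $\Psi_n^\delta\in X_n$ be the least squares solution, that is, $$(S_0\Psi_n^\delta,S_0\psi_n)=(g^\delta,S_0\psi_n)\quad\text{for all }\psi_n\in X_n.$$ Then $$\|\Psi^\dagger-\Psi_n^\delta\|_{L^2}\le c\Big(n\delta+\frac{1}{n^r}\|\Psi^\dagger\|_{H^r}\Big).$$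
   Context: The boundary has a regular analytic parametrization $\partial\Omega=\{\gamma(t):t\in[0,2\pi)\}$, where $\gamma:\mathbb{R}\to\mathbb{R}^2$ is real-analytic, $2\pi$-periodic, injective on $[0,2\pi)$, and $|\gamma'(t)|>0$ for all $t$. $|\partial\Omega|$ denotes the length of $\partial\Omega$. The modified Symm integral operator is $$(S_0\Psi)(t)=\int_0^{2\pi}G(t,s)\Psi(s)\,ds,\quad t\in[0,2\pi),$$ $$G(t,s)=-\frac{1}{2\pi}\ln|\gamma(t)-\gamma(s)|+\frac{1}{2\pi}\frac{1}{|\partial\Omega|}\int_0^{2\pi}\ln|\gamma(t)-\gamma(\sigma)|\,|\gamma'(\sigma)|\,d\sigma+\frac{1}{|\partial\Omega|}.$$ $H^r(0,2\pi)$ is the $2\pi$-periodic (complex-valued) Sobolev space of order $r$, with norm $\|x\|_{H^r}^2=\sum_{k\in\mathbb{Z}}(1+k^2)^r|a_k|^2$ in terms of the Fourier coefficients $a_k$ of $x$; $(\cdot,\cdot)$ is the inner product of $L^2(0,2\pi)$. *)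

(* Defs.v *)
From HB Require Import structures.
From mathcomp Require Import all_boot all_order all_algebra.
From mathcomp Require Import complex.
From mathcomp Require Import all_classical all_reals all_analysis.

Set Implicit Arguments.
Unset Strict Implicit.
Unset Printing Implicit Defensive.

Import Order.TTheory GRing.Theory Num.Theory.
Import numFieldNormedType.Exports.

Local Open Scope classical_set_scope.
Local Open Scope ring_scope.

Section Geometry.
Context {R : realType}.

(* The norm that the library puts on [R * R] is the sup norm; it induces the
   right topology, but the kernel below needs the Euclidean length. *)
Definition enorm (x : R * R) : R := Num.sqrt (x.1 ^+ 2 + x.2 ^+ 2).

Definition real_analytic (f : R -> R) : Prop :=
  forall t0 : R, exists (a : nat -> R) (rho : R), 0 < rho /\
    forall t, `|t - t0| < rho -> pseries a (t - t0) @ \oo --> f t.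

Definition velocity (gamma : R -> R * R) (t : R) : R * R :=
  (derive1 (fst \o gamma) t, derive1 (snd \o gamma) t).

Record regular_analytic_parametrization (gamma : R -> R * R) : Prop := {
  param_analytic1 : real_analytic (fst \o gamma);
  param_analytic2 : real_analytic (snd \o gamma);
  param_periodic : forall t, gamma (t + 2 * pi) = gamma t;
  param_injective : {in `[0, 2 * pi[ &, injective gamma};
  param_regular : forall t, 0 < enorm (velocity gamma t)
}.

Definition boundary (T : topologicalType) (A : set T) : set T :=
  closure A `\` interior A.

Definition unit_itv : set R := `[0, 1]%classic.

(* Every loop in [A] contracts, through loops in [A], to a point. *)
Definition loops_contract (T : topologicalType) (A : set T) : Prop :=
  forall p : R -> T,
    {within unit_itv, continuous p} ->
    (forall s, unit_itv s -> A (p s)) -> p 0 = p 1 ->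
    exists h : R * R -> T,
      [/\ {within unit_itv `*` unit_itv, continuous h},
          forall z, (unit_itv `*` unit_itv) z -> A (h z),
          forall s, unit_itv s -> h (0, s) = p s,
          forall u, unit_itv u -> h (u, 0) = h (u, 1) &
          exists x : T, forall s, unit_itv s -> h (1, s) = x].

(* Path-connectedness is not listed: it follows for open connected sets. *)
Record bounded_simply_connected_domain (Omega : set (R * R)) : Prop := {
  domain_open : open Omega;
  domain_nonempty : Omega !=set0;
  domain_connected : connected Omega;
  domain_bounded : bounded_set Omega;
  domain_simply : loops_contract Omega
}.

End Geometry.

Section PeriodicFunctions.
Context {R : realType}.
Local Notation C := R[i].
Local Notation mu := (@lebesgue_measure R).

Definition period : set R := `[0, 2 * pi]%classic.

Definition Cintegral (f : R -> C) : C :=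
  Complex (\int[mu]_(t in period) complex.Re (f t)) (\int[mu]_(t in period) complex.Im (f t)).

(* [normc] is the modulus with values in [R]; [`|z|] is its image in [R[i]]. *)
Definition modulus (z : C) : R := ComplexField.Normc.normc z.

(* Elements of L^2(0,2pi) are represented by functions; two of them are the
   same element when they agree almost everywhere on the period. *)
Definition L2 : set (R -> C) := [set f |
  [/\ measurable_fun period (fun t => complex.Re (f t)),
      measurable_fun period (fun t => complex.Im (f t)) &
      (\int[mu]_(t in period) ((modulus (f t)) ^+ 2)%:E < +oo)%E]].

Definition L2eq (f g : R -> C) : Prop :=
  {ae mu, forall t, period t -> f t = g t}.

Definition inner (f g : R -> C) : C :=
  Cintegral (fun t => f t * conjc (g t)).

Definition L2norm (f : R -> C) : R :=
  Num.sqrt (\int[mu]_(t in period) (modulus (f t)) ^+ 2).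

Definition cexp (k : int) (t : R) : C :=
  Complex (cos (k%:~R * t)) (sin (k%:~R * t)).

Definition fourier (f : R -> C) (k : int) : C :=
  Cintegral (fun t => f t * cexp (- k) t) / (2 * pi)%:C%C.

Definition sobolev_sum (r : R) (f : R -> C) : \bar R :=
  \esum_(k in [set: int])
    ((1 + (k%:~R) ^+ 2) `^ r * (modulus (fourier f k)) ^+ 2)%:E.

(* H^r(0,2pi) for r >= 0, as a subspace of L^2(0,2pi). *)
Definition Sobolev (r : R) : set (R -> C) :=
  [set f | L2 f /\ (sobolev_sum r f < +oo)%E].

Definition Sobolev_norm (r : R) (f : R -> C) : R :=
  Num.sqrt (fine (sobolev_sum r f)).

Definition trig_space (n : nat) : set (R -> C) := [set p |
  exists c : int -> C, forall t,
    p t = \sum_(j < (2 * n).+1) c (j%:Z - n%:Z) * cexp (j%:Z - n%:Z) t].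

End PeriodicFunctions.

Section Symm.
Context {R : realType}.
Local Notation C := R[i].
Local Notation mu := (@lebesgue_measure R).
Variable gamma : R -> R * R.

Definition curve_length : R :=
  \int[mu]_(s in period) enorm (velocity gamma s).

(* [ln 0 = 0], which only affects the null set of [s] with
   [gamma t = gamma s]. *)
Definition logdist (t s : R) : R := ln (enorm (gamma t - gamma s)).

Definition symm_kernel (t s : R) : R :=
  - (2 * pi)^-1 * logdist t s
  + (2 * pi)^-1 * curve_length^-1
    * (\int[mu]_(sigma in period) (logdist t sigma * enorm (velocity gamma sigma)))
  + curve_length^-1.

Definition S0 (Psi : R -> C) (t : R) : C :=
  Cintegral (fun s => (symm_kernel t s)%:C%C * Psi s).

Definition least_squares_solution (n : nat) (gdelta Psi : R -> C) : Prop :=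
  trig_space n Psi /\
  forall psi, trig_space n psi -> inner (S0 Psi) (S0 psi) = inner gdelta (S0 psi).

End Symm.

(* Main.v *)
Require Import Defs.
From HB Require Import structures.
From mathcomp Require Import all_boot all_order all_algebra.
From mathcomp Require Import complex lra ring.
From mathcomp Require Import all_classical all_reals all_analysis.
From mathcomp Require Import measurable_realfun.
Import Order.TTheory GRing.Theory Num.Theory.
Import numFieldNormedType.Exports.
Local Open Scope classical_set_scope.
Local Open Scope ring_scope.
Set Implicit Arguments.
Unset Strict Implicit.
Unset Printing Implicit Defensive.

(** Let P be the orthogonal projection of L^2 onto X_n.  The normal equations make the image of the
    least squares solution the point of S0(X_n) nearest to the data, so the image of its difference
    with P Psi is no larger than the distance of the data to S0 (P Psi), which is at most
    delta + |S0 (Psi - P Psi)|.  Two properties of S0 then give the theorem: S0 gains one power of n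
    on functions orthogonal to X_n (kop_high), and it loses at most one power of n on X_n
    (kop_low), that is |psi| <= C n |S0 psi| there.  Hence the error is at most a constant times
    n delta + |Psi - P Psi|, and the last term is a Fourier tail, bounded by n^(-r) times the norm
    of Psi in H^r (sobolev_tail).  The kernel is real, so all this is carried out for real functions
    and the real trigonometric basis (real_least_squares, least_squares_error).

    Both properties come from the structure of the kernel.  The difference of two values of a smooth
    periodic function is 2 sin ((s - t) / 2) times a smooth function of (t, s), because each of its
    harmonics can be divided (cos_diff_quotient, diff_quotient).  Therefore
      ln |gamma t - gamma s| = ln |2 sin ((s - t) / 2)| + b(t, s)
    with b smooth and periodic in both variables (log_kernel_split).  The first term is the kernel of
    a convolution, with eigenvalue - pi / k at the frequency k (lnsin_ebas), and the Fourier
    coefficients of b decay rapidly (decay_matrix).  So S0 maps the basis function e_i to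
    al_i e_i + r_i, where al_i is of the exact order 1 / i and r_i is smaller, and the gain on high
    modes follows.  For the lower bound, the matrix of S0 is I + N multiplied by the diagonal matrix
    of the al_i, where the entries of N decay in both indices; a compactness argument shows that I + N
    is bounded below as soon as it is injective (fredholm_bounded_below).  A null vector of I + N
    decays fast enough to come from a continuous function psi with S0 psi = 0 (Nmx_inj).

    It remains to see that such a psi vanishes.  After subtraction of a multiple of |gamma'| it has
    mean zero and a constant logarithmic potential, hence its logarithmic energy is zero, and it is
    enough that this energy is positive definite (log_energy_injective).  With rho the squared
    distance of two curve points, - ln (e + rho) is, up to functions of one variable, a sum of terms
    - ln (1 - z) for positive semidefinite kernels z, which are positive semidefinite because the
    logarithmic series has nonnegative coefficients.  When e tends to 0 this shows that the energy
    of each power of 1 / (1 + rho) is zero too, so psi is orthogonal to all the powers of the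
    functions s |-> 1 / (1 + rho(t, s)), which peak at s = t; hence psi(t) = 0
    (peak_orthogonal).  The same peak argument proves the completeness of the trigonometric basis,
    from which the Parseval identity is derived by density. *)

(** * Integrals over one period *)

Section PeriodIntegral.
Context {R : realType}.
Local Notation mu := (@lebesgue_measure R).
Implicit Types (f g h : R -> R) (a : R).

Definition pint f : R := \int[mu]_(t in period) f t.
Definition pin f : Prop := mu.-integrable period (EFin \o f).
Definition pmeas f : Prop := measurable_fun (period : set R) f.

Lemma twopi_gt0 : 0 < 2 * pi :> R.
Proof. by rewrite mulr_gt0// pi_gt0. Qed.

Lemma measurable_period : measurable (period : set (measurableTypeR R)).
Proof. exact: measurable_itv. Qed.
Hint Resolve measurable_period : core.

Lemma mu_period : mu (period : set R) = (2 * pi)%:E.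
Proof. by rewrite /period lebesgue_measure_itv/= lte_fin twopi_gt0 -EFinD subr0. Qed.

Lemma pin_meas f : pin f -> pmeas f.
Proof. by case/integrableP => /measurable_EFinP. Qed.

Lemma pmeas_cts f : continuous f -> pmeas f.
Proof. by move=> cf; apply: measurable_funTS; exact: continuous_measurable_fun. Qed.

Lemma pin_cts f : continuous f -> pin f.
Proof.
move=> cf; apply: continuous_compact_integrable; first exact: segment_compact.
exact: continuous_subspaceT.
Qed.

Lemma pin_le f g : pmeas f -> (forall t, period t -> `|f t| <= g t) -> pin g -> pin f.
Proof.
move=> mf fg; apply: le_integrable => //.
  exact/measurable_EFinP.
move=> t pt /=; rewrite lee_fin (le_trans (fg _ pt))// ler_norm//.
Qed.

Lemma eq_pin f g : (forall t, period t -> f t = g t) -> pin f -> pin g.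
Proof.
move=> fg; apply: eq_integrable; first exact: measurable_period.
by move=> x /set_mem xp /=; rewrite fg.
Qed.

Lemma eq_pint f g : (forall t, period t -> f t = g t) -> pint f = pint g.
Proof. by move=> fg; apply: eq_Rintegral => x /set_mem xp; exact: fg. Qed.

Lemma pinD f g : pin f -> pin g -> pin (fun t => f t + g t).
Proof. by rewrite /pin => pf pg; exact: (integrableD measurable_period pf pg). Qed.

Lemma pinB f g : pin f -> pin g -> pin (fun t => f t - g t).
Proof. by rewrite /pin => pf pg; exact: (integrableB measurable_period pf pg). Qed.

Lemma pinZ a f : pin f -> pin (fun t => a * f t).
Proof. by rewrite /pin => pf; exact: (integrableZl measurable_period a pf). Qed.

Lemma pin_cst a : pin (fun=> a).
Proof. by apply: pin_cts; exact: cst_continuous. Qed.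

Lemma pin_norm f : pin f -> pin (fun t => `|f t|).
Proof. by move=> pf; exact: integrable_norm. Qed.

Lemma pin_sum n (F : nat -> R -> R) : (forall i, (i < n)%N -> pin (F i)) ->
  pin (fun t => \sum_(i < n) F i t).
Proof.
elim: n => [|n IH] pF.
  by apply: eq_pin (pin_cst 0) => t _; rewrite big_ord0.
have IH' := IH (fun i hi => pF i (leqW hi)).
by apply: eq_pin (pinD IH' (pF n (ltnSn n))) => t _; rewrite big_ord_recr.
Qed.

Lemma pin_mulb f g M : pmeas g -> (forall t, period t -> `|g t| <= M) -> pin f ->
  pin (fun t => g t * f t).
Proof.
move=> mg gM pf; apply: (pin_le (g := fun t => M * `|f t|)).
- apply: measurable_funM => //; exact: pin_meas.
- by move=> t pt; rewrite normrM ler_wpM2r// gM.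
- exact/pinZ/pin_norm.
Qed.

Lemma cts_bounded f : continuous f -> exists2 M : R, 0 < M & forall t, period t -> `|f t| <= M.
Proof.
move=> cf.
have [] := @EVT_max R (fun t => `|f t|) 0 (2 * pi) (ltW twopi_gt0).
  by apply: continuous_subspaceT => t; apply: continuous_comp (cf t) _; exact: norm_continuous.
move=> c _ cmax; exists (`|f c| + 1); first by rewrite ltr_wpDl.
by move=> t pt; rewrite (le_trans (cmax _ pt))// lerDl.
Qed.

Lemma pin_mulc f g : continuous g -> pin f -> pin (fun t => g t * f t).
Proof.
move=> cg pf; have [M _ gM] := cts_bounded cg.
exact: pin_mulb (pmeas_cts cg) gM pf.
Qed.

Lemma pintD f g : pin f -> pin g -> pint (fun t => f t + g t) = pint f + pint g.
Proof. by move=> pf pg; exact: RintegralD. Qed.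

Lemma pintB f g : pin f -> pin g -> pint (fun t => f t - g t) = pint f - pint g.
Proof. by move=> pf pg; exact: RintegralB. Qed.

Lemma pintZ a f : pin f -> pint (fun t => a * f t) = a * pint f.
Proof. by move=> pf; exact: RintegralZl. Qed.

Lemma pint_cst a : pint (fun=> a) = a * (2 * pi).
Proof.
rewrite /pint (Rintegral_cst mu measurable_period); congr (a * _).
exact: (congr1 fine mu_period).
Qed.

Lemma pintN f : pin f -> pint (fun t => - f t) = - pint f.
Proof.
move=> pf; rewrite -mulN1r -pintZ//; apply: eq_pint => t _; by rewrite mulN1r.
Qed.

Lemma pint_ge0 f : (forall t, period t -> 0 <= f t) -> 0 <= pint f.
Proof. by move=> h; apply: Rintegral_ge0 => t; exact: h. Qed.

Lemma pint_le f g : pin f -> pin g -> (forall t, period t -> f t <= g t) -> pint f <= pint g.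
Proof. by move=> pf pg fg; exact: le_Rintegral. Qed.

Lemma pint_normr f : pin f -> `|pint f| <= pint (fun t => `|f t|).
Proof. by move=> pf; exact: le_normr_Rintegral. Qed.

Lemma pint_norm_le f g : pin f -> pin g -> (forall t, period t -> `|f t| <= g t) ->
  `|pint f| <= pint g.
Proof.
move=> pf pg fg; apply: le_trans (pint_normr pf) _.
by apply: pint_le => //; exact: pin_norm.
Qed.

Lemma pint_bound f M : pin f -> (forall t, period t -> `|f t| <= M) ->
  `|pint f| <= M * (2 * pi).
Proof. by move=> pf fM; rewrite -pint_cst; apply: pint_norm_le => //; exact: pin_cst. Qed.

Lemma pint_sum n (F : nat -> R -> R) : (forall i, (i < n)%N -> pin (F i)) ->
  pint (fun t => \sum_(i < n) F i t) = \sum_(i < n) pint (F i).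
Proof.
elim: n => [|n IH] pF.
  rewrite big_ord0 -[RHS](mul0r (2 * pi)) -pint_cst.
  by apply: eq_pint => t _; rewrite big_ord0.
rewrite big_ord_recr/= -IH; last by move=> i h; exact: pF (leqW h).
rewrite -pintD; last 2 first.
- by apply: pin_sum => i h; exact: pF (leqW h).
- exact: pF.
by apply: eq_pint => t _; rewrite big_ord_recr.
Qed.

Definition sqint f : Prop := pmeas f /\ pin (fun t => f t ^+ 2).
Definition ip f g : R := pint (fun t => f t * g t).
Definition nsq f : R := ip f f.

Lemma sqint_mul f g : sqint f -> sqint g -> pin (fun t => f t * g t).
Proof.
move=> [mf if2] [mg ig2]; apply: (pin_le (g := fun t => f t ^+ 2 + g t ^+ 2)).
- exact: measurable_funM.
- move=> t _; rewrite ler_norml; apply/andP; split.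
  + have := sqr_ge0 (f t + g t); have := sqr_ge0 (f t); have := sqr_ge0 (g t).
    rewrite sqrrD; set x := f t ^+ 2; set y := g t ^+ 2; set z := f t * g t.
    by rewrite mulr2n; lra.
  + have := sqr_ge0 (f t - g t); have := sqr_ge0 (f t); have := sqr_ge0 (g t).
    rewrite sqrrB; set x := f t ^+ 2; set y := g t ^+ 2; set z := f t * g t.
    by rewrite mulr2n; lra.
- exact: pinD.
Qed.

Lemma sqint_cts f : continuous f -> sqint f.
Proof.
move=> cf; split; first exact: pmeas_cts.
apply: pin_cts => t; apply: (@continuous_comp _ _ _ f (fun x => x ^+ 2)); first exact: cf.
exact: exprn_continuous.
Qed.

Lemma sqint_pin f : sqint f -> pin f.
Proof.
move=> sf; apply: eq_pin (sqint_mul sf (sqint_cts (@cst_continuous R R 1))) => t _.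
by rewrite mulr1.
Qed.

Lemma sqint_pin_sqr f g : pmeas f -> pin g -> (forall t, period t -> f t ^+ 2 <= g t) -> sqint f.
Proof.
move=> mf pg fg; split => //; apply: pin_le pg.
  by apply: measurable_funX.
by move=> t pt; rewrite ger0_norm ?sqr_ge0// fg.
Qed.

Lemma sqint_bounded f M : pmeas f -> (forall t, period t -> `|f t| <= M) -> sqint f.
Proof.
move=> mf fM; apply: (sqint_pin_sqr mf (pin_cst (M ^+ 2))) => t pt.
by rewrite -(real_normK (num_real (f t))) lerXn2r ?nnegrE ?fM// (le_trans _ (fM _ pt)).
Qed.

Lemma sqintD f g : sqint f -> sqint g -> sqint (fun t => f t + g t).
Proof.
move=> sf sg; split; first exact: measurable_funD sf.1 sg.1.
apply: eq_pin (pinD (pinD sf.2 sg.2) (pinZ 2 (sqint_mul sf sg))) => t _; by ring.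
Qed.

Lemma sqintZ a f : sqint f -> sqint (fun t => a * f t).
Proof.
move=> sf; split; first by apply: measurable_funM sf.1; exact: measurable_cst.
by apply: eq_pin (pinZ (a ^+ 2) sf.2) => t _; rewrite exprMn.
Qed.

Lemma sqintB f g : sqint f -> sqint g -> sqint (fun t => f t - g t).
Proof.
move=> sf sg; have := sqintD sf (sqintZ (-1) sg).
by congr sqint; apply/funext => t; rewrite mulN1r.
Qed.

Lemma sqint_sum n (F : nat -> R -> R) : (forall i, (i < n)%N -> sqint (F i)) ->
  sqint (fun t => \sum_(i < n) F i t).
Proof.
elim: n => [|n IH] pF.
  under eq_fun do rewrite big_ord0; exact: sqint_cts (@cst_continuous R R 0).
under eq_fun do rewrite big_ord_recr.
apply: sqintD; [by apply: IH => i h; exact: pF (leqW h)|exact: pF].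
Qed.

Lemma ipC f g : ip f g = ip g f.
Proof. by apply: eq_pint => t _; rewrite mulrC. Qed.

Lemma ipDl f g h : sqint f -> sqint g -> sqint h ->
  ip (fun t => f t + g t) h = ip f h + ip g h.
Proof.
move=> sf sg sh; rewrite -pintD; try exact: sqint_mul.
by apply: eq_pint => t _; rewrite mulrDl.
Qed.

Lemma ipBl f g h : sqint f -> sqint g -> sqint h ->
  ip (fun t => f t - g t) h = ip f h - ip g h.
Proof.
move=> sf sg sh; rewrite -pintB; try exact: sqint_mul.
by apply: eq_pint => t _; rewrite mulrBl.
Qed.

Lemma ipZl a f h : sqint f -> sqint h -> ip (fun t => a * f t) h = a * ip f h.
Proof.
move=> sf sh; rewrite -pintZ; last exact: sqint_mul.
by apply: eq_pint => t _; rewrite mulrA.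
Qed.

Lemma ip_suml n (F : nat -> R -> R) h : (forall i, (i < n)%N -> sqint (F i)) -> sqint h ->
  ip (fun t => \sum_(i < n) F i t) h = \sum_(i < n) ip (F i) h.
Proof.
move=> pF sh; rewrite -(@pint_sum n (fun i t => F i t * h t)).
  by apply: eq_pint => t _; rewrite mulr_suml.
by move=> i hi; apply: sqint_mul => //; exact: pF.
Qed.

Lemma nsq_ge0 f : 0 <= nsq f.
Proof. by apply: pint_ge0 => t _; rewrite -expr2 sqr_ge0. Qed.

Lemma nsqE f : nsq f = pint (fun t => f t ^+ 2).
Proof. by apply: eq_pint => t _; rewrite expr2. Qed.

Lemma nsqD f g : sqint f -> sqint g ->
  nsq (fun t => f t + g t) = nsq f + 2 * ip f g + nsq g.
Proof.
move=> sf sg; rewrite /nsq ipDl//; last exact: sqintD.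
rewrite (ipC f (fun t => f t + g t)) ipDl// (ipC g (fun t => f t + g t)) ipDl// (ipC g f); ring.
Qed.

Lemma nsqZ a f : sqint f -> nsq (fun t => a * f t) = a ^+ 2 * nsq f.
Proof.
move=> sf; rewrite /nsq ipZl//; last exact: sqintZ.
by rewrite ipC ipZl// mulrA.
Qed.

Lemma nsqB f g : sqint f -> sqint g ->
  nsq (fun t => f t - g t) = nsq f - 2 * ip f g + nsq g.
Proof.
move=> sf sg; rewrite /nsq ipBl//; last exact: sqintB.
rewrite (ipC f (fun t => f t - g t)) ipBl// (ipC g (fun t => f t - g t)) ipBl// (ipC g f); ring.
Qed.

Lemma cauchy_schwarz f g : sqint f -> sqint g -> ip f g ^+ 2 <= nsq f * nsq g.
Proof.
move=> sf sg.
have H (x : R) : 0 <= nsq f + 2 * x * ip f g + x ^+ 2 * nsq g.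
  have := nsq_ge0 (fun t => f t + x * g t).
  rewrite nsqD//; last exact: sqintZ.
  by rewrite nsqZ// (ipC f) ipZl// (ipC g) mulrA.
have [g0|g0] := eqVneq (nsq g) 0.
  have [->|fg0] := eqVneq (ip f g) 0; first by rewrite expr0n/= mulr_ge0// nsq_ge0.
  (* When nsq g = 0 the polynomial H is affine, and this argument gives it the value -1. *)
  have := H (- (nsq f + 1) / (2 * ip f g)).
  have -> : nsq f + 2 * (- (nsq f + 1) / (2 * ip f g)) * ip f g +
    (- (nsq f + 1) / (2 * ip f g)) ^+ 2 * nsq g = -1 by rewrite g0; field.
  by rewrite ler0N1.
have gp : 0 < nsq g by rewrite lt_neqAle eq_sym g0 nsq_ge0.
have := H (- ip f g / nsq g).
rewrite -(@ler_pM2r _ (nsq g))// mul0r => h.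
rewrite -subr_ge0; apply: le_trans h _; rewrite le_eqVlt; apply/orP; left; apply/eqP.
by field.
Qed.

End PeriodIntegral.
#[global] Hint Resolve measurable_period : core.

(** * Derivatives and primitives *)

Section Deriv.
Context {R : realType}.
Implicit Types (f g : R -> R) (t a b : R).
Local Notation der f t d := (is_derive (t : R) (1 : R) (f : R -> R) (d : R)).

Lemma der_eq f t a b : der f t a -> a = b -> der f t b.
Proof. by move=> h <-. Qed.

Lemma der_cst a t : der (fun=> a) t 0.
Proof. exact: is_derive_cst. Qed.

Lemma der_id t : der id t 1.
Proof. exact: is_derive_id. Qed.

Lemma derD f g t a b : der f t a -> der g t b -> der (fun x => f x + g x) t (a + b).
Proof. by move=> df dg; exact: is_deriveD. Qed.

Lemma derM f g t a b : der f t a -> der g t b -> der (fun x => f x * g x) t (a * g t + f t * b).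
Proof.
move=> df dg; apply: (der_eq (is_deriveM df dg)).
by rewrite addrC; congr (_ + _); rewrite /GRing.scale/= mulrC.
Qed.

Lemma derZ f t a b : der f t a -> der (fun x => b * f x) t (b * a).
Proof. by move=> df; apply: (der_eq (derM (der_cst b t) df)); rewrite mul0r add0r. Qed.

Lemma derN f t a : der f t a -> der (fun x => - f x) t (- a).
Proof. by move=> df; exact: is_deriveN. Qed.

Lemma derB f g t a b : der f t a -> der g t b -> der (fun x => f x - g x) t (a - b).
Proof. by move=> df dg; apply: derD => //; exact: derN. Qed.

Lemma der_comp f g t a b : der f (g t) a -> der g t b -> der (fun x => f (g x)) t (a * b).
Proof. by move=> df dg; exact: (is_derive1_comp df dg). Qed.

Lemma derV f t a : f t != 0 -> der f t a -> der (fun x => (f x)^-1) t (- a * (f t)^-1 ^+ 2).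
Proof.
move=> f0 df; apply: (der_eq (is_deriveV f0 df)).
by rewrite /GRing.scale/= mulrC exprVn mulrN mulNr.
Qed.

Lemma der_ln f t a : 0 < f t -> der f t a -> der (fun x => ln (f x)) t (a * (f t)^-1).
Proof. by move=> f0 df; rewrite mulrC; apply: der_comp df; exact: is_derive1_ln. Qed.

Lemma der_shift f t a b : der f (t + a) b -> der (fun x => f (x + a)) t b.
Proof.
move=> df; apply: (der_eq (@der_comp f (fun x => x + a) t b _ df (derD (der_id t) (der_cst a t)))).
by rewrite addr0 mulr1.
Qed.

Lemma der_sinM a t : der (fun x => sin (a * x)) t (a * cos (a * t)).
Proof.
apply: (der_eq (der_comp (is_derive_sin _) (derZ a (der_id t)))).
by rewrite mulr1 mulrC.
Qed.

Lemma der_cosM a t : der (fun x => cos (a * x)) t (- a * sin (a * t)).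
Proof.
apply: (der_eq (der_comp (is_derive_cos _) (derZ a (der_id t)))).
by rewrite mulr1 mulrC mulrN mulNr.
Qed.

Lemma der_cts f t a : der f t a -> {for t, continuous f}.
Proof.
by move=> df; apply/differentiable_continuous/derivable1_diffP; exact: (@ex_derive _ _ _ _ _ _ _ df).
Qed.

Lemma ders_cts f (f1 : R -> R) : (forall t, der f t (f1 t)) -> continuous f.
Proof. by move=> df t; exact: der_cts (df t). Qed.

Lemma cts_sinM a : continuous (fun x => sin (a * x) : R).
Proof. by apply: ders_cts => t; exact: der_sinM. Qed.

Lemma cts_cosM a : continuous (fun x => cos (a * x) : R).
Proof. by apply: ders_cts => t; exact: der_cosM. Qed.

Lemma der_unique f t a b : der f t a -> der f t b -> a = b.
Proof. by move=> da db; rewrite -(@derive_val _ _ _ _ _ _ _ da) (@derive_val _ _ _ _ _ _ _ db). Qed.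

Lemma ctsD f g : continuous f -> continuous g -> continuous (fun t => f t + g t).
Proof. by move=> cf cg t; apply: cvgD; [exact: cf|exact: cg]. Qed.

Lemma ctsB f g : continuous f -> continuous g -> continuous (fun t => f t - g t).
Proof. by move=> cf cg t; apply: cvgB; [exact: cf|exact: cg]. Qed.

Lemma ctsM f g : continuous f -> continuous g -> continuous (fun t => f t * g t).
Proof. by move=> cf cg t; apply: cvgM; [exact: cf|exact: cg]. Qed.

Lemma ctsZ a f : continuous f -> continuous (fun t => a * f t).
Proof. by move=> cf; apply: ctsM => //; exact: cst_continuous. Qed.

Lemma cts_comp f g : continuous f -> continuous g -> continuous (fun t => f (g t)).
Proof. by move=> cf cg t; apply: (@continuous_comp _ _ _ g f); [exact: cg|exact: cf]. Qed.

Lemma ctsX n f : continuous f -> continuous (fun t => f t ^+ n).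
Proof. by move=> cf; apply: (@cts_comp (fun x => x ^+ n)) => //; exact: exprn_continuous. Qed.

Lemma cts_norm f : continuous f -> continuous (fun t => `|f t|).
Proof. by move=> cf; apply: (@cts_comp Num.norm) => //; exact: norm_continuous. Qed.

Lemma cts_sum n (F : nat -> R -> R) : (forall i, (i < n)%N -> continuous (F i)) ->
  continuous (fun t => \sum_(i < n) F i t).
Proof.
elim: n => [|n IH] cF.
  under eq_fun do rewrite big_ord0; exact: cst_continuous.
under eq_fun do rewrite big_ord_recr.
by apply: ctsD; [apply: IH => i hi; exact: cF (leqW hi)|exact: cF].
Qed.

Lemma ftc (F f : R -> R) a b : a <= b -> (forall t, der F t (f t)) -> continuous f ->
  \int[lebesgue_measure]_(t in `[a, b]) f t = F b - F a.
Proof.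
rewrite le_eqVlt => /predU1P[->|ab] dF cf; first by rewrite set_itv1 Rintegral_set1 subrr.
have cF := ders_cts dF.
rewrite /Rintegral (@continuous_FTC2 _ f F)//.
- exact: continuous_subspaceT.
- split=> [x _||]; first exact: (@ex_derive _ _ _ _ _ _ _ (dF x)).
  + exact/cvg_at_right_filter/cF.
  + exact/cvg_at_left_filter/cF.
- by move=> x _; rewrite derive1E; exact: (@derive_val _ _ _ _ _ _ _ (dF x)).
Qed.

Lemma ftc_eq (F f : R -> R) a b c : a <= b -> (forall t, der F t (f t)) -> continuous f ->
  F b - F a = c -> \int[lebesgue_measure]_(t in `[a, b]) f t = c.
Proof. by move=> ab dF cf <-; exact: ftc. Qed.

Lemma pint_ftc (F f : R -> R) : (forall t, der F t (f t)) -> continuous f ->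
  pint f = F (2 * pi) - F 0.
Proof. by move=> dF cf; apply: ftc => //; exact: ltW twopi_gt0. Qed.

Lemma pint_ftc_eq (F f : R -> R) c : (forall t, der F t (f t)) -> continuous f ->
  F (2 * pi) - F 0 = c -> pint f = c.
Proof. by move=> dF cf <-; exact: pint_ftc. Qed.

(** A self-adjointness: the boundary terms of the two integrations by parts cancel because of the
    periodicity. *)
Lemma pint_by_parts2 (e e1 g g1 g2 : R -> R) a :
  (forall t, der e t (e1 t)) -> (forall t, der e1 t (- a * e t)) ->
  (forall t, der g t (g1 t)) -> (forall t, der g1 t (g2 t)) -> continuous g2 ->
  e (2 * pi) = e 0 -> e1 (2 * pi) = e1 0 -> g (2 * pi) = g 0 -> g1 (2 * pi) = g1 0 ->
  ip e g2 = - a * ip e g.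
Proof.
move=> de de1 dg dg1 cg2 pe pe1 pg pg1.
have ce := ders_cts de; have cg := ders_cts dg.
have : pint (fun t => e t * g2 t + a * (e t * g t)) = 0.
  apply: (@pint_ftc_eq (fun t => e t * g1 t - e1 t * g t)).
  - by move=> t; apply: (der_eq (derB (derM (de t) (dg1 t)) (derM (de1 t) (dg t)))); ring.
  - by apply: ctsD; [exact: ctsM|apply/ctsZ/ctsM].
  - by rewrite pe pe1 pg pg1 subrr.
rewrite pintD; [|exact/pin_cts/ctsM|exact/pinZ/pin_cts/ctsM].
rewrite pintZ; last exact/pin_cts/ctsM.
by rewrite /ip => h; rewrite mulNr; apply/eqP; rewrite -addr_eq0 h.
Qed.

End Deriv.

(** * The real trigonometric basis *)

Section Basis.
Context {R : realType}.
Implicit Types (f g : R -> R) (t : R).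
Local Notation der f t d := (is_derive (t : R) (1 : R) (f : R -> R) (d : R)).

Lemma cos_nat2pi (k : nat) : cos (k%:R * (2 * pi)) = 1 :> R.
Proof.
elim: k => [|k IH]; first by rewrite mul0r cos0.
by rewrite -natr1 mulrDl mul1r (mulr_natl pi 2) cosD2pi -(mulr_natl pi 2).
Qed.

Lemma sin_nat2pi (k : nat) : sin (k%:R * (2 * pi)) = 0 :> R.
Proof.
elim: k => [|k IH]; first by rewrite mul0r sin0.
by rewrite -natr1 mulrDl mul1r (mulr_natl pi 2) sinD2pi -(mulr_natl pi 2).
Qed.

(** The orthonormal basis is listed as 1, sin t, cos t, sin 2t, cos 2t, ... up to factors: the odd
    indices are the sines. *)
Definition frq (i : nat) : R := (uphalf i)%:R.
Definition ecoef (i : nat) : R := if i == 0%N then (Num.sqrt (2 * pi))^-1 else (Num.sqrt pi)^-1.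
Definition ebas (i : nat) t : R :=
  ecoef i * (if odd i then sin (frq i * t) else cos (frq i * t)).
Definition debas (i : nat) t : R :=
  ecoef i * (if odd i then frq i * cos (frq i * t) else - frq i * sin (frq i * t)).

Lemma der_ebas i t : der (ebas i) t (debas i t).
Proof.
rewrite /ebas /debas; case: odd; apply: derZ; [exact: der_sinM|exact: der_cosM].
Qed.

Lemma der_debas i t : der (debas i) t (- (frq i ^+ 2) * ebas i t).
Proof.
rewrite /ebas /debas; case: odd.
  by apply: (der_eq (derZ _ (derZ _ (der_cosM _ _)))); ring.
by apply: (der_eq (derZ _ (derZ _ (der_sinM _ _)))); ring.
Qed.

Lemma ebas_cts i : continuous (ebas i).
Proof. exact: ders_cts (der_ebas i). Qed.
Hint Resolve ebas_cts : core.

Lemma ebas_per i : ebas i (2 * pi) = ebas i 0.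
Proof. by rewrite /ebas mulr0 sin0 cos0 sin_nat2pi cos_nat2pi. Qed.

Lemma debas_per i : debas i (2 * pi) = debas i 0.
Proof. by rewrite /debas mulr0 sin0 cos0 sin_nat2pi cos_nat2pi. Qed.

Lemma ebas_sqint i : sqint (ebas i).
Proof. exact: sqint_cts. Qed.
Hint Resolve ebas_sqint : core.

Lemma sqrt_pi_gt1 : 1 < Num.sqrt pi :> R.
Proof. by rewrite -[ltLHS]sqrtr1 ltr_sqrt ?pi_gt0// (lt_le_trans _ (pi_ge2 R))// ltr1n. Qed.

Lemma ecoef_gt0 i : 0 < ecoef i.
Proof. by rewrite /ecoef; case: eqP => _; rewrite invr_gt0 sqrtr_gt0 ?twopi_gt0// pi_gt0. Qed.

Lemma ecoef_le1 i : ecoef i <= 1.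
Proof.
rewrite /ecoef; case: eqP => _; rewrite invf_le1 ?sqrtr_gt0 ?twopi_gt0 ?pi_gt0//.
  rewrite (le_trans (ltW sqrt_pi_gt1))// ler_sqrt ?(ltW twopi_gt0)//.
  by rewrite ler_peMl ?pi_ge0// ler1n.
by rewrite ltW// sqrt_pi_gt1.
Qed.

Lemma ebas_le1 i t : `|ebas i t| <= 1.
Proof.
rewrite /ebas normrM (gtr0_norm (ecoef_gt0 i)) -[leRHS]mulr1.
apply: ler_pM => //; first exact: ltW (ecoef_gt0 i); first exact: ecoef_le1.
by case: ifP => _; [exact: sin_max|exact: cos_max].
Qed.

Lemma ip_by_parts2 i g g1 g2 :
  (forall t, der g t (g1 t)) -> (forall t, der g1 t (g2 t)) -> continuous g2 ->
  g (2 * pi) = g 0 -> g1 (2 * pi) = g1 0 ->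
  ip (ebas i) g2 = - (frq i ^+ 2) * ip (ebas i) g.
Proof.
move=> dg dg1 cg2 pg pg1.
by apply: (pint_by_parts2 (der_ebas i) (der_debas i) dg dg1);
  rewrite ?ebas_per ?debas_per.
Qed.

Lemma ebas_orth (i j : nat) : ip (ebas i) (ebas j) = (i == j)%:R.
Proof.
have [->|ij] := eqVneq i j; last first.
  have [fij|fij] := eqVneq (uphalf i) (uphalf j); last first.
    have c2 : continuous (fun t => - (frq j ^+ 2) * ebas j t) by apply: ctsZ.
    have := ip_by_parts2 i (der_ebas j) (der_debas j) c2 (ebas_per j) (debas_per j).
    rewrite ipC ipZl// (ipC (ebas j)) => /eqP; rewrite -subr_eq0 -mulrBl mulf_eq0 => /orP[|/eqP//].
    rewrite opprK addrC subr_eq0 eqrXn2 ?ler0n// eqr_nat => /eqP h.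
    by rewrite h eqxx in fij.
  have oij : odd i != odd j.
    apply: contra_neq ij => oij.
    by rewrite -(odd_double_half i) -(odd_double_half j) -oij; congr (_ + _.*2)%N;
      move: fij; rewrite !uphalf_half -oij => /addnI.
  have f0 : frq j != 0.
    rewrite pnatr_eq0; apply: contra_neq ij => fj0.
    move: (fij); rewrite fj0 uphalf_half => /eqP; rewrite addn_eq0 => /andP[].
    move: fj0; rewrite uphalf_half => /eqP; rewrite addn_eq0 => /andP[oj hj] oi hi.
    rewrite -(odd_double_half i) -(odd_double_half j).
    by move: oj hj oi hi; case: odd => //; case: odd => // _ /eqP -> _ /eqP ->.
  have fE : frq i = frq j by rewrite /frq fij.
  transitivity (pint (fun t => (ecoef i * ecoef j) * (sin (frq j * t) * cos (frq j * t)))).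
    apply: eq_pint => t _; rewrite /ebas fE.
    by move: oij; case: odd; case: odd => // _; ring.
  apply: (@pint_ftc_eq R (fun t => (ecoef i * ecoef j) * ((2 * frq j)^-1 * (sin (frq j * t) * sin (frq j * t))))).
  - move=> t; apply: (der_eq (derZ _ (derZ _ (derM (der_sinM _ _) (der_sinM _ _))))).
    by field.
  - by apply: ctsZ; apply: ctsM; [exact: cts_sinM|exact: cts_cosM].
  - by rewrite mulr0 sin0 sin_nat2pi !mulr0 subrr.
have [->|j0] := eqVneq j 0%N.
  transitivity (pint (fun=> ecoef 0 ^+ 2 : R)).
    by apply: eq_pint => t _; rewrite /ebas/= /frq mul0r cos0 mulr1 expr2.
  by rewrite pint_cst /ecoef eqxx exprVn sqr_sqrtr ?(ltW twopi_gt0)// mulVf// gt_eqF// twopi_gt0.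
have f0 : frq j != 0 by rewrite pnatr_eq0; case: j j0.
have s0 : (Num.sqrt pi : R)^-1 ^+ 2 * pi = 1.
  by rewrite exprVn sqr_sqrtr ?pi_ge0// mulVf// gt_eqF// pi_gt0.
have e2 : ecoef j ^+ 2 * pi = 1 by rewrite /ecoef (negbTE j0).
pose s : R := if odd j then -1 else 1.
transitivity (pint (fun t => ecoef j ^+ 2 * (2^-1 + s * (cos (frq j * t) ^+ 2 - 2^-1)))).
  apply: eq_pint => t _; rewrite /ebas /s; case: odd; last by field.
  by rewrite mulrACA -expr2 -expr2 sin2cos2; field.
apply: (@pint_ftc_eq R (fun t => ecoef j ^+ 2 * (2^-1 * t +
   s * ((2 * frq j)^-1 * (sin (frq j * t) * cos (frq j * t)))))).
- move=> t; apply: (der_eq (derZ _ (derD (derZ _ (der_id _)) (derZ _ (derZ _ (derM (der_sinM _ _) (der_cosM _ _))))))).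
  have := sin2cos2 (frq j * t); set S := sin _; set C := cos _ => SC.
  have -> : frq j * C * C + S * (- frq j * S) = frq j * (C ^+ 2 - S ^+ 2) by ring.
  by rewrite SC; field.
- apply: ctsZ; apply: ctsD; first exact: cst_continuous.
  apply: ctsZ; apply: ctsB; last exact: cst_continuous.
  by apply: ctsX; apply: ders_cts => t; exact: der_cosM.
- rewrite !mulr0 sin0 sin_nat2pi !(mulr0, mul0r, addr0, subr0).
  by rewrite (mulrA 2^-1) mulVf// mul1r e2.
Qed.

End Basis.
#[global] Hint Resolve ebas_cts ebas_sqint : core.

(** * Uniform continuity and dominated series *)

Section Tools.
Context {R : realType}.
Implicit Types (f g : R -> R) (t e : R) (u b : nat -> R).

Lemma cts_eps f t : {for t, continuous f} -> forall e, 0 < e ->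
  exists2 d : R, 0 < d & forall s, `|s - t| < d -> `|f s - f t| < e.
Proof.
move=> /cvgrPdist_lt cf e e0; have := cf e e0.
move=> /nbhs_ballP[d/= d0 h]; exists d => // s sd.
by rewrite distrC; apply: h; rewrite /ball/= distrC.
Qed.

Lemma eps_cts f t : (forall e, 0 < e ->
  exists2 d : R, 0 < d & forall s, `|s - t| < d -> `|f s - f t| <= e) -> {for t, continuous f}.
Proof.
move=> h; apply/cvgrPdist_le => e e0; have [d d0 hd] := h e e0.
apply/nbhs_ballP; exists d => //= s; rewrite /ball/= distrC => sd.
by rewrite distrC; exact: hd.
Qed.

Lemma exists_expr_lt x e : 0 <= x < 1 -> 0 < e -> exists n : nat, x ^+ n < e.
Proof.
move=> /andP[x0 x1] e0.
have /cvgrPdist_lt/(_ e e0) : x ^+ n @[n --> \oo] --> 0 by apply: cvg_expr; rewrite ger0_norm.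
case=> N _ /(_ N (leqnn N)) /=; rewrite sub0r normrN ger0_norm ?exprn_ge0// => h.
by exists N.
Qed.

Lemma cts_of_unif_approx (G : R -> R) : (forall e, 0 < e ->
  exists2 H : R -> R, continuous H & forall t, `|G t - H t| <= e) -> continuous G.
Proof.
move=> h t; apply: eps_cts => e e0.
have [|H cH GH] := h (e / 3); first by rewrite divr_gt0.
have [|d d0 hd] := @cts_eps H t (cH t) (e / 3); first by rewrite divr_gt0.
exists d => // s sd; have := hd _ sd; have := GH s; have := GH t.
have -> : G s - G t = (G s - H s) + (H s - H t) - (G t - H t) by ring.
move=> h1 h2 h3; apply: (le_trans (ler_normB _ _)).
have := ler_normD (G s - H s) (H s - H t); lra.
Qed.

Lemma heine f : continuous f -> forall e, 0 < e -> exists2 d, 0 < d &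
  forall s t, period t -> `|s - t| < d -> `|f s - f t| <= e.
Proof.
move=> cf e e0.
have K : compact (period : set R) by exact: segment_compact.
pose F : set_system R := (0 : R)^'+.
have FF : Filter F by exact: at_right_proper_filter.
pose P (d : R) (t : R) : Prop := forall s, `|s - t| < d -> `|f s - f t| <= e.
have /(_ R F P FF) H := (@compact_near_coveringP R period).1 K.
have : \forall d \near F, (period : set R) `<=` P d.
  apply: H => x _.
  have [|d d0 hd] := @cts_eps f x (cf x) (e / 2); first by rewrite divr_gt0.
  exists (ball x (d / 2), [set y | 0 < y < d / 2]) => /=.
    split; first by apply: nbhsx_ballx; rewrite divr_gt0.
    apply/nbhs_ballP; exists (d / 2) => /=; first by rewrite divr_gt0.
    move=> y; rewrite /ball/= sub0r normrN => yd y0; rewrite y0/=.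
    by rewrite (le_lt_trans (ler_norm _) yd).
  move=> [t y]/= [xt /andP[y0 yd]] s sy.
  have tx : `|t - x| < d by rewrite distrC (lt_trans xt)// ltr_pdivrMr// ltr_pMr// ltr1n.
  have sx : `|s - x| < d.
    have -> : s - x = (s - t) - (x - t) by ring.
    move: xt; rewrite /ball/= => xt.
    apply: (le_lt_trans (ler_normB _ _)); lra.
  have := hd _ tx; have := hd _ sx.
  have -> : f s - f t = (f s - f x) - (f t - f x) by ring.
  move=> h1 h2; apply: (le_trans (ler_normB _ _)); lra.
move=> /nbhs_ballP[d/= d0 h]; exists (d / 2); first by rewrite divr_gt0.
move=> s t pt st; apply: (h (d / 2)) => //.
- by rewrite /ball/= sub0r normrN gtr0_norm ?divr_gt0// ltr_pdivrMr// ltr_pMr// ltr1n.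
- by rewrite divr_gt0.
Qed.

(** A dominating sequence b with a bound B on its sum; tail b n then bounds, uniformly in any
    parameter, the remainder of every series that b dominates. *)
Definition psum b (B : R) : Prop := (forall i, 0 <= b i) /\ forall n, \sum_(i < n) b i <= B.
Definition tail b (n : nat) : R := limn (fun m : nat => \sum_(i < m) b i) - \sum_(i < n) b i.

Lemma psum_cvg b B : psum b B -> cvgn (fun m : nat => \sum_(i < m) b i).
Proof.
move=> [b0 bB]; apply: nondecreasing_is_cvgn.
  apply/nondecreasing_seqP => n; by rewrite big_ord_recr/= lerDl.
by exists B => _ [n _ <-]; exact: bB.
Qed.

Lemma psum_homo b B n m : psum b B -> (n <= m)%N -> \sum_(i < n) b i <= \sum_(i < m) b i.
Proof.
move=> [b0 _]; elim: m => [|m IH]; first by rewrite leqn0 => /eqP->.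
rewrite leq_eqVlt => /predU1P[->//|/IH]; rewrite big_ord_recr/= => h.
by rewrite (le_trans h)// lerDl.
Qed.

Lemma tail_ge b B n m : psum b B -> (n <= m)%N -> \sum_(i < m) b i - \sum_(i < n) b i <= tail b n.
Proof.
move=> pb nm; rewrite lerD2r.
apply: (nondecreasing_cvgn_le _ (psum_cvg pb) m) => i j ij.
exact: psum_homo pb ij.
Qed.

Lemma tail_ge0 b B n : psum b B -> 0 <= tail b n.
Proof. by move=> pb; rewrite (le_trans _ (tail_ge pb (leqnn n)))// subrr. Qed.

Lemma tail_small b B e : psum b B -> 0 < e -> exists N, forall n, (N <= n)%N -> tail b n < e.
Proof.
move=> pb e0; have /cvgrPdist_lt/(_ e e0)[N _ h] := psum_cvg pb.
exists N => n Nn; have := h n Nn => /=; apply: le_lt_trans; exact: ler_norm.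
Qed.

Lemma cvg_dist_le (u : nat -> R) (l a c : R) (n : nat) : u @ \oo --> l ->
  (forall m, (n <= m)%N -> `|u m - a| <= c) -> `|l - a| <= c.
Proof.
move=> ul h; apply/ler_addgt0Pr => e e0.
have /cvgrPdist_lt/(_ e e0)[N _ hN] := ul.
have := hN (maxn N n) (leq_maxl _ _); have := h _ (leq_maxr N n) => /=.
set x := u _ => h1 h2; have -> : l - a = (l - x) + (x - a) by ring.
apply: (le_trans (ler_normD _ _)); lra.
Qed.

Lemma weierstrass_mtest (T : Type) (F : nat -> T -> R) b B : psum b B -> (forall i (t : T), `|F i t| <= b i) ->
  exists G : T -> R, forall (t : T) n, `|G t - \sum_(i < n) F i t| <= tail b n.
Proof.
move=> pb Fb.
have FM (t : T) n m : (n <= m)%N -> `|\sum_(i < m) F i t - \sum_(i < n) F i t| <= tail b n.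
  move=> nm; apply: le_trans (tail_ge pb nm).
  elim: m nm => [|m IH]; first by rewrite leqn0 => /eqP->; rewrite !subrr normr0.
  rewrite leq_eqVlt => /predU1P[->|/IH h]; first by rewrite !subrr normr0.
  rewrite !big_ord_recr/=.
  have -> : \sum_(i < m) F i t + F m t - \sum_(i < n) F i t =
    (\sum_(i < m) F i t - \sum_(i < n) F i t) + F m t by ring.
  apply: (le_trans (ler_normD _ _)); have := Fb m t; lra.
have C (t : T) : cvgn (fun m : nat => \sum_(i < m) F i t).
  have Cn : cvgn [normed series (F ^~ t)]%classic.
    apply: (series_le_cvg (v_ := b)) => [i|i|i|]; [exact: normr_ge0|exact: pb.1|exact: Fb|].
    have -> : series b = fun m : nat => \sum_(i < m) b i.
      by apply/funext => m; rewrite /series/= big_mkord.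
    exact: psum_cvg pb.
  have -> : (fun m : nat => \sum_(i < m) F i t) = series (F ^~ t).
    by apply/funext => m; rewrite /series/= big_mkord.
  exact: normed_cvg.
exists (fun t : T => limn (fun m : nat => \sum_(i < m) F i t)) => t n.
apply: (cvg_dist_le (n := n) (C t)) => m nm; exact: FM.
Qed.

(** The partial sums are at most 2 - 1/n, by telescoping. *)
Lemma psum_inv2 : psum (fun i => (i.+1%:R ^+ 2)^-1) 2.
Proof.
split=> [i|n]; first by rewrite invr_ge0 sqr_ge0.
suff : \sum_(i < n) (i.+1%:R ^+ 2 : R)^-1 <= 2 - n%:R^-1.
  by move=> h; apply: (le_trans h); rewrite gerBl.
elim: n => [|[|n] IH]; first by rewrite big_ord0 invr0 subr0.
  by rewrite big_ord1 expr1n invr1; lra.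
rewrite big_ord_recr/=; apply: (le_trans (lerD IH (lexx _))).
have n1 : 0 < n.+1%:R :> R by rewrite ltr0n.
have E : n.+2%:R = n.+1%:R + 1 :> R by rewrite -natr1.
rewrite E; move: (n.+1%:R : R) n1 => x x0.
rewrite -subr_ge0.
have -> : 2 - (x + 1)^-1 - (2 - x^-1 + (x + 1) ^- 2) = (x * (x + 1) ^+ 2)^-1.
  by field; rewrite !gt_eqF//; lra.
by rewrite invr_ge0 mulr_ge0 ?sqr_ge0// ltW.
Qed.

End Tools.

(** * Powers of a kernel that peaks *)

Section Peak.
Context {R : realType}.
Local Notation mu := (@lebesgue_measure R).
Implicit Types (f g h : R -> R) (t a b : R).

Definition ind a b : R -> R := \1_(`[a, b]%classic).

Lemma indE a b s : ind a b s = if a <= s <= b then 1 else 0.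
Proof.
rewrite /ind indicE; case: ifPn => h.
  by rewrite mem_set//= in_itv/=.
by rewrite memNset//= in_itv/=; apply/negP.
Qed.

Lemma pmeas_ind a b : pmeas (ind a b).
Proof. by apply: measurable_funTS; apply: measurable_indic; exact: measurable_itv. Qed.

Lemma ind_norm a b s : `|ind a b s| <= 1.
Proof. by rewrite indE; case: ifP; rewrite ?normr1 ?normr0. Qed.

Lemma ind_sqint a b : sqint (ind a b).
Proof. by apply: (sqint_bounded (M := 1)) => [|t _]; [exact: pmeas_ind|exact: ind_norm]. Qed.

Lemma pint_ind a b h : 0 <= a -> b <= 2 * pi ->
  pint (fun s => ind a b s * h s) = \int[mu]_(s in `[a, b]) h s.
Proof.
move=> a0 b2; rewrite /pint.
under eq_Rintegral do rewrite mulrC -[_ * _]/((h \* \1_(`[a, b]%classic)) _) -patch_indic.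
rewrite -Rintegral_mkcondr; congr (Rintegral _ _ _).
rewrite eqEsubset; split=> s /=; first by case.
move=> sab; split=> //; rewrite /period/= in_itv/=.
move: sab; rewrite in_itv/= => /andP[as_ sb].
by rewrite (le_trans a0 as_) (le_trans sb b2).
Qed.

Lemma pint_ind1 a b : 0 <= a -> a <= b -> b <= 2 * pi -> pint (ind a b) = b - a.
Proof.
move=> a0 ab b2; transitivity (pint (fun s => ind a b s * 1)).
  by apply: eq_pint => s _; rewrite mulr1.
rewrite pint_ind//; by apply: (@ftc _ id) => //; exact: cst_continuous.
Qed.

(** Far from the peak the powers of k are exponentially small compared to their size near the
    peak, so a function orthogonal to all of them cannot be positive there. *)
Lemma peak_orthogonal_le0 (k D : R -> R) t0 : continuous k -> continuous D -> 0 < t0 < 2 * pi ->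
  (forall s, period s -> 0 <= k s) -> k t0 = 1 ->
  (forall s, period s -> s != t0 -> k s < 1) ->
  (forall n, pint (fun s => k s ^+ n * D s) = 0) -> D t0 <= 0.
Proof.
move=> ck cD /andP[t00 t02] k0 kt0 k1 kD; rewrite leNgt; apply/negP => D0.
have [d d0 [hd dt0 dt2]] : exists2 d : R, 0 < d & [/\ forall s, `|s - t0| < d -> D t0 / 2 < D s,
    d < t0 & t0 + d < 2 * pi].
  have [|d d0 hd] := @cts_eps R D t0 (cD t0) (D t0 / 2); first by rewrite divr_gt0.
  exists (Num.min d (Num.min t0 (2 * pi - t0) / 2)).
    by rewrite lt_min d0/= divr_gt0// lt_min t00/= subr_gt0.
  split.
  - move=> s; rewrite lt_min => /andP[/hd + _]; rewrite ltr_norml; lra.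
  - rewrite gt_min; apply/orP; right; rewrite ltr_pdivrMr// gt_min; apply/orP; left.
    by rewrite ltr_pMr// ltr1n.
  - rewrite -ltrBrDl gt_min; apply/orP; right; rewrite ltr_pdivrMr// gt_min; apply/orP; right.
    by rewrite ltr_pMr ?subr_gt0// ltr1n.
(* The bound q of k away from t0 is beaten by q', a lower bound of k close to t0. *)
have [q /andP[q0 q1] hq] : exists2 q : R, 0 <= q < 1 & forall s, period s -> d <= `|s - t0| -> k s <= q.
  have cw (a b : R) : {within `[a, b], continuous k} by exact: continuous_subspaceT.
  have [|c1 c1I c1m] := @EVT_max R k 0 (t0 - d) _ (cw _ _); first by rewrite subr_ge0 ltW.
  have [|c2 c2I c2m] := @EVT_max R k (t0 + d) (2 * pi) _ (cw _ _); first exact: ltW.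
  move: c1I c2I; rewrite !in_itv/= => /andP[c10 c1t] /andP[c2t c22].
  have p1 : period c1 by rewrite /period/= in_itv/= c10/=; lra.
  have p2 : period c2 by rewrite /period/= in_itv/= c22 andbT; lra.
  exists (Num.max (k c1) (k c2)).
    rewrite le_max k0//= gt_max !k1//; last 2 first.
      by rewrite gt_eqF//; lra.
    by rewrite lt_eqF//; lra.
  move=> s; rewrite /period/= in_itv/= => /andP[s0 s2]; rewrite le_max ler_normr.
  move=> /orP[h|h]; apply/orP; [right; apply: c2m|left; apply: c1m]; rewrite in_itv/=; lra.
pose q' := (1 + q) / 2.
have q'q : q < q' by rewrite /q'; lra.
have q'1 : q' < 1 by rewrite /q'; lra.
have q'0 : 0 < q' by exact: le_lt_trans q'q.
have [h h0 [hh hhd]] : exists2 h : R, 0 < h & (forall s, `|s - t0| <= h -> q' <= k s) /\ h < d.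
  have [|h h0 hh] := @cts_eps R k t0 (ck t0) (1 - q'); first by rewrite subr_gt0.
  exists (Num.min h d / 2); first by rewrite divr_gt0// lt_min h0.
  have H : Num.min h d / 2 < Num.min h d by rewrite ltr_pdivrMr ?ltr_pMr ?ltr1n// lt_min h0.
  split=> [s sh|]; last by apply: lt_le_trans H _; rewrite ge_min lexx orbT.
  have /hh : `|s - t0| < h by apply: le_lt_trans sh (lt_le_trans H _); rewrite ge_min lexx.
  by rewrite kt0 ltr_norml; lra.
have [M M0 hM] := cts_bounded cD.
have key n : D t0 / 2 * q' ^+ n * (2 * h) <= M * (2 * pi) * q ^+ n.
  pose L s := (D t0 / 2 * q' ^+ n) * ind (t0 - h) (t0 + h) s - M * q ^+ n.
  have iL1 : pin (fun s => (D t0 / 2 * q' ^+ n) * ind (t0 - h) (t0 + h) s).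
    by apply/pinZ/sqint_pin/ind_sqint.
  have : pint L <= pint (fun s => k s ^+ n * D s).
    apply: pint_le.
    - by apply: pinB => //; exact: pin_cst.
    - by apply: pin_cts; apply: ctsM => //; exact: ctsX.
    - move=> s ps; rewrite /L indE -ler_distl.
      have kn0 : 0 <= k s ^+ n by rewrite exprn_ge0// k0.
      have Mq : 0 <= M * q ^+ n by rewrite mulr_ge0 ?exprn_ge0// ltW.
      case: ifPn => [sh|_].
        have Ds := hd _ (le_lt_trans sh hhd).
        rewrite mulr1 lerBlDr (@le_trans _ _ (k s ^+ n * D s))//; last by rewrite lerDl.
        rewrite mulrC; apply: ler_pM => //; last exact: ltW.
        - by rewrite exprn_ge0// ltW.
        - by rewrite divr_ge0// ltW.
        - by rewrite lerXn2r ?nnegrE ?k0 ?(ltW q'0)// hh.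
      rewrite mulr0 sub0r.
      have [sd|ds] := ltP `|s - t0| d.
        rewrite (@le_trans _ _ 0) ?oppr_le0// mulr_ge0// ltW// (lt_trans _ (hd _ sd))//.
        by rewrite divr_gt0.
      rewrite lerNl -mulrN (le_trans (ler_norm _))// normrM normrN mulrC ger0_norm//.
      rewrite ler_pM ?hM//.
      by rewrite lerXn2r ?nnegrE ?k0// hq.
  rewrite kD pintB//; last exact: pin_cst.
  rewrite pintZ; last by apply/sqint_pin/ind_sqint.
  rewrite pint_cst pint_ind1; [|lra|lra|lra].
  have -> : t0 + h - (t0 - h) = 2 * h by ring.
  by rewrite subr_le0 [leRHS]mulrAC.
have [||n hn] := @exists_expr_lt R (q / q') (D t0 * h / (M * (2 * pi))).
- by rewrite ltr_pdivrMr// mul1r q'q andbT divr_ge0// ltW.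
- by rewrite !divr_gt0 ?mulr_gt0// pi_gt0.
- have := key n; apply/negP; rewrite -ltNge.
  move: hn; rewrite expr_div_n ltr_pdivrMr ?exprn_gt0// mulrAC ltr_pdivlMr ?mulr_gt0 ?pi_gt0//.
  rewrite (mulrC (q ^+ n)); congr (_ < _); by field.
Qed.

Lemma peak_orthogonal (k D : R -> R) t0 : continuous k -> continuous D -> 0 < t0 < 2 * pi ->
  (forall s, period s -> 0 <= k s) -> k t0 = 1 ->
  (forall s, period s -> s != t0 -> k s < 1) ->
  (forall n, pint (fun s => k s ^+ n * D s) = 0) -> D t0 = 0.
Proof.
move=> ck cD t0I k0 kt0 k1 kD; apply: le_anti; rewrite (peak_orthogonal_le0 ck cD t0I)//=.
rewrite -oppr_le0; apply: (peak_orthogonal_le0 ck (D := fun s => - D s) _ t0I) => //.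
  by move=> t; apply: cvgN; exact: cD.
move=> n; transitivity (pint (fun s => - (k s ^+ n * D s))).
  by apply: eq_pint => s _; rewrite mulrN.
by rewrite pintN ?kD ?oppr0//; apply/pin_cts/ctsM => //; exact: ctsX.
Qed.

End Peak.

(** * The Parseval identity *)

Section Parseval.
Context {R : realType}.
Local Notation mu := (@lebesgue_measure R).
Local Notation der f t d := (is_derive (t : R) (1 : R) (f : R -> R) (d : R)).
Implicit Types (f g h : R -> R) (t a b : R).

Lemma cts_phase (k : nat) (a : R) : continuous (fun s : R => cos (k%:R * s + a)).
Proof.
apply: (@cts_comp _ cos) => //; first exact: continuous_cos.
apply: ctsD; last exact: cst_continuous.
by apply: ctsZ => t; exact: cvg_id.
Qed.

(** Arbitrary phases are what makes these integrands stable under multiplication by a shifted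
    cosine. *)
Lemma ip_phase0 (D : R -> R) : continuous D -> (forall i, ip D (ebas i) = 0) ->
  forall (k : nat) (a : R), pint (fun s => D s * cos (k%:R * s + a)) = 0.
Proof.
move=> cD h k a.
have C i : ecoef i != 0 :> R by rewrite gt_eqF// ecoef_gt0.
have hc : pint (fun s => D s * cos (k%:R * s)) = 0.
  transitivity (pint (fun s => (ecoef k.*2)^-1 * (D s * ebas k.*2 s))).
    apply: eq_pint => s _; rewrite /ebas odd_double /frq uphalf_double.
    by rewrite mulrCA mulKf.
  by rewrite pintZ ?[pint _]h ?mulr0//; exact/pin_cts/ctsM.
have hs : pint (fun s => D s * sin (k%:R * s)) = 0.
  case: k {hc} => [|k].
    rewrite -[RHS](mul0r (2 * pi)) -pint_cst.
    by apply: eq_pint => s _; rewrite mul0r sin0 mulr0.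
  transitivity (pint (fun s => (ecoef k.*2.+1)^-1 * (D s * ebas k.*2.+1 s))).
    apply: eq_pint => s _; rewrite /ebas /= odd_double /= /frq /= doubleK.
    by rewrite mulrCA mulKf.
  by rewrite pintZ ?[pint _]h ?mulr0//; exact/pin_cts/ctsM.
transitivity (pint (fun s => cos a * (D s * cos (k%:R * s)) - sin a * (D s * sin (k%:R * s)))).
  by apply: eq_pint => s _; rewrite cosD; ring.
have i1 : pin (fun s => D s * cos (k%:R * s)) by apply/pin_cts/ctsM => //; exact: cts_cosM.
have i2 : pin (fun s => D s * sin (k%:R * s)) by apply/pin_cts/ctsM => //; exact: cts_sinM.
by rewrite pintB ?pintZ ?hc ?hs ?mulr0 ?subrr//; exact: pinZ.
Qed.

Lemma cos_lt1 (x : R) : 0 < x < 2 * pi -> cos x < 1.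
Proof.
move=> /andP[x0 x2]; have -> : x = (x / 2) *+ 2 by rewrite mulr2n; field.
rewrite cos_mulr2n cos2sin2.
have s0 : 0 < sin (x / 2) by apply: sin_gt0_pi; apply/andP; split; lra.
by have := exprn_gt0 2 s0; rewrite mulr2n; lra.
Qed.

(** The powers of (1 + cos (s - t)) / 2 peak at s = t, and they are trigonometric polynomials in
    s, to which D is orthogonal. The end points of the period follow by continuity. *)
Lemma ebas_complete (D : R -> R) : continuous D -> (forall i, ip D (ebas i) = 0) ->
  forall t, period t -> D t = 0.
Proof.
move=> cD h.
have inner t : 0 < t < 2 * pi -> D t = 0.
  move=> t0I; move: (t0I) => /andP[t0 t2].
  pose k s : R := (1 + cos (1%:R * s - t)) / 2.
  have ck : continuous k.
    apply: ctsM; last exact: cst_continuous.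
    apply: ctsD; first exact: cst_continuous.
    exact: (@cts_phase 1 (- t)).
  apply: (peak_orthogonal ck cD t0I).
  - by move=> s _; rewrite /k divr_ge0//; have := cos_geN1 (1%:R * s - t); lra.
  - by rewrite /k mul1r subrr cos0; field.
  - move=> s; rewrite /period/= in_itv/= => /andP[s0 s2] st.
    suff : cos (1%:R * s - t) < 1 by rewrite /k; lra.
    rewrite mul1r -cos_norm cos_lt1// normr_gt0 subr_eq0 st/=.
    by rewrite ltr_norml; lra.
  - move=> n; suff H : forall (n k' : nat) (a : R), pint (fun s => (k s ^+ n * D s) * cos (k'%:R * s + a)) = 0.
      rewrite -[RHS](H n 0%N 0); apply: eq_pint => s _.
      by rewrite mul0r addr0 cos0 mulr1.
    move=> {}n; elim: n => [|n IH] k' a.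
      rewrite -[RHS](@ip_phase0 D cD h k' a); apply: eq_pint => s _.
      by rewrite expr0 mul1r.
    have cE (k2 : nat) (b : R) : continuous (fun s => (k s ^+ n * D s) * cos (k2%:R * s + b)).
      by apply: ctsM; [apply: ctsM => //; exact: ctsX|exact: cts_phase].
    (* The product lowers the frequency by one; below the frequency 0 this is the frequency 1 with
       the opposite phase. *)
    pose a' : R := if k' is 0%N then - a - t else a + t.
    pose k2 := if k' is 0%N then 1%N else k'.-1.
    transitivity (pint (fun s => 2^-1 * ((k s ^+ n * D s) * cos (k'%:R * s + a)) +
       (4^-1 * ((k s ^+ n * D s) * cos (k'.+1%:R * s + (a - t))) +
        4^-1 * ((k s ^+ n * D s) * cos (k2%:R * s + a'))))).
      apply: eq_pint => s _; rewrite exprS /k.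
      have -> : cos (k2%:R * s + a') = cos (k'%:R * s + a - (1%:R * s - t)).
        rewrite /k2 /a'; case: (k') => [|k3].
          rewrite -cosN; congr cos; ring.
        rewrite /= -natr1; congr cos; ring.
      have -> : k'.+1%:R * s + (a - t) = k'%:R * s + a + (1%:R * s - t) by rewrite -natr1; ring.
      move: (k'%:R * s + a) (1%:R * s - t) => x y; rewrite cosB cosD.
      by field.
    have pE (x : R) (k1 : nat) (b : R) : pin (fun s => x * ((k s ^+ n * D s) * cos (k1%:R * s + b))).
      exact/pin_cts/ctsZ/cE.
    have zE (x : R) (k1 : nat) (b : R) : pint (fun s => x * ((k s ^+ n * D s) * cos (k1%:R * s + b))) = 0.
      by rewrite pintZ ?IH ?mulr0//; exact/pin_cts/cE.
    by rewrite (pintD (pE _ _ _) (pinD (pE _ _ _) (pE _ _ _))) (pintD (pE _ _ _) (pE _ _ _)) !zE !addr0.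
move=> t pt; apply/eqP; rewrite -normr_le0; apply/ler_addgt0Pr => e e0; rewrite add0r.
have [d d0 hd] := @cts_eps R D t (cD t) _ e0.
pose d' : R := Num.min d pi.
have d'0 : 0 < d' by rewrite lt_min d0 pi_gt0.
have d'd : d' <= d by rewrite ge_min lexx.
have d'p : d' <= pi by rewrite ge_min lexx orbT.
move: pt; rewrite /period/= in_itv/= => /andP[t0 t2].
have p0 := pi_gt0 R.
clearbody d'.
pose s : R := if t < pi then t + d' / 2 else t - d' / 2.
have sI : 0 < s < 2 * pi 
  by rewrite /s; move: d'p t2 p0; move: (pi : R) => P d'P t2 P0;
    case: (ltrP t P) => tp; apply/andP; split; lra.
have sd : `|s - t| < d.
  rewrite /s; case: ifP => _.
    by rewrite addrAC subrr add0r gtr0_norm ?divr_gt0//; lra.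
  by rewrite addrAC subrr add0r normrN gtr0_norm ?divr_gt0//; lra.
by have := hd _ sd; rewrite (inner s)// sub0r normrN => /ltW.
Qed.

Lemma sqint_comb (n : nat) (c : nat -> R) : sqint (fun t => \sum_(i < n) c i * ebas i t).
Proof. by apply: (@sqint_sum _ n (fun i t => c i * ebas i t)) => i _; exact: sqintZ. Qed.

Lemma ip_comb f (n : nat) (c : nat -> R) : sqint f ->
  ip f (fun t => \sum_(i < n) c i * ebas i t) = \sum_(i < n) c i * ip f (ebas i).
Proof.
move=> sf; rewrite ipC (@ip_suml _ n (fun i t => c i * ebas i t))//; last by move=> i _; exact: sqintZ.
by apply: eq_bigr => i _; rewrite ipZl// ipC.
Qed.

Lemma ip_comb_ebas (n : nat) (c : nat -> R) j :
  ip (fun t => \sum_(i < n) c i * ebas i t) (ebas j) = if (j < n)%N then c j else 0.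
Proof.
rewrite ipC ip_comb//; under eq_bigr do rewrite ebas_orth.
case: ifPn => [jn|nj].
  rewrite (bigD1 (Ordinal jn))//= eqxx mulr1 big1 ?addr0// => i ij.
  suff /negbTE -> : j != i by rewrite mulr0.
  by rewrite eq_sym.
rewrite big1// => i _; suff /negbTE -> : j != i by rewrite mulr0.
by apply: contra nj => /eqP ->.
Qed.

Lemma nsq_comb (n : nat) (c : nat -> R) :
  nsq (fun t => \sum_(i < n) c i * ebas i t) = \sum_(i < n) c i ^+ 2.
Proof.
rewrite /nsq ip_comb; last exact: sqint_comb.
by apply: eq_bigr => i _; rewrite ip_comb_ebas ltn_ord expr2.
Qed.

(** The theorem of Pythagoras: the Fourier coefficients give the best approximation, and any other
    choice adds the squared distance of the coefficients. *)
Lemma nsq_sub_comb f (n : nat) (c : nat -> R) : sqint f ->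
  nsq (fun t => f t - \sum_(i < n) c i * ebas i t) =
  nsq f - \sum_(i < n) ip f (ebas i) ^+ 2 + \sum_(i < n) (c i - ip f (ebas i)) ^+ 2.
Proof.
move=> sf; rewrite nsqB//; last exact: sqint_comb.
rewrite ip_comb// nsq_comb mulr_sumr -addrA -[RHS]addrA; congr (_ + _).
rewrite -!sumrN -!big_split/=; apply: eq_bigr => i _; ring.
Qed.

Lemma bessel f (n : nat) : sqint f -> \sum_(i < n) ip f (ebas i) ^+ 2 <= nsq f.
Proof.
move=> sf; have := nsq_ge0 (fun t => f t - \sum_(i < n) ip f (ebas i) * ebas i t).
rewrite (nsq_sub_comb n (fun i => ip f (ebas i)))//.
have -> : \sum_(i < n) (ip f (ebas i) - ip f (ebas i)) ^+ 2 = 0.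
  by apply: big1 => i _; rewrite subrr expr0n.
by rewrite addr0 subr_ge0.
Qed.

(** Membership in the mean square closure of the trigonometric polynomials. *)
Definition trig_approx f : Prop := forall e : R, 0 < e -> exists (n : nat) (c : nat -> R),
  nsq (fun t => f t - \sum_(i < n) c i * ebas i t) < e.

Lemma trig_approx_parseval f : sqint f -> trig_approx f -> forall e : R, 0 < e ->
  exists N, forall n, (N <= n)%N -> nsq f - \sum_(i < n) ip f (ebas i) ^+ 2 < e.
Proof.
move=> sf af e e0; have [N [c]] := af e e0.
rewrite nsq_sub_comb// => h; exists N => n Nn; apply: le_lt_trans h.
rewrite -[leLHS]addr0; apply: lerD; last by apply: sumr_ge0 => i _; exact: sqr_ge0.
rewrite lerD2l lerN2 -!(big_mkord xpredT (fun i => ip f (ebas i) ^+ 2)).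
rewrite (big_cat_nat _ Nn)//= lerDl; apply: sumr_ge0 => i _; exact: sqr_ge0.
Qed.

Lemma nsqD_le f g : sqint f -> sqint g -> nsq (fun t => f t + g t) <= 2 * nsq f + 2 * nsq g.
Proof.
move=> sf sg; have := nsq_ge0 (fun t => f t - g t).
by rewrite nsqB// nsqD//; lra.
Qed.

Lemma trig_approx_lim f : sqint f -> (forall e : R, 0 < e -> exists2 g, sqint g /\ trig_approx g &
  nsq (fun t => f t - g t) < e) -> trig_approx f.
Proof.
move=> sf h e e0; have [|g [sg ag] fg] := h (e / 4); first by rewrite divr_gt0.
have [|n [c gc]] := ag (e / 4); first by rewrite divr_gt0.
exists n, c; have sc := sqint_comb n c.
have := nsqD_le (sqintB sf sg) (sqintB sg sc).
under [X in nsq X <= _]eq_fun do rewrite subrKA.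
move=> /le_lt_trans; apply; lra.
Qed.

Lemma trig_approxD f g : sqint f -> sqint g -> trig_approx f -> trig_approx g -> trig_approx (fun t => f t + g t).
Proof.
move=> sf sg af ag e e0.
have [|n [c fc]] := af (e / 4); first by rewrite divr_gt0.
have [|m [d gd]] := ag (e / 4); first by rewrite divr_gt0.
have [sc sd] := (sqint_comb n c, sqint_comb m d).
exists (n + m)%N, (fun i => (if (i < n)%N then c i else 0) + (if (i < m)%N then d i else 0)).
have ext (k l : nat) (u : nat -> R) t : (k <= l)%N ->
   \sum_(i < l) (if (i < k)%N then u i else 0) * ebas i t = \sum_(i < k) u i * ebas i t.
  move=> kl; rewrite -(big_mkord xpredT (fun i => (if (i < k)%N then u i else 0) * ebas i t)).
  rewrite (big_cat_nat _ kl)//= [X in _ + X](_ : _ = 0) ?addr0.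
    by rewrite big_mkord; apply: eq_bigr => i _; rewrite ltn_ord.
  by rewrite big_nat; apply: big1 => i /andP[ki _]; rewrite ltnNge ki mul0r.
have := nsqD_le (sqintB sf sc) (sqintB sg sd).
suff -> : (fun t => f t - \sum_(i < n) c i * ebas i t + (g t - \sum_(i < m) d i * ebas i t)) =
  (fun t => f t + g t - \sum_(i < n + m) ((if (i < n)%N then c i else 0) + (if (i < m)%N then d i else 0)) * ebas i t).
  by move=> /le_lt_trans; apply; lra.
apply/funext => t; under [in RHS]eq_bigr do rewrite mulrDl.
rewrite big_split/= !ext ?leq_addr ?leq_addl//; ring.
Qed.

Lemma trig_approxZ f a : sqint f -> trig_approx f -> trig_approx (fun t => a * f t).
Proof.
move=> sf af e e0.
have a1 : 0 < a ^+ 2 + 1 by rewrite ltr_wpDl// sqr_ge0.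
have [|n [c fc]] := af (e / (a ^+ 2 + 1)); first by rewrite divr_gt0.
have sc := sqint_comb n c.
exists n, (fun i => a * c i).
have -> : (fun t => a * f t - \sum_(i < n) a * c i * ebas i t) = (fun t => a * (f t - \sum_(i < n) c i * ebas i t)).
  apply/funext => t; rewrite mulrBr mulr_sumr.
  by under [in RHS]eq_bigr do rewrite mulrA.
rewrite nsqZ; last exact: sqintB.
apply: (@le_lt_trans _ _ ((a ^+ 2 + 1) * nsq (fun t => f t - \sum_(i < n) c i * ebas i t))).
  by rewrite ler_wpM2r ?nsq_ge0// lerDl.
by rewrite mulrC -ltr_pdivlMr.
Qed.

Lemma trig_approx0 : trig_approx (fun=> 0).
Proof.
move=> e e0; exists 0%N, (fun=> 0); rewrite (_ : nsq _ = 0)//.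
rewrite /nsq /ip -[RHS](mul0r (2 * pi)) -pint_cst.
by apply: eq_pint => t _; rewrite big_ord0 subr0 mulr0.
Qed.

End Parseval.

Section Parseval2.
Context {R : realType}.
Local Notation mu := (@lebesgue_measure R).
Local Notation der f t d := (is_derive (t : R) (1 : R) (f : R -> R) (d : R)).
Implicit Types (f g h : R -> R) (t a b x : R).

Lemma psumZ (b : nat -> R) (B c : R) : 0 <= c -> psum b B -> psum (fun i => c * b i) (c * B).
Proof.
move=> c0 [b0 bB]; split=> [i|n]; first exact: mulr_ge0.
by rewrite -mulr_sumr ler_wpM2l.
Qed.

(** The Fourier series of the periodic parabola, x - x^2/2pi on the period. *)
Let F (k : nat) (x : R) : R := (2 - 2 * cos (k.+1%:R * x)) / (pi * k.+1%:R ^+ 2).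
Let fb (k : nat) : R := 4 * (k.+1%:R ^+ 2)^-1.

Let psum_fb : psum fb (4 * 2).
Proof. exact: (psumZ _ psum_inv2). Qed.

Let F_le k x : `|F k x| <= fb k.
Proof.
rewrite /F /fb normrM normfV (gtr0_norm (x := pi * _)); last first.
  by rewrite mulr_gt0 ?pi_gt0// exprn_gt0// ltr0n.
rewrite invfM mulrA ler_pM2r ?invr_gt0 ?exprn_gt0 ?ltr0n//.
have p2 := pi_ge2 R.
rewrite ler_pdivrMr ?pi_gt0//.
by rewrite ler_norml; have := cos_max (k.+1%:R * x); rewrite ler_norml; lra.
Qed.

Let F_cts k : continuous (F k).
Proof.
apply: ctsM; last exact: cst_continuous.
by apply: ctsB; [exact: cst_continuous|apply: ctsZ; exact: cts_cosM].
Qed.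

Let F_ip k j : (0 < j)%N -> ip (F k) (ebas j) =
  if j == k.+1.*2 then - 2 * ebas j 0 / frq j ^+ 2 else 0.
Proof.
move=> j0.
have sp : Num.sqrt pi != 0 :> R by rewrite gt_eqF// sqrtr_gt0 pi_gt0.
have sp2 : Num.sqrt (2 * pi) != 0 :> R by rewrite gt_eqF// sqrtr_gt0 twopi_gt0.
have pE : pi = Num.sqrt pi ^+ 2 :> R by rewrite sqr_sqrtr// pi_ge0.
have k0 : k.+1%:R != 0 :> R by rewrite pnatr_eq0.
pose al : R := 2 / (pi * k.+1%:R ^+ 2) * Num.sqrt (2 * pi).
pose be : R := - 2 / (Num.sqrt pi * k.+1%:R ^+ 2).
have -> : F k = fun t => al * ebas 0 t + be * ebas (k.+1.*2) t.
  apply/funext => t; rewrite /F /al /be /ebas odd_double /frq uphalf_double /ecoef/= mul0r cos0.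
  move: pE sp sp2 k0; move: (cos _) => c.
  move: (Num.sqrt pi : R) (Num.sqrt (2 * pi) : R) (k.+1%:R : R) => x z y -> x0 z0 y0.
  by field; rewrite x0 y0 z0.
rewrite ipDl; [|exact: sqintZ|exact: sqintZ|by []].
rewrite (@ipZl _ al (ebas 0))// (@ipZl _ be (ebas k.+1.*2))//.
rewrite !ebas_orth (ltn_eqF j0) mulr0 add0r (eq_sym j); case: eqP => [<-|_]; last by rewrite mulr0.
rewrite mulr1 /be /ebas odd_double /frq uphalf_double mulr0 cos0 mulr1 /ecoef/=.
move: sp k0; move: (Num.sqrt pi : R) (k.+1%:R : R) => x y x0 y0.
by rewrite invfM mulrA.
Qed.

Let parab (x : R) : R := x ^+ 2 / (2 * pi) - x.

Let parab_cts : continuous parab.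
Proof.
apply: ctsB => [|t]; last exact: cvg_id.
apply: ctsM; last exact: cst_continuous.
exact: exprn_continuous.
Qed.

Let parab_ip j : (0 < j)%N -> ip parab (ebas j) = 2 * ebas j 0 / frq j ^+ 2.
Proof.
move=> j0; have f0 : frq j != 0 :> R by rewrite pnatr_eq0; case: j j0.
have pn0 : pi != 0 :> R by rewrite gt_eqF// pi_gt0.
pose p1 (x : R) : R := x / pi - 1.
have dp t : der parab t (p1 t).
  apply: (der_eq (derB (derM (derM (der_id t) (der_id t)) (der_cst _ t)) (der_id t))).
  by rewrite /p1; move: (pi : R) pn0 => P P0; field.
have dp1 t : der p1 t (pi^-1).
  apply: (der_eq (derB (derM (der_id t) (der_cst _ t)) (der_cst 1 t))).
  by rewrite mul1r mulr0 addr0 subr0.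
have cej : continuous (@ebas R j) by [].
have H : pint (fun t => ebas j t * pi^-1 + frq j ^+ 2 * (ebas j t * parab t)) = 2 * ebas j 0.
  apply: (@pint_ftc_eq R (fun t => ebas j t * p1 t - debas j t * parab t)).
  - move=> t; apply: (der_eq (derB (derM (der_ebas j t) (dp1 t)) (derM (der_debas j t) (dp t)))).
    by ring.
  - apply: ctsD; first by apply: ctsM => //; exact: cst_continuous.
    by apply: ctsZ; exact: ctsM.
  - rewrite ebas_per debas_per /p1 /parab expr2.
    by move: (ebas j 0) (debas j 0) (pi : R) pn0 => E1 E2 P P0; field.
have ej0 : pint (@ebas R j) = 0.
  have := @ebas_orth R 0 j; rewrite (ltn_eqF j0) /ip => h.
  transitivity (pint (fun t => (ecoef 0)^-1 * (ebas 0 t * ebas j t))).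
    apply: eq_pint => t _; rewrite {2}/ebas/= /frq mul0r cos0 mulr1 mulKf// gt_eqF// ecoef_gt0//.
  by rewrite pintZ ?h ?mulr0//; apply/pin_cts/ctsM.
move: H; rewrite pintD; [|by apply: pin_cts; apply: ctsM => //; exact: cst_continuous
  |by apply: pin_cts; apply: ctsZ; exact: ctsM].
have -> : pint (fun t => ebas j t * pi^-1) = 0.
  transitivity (pint (fun t => pi^-1 * ebas j t)); first by apply: eq_pint => t _; rewrite mulrC.
  by rewrite pintZ ?ej0 ?mulr0//; exact: pin_cts.
rewrite pintZ; last by apply/pin_cts/ctsM.
rewrite add0r -[pint _]/(ip (ebas j) parab) ipC => <-.
by rewrite mulrC mulKf// expf_neq0.
Qed.

(** Both sides are continuous and have the same nonconstant Fourier coefficients, so they differ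
    by a constant, by completeness; the constant is 0 since both vanish at x = 0. *)
Let parab_series : forall e : R, 0 < e -> exists N, forall n, (N <= n)%N ->
  forall x, period x -> x - x ^+ 2 / (2 * pi) - \sum_(k < n) F k x < e.
Proof.
have [G GF] := weierstrass_mtest psum_fb F_le.
have cG : continuous G.
  apply: cts_of_unif_approx => e e0; have [N hN] := tail_small psum_fb e0.
  exists (fun t => \sum_(k < N) F k t); first by apply: cts_sum => i _; exact: F_cts.
  by move=> t; rewrite (le_trans (GF t N))// ltW// hN.
have Gip j : (0 < j)%N -> ip G (ebas j) = - 2 * ebas j 0 / frq j ^+ 2.
  move=> j0; apply/eqP; rewrite -subr_eq0 -normr_le0; apply/ler_addgt0Pr => e e0; rewrite add0r.
  have e1 : 0 < e / (2 * pi) by rewrite divr_gt0// twopi_gt0.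
  have [N hN] := tail_small psum_fb e1.
  pose n := maxn N j.
  have sF : sqint (fun t => \sum_(k < n) F k t) by apply: sqint_cts; apply: cts_sum => i _; exact: F_cts.
  have -> : - 2 * ebas j 0 / frq j ^+ 2 = ip (fun t => \sum_(k < n) F k t) (ebas j).
    rewrite ip_suml//; last by move=> i _; exact/sqint_cts/F_cts.
    under eq_bigr do rewrite F_ip//.
    have [oj|ej] := boolP (odd j).
      rewrite /ebas oj mulr0 sin0 !mulr0 mul0r big1// => i _.
      by case: eqP => // ji; move: oj; rewrite ji odd_double.
    have j2 : j = (j./2.-1).+1.*2.
      rewrite prednK; first by rewrite -[LHS]odd_double_half (negbTE ej).
      by rewrite half_gt0; case: j j0 ej {sF n} => [|[|]].
    have jn : (j./2.-1 < n)%N.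
      rewrite /n leq_max; apply/orP; right; rewrite [X in (_ < X)%N]j2 -addnn.
      by rewrite addSn ltnS leq_addr.
    rewrite (bigD1 (Ordinal jn))//= -j2 eqxx big1 ?addr0// => i ij.
    case: eqP => // ji; exfalso; move/eqP: ij; apply; apply/val_inj => /=.
    by rewrite ji doubleK.
  rewrite -ipBl//; last exact: sqint_cts.
  rewrite -[leRHS](@divfK _ (2 * pi)) ?gt_eqF ?twopi_gt0// /ip.
  apply: pint_bound.
    apply: pin_cts; apply: ctsM => //; apply: ctsB => //.
    by apply: cts_sum => i _; exact: F_cts.
  move=> t _; rewrite normrM -[leRHS]mulr1 ler_pM ?ebas_le1//.
  by rewrite (le_trans (GF t n))// ltW// hN// leq_maxl.
pose D t : R := parab t + G t.
have cD : continuous D by exact: ctsD.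
have Dip j : (0 < j)%N -> ip D (ebas j) = 0.
  by move=> j0; rewrite ipDl ?parab_ip ?Gip//; [ring|exact: sqint_cts|exact: sqint_cts].
pose c := ip D (ebas 0).
have h : forall i, ip (fun t => D t - c * ebas 0 t) (ebas i) = 0.
  move=> i; rewrite ipBl; [|exact: sqint_cts|exact: sqintZ|by []].
  rewrite (@ipZl _ c (ebas 0))//.
  rewrite ebas_orth; case: i => [|i]; first by rewrite mulr1 subrr.
  by rewrite Dip// mulr0 subrr.
have D0 t : period t -> D t - c * ebas 0 t = 0.
  apply: (@ebas_complete R (fun t => D t - c * ebas 0 t) _ h).
  by apply: ctsB => //; exact: ctsZ.
have p0 : period (0 : R) by rewrite /period/= in_itv/= lexx ltW// twopi_gt0.
have G0 : G 0 = 0.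
  apply/eqP; rewrite -normr_le0; apply/ler_addgt0Pr => e e0; rewrite add0r.
  have [N hN] := tail_small psum_fb e0.
  have := GF 0 N; rewrite big1 ?subr0; last first.
    by move=> i _; rewrite /F mulr0 cos0 mulr1 subrr mul0r.
  by move=> /le_trans; apply; rewrite ltW// hN.
have c0 : c * ebas 0 0 = 0.
  by have := D0 _ p0; rewrite /D G0 /parab expr0n mul0r subrr add0r sub0r => /eqP; rewrite oppr_eq0 => /eqP.
move=> e e0; have [N hN] := tail_small psum_fb e0.
exists N => n Nn x px.
have := D0 _ px; have -> : ebas 0 x = ebas 0 0 by rewrite /ebas/= /frq !mul0r.
rewrite c0 subr0 /D /parab => /eqP; rewrite addr_eq0 => /eqP Gx.
have -> : x - x ^+ 2 / (2 * pi) = G x by rewrite -[RHS]opprK -Gx opprB.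
apply: le_lt_trans (hN _ Nn); apply: le_trans (GF x n); exact: ler_norm.
Qed.

Let ind_ebas x i : 0 <= x -> x <= 2 * pi -> ip (ind 0 x) (ebas i) =
  if i == 0%N then ecoef 0 * x else
  if odd i then ecoef i * ((1 - cos (frq i * x)) / frq i) else ecoef i * (sin (frq i * x) / frq i).
Proof.
move=> x0 x2; rewrite /ip pint_ind//.
case: eqP => [->|/eqP i0].
  apply: (@ftc_eq _ (fun t => ecoef 0 * t)) => //; last by rewrite mulr0 subr0.
  by move=> t; apply: (der_eq (derZ _ (der_id t))); rewrite /ebas/= /frq mul0r cos0.
have f0 : frq i != 0 :> R by rewrite pnatr_eq0; case: i i0.
case: ifPn => oi.
  apply: (@ftc_eq _ (fun t => ecoef i * (- (frq i)^-1 * cos (frq i * t)))) => //.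
    move=> t; apply: (der_eq (derZ _ (derZ _ (der_cosM _ t)))).
    by rewrite /ebas oi; field.
  by rewrite mulr0 cos0; field.
apply: (@ftc_eq _ (fun t => ecoef i * ((frq i)^-1 * sin (frq i * t)))) => //.
  move=> t; apply: (der_eq (derZ _ (derZ _ (der_sinM _ t)))).
  by rewrite /ebas (negbTE oi); field.
by rewrite mulr0 sin0; field.
Qed.

Let ind_coefs m x : 0 <= x -> x <= 2 * pi ->
  \sum_(i < m.*2.+1) ip (ind 0 x) (ebas i) ^+ 2 = x ^+ 2 / (2 * pi) + \sum_(k < m) F k x.
Proof.
move=> x0 x2; elim: m => [|m IH].
  rewrite big_ord1 big_ord0 addr0 ind_ebas//= /ecoef/= exprMn exprVn sqr_sqrtr ?ltW ?twopi_gt0//.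
  by rewrite mulrC.
rewrite doubleS 2!big_ord_recr/= IH big_ord_recr/= -addrA -addrA; congr (_ + (_ + _)).
rewrite !ind_ebas//= odd_double /= /frq /= !uphalf_double /ecoef/= /F.
rewrite -[m.*2./2]/(m.*2)./2 ?doubleK.
have sp : Num.sqrt pi != 0 :> R by rewrite gt_eqF// sqrtr_gt0 pi_gt0.
have pE : pi = Num.sqrt pi ^+ 2 :> R by rewrite sqr_sqrtr// pi_ge0.
have k0 : m.+1%:R != 0 :> R by rewrite pnatr_eq0.
have := sin2cos2 (m.+1%:R * x).
move: pE sp k0; move: (cos _) (sin _) => c s.
move: (Num.sqrt pi : R) (m.+1%:R : R) => z y -> z0 y0 sc.
rewrite !exprMn sc; field; by rewrite z0 y0.
Qed.

(** The explicit Fourier coefficients of the indicator of [0, x] turn its Parseval defect into the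
    remainder of the Fourier series of the parabola. *)
Lemma trig_approx_ind x : 0 <= x -> x <= 2 * pi -> trig_approx (ind 0 x).
Proof.
move=> x0 x2 e e0; have [N hN] := parab_series e0.
have px : period x by rewrite /period/= in_itv/= x0.
exists N.*2.+1, (fun i => ip (ind 0 x) (ebas i)).
rewrite (@nsq_sub_comb _ _ _ (fun i => ip (ind 0 x) (ebas i))); last exact: ind_sqint.
rewrite [X in _ + X]big1 ?addr0; last by move=> i _; rewrite subrr expr0n.
rewrite ind_coefs// opprD addrA.
have -> : nsq (ind 0 x) = x.
  rewrite -[RHS]subr0 -(pint_ind1 (lexx 0) x0 x2); apply: eq_pint => t _.
  by rewrite indE; case: ifP; rewrite ?mulr1 ?mulr0.
exact: hN.
Qed.

Lemma trig_approx_sum n (g : nat -> R -> R) : (forall i, (i < n)%N -> sqint (g i) /\ trig_approx (g i)) ->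
  trig_approx (fun t => \sum_(i < n) g i t).
Proof.
elim: n => [|n IH] h.
  under eq_fun do rewrite big_ord0; exact: trig_approx0.
under eq_fun do rewrite big_ord_recr/=.
apply: trig_approxD; [|exact: (h n _).1|apply: IH => i ni; exact: h (leqW ni)|exact: (h n _).2].
by apply: sqint_sum => i ni; exact: (h i (leqW ni)).1.
Qed.

Lemma pinS (E : set (measurableTypeR R)) f : measurable E -> E `<=` period -> pin f ->
  mu.-integrable E (EFin \o f).
Proof. by move=> mE sub; apply: integrableS. Qed.

(** A continuous function is uniformly close to a step function, which is a combination of the
    indicators of intervals [0, x]. *)
Lemma trig_approx_cts f : continuous f -> trig_approx f.
Proof.
move=> cf; apply: trig_approx_lim; first exact: sqint_cts.
move=> e e0.
have tp : 0 < 2 * pi :> R := twopi_gt0.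
pose e1 : R := Num.min 1 (e / (2 * (2 * pi))).
have e10 : 0 < e1 by rewrite lt_min ltr01 divr_gt0// mulr_gt0.
have [d d0 hd] := heine cf e10.
have [m m0 hm] : exists2 m : nat, (0 < m)%N & 2 * pi / m%:R < d :> R.
  exists (Num.truncn (2 * pi / d)).+1 => //.
  rewrite ltr_pdivrMr ?ltr0n// (mulrC d) -ltr_pdivrMr//; exact: truncnS_gt.
have m0' : 0 < m%:R :> R by rewrite ltr0n.
pose x (j : nat) : R := 2 * pi / m%:R * j%:R.
have x0 j : 0 <= x j by rewrite /x mulr_ge0// divr_ge0// ltW.
have x2 j : (j <= m)%N -> x j <= 2 * pi.
  by move=> jm; rewrite /x mulrAC ler_pdivrMr// ler_pM2l// ler_nat.
have xS j : x j.+1 = x j + 2 * pi / m%:R.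
    rewrite /x; move: (2 * pi / m%:R : R) => z.
    by rewrite mulrSr mulrDr mulr1.
(* The indicator of the interval from x j, excluded, to x j.+1. *)
pose s (j : nat) t : R := ind 0 (x j.+1) t - ind 0 (x j) t.
have ss j : sqint (s j) by apply: sqintB; exact: ind_sqint.
have as_ j : (j < m)%N -> trig_approx (s j).
  move=> jm; have -> : s j = fun t => ind 0 (x j.+1) t + (-1) * ind 0 (x j) t.
    by apply/funext => t; rewrite mulN1r.
  apply: trig_approxD; [exact: ind_sqint|exact/sqintZ/ind_sqint|exact/trig_approx_ind/x2|].
  by apply: trig_approxZ; [exact: ind_sqint|exact/trig_approx_ind/x2/ltnW].
exists (fun t => \sum_(j < m) f (x j.+1) * s j t).
  split; first by apply: (@sqint_sum _ m (fun j t => f (x j.+1) * s j t)) => j _; exact: sqintZ.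
  apply: (@trig_approx_sum m (fun j t => f (x j.+1) * s j t)) => j jm; split; first exact: sqintZ.
  by apply: trig_approxZ => //; exact: as_.
pose g t := \sum_(j < m) f (x j.+1) * s j t; rewrite -/(nsq (fun t => f t - g t)).
have sg : sqint g by apply: (@sqint_sum _ m (fun j t => f (x j.+1) * s j t)) => j _; exact: sqintZ.
have fg t : period t -> 0 < t -> `|f t - g t| <= e1.
  move=> pt t0; move: (pt); rewrite /period/= in_itv/= => /andP[_ t2].
  have s1 : \sum_(j < m) s j t = 1.
    rewrite -(big_mkord xpredT (fun j => s j t)) telescope_sumr// /x mulr0 divfK ?gt_eqF//.
    rewrite !indE (ltW t0)/= t2 leNgt t0/=; by rewrite subr0.
  rewrite -[f t]mulr1 -s1 mulr_sumr /g -sumrB.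
  apply: (le_trans (ler_norm_sum _ _ _)).
  rewrite -[leRHS]mulr1 -s1 mulr_sumr; apply: ler_sum => j _.
  rewrite -mulrBl normrM /s !indE (ltW t0)/=.
  have [txS|txS] := leP t (x j.+1); last first.
    have -> : (t <= x j) = false.
      apply/negbTE; rewrite -ltNge (le_lt_trans _ txS)// xS lerDl divr_ge0//; exact: ltW.
    by rewrite subrr normr0 !mulr0.
  case: (leP t (x j)) => [_|xt]; first by rewrite subrr normr0 !mulr0.
  rewrite subr0 normr1 !mulr1 distrC; apply: hd => //.
  by rewrite xS ger0_norm ?subr_ge0 -?xS// xS; move: hm xt; move: (2 * pi / m%:R : R) => z; lra.
have e1e : e1 ^+ 2 * (2 * pi) < e.
  have h1 : e1 ^+ 2 <= e1.
    by rewrite expr2 -[leRHS]mulr1 ler_wpM2l ?(ltW e10)// ge_min lexx.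
  have h2 : e1 * (2 * pi) <= e / 2.
    by rewrite -ler_pdivlMr// -mulrA -invfM ge_min lexx orbT.
  rewrite (le_lt_trans (ler_wpM2r (ltW tp) h1))// (le_lt_trans h2)//.
  by rewrite ltr_pdivrMr// ltr_pMr// ltr1n.
apply: le_lt_trans e1e.
have : \int[mu]_(t in `]0, 2 * pi]) (f t - g t) ^+ 2 <= e1 ^+ 2 * (2 * pi).
  have sfg : sqint (fun t => f t - g t) by apply: sqintB => //; exact: sqint_cts.
  have sub : (`]0, 2 * pi]%classic : set R) `<=` period.
    by move=> t /=; rewrite /period/= !in_itv/= => /andP[/ltW-> ->].
  have -> : e1 ^+ 2 * (2 * pi) = \int[mu]_(t in `]0, 2 * pi]) (e1 ^+ 2).
    rewrite (Rintegral_cst mu); last exact: measurable_itv.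
    congr (_ * _).
    have h : mu (`]0, 2 * pi]%classic : set R) = (2 * pi)%:E.
      by rewrite lebesgue_measure_itv/= lte_fin tp -EFinD subr0.
    exact: (esym (congr1 fine h)).
  apply: le_Rintegral.
  - exact: measurable_itv.
  - by apply: pinS => //; exact: sfg.2.
  - by apply: pinS => //; exact: pin_cst.
  - move=> t; rewrite /= in_itv/= => /andP[t0 t2].
    rewrite -(real_normK (num_real (f t - g t))) lerXn2r ?nnegrE ?(ltW e10)// fg//.
    by rewrite /period/= in_itv/= ltW.
rewrite nsqE /pint /period -Rintegral_itv_obnd_cbnd//.
have sfg : sqint (fun t => f t - g t) by apply: sqintB => //; exact: sqint_cts.
have sub : (`]0, 2 * pi]%classic : set R) `<=` period.
  by move=> t /=; rewrite /period/= !in_itv/= => /andP[/ltW-> ->].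
by apply: pinS => //; exact: sfg.2.
Qed.

Definition clamp (M y : R) : R := Num.max (- M) (Num.min M y).

Let clampE M y : 0 <= M -> clamp M y = if y < - M then - M else if M < y then M else y.
Proof.
move=> M0; rewrite /clamp /Num.max /Num.min /Order.max /Order.min.
by case: (ltrP M y) => h1; case: (ltrP y (- M)) => h2 //; case: ifP => //; lra.
Qed.

Let clamp_cts M : continuous (clamp M).
Proof.
move=> y; apply: (@continuous_max _ _ (fun=> - M) (fun y => Num.min M y)); first exact: cst_continuous.
apply: (@continuous_min _ _ (fun=> M) id); [exact: cst_continuous|exact: cvg_id].
Qed.

Let clamp_le M y : 0 < M -> `|clamp M y| <= M.
Proof.
move=> M0; rewrite ler_norml clampE ?(ltW M0)//.
by case: ifPn => // a; last case: ifPn => // b; apply/andP; split; lra.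
Qed.

(** Continuous functions are dense in mean. Clamping them to the bound M of f makes the mean
    square error at most 2 M times the mean error. *)
Lemma trig_approx_bounded f M : 0 < M -> pmeas f -> (forall t, `|f t| <= M) -> trig_approx f.
Proof.
move=> M0 mf fM; have sf : sqint f by apply: (sqint_bounded mf (M := M)).
apply: trig_approx_lim => // e e0.
have fin : (mu (period : set (measurableTypeR R)) < +oo)%E.
  by move: (ltry (2 * pi : R)); rewrite -mu_period.
have [g_ [cg _ gf]] := approximation_continuous_integrable measurable_period fin (sqint_pin sf).
have e1 : 0 < e / (2 * M) by rewrite divr_gt0// mulr_gt0.
have [g cg' fg] : exists2 g : R -> R, continuous g & pint (fun t => `|f t - g t|) < e / (2 * M).
  move/fine_cvgP : gf => [_ /cvgrPdist_lt /(_ _ e1)[N _ /(_ N (leqnn N))]] /=.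
  rewrite sub0r normrN => h; exists (g_ N) => //.
  by apply: le_lt_trans h; exact: ler_norm.
pose h t := clamp M (g t).
have ch : continuous h by apply: cts_comp => //; exact: clamp_cts.
have sh := sqint_cts ch; have sg := sqint_cts cg'.
exists h; first by split => //; exact: trig_approx_cts.
have fgM t : (f t - h t) ^+ 2 <= (2 * M) * `|f t - g t|.
  have := fM t; rewrite ler_norml => /andP[f1 f2].
  have hE := clampE (g t) (ltW M0).
  have h1 : `|f t - h t| <= 2 * M.
    rewrite ler_norml /h hE; case: ifP => // a; last first; first case: ifP => // b; apply/andP; split; lra.
  have h2 : `|f t - h t| <= `|f t - g t|.
    rewrite /h hE; case: ifPn => // a.
      by rewrite !ger0_norm; lra.
    by case: ifPn => // b; rewrite !ler0_norm; lra.
  by rewrite -(real_normK (num_real (f t - h t))) expr2; exact: ler_pM.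
rewrite nsqE; apply: (@le_lt_trans _ _ (2 * M * pint (fun t => `|f t - g t|))).
  have i1 : pin (fun t => `|f t - g t|) by apply/pin_norm/sqint_pin/sqintB.
  rewrite -pintZ//; apply: pint_le => //; last exact: pinZ.
  by case: (sqintB sf sh).
by rewrite mulrC -ltr_pdivlMr// mulr_gt0.
Qed.

(** Truncation at height n + 1, by dominated convergence. *)
Lemma trig_approx_sqint f : sqint f -> trig_approx f.
Proof.
move=> sf; apply: trig_approx_lim => // e e0.
pose g (n : nat) t := clamp n.+1%:R (f t).
have n0 (n : nat) : 0 < n.+1%:R :> R by rewrite ltr0n.
have mg n : pmeas (g n).
  apply: measurableT_comp; last exact: sf.1.
  exact: continuous_measurable_fun (@clamp_cts _).
have gn n t : `|g n t| <= n.+1%:R.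
  exact: clamp_le.
have ag n : sqint (g n) /\ trig_approx (g n).
  split; first by apply: (sqint_bounded (mg n) (M := n.+1%:R)).
  exact: trig_approx_bounded (mg n) (gn n).
have dom n t : (f t - g n t) ^+ 2 <= f t ^+ 2.
  have := n0 n => nn.
  rewrite -(real_normK (num_real (f t - _))) -(real_normK (num_real (f t))).
  rewrite lerXn2r ?nnegrE// /g clampE ?(ltW nn)//.
  case: ifPn => // a.
    by rewrite !ler0_norm; lra.
  case: ifPn => // b; first by rewrite !ger0_norm; lra.
  by rewrite subrr normr0.
have mfg n : measurable_fun (period : set (measurableTypeR R)) (fun t => ((f t - g n t) ^+ 2)%:E).
  apply/measurable_EFinP; apply: measurable_funX; apply: measurable_funB; [exact: sf.1|exact: mg].
have m0 : measurable_fun (period : set (measurableTypeR R)) (fun=> (0 : \bar R)).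
  exact: measurable_cst.
have cv : {ae mu, forall t, period t -> ((f t - g n t) ^+ 2)%:E @[n --> \oo] --> (0 : \bar R)}.
  apply: aeW => t _; apply: cvg_near_cst.
  exists (Num.truncn `|f t|).+1 => // n /= nN.
  have fn : `|f t| < n.+1%:R.
    apply: lt_trans (truncnS_gt `|f t|) _; by rewrite ltr_nat ltnS.
  have := n0 n; rewrite /g clampE ?ltW//; move: fn; rewrite ltr_norml => /andP[f1 f2] _.
  by rewrite (ltNge (f t)) (ltW f1)/= ltNge (ltW f2)/= subrr expr0n.
have db : {ae mu, forall t, forall n, period t -> (`|((f t - g n t) ^+ 2)%:E| <= (f t ^+ 2)%:E)%E}.
  by apply: aeW => t n _; rewrite /= lee_fin ger0_norm ?sqr_ge0// dom.
have [_ _] := dominated_convergence measurable_period mfg m0 cv sf.2 db.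
rewrite integral0 => /fine_cvgP[_ /cvgrPdist_lt /(_ _ e0)[N _ /(_ N (leqnn N))]] /=.
rewrite sub0r normrN => h; exists (g N) => //.
rewrite nsqE; apply: le_lt_trans h; exact: ler_norm.
Qed.

Lemma parseval f : sqint f -> forall e : R, 0 < e ->
  exists N, forall n, (N <= n)%N -> nsq f - \sum_(i < n) ip f (ebas i) ^+ 2 < e.
Proof. by move=> sf; apply: trig_approx_parseval => //; exact: trig_approx_sqint. Qed.

End Parseval2.

(** * Translations of the period and improper integrals *)

Section Shift.
Context {R : realType}.
Local Notation mu := (@lebesgue_measure R).
Implicit Types (f g : R -> R) (a t x y : R).

Let measurable_shift a : measurable_fun setT ((fun x => x + a) : measurableTypeR R -> measurableTypeR R).
Proof.
apply: continuous_measurable_fun => x; apply: cvgD; [exact: cvg_id|exact: cvg_cst].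
Qed.

Let measurable_reflect a : measurable_fun setT ((fun x => a - x) : measurableTypeR R -> measurableTypeR R).
Proof.
apply: continuous_measurable_fun => x; apply: cvgB; [exact: cvg_cst|exact: cvg_id].
Qed.

Lemma lebesgue_measure_shift a (A : set R) : measurable A ->
  pushforward mu ((fun x => x + a) : measurableTypeR R -> measurableTypeR R) A = mu A.
Proof.
move=> mA; have ms := measurable_shift a.
apply/esym; apply: lebesgue_measure_unique => //= _ [[x y]] _ <-; rewrite /pushforward.
have -> : (fun z => z + a) @^-1` `]x, y] = `]x - a, y - a]%classic :> set R.
  by apply/seteqP; split => z /=; rewrite !in_itv/= ltrBlDr lerBrDr.
rewrite !lebesgue_measure_itv/= !lte_fin ltrD2r -!EFinD.
by rewrite opprB addrA subrK.
Qed.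

Lemma lebesgue_measure_reflect a (A : set R) : measurable A ->
  pushforward mu ((fun x => a - x) : measurableTypeR R -> measurableTypeR R) A = mu A.
Proof.
move=> mA; have ms := measurable_reflect a.
apply/esym; apply: lebesgue_measure_unique => //= _ [[x y]] _ <-; rewrite /pushforward.
have -> : (fun z => a - z) @^-1` `]x, y] = `[a - y, a - x[%classic :> set R.
  apply/seteqP; split => z /=; rewrite !in_itv/= => /andP[h1 h2]; apply/andP; split; lra.
rewrite !lebesgue_measure_itv/= !lte_fin ltrD2l ltrN2 -!EFinD.
by have -> : a - x - (a - y) = y - x by ring.
Qed.

Lemma ge0_integral_shift a f (D : set R) : measurable D -> measurable_fun setT f ->
  (forall x, 0 <= f x) ->
  (\int[mu]_(x in D) (f x)%:E = \int[mu]_(x in (fun x => (x + a)%R) @^-1` D) (f (x + a)%R)%:E)%E.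
Proof.
move=> mD mf f0.
rewrite -(@ge0_integral_pushforward _ _ _ _ R _ (measurable_shift a) mu D (fun x => (f x)%:E))//=.
- by apply: eq_measure_integral => A mA _; exact/esym/lebesgue_measure_shift.
- exact/measurable_EFinP/measurable_funTS.
- by move=> x _; rewrite lee_fin.
Qed.

Lemma ge0_integral_reflect a f (D : set R) : measurable D -> measurable_fun setT f ->
  (forall x, 0 <= f x) ->
  (\int[mu]_(x in D) (f x)%:E = \int[mu]_(x in (fun x => (a - x)%R) @^-1` D) (f (a - x)%R)%:E)%E.
Proof.
move=> mD mf f0.
rewrite -(@ge0_integral_pushforward _ _ _ _ R _ (measurable_reflect a) mu D (fun x => (f x)%:E))//=.
- by apply: eq_measure_integral => A mA _; exact/esym/lebesgue_measure_reflect.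
- exact/measurable_EFinP/measurable_funTS.
- by move=> x _; rewrite lee_fin.
Qed.

Let period_co f : measurable_fun setT f -> (\int[mu]_(x in period) (f x)%:E =
   \int[mu]_(x in `[0%R, (2 * pi)%R[) (f x)%:E)%E.
Proof.
move=> mf; rewrite integral_itv_bndo_bndc//.
exact/measurable_EFinP/measurable_funTS.
Qed.

(** The two parts into which t cuts the period are exchanged by the translation modulo 2 pi. *)
Lemma ge0_integral_periodic t f : period t -> measurable_fun setT f -> (forall x, 0 <= f x) ->
  (forall x, f (x + 2 * pi) = f x) ->
  (\int[mu]_(x in period) (f (x - t)%R)%:E = \int[mu]_(x in period) (f x)%:E)%E.
Proof.
rewrite /period/= in_itv/= => /andP[t0 t2] mf f0 fp.
have mft : measurable_fun setT (fun x => f (x - t)).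
  by apply: (measurableT_comp mf); exact: measurable_shift.
rewrite !period_co//.
have mE h : measurable_fun setT h -> forall D : set R, measurable_fun D (fun x => (h x)%:E).
  by move=> mh D; exact/measurable_EFinP/measurable_funTS.
have E1 : `[0, 2 * pi[%classic = `[0, 2 * pi - t[ `|` `[2 * pi - t, 2 * pi[ :> set R.
  apply/seteqP; split => x /=; rewrite !in_itv/=.
    by move=> /andP[-> ->]; rewrite andbT/=; case: (ltP x (2 * pi - t)) => h; [left|right].
  by case=> /andP[h1 h2]; apply/andP; split; lra.
have E2 : `[0, 2 * pi[%classic = `[0, t[ `|` `[t, 2 * pi[ :> set R.
  apply/seteqP; split => x /=; rewrite !in_itv/=.
    by move=> /andP[-> ->]; rewrite andbT/=; case: (ltP x t) => h; [left|right].
  by case=> /andP[h1 h2]; apply/andP; split; lra.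
rewrite {1}E2 E1 !ge0_integral_setU//; try exact: mE; try (by move=> x _; rewrite lee_fin).
- rewrite addeC; congr (_ + _)%E.
  + rewrite (@ge0_integral_shift (- t) f `[0, 2 * pi - t[)//.
    congr (integral _ _ _); apply/seteqP; split => x /=; rewrite !in_itv/= => /andP[h1 h2];
      apply/andP; split; lra.
  + rewrite (@ge0_integral_shift (2 * pi - t) f `[2 * pi - t, 2 * pi[)//.
    transitivity (\int[mu]_(x in `[0%R, t[) (f (x + (2 * pi - t))%R)%:E)%E.
      apply: eq_integral => x _; congr (_%:E); rewrite -fp; congr f; ring.
    congr (integral _ _ _); apply/seteqP; split => x /=; rewrite !in_itv/= => /andP[h1 h2];
      apply/andP; split; lra.
- apply/disj_setPS => x [] /=; rewrite !in_itv/= => /andP[_ h1] /andP[h2 _]; lra.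
- apply/disj_setPS => x [] /=; rewrite !in_itv/= => /andP[_ h1] /andP[h2 _]; lra.
Qed.

Lemma ge0_integral_periodN f : measurable_fun setT f -> (forall x, 0 <= f x) ->
  (\int[mu]_(x in period) (f (2 * pi - x)%R)%:E = \int[mu]_(x in period) (f x)%:E)%E.
Proof.
move=> mf f0; rewrite [RHS](@ge0_integral_reflect (2 * pi))//; last exact: measurable_period.
congr (integral _ _ _); apply/seteqP; split => x /=; rewrite /period/= !in_itv/= => /andP[h1 h2];
  apply/andP; split; lra.
Qed.

Lemma pinE f : pmeas f -> (\int[mu]_(x in period) (`|f x|)%:E < +oo)%E -> pin f.
Proof. by move=> mf fi; apply/integrableP; split => //; exact/measurable_EFinP. Qed.

Lemma pin_lty f : pin f -> (\int[mu]_(x in period) (`|f x|)%:E < +oo)%E.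
Proof. by case/integrableP. Qed.

Lemma pin_periodic t f : period t -> measurable_fun setT f ->
  (forall x, f (x + 2 * pi) = f x) -> pin f -> pin (fun x => f (x - t)).
Proof.
move=> pt mf fp pf; apply: pinE.
  apply: measurable_funTS; apply: (measurableT_comp mf); exact: measurable_shift.
rewrite (@ge0_integral_periodic t (fun x => `|f x|))//; first exact: pin_lty.
  exact: measurableT_comp.
by move=> x; rewrite fp.
Qed.

Lemma pint_periodic t f : period t -> measurable_fun setT f ->
  (forall x, f (x + 2 * pi) = f x) -> pin f -> pint (fun x => f (x - t)) = pint f.
Proof.
move=> pt mf fp pf.
have mnf : measurable_fun setT (fun x => `|f x|) by exact: measurableT_comp.
have H g : measurable_fun setT g -> (forall x, 0 <= g x) -> (forall x, g (x + 2 * pi) = g x) ->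
    pint (fun x => g (x - t)) = pint g.
  by move=> mg g0 gp; congr fine; exact: ge0_integral_periodic.
have i1 : pin (fun x => f (x - t)) by exact: pin_periodic.
have i2 := pin_norm i1; have i3 := pin_norm pf.
have h1 := H _ mnf (fun x => normr_ge0 _) (fun x => congr1 Num.norm (fp x)).
have h2 : pint (fun x => f (x - t) + `|f (x - t)|) = pint (fun x => f x + `|f x|).
  apply: (H (fun x => f x + `|f x|)) => [|x|x]; last by rewrite fp.
  - exact: measurable_funD.
  - by rewrite -lerBlDr sub0r lerNnormlW.
have := h2; rewrite !pintD// h1 => /addIr; exact.
Qed.

Lemma pint_odd f : measurable_fun setT f -> pin f -> (forall x, f (2 * pi - x) = - f x) -> pint f = 0.
Proof.
move=> mf pf fo.
have mnf : measurable_fun setT (fun x => `|f x|) by exact: measurableT_comp.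
have i3 := pin_norm pf.
have h2 : pint (fun x => f (2 * pi - x) + `|f (2 * pi - x)|) = pint (fun x => f x + `|f x|).
  congr fine; apply: (@ge0_integral_periodN (fun x => f x + `|f x|)) => [|x].
  - exact: measurable_funD.
  - by rewrite -lerBlDr sub0r lerNnormlW.
have : pint (fun x => - f x + `|f x|) = pint f + pint (fun x => `|f x|).
  rewrite -pintD// -h2; apply: eq_pint => x _; by rewrite fo normrN.
have pNf : pin (fun x => - f x) by apply: eq_pin (pinZ (-1) pf) => x _; rewrite mulN1r.
rewrite pintD// pintN// => /addIr /eqP; rewrite eq_sym -addr_eq0 -mulr2n mulrn_eq0/=.
by move=> /eqP.
Qed.

(** Integrands that are singular at the end points, where they are given the value 0, are cut off
    at distance 1/(n+1) from the end points before the fundamental theorem of calculus is applied.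
    *)
Let cut (n : nat) : R -> R := ind (n.+1%:R^-1) (2 * pi - n.+1%:R^-1).

Let inv1 (n : nat) : 0 < (n.+1%:R^-1 : R) <= 1.
Proof. by rewrite invr_gt0 ltr0n/= invf_le1 ?ltr0n// ler1n. Qed.

Let cutI (n : nat) : [/\ 0 < n.+1%:R^-1 :> R, n.+1%:R^-1 < 2 * pi - n.+1%:R^-1 :> R,
  2 * pi - n.+1%:R^-1 < 2 * pi :> R, period (n.+1%:R^-1 : R) & period (2 * pi - n.+1%:R^-1 : R)].
Proof.
have /andP[] := inv1 n; have := pi_ge2 R; rewrite /period/= !in_itv/=.
move: (n.+1%:R^-1 : R) (pi : R) => a P P2 a0 a1.
by split; try (apply/andP; split); lra.
Qed.

Let cut_cvg f s : f 0 = 0 -> f (2 * pi) = 0 -> period s ->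
  exists N, forall n, (N <= n)%N -> cut n s * f s = f s.
Proof.
move=> f0 f2; rewrite /period/= in_itv/= => /andP[].
rewrite le_eqVlt => /predU1P[<- _|s0]; first by exists 0%N => n _; rewrite f0 mulr0.
rewrite le_eqVlt => /predU1P[->|s2]; first by exists 0%N => n _; rewrite f2 mulr0.
pose m : R := Num.min s (2 * pi - s).
have m0 : 0 < m by rewrite lt_min s0 subr_gt0.
exists (Num.truncn m^-1) => n Nn.
have : n.+1%:R^-1 <= m.
  rewrite -[leRHS]invrK lef_pV2 ?posrE ?ltr0n ?invr_gt0//.
  rewrite (le_trans (ltW (truncnS_gt m^-1)))// ler_nat ltnS//.
rewrite le_min => /andP[h1 h2]; rewrite /cut indE ifT ?mul1r//.
by rewrite h1/= lerBrDl -lerBrDr.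
Qed.

Lemma FTC_inside (F f : R -> R) a b : 0 < a -> a < b -> b < 2 * pi ->
  (forall t, 0 < t < 2 * pi -> is_derive t (1 : R) F (f t)) ->
  (forall t, 0 < t < 2 * pi -> {for t, continuous f}) ->
  {within `[a, b], continuous f} /\ (\int[mu]_(x in `[a, b]) (f x)%:E = (F b - F a)%:E)%E.
Proof.
move=> a0 ab b2 dF cf.
have wf : {within `[a, b], continuous f}.
  apply: continuous_in_subspaceT => t /set_mem/=; rewrite in_itv/= => /andP[t1 t3].
  by apply: cf; apply/andP; split; lra.
split => //; rewrite (@continuous_FTC2 _ f F a b)//.
- have cF t : 0 < t < 2 * pi -> {for t, continuous F} by move=> /dF; exact: der_cts.
  split=> [x|  |].
  + rewrite in_itv/= => /andP[x1 x2]; apply: (@ex_derive _ _ _ _ _ _ _ (dF x _)).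
    by apply/andP; split; lra.
  + by apply/cvg_at_right_filter/cF; apply/andP; split; lra.
  + by apply/cvg_at_left_filter/cF; apply/andP; split; lra.
- move=> x; rewrite in_itv/= => /andP[x1 x2].
  rewrite derive1E; apply: (@derive_val _ _ _ _ _ _ _ (dF x _)).
  by apply/andP; split; lra.
Qed.

Let cut_int f n : (\int[mu]_(s in period) (cut n s * f s)%:E =
  \int[mu]_(s in `[(n.+1%:R^-1)%R, (2 * pi - n.+1%:R^-1)%R]) (f s)%:E)%E.
Proof.
have /andP[n0 n1] := inv1 n; have p2 := pi_ge2 R.
transitivity (\int[mu]_(s in period) ((fun x => (f x)%:E) \_ (`[(n.+1%:R^-1)%R, (2 * pi - n.+1%:R^-1)%R]%classic)) s)%E.
  apply: eq_integral => s _; rewrite /cut indE /patch.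
  case: ifPn => h; first by rewrite mem_set ?mul1r//= in_itv.
  by rewrite memNset ?mul0r//= in_itv/=; exact/negP.
rewrite -integral_mkcondr; congr (integral _ _ _).
rewrite eqEsubset; split=> s /=; first by case.
move=> sab; split=> //; rewrite /period/= in_itv/=.
move: sab; rewrite in_itv/= => /andP[as_ sb]; have [h1 h2 h3 _ _] := cutI n.
by rewrite (le_trans (ltW h1) as_) (le_trans sb (ltW h3)).
Qed.

Let cut_FTC (F f : R -> R) n :
  (forall t, 0 < t < 2 * pi -> is_derive t (1 : R) F (f t)) ->
  (forall t, 0 < t < 2 * pi -> {for t, continuous f}) ->
  (\int[mu]_(s in period) (cut n s * f s)%:E = (F (2 * pi - n.+1%:R^-1) - F (n.+1%:R^-1))%:E)%E.
Proof.
move=> dF cf; have [h1 h2 h3 _ _] := cutI n.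
by rewrite cut_int; exact: (FTC_inside h1 h2 h3 dF cf).2.
Qed.

(** The integrals of the truncations are increments of the bounded function F, so monotone
    convergence applies. *)
Lemma pin_sing (F f : R -> R) : f 0 = 0 -> f (2 * pi) = 0 -> measurable_fun setT f ->
  (forall t, period t -> 0 <= f t) -> continuous F ->
  (forall t, 0 < t < 2 * pi -> is_derive t (1 : R) F (f t)) ->
  (forall t, 0 < t < 2 * pi -> {for t, continuous f}) -> pin f.
Proof.
move=> f0 f2 mf fge cF dF cf.
have [M M0 FM] := cts_bounded cF.
have mc n : measurable_fun (period : set (measurableTypeR R)) (fun s => (cut n s * f s)%:E).
  apply/measurable_EFinP; apply: measurable_funM; first exact: pmeas_ind.
  exact: measurable_funTS.
have c0 n s : 0 <= cut n s by rewrite /cut indE; case: ifP.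
have ge0 n s : period s -> (0 <= (cut n s * f s)%:E)%E.
  by move=> ps; rewrite lee_fin mulr_ge0// fge.
have hom s : period s -> {homo (fun n => (cut n s * f s)%:E) : n m / (n <= m)%N >-> (n <= m)%E}.
  move=> ps n m nm; rewrite lee_fin ler_wpM2r ?fge// /cut !indE.
  have nmi : m.+1%:R^-1 <= n.+1%:R^-1 :> R by rewrite lef_pV2 ?posrE ?ltr0n// ler_nat ltnS.
  case: ifPn => [/andP[h1 h2]|_]; last by case: ifP.
  rewrite ifT//; apply/andP; split; first exact: le_trans h1.
  by apply: (le_trans h2); rewrite lerD2l lerN2.
have LE n : (\int[mu]_(s in period) (cut n s * f s)%:E <= (2 * M)%:E)%E.
  have [_ _ _ h1 h2] := cutI n.
  rewrite (cut_FTC n dF cf) lee_fin (le_trans (ler_norm _))// (le_trans (ler_normB _ _))//.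
  have -> : 2 * M = M + M by ring.
  by apply: lerD; exact: FM.
have CV := cvg_monotone_convergence (mu := mu) measurable_period mc ge0 hom.
apply: pinE; first exact: measurable_funTS.
have -> : (\int[mu]_(x in period) (`|f x|)%:E = \int[mu]_(x in period) limn (fun n => (cut n x * f x)%:E))%E.
  apply: eq_integral => s /set_mem ps; rewrite ger0_norm ?fge//.
  apply/esym/cvg_lim => //; have [N hN] := cut_cvg f0 f2 ps.
  by apply: cvg_near_cst; exists N => // n /= /hN ->.
rewrite -(cvg_lim _ CV)//; apply: (@le_lt_trans _ _ (2 * M)%:E); last exact: ltry.
apply: lime_le; first by apply/cvg_ex; eexists; exact: CV.
by apply: nearW => n; exact: LE.
Qed.

Lemma pint_sing (F f : R -> R) : f 0 = 0 -> f (2 * pi) = 0 -> measurable_fun setT f ->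
  continuous F ->
  (forall t, 0 < t < 2 * pi -> is_derive t (1 : R) F (f t)) ->
  (forall t, 0 < t < 2 * pi -> {for t, continuous f}) -> pin f -> pint f = F (2 * pi) - F 0.
Proof.
move=> f0 f2 mf cF dF cf pf.
have mc n : measurable_fun (period : set (measurableTypeR R)) (fun s => (cut n s * f s)%:E).
  apply/measurable_EFinP; apply: measurable_funM; first exact: pmeas_ind.
  exact: measurable_funTS.
have mf' : measurable_fun (period : set (measurableTypeR R)) (fun s => (f s)%:E).
  by apply/measurable_EFinP; exact: measurable_funTS.
have cv : {ae mu, forall s, period s -> (cut n s * f s)%:E @[n --> \oo] --> (f s)%:E}.
  apply: aeW => s ps; have [N hN] := cut_cvg f0 f2 ps.
  by apply: cvg_near_cst; exists N => // n /= /hN ->.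
have db : {ae mu, forall s, forall n, period s -> (`|(cut n s * f s)%:E| <= (`|f s|)%:E)%E}.
  apply: aeW => s n ps; rewrite /= lee_fin normrM -[leRHS]mul1r ler_wpM2r//.
  exact: ind_norm.
have [_ _ +] := dominated_convergence measurable_period mc mf' cv (pin_norm pf) db.
rewrite (_ : (fun n => _) = (fun n => (F (2 * pi - n.+1%:R^-1) - F (n.+1%:R^-1))%:E)); last first.
  by apply/funext => n; rewrite (cut_FTC n dF cf).
move=> H1.
have H2 : (F (2 * pi - n.+1%:R^-1) - F (n.+1%:R^-1))%:E @[n --> \oo] --> (F (2 * pi) - F 0)%:E.
  apply: cvg_EFin; first exact: nearW.
  have inv0 : n.+1%:R^-1 @[n --> \oo] --> (0 : R) by exact: cvg_harmonic.
  apply: cvgB; last by apply: continuous_cvg => //; exact: cF.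
  apply: continuous_cvg; first exact: cF.
  rewrite -[X in _ --> X]subr0; apply: cvgB => //; exact: cvg_cst.
by rewrite /pint /Rintegral; have -> := cvg_unique _ H1 H2.
Qed.

End Shift.

(** * Fourier coefficients of the logarithm of the sine *)

Section LogSine.
Context {R : realType}.
Local Notation mu := (@lebesgue_measure R).
Local Notation der f t d := (is_derive (t : R) (1 : R) (f : R -> R) (d : R)).
Implicit Types (f g : R -> R) (a t u x y : R).

Lemma der_sqrt f t a : 0 < f t -> der f t a -> der (fun x => Num.sqrt (f x)) t (a / (2 * Num.sqrt (f t))).
Proof. by move=> f0 df; rewrite mulrC; apply: der_comp df; exact: is_derive1_sqrt. Qed.

Lemma ln_le1B x : 0 < x -> ln x <= x - 1.
Proof. by move=> x0; rewrite -{1}(subrK 1 x) addrC le_ln1Dx//; lra. Qed.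

(** With y the fourth root of x, the size of ln x = 4 ln y is at most 4 / y. *)
Lemma ln_sqr_le x : 0 < x <= 2 -> ln x ^+ 2 <= 16 / Num.sqrt x.
Proof.
move=> /andP[x0 x2].
pose y := Num.sqrt (Num.sqrt x).
have s0 : 0 < Num.sqrt x by rewrite sqrtr_gt0.
have y0 : 0 < y by rewrite /y sqrtr_gt0.
have yy : y ^+ 2 = Num.sqrt x by rewrite /y sqr_sqrtr// ltW.
have y4 : x = y ^+ 4 by rewrite (exprM y 2 2) yy sqr_sqrtr// ltW.
rewrite -yy (_ : 16 / y ^+ 2 = (4 / y) ^+ 2); last by rewrite exprMn exprVn; congr (_ / _); ring.
suff h : `|ln x| <= 4 / y.
  by rewrite -(real_normK (num_real (ln x))) lerXn2r ?nnegrE ?divr_ge0// ltW.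
have yi : 0 < y^-1 by rewrite invr_gt0.
have y2 : y <= 2.
  rewrite leNgt; apply/negP => h; have : 2 ^+ 4 < y ^+ 4 by rewrite ltrXn2r ?nnegrE// ltW.
  by rewrite -y4; lra.
have yi2 : 2^-1 <= y^-1 by rewrite lef_pV2 ?posrE.
rewrite ler_norml; apply/andP; split.
  have -> : ln x = - (4 * ln y^-1).
    by rewrite lnV ?posrE// {1}y4 lnXn// mulrN opprK mulr_natl.
  rewrite lerN2 ler_pM2l//; by apply: (le_trans (ln_le1B yi)); lra.
by apply: (le_trans (ln_le1B x0)); lra.
Qed.

Lemma xlnx_le x : 0 <= x <= 2 -> `|x * ln x| <= 2 * Num.sqrt x.
Proof.
move=> /andP[]; rewrite le_eqVlt => /predU1P[<- _|x0 x2].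
  by rewrite mul0r normr0 mulr_ge0// sqrtr_ge0.
have s0 : 0 < Num.sqrt x by rewrite sqrtr_gt0.
have ss : x = Num.sqrt x ^+ 2 by rewrite sqr_sqrtr// ltW.
rewrite normrM (gtr0_norm x0); move: s0 ss; move: (Num.sqrt x) => s s0 ss.
have [x1|x1] := lerP x 1.
  rewrite ler0_norm ?ln_le0// -lnV// {2}ss -exprVn lnXn ?invr_gt0//.
  have si : 0 < s^-1 by rewrite invr_gt0.
  have := ln_le1B si => h.
  have : x * (ln s^-1 *+ 2) <= x * (s^-1 *+ 2).
    by rewrite ler_wpM2l ?(ltW x0)// lerMn2r/=; apply: (le_trans h); lra.
  have -> : x * (s^-1 *+ 2) = 2 * s by rewrite ss mulr2n; field; rewrite gt_eqF.
  by [].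
rewrite ger0_norm; last exact/ln_ge0/ltW.
have s1 : 1 < s by rewrite -(@ltr_pXn2r _ 2)// ?nnegrE ?ltW// -ss expr1n.
have l1 : ln x <= 1 by apply: (le_trans (ln_le1B x0)); lra.
apply: (@le_trans _ _ (x * 1)); first by rewrite ler_wpM2l// ltW.
by rewrite mulr1; apply: (le_trans x2); lra.
Qed.

(** The kernel of a convolution that the trigonometric basis diagonalizes; its value at the
    multiples of 2 pi is ln 0 = 0. *)
Definition lnsin u : R := ln `|2 * sin (u / 2)|.

Lemma sin_half2pi u : sin ((u + 2 * pi) / 2) = - sin (u / 2).
Proof. by rewrite mulrDl (mulrC 2) mulfK// sinDpi. Qed.

Lemma lnsin_per u : lnsin (u + 2 * pi) = lnsin u.
Proof. by rewrite /lnsin sin_half2pi mulrN normrN. Qed.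

Lemma lnsinN u : lnsin (- u) = lnsin u.
Proof. by rewrite /lnsin mulNr sinN mulrN normrN. Qed.

Lemma lnsin0 : lnsin 0 = 0.
Proof. by rewrite /lnsin mul0r sin0 mulr0 normr0 ln0. Qed.

Lemma lnsin2pi : lnsin (2 * pi) = 0.
Proof. by rewrite -[2 * pi]add0r lnsin_per lnsin0. Qed.

Let cts_half : continuous (fun u : R => 2 * sin (u / 2)).
Proof.
apply: ctsZ; apply: (@cts_comp R sin); first exact: continuous_sin.
by apply: ctsM; [move=> x; exact: cvg_id|exact: cst_continuous].
Qed.

Lemma measurable_lnsin : measurable_fun setT lnsin.
Proof.
apply: (@measurableT_comp _ _ _ _ _ _ (@ln R)); first exact: measurable_ln.
by apply: continuous_measurable_fun; exact: cts_norm.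
Qed.

Lemma sin_half_gt0 u : 0 < u < 2 * pi -> 0 < 2 * sin (u / 2).
Proof.
move=> /andP[u0 u2]; rewrite mulr_gt0// sin_gt0_pi// divr_gt0//=.
by rewrite ltr_pdivrMr// mulrC.
Qed.

Lemma sin_half_le2 u : `|2 * sin (u / 2)| <= 2.
Proof. by rewrite normrM ger0_norm// -[leRHS]mulr1 ler_wpM2l// sin_max. Qed.

Lemma der_lnsin u : 0 < u < 2 * pi -> der lnsin u (cos (u / 2) / (2 * sin (u / 2))).
Proof.
move=> uI; have s0 := sin_half_gt0 uI.
have d1 : der (fun v : R => 2 * sin (v / 2)) u (cos (u / 2)).
  have -> : (fun v : R => 2 * sin (v / 2)) = (fun v => 2 * sin (2^-1 * v)).
    by apply/funext => v; rewrite (mulrC v).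
  by apply: (der_eq (derZ 2 (der_sinM 2^-1 u))); rewrite mulrA mulfV// mul1r mulrC.
have d2 := @der_ln R (fun v => 2 * sin (v / 2)) u _ s0 d1.
apply: (near_eq_is_derive _ d2).
have [d d0 hd] := @cts_eps R (fun v => 2 * sin (v / 2)) u (@cts_half u) _ s0.
apply/nbhs_ballP; exists d => //= v; rewrite /ball/= distrC => /hd.
by rewrite ltr_norml => /andP[h _]; rewrite /lnsin gtr0_norm//; lra.
Qed.

(** A majorant of the inverse square root of the sine that has the bounded primitive 8 (sqrt (sin
    (u/4)) - sqrt (cos (u/4))). *)
Let maj u : R := sin (4^-1 * u) / Num.sqrt (cos (4^-1 * u)) + cos (4^-1 * u) / Num.sqrt (sin (4^-1 * u)).

Let sc_gt0 u : 0 < u < 2 * pi -> 0 < sin (4^-1 * u) /\ 0 < cos (4^-1 * u).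
Proof.
have p0 := pi_gt0 R.
move=> /andP[u0 u2]; split.
  by apply: sin_gt0_pihalf; apply/andP; split; [rewrite mulr_gt0//|move: u2; move: (pi : R) => P; lra].
apply: cos_gt0_pihalf; move: u2 p0; move: (pi : R) => P u2 P0; apply/andP; split; lra.
Qed.

Lemma measurable_rsqrt : measurable_fun setT (fun u : R => (Num.sqrt u)^-1).
Proof.
  have -> : (fun u : R => (Num.sqrt u)^-1) = (fun u : R => if 0 < u then u `^ (- 2^-1) else 0).
    apply/funext => u; case: ifPn => [u0|]; first by rewrite powRN powR12_sqrt// ltW.
    by rewrite -leNgt => u0; rewrite ler0_sqrtr// invr0.
  apply: measurable_fun_ifT.
  + exact: measurable_fun_ltr.
  + exact: measurable_powR.
  + exact: measurable_cst.
Qed.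

Let pin_maj : pin maj.
Proof.
pose F u : R := 8 * Num.sqrt (sin (4^-1 * u)) - 8 * Num.sqrt (cos (4^-1 * u)).
have q2 : 4^-1 * (2 * pi) = pi / 2 :> R by move: (pi : R) => P; field.
have csqrt : continuous (@Num.sqrt R) by exact: sqrt_continuous.
have h0 : maj 0 = 0.
  by rewrite /maj mulr0 sin0 cos0 mul0r sqrtr0 invr0 mulr0 addr0.
have h1 : maj (2 * pi) = 0.
  by rewrite /maj q2 sin_pihalf cos_pihalf sqrtr0 invr0 mulr0 mul0r addr0.
have h2 : measurable_fun setT maj.
  have mS : measurable_fun setT (fun u : R => sin (4^-1 * u)).
    exact: continuous_measurable_fun (@cts_sinM R 4^-1).
  have mC : measurable_fun setT (fun u : R => cos (4^-1 * u)).
    exact: continuous_measurable_fun (@cts_cosM R 4^-1).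
  have mI := measurable_rsqrt.
  apply: measurable_funD; apply: measurable_funM => //.
  + exact: (measurableT_comp mI mC).
  + exact: (measurableT_comp mI mS).
have h3 : forall t, period t -> 0 <= maj t.
  have p0 := pi_gt0 R.
  move=> t; rewrite /period/= in_itv/= => /andP[t0 t2].
  have s0 : 0 <= sin (4^-1 * t).
    by apply: sin_ge0_pi; move: t2 p0; move: (pi : R) => P t2 P0; apply/andP; split; lra.
  have c0 : 0 <= cos (4^-1 * t).
    by apply: cos_ge0_pihalf; move: t2 p0; move: (pi : R) => P t2 P0; apply/andP; split; lra.
  by rewrite addr_ge0// divr_ge0// sqrtr_ge0.
have h4 : continuous F.
  apply: ctsB; apply: ctsZ; apply: (@cts_comp R Num.sqrt) => //; [exact: cts_sinM|exact: cts_cosM].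
have h5 : forall t, 0 < t < 2 * pi -> der F t (maj t).
  move=> t /sc_gt0[s0 c0].
  apply: (der_eq (derB (derZ 8 (der_sqrt s0 (der_sinM _ t))) (derZ 8 (der_sqrt c0 (der_cosM _ t))))).
  have p0 : Num.sqrt (sin (4^-1 * t)) != 0 by rewrite gt_eqF// sqrtr_gt0.
  have q0 : Num.sqrt (cos (4^-1 * t)) != 0 by rewrite gt_eqF// sqrtr_gt0.
  rewrite /maj; move: p0 q0; move: (Num.sqrt (sin _)) (Num.sqrt (cos _)) => p q p0 q0.
  by field; rewrite p0 q0.
have h6 : forall t, 0 < t < 2 * pi -> {for t, continuous maj}.
  move=> t /sc_gt0[s0 c0].
  have sN : Num.sqrt (sin (4^-1 * t)) != 0 by rewrite gt_eqF// sqrtr_gt0.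
  have cN : Num.sqrt (cos (4^-1 * t)) != 0 by rewrite gt_eqF// sqrtr_gt0.
  have ds := @derV R (fun x => Num.sqrt (sin (4^-1 * x))) t _ sN
    (@der_sqrt (fun x => sin (4^-1 * x)) t _ s0 (der_sinM _ t)).
  have dc := @derV R (fun x => Num.sqrt (cos (4^-1 * x))) t _ cN
    (@der_sqrt (fun x => cos (4^-1 * x)) t _ c0 (der_cosM _ t)).
  exact: (der_cts (derD (derM (der_sinM _ t) dc) (derM (der_cosM _ t) ds))).
exact: (pin_sing h0 h1 h2 h3 h4 h5 h6).
Qed.

(** With p^2 = sin (u/4) and q^2 = cos (u/4), the majorant is (p^3 + q^3) / (p q), where p^3 + q^3
    >= p^4 + q^4 = 1, while the square root of 2 sin (u/2) is 2 p q. *)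
Lemma pin_rsqrt_sin : pin (fun u => (Num.sqrt `|2 * sin (u / 2)|)^-1).
Proof.
apply: (@pin_le _ _ maj) pin_maj.
  apply: measurable_funTS; apply: (measurableT_comp measurable_rsqrt).
  exact: continuous_measurable_fun (cts_norm cts_half).
move=> u; rewrite /period/= in_itv/= => /andP[u0 u2].
rewrite ger0_norm ?invr_ge0 ?sqrtr_ge0//.
have [u0'|u0'] := eqVneq u 0.
  by rewrite u0' mul0r sin0 mulr0 normr0 sqrtr0 invr0 /maj mulr0 sin0 cos0 mul0r sqrtr0 invr0 mulr0 addr0.
have [u2'|u2'] := eqVneq u (2 * pi).
  have -> : 2 * sin (u / 2) = 0 by rewrite u2' (mulrC 2 pi) mulfK// sinpi mulr0.
  have q2 : 4^-1 * u = pi / 2 :> R by rewrite u2'; move: (pi : R) => P; field.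
  by rewrite normr0 sqrtr0 invr0 /maj q2 sin_pihalf cos_pihalf sqrtr0 invr0 mulr0 mul0r addr0.
have [|s0 c0] := @sc_gt0 u; first by rewrite !lt_neqAle eq_sym u0' u2' u0 u2.
have -> : u / 2 = 4^-1 * u + 4^-1 * u by lra.
rewrite sinD /maj; move: s0 c0 (cos2Dsin2 (4^-1 * u)).
move: (sin (4^-1 * u)) (cos (4^-1 * u)) => s c s0 c0 sc.
rewrite ger0_norm; last by nra.
have -> : 2 * (s * c + c * s) = 4 * (s * c) by ring.
rewrite !sqrtrM ?(ltW s0)//.
have -> : Num.sqrt 4 = 2 :> R by rewrite (_ : 4 = 2 ^+ 2) ?sqrtr_sqr ?ger0_norm//; ring.
have [p p0 sE] : exists2 p : R, 0 < p & s = p ^+ 2.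
  by exists (Num.sqrt s); rewrite ?sqrtr_gt0// sqr_sqrtr// ltW.
have [q q0 cE] : exists2 q : R, 0 < q & c = q ^+ 2.
  by exists (Num.sqrt c); rewrite ?sqrtr_gt0// sqr_sqrtr// ltW.
rewrite sE cE !sqrtr_sqr !(gtr0_norm p0) !(gtr0_norm q0).
move: sc; rewrite sE cE => pq.
have p1 : p <= 1 by rewrite -(@ler_pXn2r _ 4) ?nnegrE ?ler01 ?(ltW p0) ?(ltW q0)// expr1n -pq -!exprM lerDr exprn_ge0// ltW.
have q1 : q <= 1 by rewrite -(@ler_pXn2r _ 4) ?nnegrE ?ler01 ?(ltW p0) ?(ltW q0)// expr1n -pq -!exprM lerDl exprn_ge0// ltW.
have pqN : p != 0 /\ q != 0 by rewrite !gt_eqF.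
have -> : p ^+ 2 / q + q ^+ 2 / p = (p ^+ 3 + q ^+ 3) / (p * q) by field; rewrite ?pqN.1 ?pqN.2.
rewrite ler_pdivlMr ?mulr_gt0//.
have -> : (2 * (p * q))^-1 * (p * q) = 2^-1 by field; rewrite ?pqN.1 ?pqN.2.
have h1 : p ^+ 4 <= p ^+ 3 by rewrite exprS ler_piMl// exprn_ge0// ltW.
have h2 : q ^+ 4 <= q ^+ 3 by rewrite exprS ler_piMl// exprn_ge0// ltW.
have : p ^+ 4 + q ^+ 4 = 1 by rewrite -pq; ring.
by lra.
Qed.

Lemma sqint_lnsin : sqint lnsin.
Proof.
apply: (sqint_pin_sqr (g := fun u => 16 * (Num.sqrt `|2 * sin (u / 2)|)^-1)).
- by apply: measurable_funTS; exact: measurable_lnsin.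
- exact: pinZ pin_rsqrt_sin.
move=> u _; rewrite /lnsin; have [->|x0] := eqVneq (2 * sin (u / 2)) 0.
  by rewrite normr0 ln0// expr0n sqrtr0 invr0 mulr0.
by apply: ln_sqr_le; rewrite normr_gt0 x0 sin_half_le2.
Qed.

Lemma norm_sin_natM (k : nat) u : `|sin (k%:R * u)| <= k%:R * `|sin u|.
Proof.
elim: k => [|k IH]; first by rewrite !mul0r sin0 normr0.
rewrite -natr1 !mulrDl !mul1r sinD; apply: (le_trans (ler_normD _ _)); apply: lerD.
  rewrite normrM; apply: le_trans IH; rewrite -[leRHS]mulr1 ler_wpM2l//; exact: cos_max.
by rewrite normrM -[leRHS]mul1r ler_wpM2r//; exact: cos_max.
Qed.

(** The trigonometric polynomial cos (u/2) sin (k u) / (2 sin (u/2)), with its primitive Tau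
    below. *)
Let tau (k : nat) u : R := \sum_(j < k) 2^-1 * (cos (j.+1%:R * u) + cos (j%:R * u)).

Let tauE k u : 2 * sin (u / 2) * tau k u = cos (u / 2) * sin (k%:R * u).
Proof.
elim: k => [|k IH]; first by rewrite /tau big_ord0 mul0r sin0 !mulr0.
rewrite /tau big_ord_recr/= mulrDr -/(tau k u) IH.
have -> : k.+1%:R * u = k%:R * u + (u / 2 + u / 2) by rewrite -natr1; field.
rewrite !(cosD, sinD); have := sin2cos2 (u / 2).
move: (sin (u / 2)) (cos (u / 2)) (sin (k%:R * u)) (cos (k%:R * u)) => s c S C h.
apply/eqP; rewrite -subr_eq0.
set L := (X in X == 0); have -> : L = (c * S + s * C) * (1 - c ^+ 2 - s ^+ 2) by rewrite /L; field.
by rewrite h subrr mulr0.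
Qed.

Let Tau (k : nat) u : R := \sum_(j < k) 2^-1 *
  (j.+1%:R^-1 * sin (j.+1%:R * u) + (if j == 0%N :> nat then u else j%:R^-1 * sin (j%:R * u))).

Let der_Tau k u : der (Tau k) u (tau k u).
Proof.
elim: k => [|k IH].
  have -> : Tau 0 = fun=> 0 by apply/funext => v; rewrite /Tau big_ord0.
  by rewrite /tau big_ord0; exact: der_cst.
have -> : Tau k.+1 = fun v => Tau k v + 2^-1 * (k.+1%:R^-1 * sin (k.+1%:R * v) +
    (if k == 0%N then v else k%:R^-1 * sin (k%:R * v))).
  by apply/funext => v; rewrite /Tau big_ord_recr.
have d1 : der (fun v => k.+1%:R^-1 * sin (k.+1%:R * v)) u (cos (k.+1%:R * u)).
  by apply: (der_eq (derZ _ (der_sinM _ u))); rewrite mulKf// pnatr_eq0.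
have d2 : der (fun v => if k == 0%N then v else k%:R^-1 * sin (k%:R * v)) u (cos (k%:R * u)).
  case: eqP => [->|/eqP k0]; first by rewrite mul0r cos0; exact: der_id.
  by apply: (der_eq (derZ _ (der_sinM _ u))); rewrite mulKf// pnatr_eq0.
by rewrite /tau big_ord_recr/= -/(tau k u); exact: (derD IH (derZ _ (derD d1 d2))).
Qed.

Let Tau_end k : (0 < k)%N -> Tau k (2 * pi) - Tau k 0 = pi.
Proof.
case: k => // k _; rewrite /Tau !big_ord_recl/= !mulr0 sin0 sin_nat2pi !mulr0 !add0r mulr0 add0r.
rewrite !big1 ?addr0 ?subr0 ?mulKf//; move=> i _ /=.
  by rewrite !mulr0 !sin0 !mulr0 addr0 mulr0.
by rewrite !sin_nat2pi !mulr0 addr0 mulr0.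
Qed.

Let cts_lnsin u : 2 * sin (u / 2) != 0 -> {for u, continuous lnsin}.
Proof.
move=> s0; apply: (@continuous_comp R R R (fun v => `|2 * sin (v / 2)|) (@ln R) u).
  exact: (cts_norm cts_half).
by apply: continuous_ln; rewrite normr_gt0.
Qed.

(** The zero of sin (k u) absorbs the logarithmic singularity. *)
Let cts_lnsin_sin (k : nat) : continuous (fun u => lnsin u * sin (k%:R * u)).
Proof.
move=> u; have [s0|s0] := eqVneq (2 * sin (u / 2)) 0; last first.
  by apply: cvgM; [exact: cts_lnsin|exact: cts_sinM].
have bnd v : `|lnsin v * sin (k%:R * v)| <= (2 * k%:R) * Num.sqrt `|2 * sin (v / 2)|.
  rewrite normrM (_ : 2 * k%:R * _ = k%:R * (2 * Num.sqrt `|2 * sin (v / 2)|)); last by ring.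
  have h : `|sin (k%:R * v)| <= k%:R * `|2 * sin (v / 2)|.
    apply: (le_trans (norm_sin_natM k v)); rewrite ler_wpM2l//.
    have {1}-> : v = v / 2 + v / 2 by field.
    rewrite sinD -(mulrC (cos _)) -mulr2n -mulrnAr normrM -[leRHS]mul1r (mulr_natl _ 2).
    by rewrite ler_wpM2r//; exact: cos_max.
  apply: (@le_trans _ _ (`|lnsin v| * (k%:R * `|2 * sin (v / 2)|))); first by rewrite ler_wpM2l.
  rewrite mulrCA ler_wpM2l//.
  have := @xlnx_le `|2 * sin (v / 2)|; rewrite normr_ge0 sin_half_le2 => /(_ isT).
  by rewrite normrM normr_id mulrC.
have c2 : continuous (fun v : R => (2 * k%:R) * Num.sqrt `|2 * sin (v / 2)|).
  apply: ctsZ; apply: (@cts_comp R Num.sqrt); first exact: sqrt_continuous.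
  exact: cts_norm.
have lu : lnsin u = 0 by rewrite /lnsin s0 normr0 ln0.
apply: eps_cts => e e0; have [d d0 hd] := cts_eps (c2 u) e0.
exists d => // v /hd; rewrite s0 normr0 sqrtr0 mulr0 subr0 lu mul0r subr0 => h.
by apply: (le_trans (bnd v)); apply: (le_trans (ler_norm _)); exact: ltW.
Qed.

(** Integration by parts: the derivative of lnsin multiplied by sin (k u) is the trigonometric
    polynomial tau, whose integral over the period is pi. *)
Lemma lnsin_cos (k : nat) : (0 < k)%N -> pint (fun u => lnsin u * cos (k%:R * u)) = - (pi / k%:R).
Proof.
move=> k0; have kN : k%:R != 0 :> R by rewrite pnatr_eq0 -lt0n.
pose F u : R := k%:R^-1 * (lnsin u * sin (k%:R * u) - Tau k u).
have cT : continuous (Tau k) by exact: ders_cts (der_Tau k).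
have cF : continuous F by apply: ctsZ; exact: ctsB.
have dF u : 0 < u < 2 * pi -> der F u (lnsin u * cos (k%:R * u)).
  move=> uI; have s0 := sin_half_gt0 uI.
  apply: (der_eq (derZ _ (derB (derM (der_lnsin uI) (der_sinM _ u)) (der_Tau k u)))).
  have -> : tau k u = cos (u / 2) / (2 * sin (u / 2)) * sin (k%:R * u).
    by rewrite mulrAC -tauE mulrC mulKf// gt_eqF.
  move: (cos (u / 2) / _ * _) => z.
  by rewrite [X in _ * X](_ : _ = k%:R * (lnsin u * cos (k%:R * u))) ?mulKf//; ring.
rewrite (pint_sing _ _ _ cF dF).
- rewrite /F -mulrBr sin_nat2pi mulr0 mulr0 sin0 mulr0 !sub0r opprK addrC -opprB Tau_end//.
  by rewrite mulrN mulrC.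
- by rewrite lnsin0 mul0r.
- by rewrite lnsin2pi mul0r.
- apply: measurable_funM; first exact: measurable_lnsin.
  exact: continuous_measurable_fun (@cts_cosM R k%:R).
- move=> u uI; apply: cvgM; first by apply: cts_lnsin; rewrite gt_eqF// sin_half_gt0.
  exact: cts_cosM.
- apply: sqint_mul; first exact: sqint_lnsin.
  exact/sqint_cts/cts_cosM.
Qed.

Lemma lnsin_sin (k : nat) : pint (fun u => lnsin u * sin (k%:R * u)) = 0.
Proof.
apply: pint_odd.
- apply: measurable_funM; first exact: measurable_lnsin.
  exact: continuous_measurable_fun (@cts_sinM R k%:R).
- by apply: sqint_mul; [exact: sqint_lnsin|exact/sqint_cts/cts_sinM].
- move=> u; have -> : 2 * pi - u = - u + 2 * pi by rewrite addrC.
  rewrite lnsin_per lnsinN mulrDr sinD cos_nat2pi sin_nat2pi mulr1 mulr0 addr0.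
  by rewrite mulrN sinN mulrN.
Qed.

Definition lnsin_coef (i : nat) : R := if i == 0%N then pint lnsin else - (pi / frq i).

Lemma lnsin_shift_sqint t : period t -> sqint (fun s => lnsin (s - t)).
Proof.
move=> pt; split.
  apply: measurable_funTS; apply: (measurableT_comp measurable_lnsin).
  by apply: continuous_measurable_fun => x; apply: cvgB; [exact: cvg_id|exact: cvg_cst].
apply: (pin_periodic (f := fun u => lnsin u ^+ 2) pt) => [|u|]; last exact: sqint_lnsin.2.
  exact: measurable_funX measurable_lnsin.
by rewrite lnsin_per.
Qed.

(** The addition formulas reduce the translated integrals to those at t = 0, of which the sine
    part vanishes by symmetry. *)
Lemma lnsin_ebas t i : period t -> ip (fun s => lnsin (s - t)) (ebas i) = lnsin_coef i * ebas i t.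
Proof.
move=> pt; set k := uphalf i.
have mc : measurable_fun setT (fun u : R => cos (k%:R * u)).
  exact: continuous_measurable_fun (@cts_cosM R k%:R).
have ms : measurable_fun setT (fun u : R => sin (k%:R * u)).
  exact: continuous_measurable_fun (@cts_sinM R k%:R).
have sc : pin (fun u => lnsin u * cos (k%:R * u)).
  by apply: sqint_mul; [exact: sqint_lnsin|exact/sqint_cts/cts_cosM].
have ss : pin (fun u => lnsin u * sin (k%:R * u)).
  by apply: sqint_mul; [exact: sqint_lnsin|exact/sqint_cts/cts_sinM].
have perc u : lnsin (u + 2 * pi) * cos (k%:R * (u + 2 * pi)) = lnsin u * cos (k%:R * u).
  by rewrite lnsin_per mulrDr cosD cos_nat2pi sin_nat2pi mulr1 mulr0 subr0.
have pers u : lnsin (u + 2 * pi) * sin (k%:R * (u + 2 * pi)) = lnsin u * sin (k%:R * u).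
  by rewrite lnsin_per mulrDr sinD cos_nat2pi sin_nat2pi mulr1 mulr0 addr0.
have mlc := measurable_funM measurable_lnsin mc.
have mls := measurable_funM measurable_lnsin ms.
have ic := pint_periodic pt mlc perc sc; have is_ := pint_periodic pt mls pers ss.
have pc := pin_periodic pt mlc perc sc; have ps := pin_periodic pt mls pers ss.
have H (a b : R) : pint (fun s => a * (lnsin (s - t) * cos (k%:R * (s - t))) +
    b * (lnsin (s - t) * sin (k%:R * (s - t)))) = a * pint (fun u => lnsin u * cos (k%:R * u)).
  by rewrite pintD ?pintZ ?ic ?is_ ?lnsin_sin ?mulr0 ?addr0//; exact: pinZ.
have E s : k%:R * s = k%:R * (s - t) + k%:R * t :> R by ring.
have cE : lnsin_coef i = pint (fun u => lnsin u * cos (k%:R * u)).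
  rewrite /lnsin_coef /k; case: eqP => [->|/eqP i0].
    by apply: eq_pint => u _; rewrite mul0r cos0 mulr1.
  by rewrite lnsin_cos// /k; case: i i0 {k mc ms sc ss perc pers mlc mls ic is_ pc ps H E}.
rewrite cE mulrC /ebas /frq -/k /ip; case: ifP => oi.
  rewrite -(H (ecoef i * sin (k%:R * t)) (ecoef i * cos (k%:R * t))).
  by apply: eq_pint => s _; rewrite {1}(E s) sinD; ring.
rewrite -(H (ecoef i * cos (k%:R * t)) (- (ecoef i * sin (k%:R * t)))).
by apply: eq_pint => s _; rewrite {1}(E s) cosD; ring.
Qed.

End LogSine.

(** * A Fredholm alternative for infinite matrices *)

Section Fredholm.
Context {R : realType}.
Implicit Types (a b x y : nat -> R).

(** Limits along an ultrafilter replace the extraction of a weakly convergent subsequence. *)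
Lemma ultra_lim (U : set_system nat) (x : nat -> R) (M : R) : UltraFilter U ->
  (forall j, `|x j| <= M) -> exists a : R, x @ U --> a.
Proof.
move=> UU xM; have PU := @ultra_proper _ _ UU.
have cpt : compact `[(- M)%R, M]%classic by exact: segment_compact.
have [|p [_ clp]] := cpt (x @ U) _.
  by apply: (@filterE _ U) => j /=; rewrite in_itv /= -ler_norml.
exists p => A Ap; have [//|UA] := in_ultra_setVsetC (x @^-1` A) UU.
by have [q []] := clp (~` A) A UA Ap.
Qed.

Lemma cs_sum (I : Type) (r : seq I) (x y : I -> R) :
  (\sum_(k <- r) x k * y k) ^+ 2 <= (\sum_(k <- r) x k ^+ 2) * (\sum_(k <- r) y k ^+ 2).
Proof.
suff [H _ _] : [/\ (\sum_(k <- r) x k * y k) ^+ 2 <=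
  (\sum_(k <- r) x k ^+ 2) * (\sum_(k <- r) y k ^+ 2),
  0 <= \sum_(k <- r) x k ^+ 2 & 0 <= \sum_(k <- r) y k ^+ 2] by [].
elim/big_rec3 : _ => [|k B A P _ [H A0 B0]]; first by rewrite expr0n mulr0.
split; last 2 first.
- by rewrite addr_ge0 ?sqr_ge0.
- by rewrite addr_ge0 ?sqr_ge0.
have : 2 * (P * (x k * y k)) <= A * y k ^+ 2 + B * x k ^+ 2.
  apply: le_trans (ler_norm _) _.
  rewrite -ler_sqr ?nnegrE ?normr_ge0//; last by rewrite addr_ge0// mulr_ge0// sqr_ge0.
  rewrite real_normK ?num_real//.
  have := sqr_ge0 (A * y k ^+ 2 - B * x k ^+ 2).
  have : P ^+ 2 * (x k ^+ 2 * y k ^+ 2) <= A * B * (x k ^+ 2 * y k ^+ 2).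
    by rewrite ler_wpM2r// mulr_ge0// sqr_ge0.
  by nra.
by nra.
Qed.

Lemma lim_norm_le (U : set_system nat) {PU : ProperFilter U} (u : nat -> R) (x c : R) :
  u @ U --> x -> (\forall j \near U, `|u j| <= c) -> `|x| <= c.
Proof.
move=> ux uc; apply/ler_addgt0Pr => e e0.
move/cvgrPdist_le : ux => /(_ e e0) h.
have [j [h1 h2]] := filter_ex (filterI h uc).
rewrite -[x](subrK (u j)) addrC; apply: le_trans (ler_normD _ _) _; exact: lerD.
Qed.

Lemma cvg_sum_ord (U : set_system nat) {FU : Filter U} (F : nat -> nat -> R) x m :
  (forall k, (F ^~ k) @ U --> x k) -> (fun j => \sum_(k < m) F j k) @ U --> \sum_(k < m) x k.
Proof.
move=> H; elim: m => [|m IH].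
  rewrite big_ord0; under eq_fun do rewrite big_ord0; exact: cvg_cst.
by rewrite big_ord_recr/=; under eq_fun do rewrite big_ord_recr/=; apply: cvgD.
Qed.

Let w (k : nat) : R := (k.+1%:R ^+ 2)^-1.

Lemma tail_row (c : R) b (z : nat -> R) (m n : nat) : 0 <= c ->
  (forall k, `|z k| <= c / k.+1%:R) -> (forall n, \sum_(k < n) b k ^+ 2 <= 1) -> (m <= n)%N ->
  (\sum_(m <= k < n) z k * b k) ^+ 2 <= c ^+ 2 * tail w m.
Proof.
move=> c0 zc b1 mn; apply: le_trans (cs_sum _ _ _) _.
have -> : c ^+ 2 * tail w m = c ^+ 2 * tail w m * 1 by rewrite mulr1.
apply: ler_pM.
- by apply: sumr_ge0 => *; exact: sqr_ge0.
- by apply: sumr_ge0 => *; exact: sqr_ge0.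
- apply: (@le_trans _ _ (\sum_(m <= k < n) c ^+ 2 * w k)).
    apply: ler_sum_nat => k _; rewrite /w -exprVn -exprMn -[X in X <= _]real_normK ?num_real//.
    by rewrite ler_sqr ?nnegrE// ?mulr_ge0// ?invr_ge0.
  rewrite -mulr_sumr ler_wpM2l ?sqr_ge0//.
  have := tail_ge (@psum_inv2 R) mn; apply: le_trans.
  rewrite -/w -!(big_mkord xpredT w) (@big_cat_nat _ _ _ m 0 n)//=.
  by rewrite addrAC subrr add0r.
- apply: le_trans (b1 n); rewrite -(big_mkord xpredT (fun k => b k ^+ 2)).
  rewrite (@big_cat_nat _ _ _ m 0 n)//= lerDr.
  by apply: sumr_ge0 => *; exact: sqr_ge0.
Qed.

Lemma sqr_le_abs (u v : R) : 0 <= v -> u ^+ 2 <= v ^+ 2 -> `|u| <= v.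
Proof. by move=> v0 h; rewrite -ler_sqr ?nnegrE// real_normK ?num_real. Qed.

(** Uniformity in the vector b of norm at most 1 is what makes each row of the matrix continuous
    for coordinatewise limits. *)
Lemma row_tail_small (c : R) (z : nat -> R) (e : R) : 0 <= c -> 0 < e ->
  (forall k, `|z k| <= c / k.+1%:R) ->
  exists M, forall m n b, (M <= m)%N -> (m <= n)%N ->
    (forall n, \sum_(k < n) b k ^+ 2 <= 1) -> `|\sum_(m <= k < n) z k * b k| <= e.
Proof.
move=> c0 e0 zc.
have c1 : 0 < c ^+ 2 + 1 by rewrite ltr_wpDl// sqr_ge0.
have [|M HM] := @tail_small R w 2 (e ^+ 2 / (c ^+ 2 + 1)) psum_inv2.
  by rewrite divr_gt0// exprn_gt0.
exists M => m n b Mm mn b1; apply: sqr_le_abs (ltW e0) _.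
apply: le_trans (tail_row c0 zc b1 mn) _.
have := HM m Mm; rewrite ltr_pdivlMr//.
have := tail_ge0 m (@psum_inv2 R).
rewrite -/w; move: (tail w m) => T; nra.
Qed.

Variables (N : nat -> nat -> R) (C : R).
Hypothesis C0 : 0 <= C.
Hypothesis NC : forall l k, `|N l k| <= C / (l.+1%:R * k.+1%:R).

Lemma row_bound l k : `|N l k| <= (C / l.+1%:R) / k.+1%:R.
Proof. by apply: le_trans (NC l k) _; rewrite invfM mulrA. Qed.

Hypothesis inj : forall a, (forall n, \sum_(k < n) a k ^+ 2 <= 1) ->
  (forall l, (fun n => a l + \sum_(k < n) N l k * a k) @ \oo --> (0 : R)) ->
  forall k, a k = 0.

(** If b_j + N b_j tends to 0 for unit vectors b_j, then the coordinatewise limit a of b_j along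
    an ultrafilter satisfies a + N a = 0, so that a = 0 by injectivity. The decay of N in both
    indices then forces N b_j to 0 in norm, hence also b_j. *)
Lemma fredholm_no_null_sequence (b : nat -> nat -> R) (n : nat -> nat) :
  (forall j, \sum_(k < n j) b j k ^+ 2 = 1) ->
  (forall j k, (n j <= k)%N -> b j k = 0) ->
  (forall j L, \sum_(l < L) (b j l + \sum_(k < n j) N l k * b j k) ^+ 2 <= j.+1%:R^-1) ->
  False.
Proof.
move=> bn b0 yb.
have bsum j m (z : nat -> R) : (n j <= m)%N ->
    \sum_(k < m) z k * b j k = \sum_(k < n j) z k * b j k.
  move=> nm; rewrite -!(big_mkord xpredT (fun k => z k * b j k)) (big_cat_nat (n := n j))//=.
  rewrite [X in _ + X]big_nat_cond [X in _ + X]big1 ?addr0// => k /andP[/andP[nk _] _].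
  by rewrite b0// mulr0.
have b1 j m : \sum_(k < m) b j k ^+ 2 <= 1.
  have [nm|/ltnW mn] := leqP (n j) m.
    by under eq_bigr do rewrite expr2; rewrite bsum// -(bn j); under [leRHS]eq_bigr do rewrite expr2.
  rewrite -(bn j) -!(big_mkord xpredT (fun k => b j k ^+ 2)) (big_cat_nat (p := n j) (n := m))//=.
  by rewrite lerDl; apply: sumr_ge0 => *; exact: sqr_ge0.
have bk j k : `|b j k| <= 1.
  apply: sqr_le_abs => //; rewrite expr1n; apply: le_trans (b1 j k.+1).
  by rewrite big_ord_recr/= lerDr; apply: sumr_ge0 => *; exact: sqr_ge0.
have [U [UU ooU]] := @ultraFilterLemma nat (\oo : set_system nat) _.
have PU := @ultra_proper _ _ UU.
have /choice [a Ha] k : exists a : R, (b ^~ k) @ U --> a by apply: ultra_lim UU _ => j; exact: bk.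
pose y j l := b j l + \sum_(k < n j) N l k * b j k.
have y2 j l : y j l ^+ 2 <= j.+1%:R^-1.
  apply: le_trans (yb j l.+1); rewrite big_ord_recr/= lerDr.
  by apply: sumr_ge0 => *; exact: sqr_ge0.
have ysmall e : 0 < e -> \forall j \near U, forall l, `|y j l| <= e.
  move=> e0; apply: ooU; near=> j => l; apply: sqr_le_abs (ltW e0) _.
  apply: le_trans (y2 j l) _; apply: ltW.
  near: j; apply: near_infty_natSinv_lt (PosNum (exprn_gt0 2 e0)).
have a1 m : \sum_(k < m) a k ^+ 2 <= 1.
  have h : (fun j => \sum_(k < m) b j k ^+ 2) @ U --> \sum_(k < m) a k ^+ 2.
    by apply: (cvg_sum_ord (F := fun j k => b j k ^+ 2) (x := fun k => a k ^+ 2)) => k; apply: cvgM; exact: Ha.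
  apply: le_trans (ler_norm _) _; apply: lim_norm_le h _; apply: filterE => j.
  by rewrite ger0_norm ?b1// sumr_ge0// => k _; exact: sqr_ge0.
have az : forall k, a k = 0.
  apply: inj => // l; apply/cvgrPdist_le => e e0.
  have Cl0 : 0 <= C / l.+1%:R by rewrite divr_ge0.
  have e2 : 0 < e / 2 by rewrite divr_gt0.
  have [M HM] := row_tail_small Cl0 e2 (row_bound l).
  exists M => // m /= Mm; rewrite sub0r normrN.
  have h : (fun j => b j l + \sum_(k < m) N l k * b j k) @ U --> a l + \sum_(k < m) N l k * a k.
    by apply: cvgD; [exact: Ha|apply: (cvg_sum_ord (F := fun j k => N l k * b j k) (x := fun k => N l k * a k)) => k; apply: cvgM; [exact: cvg_cst|exact: Ha]].
  apply: lim_norm_le h _.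
  apply: filterS (ysmall _ e2) => j /(_ l) yj /=.
  pose p := maxn m (n j).
  have := bsum j p (N l) (leq_maxr _ _).
  rewrite -!(big_mkord xpredT (fun k => N l k * b j k)) (big_cat_nat (n := m))//= ?leq_maxl// => E.
  have := HM m p (b j) Mm (leq_maxl _ _) (b1 j).
  move: yj; rewrite /y -!(big_mkord xpredT (fun k => N l k * b j k)) -E.
  set X := \sum_(0 <= _ < m) _; set Y := \sum_(_ <= _ < _) _ => h1 h2.
  have -> : b j l + X = b j l + (X + Y) - Y by lra.
  by apply: le_trans (ler_normB _ _) _; lra.
(* Coordinates beyond M carry too little weight for N b_j to be large, and the first M ones tend
   to 0. *)
have [M HM] : exists M : nat, 8 * C ^+ 2 * tail w M < 4^-1.
  have c1 : 0 < 8 * C ^+ 2 + 1 by rewrite ltr_wpDl// mulr_ge0// sqr_ge0.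
  have [|M HM] := @tail_small R w 2 (4^-1 / (8 * C ^+ 2 + 1)) psum_inv2; first by rewrite divr_gt0.
  exists M; have := HM M (leqnn M); rewrite ltr_pdivlMr//.
  have := tail_ge0 M (@psum_inv2 R); rewrite -/w; move: (tail w M) => T; nra.
have key j : 1 <= 2 / j.+1%:R + 4 * C ^+ 2 * (2 * (\sum_(k < M) `|b j k|) ^+ 2 + 2 * tail w M).
  pose p := maxn M (n j).
  pose be := \sum_(k < p) k.+1%:R^-1 * `|b j k|.
  have be2 : be ^+ 2 <= 2 * (\sum_(k < M) `|b j k|) ^+ 2 + 2 * tail w M.
    rewrite /be -(big_mkord xpredT (fun k => k.+1%:R^-1 * `|b j k|)).
    rewrite (big_cat_nat (n := M))//= ?leq_maxl//.
    set X := \sum_(0 <= _ < M) _; set Y := \sum_(_ <= _ < _) _.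
    have Y2 : Y ^+ 2 <= tail w M.
      have := @tail_row 1 (fun k => `|b j k|) (fun k => k.+1%:R^-1) M p ler01.
      rewrite expr1n mul1r; apply; last exact: leq_maxl.
        by move=> k; rewrite mul1r ger0_norm.
      by move=> m; under eq_bigr do rewrite real_normK ?num_real//.
    have X2 : 0 <= X <= \sum_(k < M) `|b j k|.
      rewrite /X big_mkord; apply/andP; split; first by apply: sumr_ge0 => k _; rewrite mulr_ge0.
      by apply: ler_sum => k _; rewrite ler_piMl// invf_le1 ?ltr0n// ler1n.
    have := sqr_ge0 (X - Y); nra.
  have row l : (\sum_(k < n j) N l k * b j k) ^+ 2 <= C ^+ 2 * be ^+ 2 * w l.
    rewrite /w -exprVn -!exprMn -[X in X <= _]real_normK ?num_real// ler_sqr ?nnegrE//; last first.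
      by rewrite !mulr_ge0// sumr_ge0// => k _; rewrite mulr_ge0.
    rewrite -(bsum j p (N l)) ?leq_maxr//; apply: le_trans (ler_norm_sum _ _ _) _.
    rewrite /be mulr_sumr mulr_suml; apply: ler_sum => k _; rewrite normrM.
    apply: le_trans (ler_wpM2r (normr_ge0 _) (NC l k)) _.
    by rewrite invfM le_eqVlt; apply/orP; left; apply/eqP; ring.
  have : \sum_(l < n j) b j l ^+ 2 <=
      \sum_(l < n j) (2 * y j l ^+ 2 + 2 * (C ^+ 2 * be ^+ 2) * w l).
    apply: ler_sum => l _; have := row l; rewrite /y.
    set X := \sum_(_ < _) _; have := sqr_ge0 (b j l + 2 * X); nra.
  rewrite bn big_split/= -!mulr_sumr => h; apply: le_trans h _.
  have := yb j (n j); rewrite -/y.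
  have [_ /(_ (n j))] := @psum_inv2 R; rewrite -/w.
  have := sqr_ge0 C; have := sqr_ge0 be.
  set W := \sum_(_ < _) w _; set Y := \sum_(_ < _) _ ^+ 2 => h1 h2 h3.
  rewrite -/(Y) => h4.
  have hh : C ^+ 2 * be ^+ 2 * W <= C ^+ 2 * be ^+ 2 * 2 by rewrite ler_wpM2l// mulr_ge0.
  have h5 : C ^+ 2 * be ^+ 2 <= C ^+ 2 * (2 * (\sum_(k < M) `|b j k|) ^+ 2 + 2 * tail w M).
    by rewrite ler_wpM2l.
  move: hh h4 h5; set Z := C ^+ 2 * (_ + _); set CB := C ^+ 2 * be ^+ 2.
  rewrite -(mulrA 4) -/Z -(mulrA 2 CB).
  by clearbody Z CB Y; move: (CB * W) (j.+1%:R^-1) => Q J k1 k2 k3; lra.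
have lim0 : (fun j => \sum_(k < M) `|b j k|) @ U --> (0 : R).
  rewrite [X in _ --> X](_ : 0 = \sum_(k < M) 0); last by rewrite big1.
  apply: (cvg_sum_ord (F := fun j k => `|b j k|) (x := fun=> 0)) => k; rewrite -(normr0 R); apply: cvg_norm; rewrite -(az k); exact: Ha.
have : \forall j \near U, 1 < (1 : R).
  have e1 : 0 < 4^-1 / (8 * C ^+ 2 + 1) :> R.
    by rewrite divr_gt0// ltr_wpDl// mulr_ge0// sqr_ge0.
  have e8 : 0 < 8^-1 :> R by lra.
  have h2 : \forall j \near U, j.+1%:R^-1 < 8^-1 := ooU _ (near_infty_natSinv_lt (PosNum e8)).
  have lim2 : (fun j => (\sum_(k < M) `|b j k|) ^+ 2) @ U --> (0 : R).
    by rewrite [X in _ --> X](_ : 0 = 0 * 0); [exact: cvgM|rewrite mulr0].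
  move/cvgrPdist_lt : lim2 => /(_ _ e1) h1.
  near=> j.
  have : `|0 - (\sum_(k < M) `|b j k|) ^+ 2| < 4^-1 / (8 * C ^+ 2 + 1) by near: j.
  have : j.+1%:R^-1 < 8^-1 :> R by near: j.
  have := key j; move: HM; rewrite sub0r normrN ger0_norm ?sqr_ge0//.
  set X := _ ^+ 2; move: (tail w M) => T; move: (j.+1%:R^-1) => J.
  rewrite ltr_pdivlMr; last by rewrite ltr_wpDl// mulr_ge0// sqr_ge0.
  have : 0 <= X by exact: sqr_ge0.
  nra.
by move=> /filter_ex [j]; rewrite ltxx.
Unshelve. all: by end_near.
Qed.

(** If no constant worked, normalized counterexamples would form the sequence excluded above. *)
Lemma fredholm_bounded_below : exists2 c : R, 0 < c & forall n a, exists L : nat,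
  \sum_(k < n) a k ^+ 2 <=
  c * \sum_(l < L) ((if (l < n)%N then a l else 0) + \sum_(k < n) N l k * a k) ^+ 2.
Proof.
apply: contrapT => H.
have /choice [f Hf] (j : nat) : exists p : nat * (nat -> R), forall L : nat,
    j.+1%:R * \sum_(l < L) ((if (l < p.1)%N then p.2 l else 0) +
      \sum_(k < p.1) N l k * p.2 k) ^+ 2 < \sum_(k < p.1) p.2 k ^+ 2.
  apply: contrapT => K; apply: H; exists j.+1%:R; first by rewrite ltr0n.
  move=> n a; apply: contrapT => K2; apply: K; exists (n, a) => L /=.
  by rewrite ltNge; apply/negP => K3; apply: K2; exists L.
pose n j := (f j).1.
pose s j := \sum_(k < n j) (f j).2 k ^+ 2.
have s0 j : 0 < s j by have := Hf j 0%N; rewrite big_ord0 mulr0.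
pose b j k := if (k < n j)%N then (f j).2 k / Num.sqrt (s j) else 0.
have q0 j : 0 < Num.sqrt (s j) by rewrite sqrtr_gt0.
apply: (@fredholm_no_null_sequence b n).
- move=> j; under eq_bigr => k _ do rewrite /b ltn_ord exprMn exprVn sqr_sqrtr ?(ltW (s0 j))//.
  by rewrite -mulr_suml -/(s j) divff// gt_eqF.
- by move=> j k; rewrite /b leqNgt => /negbTE ->.
- move=> j L; have := Hf j L; rewrite -/(n j) -/(s j) => h.
  have -> : \sum_(l < L) (b j l + \sum_(k < n j) N l k * b j k) ^+ 2 =
     (\sum_(l < L) ((if (l < n j)%N then (f j).2 l else 0) +
      \sum_(k < n j) N l k * (f j).2 k) ^+ 2) / s j.
    rewrite mulr_suml; apply: eq_bigr => l _.
    rewrite -[X in _ / X](sqr_sqrtr (ltW (s0 j))) -exprVn -exprMn; congr (_ ^+ 2).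
    rewrite mulrDl mulr_suml /b; congr (_ + _); first by case: ifP; rewrite ?mul0r.
    by apply: eq_bigr => k _; rewrite ltn_ord mulrA.
  rewrite ler_pdivrMr// ler_pdivlMl ?ltr0n//.
  exact: ltW.
Qed.

End Fredholm.

(** * Positive semidefinite kernels *)

Section PsdKernel.
Context {R : realType}.
Implicit Types (kap : R -> R -> R) (f g psi : R -> R) (t s e : R).

(** A kernel of finite rank that is visibly positive semidefinite. *)
Definition frank (I : finType) (phi : I -> R -> R) t s : R := \sum_i phi i t * phi i s.

(** The uniform closure of the positive semidefinite kernels of finite rank: a convex cone, stable
    under products, on which the quadratic form is nonnegative because it is a limit of sums of
    squares. *)
Definition psd kap : Prop := forall e, 0 < e -> exists (I : finType) (phi : I -> R -> R),
  (forall i, continuous (phi i)) /\ forall t s, `|kap t s - frank phi t s| <= e.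

Lemma cts_fsum (I : finType) (F : I -> R -> R) : (forall i, continuous (F i)) ->
  continuous (fun t => \sum_i F i t).
Proof.
move=> H; elim: (index_enum I) => [|i r IH].
  by under eq_fun do rewrite big_nil; exact: cst_continuous.
by under eq_fun do rewrite big_cons; exact: ctsD.
Qed.

Lemma pint_fsum (I : finType) (F : I -> R -> R) : (forall i, pin (F i)) ->
  pint (fun t => \sum_i F i t) = \sum_i pint (F i).
Proof.
move=> H; suff [] : pin (fun t => \sum_i F i t) /\ pint (fun t => \sum_i F i t) = \sum_i pint (F i) by [].
elim: (index_enum I) => [|i r [IH1 IH2]].
  split; first by under eq_fun do rewrite big_nil; exact: pin_cst.
  by under eq_pint do rewrite big_nil; rewrite pint_cst mul0r big_nil.
split; first by under eq_fun do rewrite big_cons; exact: pinD.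
rewrite big_cons -IH2 -pintD//; apply: eq_pint => t _; by rewrite big_cons.
Qed.

Lemma psd_rank1 g : continuous g -> psd (fun t s => g t * g s).
Proof.
move=> cg e e0; exists unit, (fun=> g); split => // t s.
by rewrite /frank big_const cardT enumT unlock/= addr0 subrr normr0 ltW.
Qed.

Lemma psd_eq kap1 kap2 : (forall t s, kap1 t s = kap2 t s) -> psd kap1 -> psd kap2.
Proof. by move=> H P e /P[I [phi [c h]]]; exists I, phi; split => // t s; rewrite -H. Qed.

Lemma psdD kap1 kap2 : psd kap1 -> psd kap2 -> psd (fun t s => kap1 t s + kap2 t s).
Proof.
move=> P1 P2 e e0; have e2 : 0 < e / 2 by rewrite divr_gt0.
have [I [phi [c1 h1]]] := P1 _ e2; have [J [chi [c2 h2]]] := P2 _ e2.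
exists (I + J)%type, (fun k => match k with inl i => phi i | inr j => chi j end).
split; first by case.
move=> t s; rewrite /frank big_sumType/= -/(frank phi t s) -/(frank chi t s).
rewrite opprD addrACA; apply: le_trans (ler_normD _ _) _.
have := h1 t s; have := h2 t s; lra.
Qed.

Lemma psd_lim kap : (forall e, 0 < e -> exists2 kap', psd kap' & forall t s, `|kap t s - kap' t s| <= e) ->
  psd kap.
Proof.
move=> H e e0; have e2 : 0 < e / 2 by rewrite divr_gt0.
have [k' P' h'] := H _ e2; have [I [phi [c1 h1]]] := P' _ e2.
exists I, phi; split => // t s.
have -> : kap t s - frank phi t s = (kap t s - k' t s) + (k' t s - frank phi t s) by ring.
apply: le_trans (ler_normD _ _) _; have := h' t s; have := h1 t s; lra.
Qed.

(** The Schur product theorem: the products of the factors of two finite rank kernels are factors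
    of the product kernel. *)
Lemma psdM kap1 kap2 B1 B2 : (forall t s, `|kap1 t s| <= B1) -> (forall t s, `|kap2 t s| <= B2) ->
  psd kap1 -> psd kap2 -> psd (fun t s => kap1 t s * kap2 t s).
Proof.
move=> b1 b2 P1 P2 e e0.
have B10 : 0 <= B1 by apply: le_trans (normr_ge0 _) (b1 0 0).
have B20 : 0 <= B2 by apply: le_trans (normr_ge0 _) (b2 0 0).
pose d := Num.min 1 (e / (B1 + B2 + 1)).
have S0 : 0 < B1 + B2 + 1 by lra.
have d0 : 0 < d by rewrite /d lt_min ltr01 divr_gt0.
have d1 : d <= 1 by rewrite /d ge_min lexx.
have de : (B1 + B2 + 1) * d <= e.
  by rewrite mulrC -ler_pdivlMr// /d ge_min lexx orbT.
have [I [phi [c1 h1]]] := P1 _ d0; have [J [chi [c2 h2]]] := P2 _ d0.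
exists (I * J)%type, (fun k t => phi k.1 t * chi k.2 t).
split; first by move=> k; apply: ctsM.
move=> t s.
have -> : frank (fun k : I * J => fun t => phi k.1 t * chi k.2 t) t s = frank phi t s * frank chi t s.
  rewrite /frank big_distrl/= -(pair_big xpredT xpredT
    (fun i j => phi i t * chi j t * (phi i s * chi j s)))/=.
  by apply: eq_bigr => i _; rewrite big_distrr/=; apply: eq_bigr => j _; ring.
have := h1 t s; have := h2 t s; have := b1 t s; have := b2 t s.
move: (frank phi t s) (frank chi t s) (kap1 t s) (kap2 t s) => F G k1 k2 b2' b1' h2' h1'.
have -> : k1 * k2 - F * G = k1 * (k2 - G) + (k1 - F) * k2 - (k1 - F) * (k2 - G) by ring.
apply: le_trans (ler_normB _ _) _; apply: le_trans (lerD (ler_normD _ _) (lexx _)) _.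
rewrite !normrM; move: b2' b1' h2' h1'.
have := normr_ge0 k1; have := normr_ge0 k2; have := normr_ge0 (k1 - F); have := normr_ge0 (k2 - G).
move: `|k1| `|k2| `|k1 - F| `|k2 - G| => a b x y y0 x0 b0 a0 bB aB yd xd.
have : a * y <= B1 * d by apply: ler_pM.
have : x * b <= d * B2 by apply: ler_pM.
have : x * y <= d * 1 by apply: ler_pM => //; exact: le_trans d1.
lra.
Qed.

Lemma psd_cst (c : R) : 0 <= c -> psd (fun _ _ => c).
Proof.
move=> c0; apply: psd_eq (psd_rank1 (@cst_continuous _ _ (Num.sqrt c))) => t s.
by rewrite -expr2 sqr_sqrtr.
Qed.

Lemma psdZ kap c : 0 <= c -> psd kap -> psd (fun t s => c * kap t s).
Proof.
move=> c0 P e e0; have c1 : 0 < c + 1 by lra.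
have [I [phi [h1 h2]]] := P (e / (c + 1)) (divr_gt0 e0 c1).
exists I, (fun i t => Num.sqrt c * phi i t); split; first by move=> i; exact: ctsZ.
move=> t s; rewrite /frank.
have -> : \sum_i Num.sqrt c * phi i t * (Num.sqrt c * phi i s) = c * frank phi t s.
  rewrite /frank big_distrr/=; apply: eq_bigr => i _.
  by rewrite -[in RHS](sqr_sqrtr c0); ring.
rewrite -mulrBr normrM (ger0_norm c0); have := h2 t s.
rewrite ler_pdivlMr// => h; apply: le_trans h.
by rewrite mulrC ler_wpM2l//; lra.
Qed.

Lemma psdX kap B n : (forall t s, `|kap t s| <= B) -> psd kap -> psd (fun t s => kap t s ^+ n).
Proof.
move=> b P; elim: n => [|n IH]; first exact: psd_cst.
apply: psd_eq (psdM (B2 := B ^+ n) b _ P IH) => [t s|t s]; first by rewrite exprS.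
by rewrite normrX lerXn2r ?nnegrE// (le_trans (normr_ge0 _) (b 0 0)).
Qed.

Lemma psd_poly kap B n (c : nat -> R) : (forall i, 0 <= c i) -> (forall t s, `|kap t s| <= B) ->
  psd kap -> psd (fun t s => \sum_(i < n) c i * kap t s ^+ i).
Proof.
move=> c0 b P; elim: n => [|n IH].
  by apply: psd_eq (psd_cst (lexx _)) => t s; rewrite big_ord0.
apply: psd_eq (psdD IH (psdZ (c0 n) (psdX n b P))) => t s.
by rewrite big_ord_recr.
Qed.

(** The geometric series has nonnegative coefficients. *)
Lemma psd_geom kap th : th < 1 -> (forall t s, `|kap t s| <= th) -> psd kap ->
  psd (fun t s => (1 - kap t s)^-1).
Proof.
move=> th1 b P; apply: psd_lim => e e0.
have th0 : 0 <= th by apply: le_trans (normr_ge0 _) (b 0 0).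
have [||n hn] := @exists_expr_lt R th (e * (1 - th)); [by rewrite th0|by rewrite mulr_gt0// subr_gt0|].
exists (fun t s => \sum_(i < n) 1 * kap t s ^+ i); first by apply: (psd_poly n _ b P (c := fun=> 1)).
move=> t s; under eq_bigr do rewrite mul1r.
have := b t s; move: (kap t s) => z bz.
have zth : z <= th by apply: le_trans (ler_norm _) bz.
have z1 : 0 < 1 - z by lra.
have E : (1 - z) * (\sum_(i < n) z ^+ i) = 1 - z ^+ n.
  by rewrite -[RHS]opprB subrX1 -mulNr opprB.
have -> : (1 - z)^-1 - \sum_(i < n) z ^+ i = z ^+ n / (1 - z).
  have zN : 1 - z != 0 by rewrite gt_eqF.
  apply: (mulfI zN); rewrite mulrBr E divff// mulrC divfK//; ring.
rewrite normrM normfV (gtr0_norm z1) ler_pdivrMr// normrX.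
apply: le_trans (_ : th ^+ n <= _); first by rewrite lerXn2r ?nnegrE.
apply: le_trans (ltW hn) _; rewrite ler_wpM2l ?(ltW e0)//; lra.
Qed.

Lemma psd_ctsr kap t : psd kap -> continuous (kap t).
Proof.
move=> P; apply: cts_of_unif_approx => e e0; have [I [phi [c1 h1]]] := P _ e0.
by exists (frank phi t) => // s; apply: cts_fsum => i; exact: ctsZ.
Qed.

Variable psi : R -> R.
Hypothesis cpsi : continuous psi.

(** The potential of the density psi for the kernel kap, and below its energy. *)
Definition kint kap t : R := pint (fun s => kap t s * psi s).
Definition energy kap : R := ip psi (kint kap).

Lemma kint_frank (I : finType) (phi : I -> R -> R) : (forall i, continuous (phi i)) ->
  forall t, kint (frank phi) t = \sum_i phi i t * ip (phi i) psi.
Proof.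
move=> c t; rewrite /kint; under eq_pint do rewrite /frank big_distrl/=.
rewrite pint_fsum => [|i]; last first.
  by apply: pin_cts; apply: ctsM => //; exact: ctsZ.
apply: eq_bigr => i _; under eq_pint do rewrite -mulrA.
by rewrite pintZ//; apply: pin_cts; exact: ctsM.
Qed.

Lemma energy_frank (I : finType) (phi : I -> R -> R) : (forall i, continuous (phi i)) ->
  energy (frank phi) = \sum_i ip (phi i) psi ^+ 2.
Proof.
move=> c; rewrite /energy /ip; under eq_pint do rewrite kint_frank// big_distrr/=.
rewrite pint_fsum => [|i]; last first.
  by apply: pin_cts; apply: ctsM => //; apply: ctsM => //; exact: cst_continuous.
apply: eq_bigr => i _.
transitivity (pint (fun t => ip (phi i) psi * (phi i t * psi t))).
  by apply: eq_pint => t _; ring.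
by rewrite pintZ ?expr2//; apply: pin_cts; exact: ctsM.
Qed.

Let A : R := pint (fun s => `|psi s|).

Let A0 : 0 <= A. Proof. by apply: pint_ge0. Qed.

Lemma kint_dist kap1 kap2 e t : continuous (kap1 t) -> continuous (kap2 t) ->
  (forall s, `|kap1 t s - kap2 t s| <= e) -> `|kint kap1 t - kint kap2 t| <= e * A.
Proof.
move=> c1 c2 h.
rewrite /kint -pintB; [|by apply: pin_cts; exact: ctsM ..].
rewrite -pintZ; last by apply: pin_cts; exact: cts_norm.
apply: pint_norm_le.
- by apply: pin_cts; apply: ctsB; exact: ctsM.
- by apply: pin_cts; apply: ctsZ; exact: cts_norm.
- by move=> s _; rewrite -mulrBl normrM ler_wpM2r.
Qed.

Lemma kint_cts kap : psd kap -> continuous (kint kap).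
Proof.
move=> P; apply: cts_of_unif_approx => e e0.
have A1 : 0 < A + 1 by have := A0; lra.
have [I [phi [c1 h1]]] := P _ (divr_gt0 e0 A1).
exists (kint (frank phi)).
  have -> : kint (frank phi) = (fun t => \sum_i phi i t * ip (phi i) psi).
    by apply/funext => t; exact: kint_frank.
  by apply: cts_fsum => i; apply: ctsM => //; exact: cst_continuous.
move=> t; apply: le_trans (kint_dist (e := e / (A + 1)) _ _ _) _.
- exact: psd_ctsr.
- by apply: cts_fsum => i; exact: ctsZ.
- exact: h1.
- rewrite mulrAC ler_pdivrMr// ler_wpM2l ?(ltW e0)//; lra.
Qed.

Lemma energy_dist kap1 kap2 e : psd kap1 -> psd kap2 ->
  (forall t s, `|kap1 t s - kap2 t s| <= e) -> `|energy kap1 - energy kap2| <= e * A * A.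
Proof.
move=> P1 P2 h; rewrite /energy /ip -pintB; try by apply: pin_cts; apply: ctsM => //; exact: kint_cts.
rewrite -pintZ; last by apply: pin_cts; exact: cts_norm.
have c1 := kint_cts P1; have c2 := kint_cts P2.
apply: pint_norm_le.
- by apply: pin_cts; apply: ctsB; exact: ctsM.
- by apply: pin_cts; apply: ctsZ; exact: cts_norm.
- move=> s _; rewrite -mulrBr normrM mulrC ler_wpM2r//.
  by apply: kint_dist => //; exact: psd_ctsr.
Qed.

Lemma psd_frank (I : finType) (phi : I -> R -> R) : (forall i, continuous (phi i)) -> psd (frank phi).
Proof. by move=> c e e0; exists I, phi; split => // t s; rewrite subrr normr0 ltW. Qed.

Lemma le_of_linear_slack (x y C : R) : (forall e, 0 < e <= 1 -> x <= y + C * e) -> x <= y.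
Proof.
move=> H; apply/ler_addgt0Pr => e e0.
have C1 : 0 < `|C| + 1 by rewrite ltr_wpDl.
have d0 : 0 < Num.min 1 (e / (`|C| + 1)) by rewrite lt_min ltr01 divr_gt0.
apply: le_trans (H (Num.min 1 (e / (`|C| + 1))) _) _; first by rewrite d0 ge_min lexx.
rewrite lerD2l; apply: le_trans (_ : `|C| * Num.min 1 (e / (`|C| + 1)) <= _).
  by rewrite ler_wpM2r ?(ltW d0)// ler_norm.
apply: le_trans (_ : `|C| * (e / (`|C| + 1)) <= _).
  by rewrite ler_wpM2l// ge_min lexx orbT.
rewrite mulrA ler_pdivrMr// mulrC ler_wpM2l ?(ltW e0)//; lra.
Qed.

Lemma energy_ge0 kap : psd kap -> 0 <= energy kap.
Proof.
move=> P; apply: (@le_of_linear_slack _ _ (A * A)) => e /andP[e0 _].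
have [I [phi [c h]]] := P _ e0.
have := energy_dist P (psd_frank c) h; rewrite energy_frank//.
have : 0 <= \sum_i ip (phi i) psi ^+ 2 by apply: sumr_ge0 => i _; exact: sqr_ge0.
rewrite ler_norml => h0 /andP[h1 _]; lra.
Qed.

(** The Cauchy-Schwarz inequality for the semi-inner product that the kernel defines, tested
    against a point mass at t. *)
Lemma energy_cs kap t : psd kap -> kint kap t ^+ 2 <= kap t t * energy kap.
Proof.
move=> P.
have J0 := energy_ge0 P.
apply: (@le_of_linear_slack _ _ (`|kap t t| * (A * A) + energy kap + A * A + 2 * `|kint kap t| * A)).
move=> e /andP[e0 e1]; have [I [phi [c h]]] := P _ e0.
have := energy_dist P (psd_frank c) h; rewrite energy_frank//.
have := kint_dist (@psd_ctsr _ t P) (@psd_ctsr _ t (psd_frank c)) (h t); rewrite kint_frank//.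
have := cs_sum (index_enum I) (fun i => phi i t) (fun i => ip (phi i) psi).
have := h t t; rewrite /frank; under eq_bigr do rewrite -expr2.
have : 0 <= \sum_i phi i t ^+ 2 by apply: sumr_ge0 => i _; exact: sqr_ge0.
have : 0 <= \sum_i ip (phi i) psi ^+ 2 by apply: sumr_ge0 => i _; exact: sqr_ge0.
move: (\sum_i _ * _) (\sum_i _) (\sum_i _) (kint kap t) (kap t t) (energy kap) J0 => u k' J' U k J J0.
move=> J'0 k'0 h1 h2 h3 h4.
have AA : 0 <= A * A by rewrite mulr_ge0.
have k'k : k' <= k + e by move: h1; rewrite ler_norml => /andP[? ?]; lra.
have J'J : J' <= J + e * A * A by move: h4; rewrite ler_norml => /andP[? ?]; lra.
have uu : U ^+ 2 <= u ^+ 2 + 2 * `|U| * (e * A).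
  have : U ^+ 2 - u ^+ 2 <= 2 * (U * (U - u)) by have := sqr_ge0 (U - u); nra.
  have : U * (U - u) <= `|U| * (e * A).
    by apply: le_trans (ler_norm _) _; rewrite normrM ler_wpM2l.
  lra.
have kJ : u ^+ 2 <= (k + e) * (J + e * A * A).
  apply: le_trans h2 _; apply: ler_pM => //.
have ke : k * (e * (A * A)) <= `|k| * (e * (A * A)).
  by rewrite ler_wpM2r ?ler_norm// mulr_ge0// ltW.
have ee : e * e * (A * A) <= e * (A * A) by rewrite ler_wpM2r// ler_piMl// ltW.
move: ke ee kJ uu; rewrite -!mulrA; move: `|k| `|U| (A * A) => K V B.
have eqn : (k + e) * (J + e * B) = k * J + k * (e * B) + e * J + e * (e * B) by ring.
rewrite eqn => q1 q2 q3 q4.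
have -> : (K * B + J + B + 2 * (V * A)) * e = K * (e * B) + e * J + e * B + 2 * (V * (e * A)) by ring.
lra.
Qed.

Lemma energyD kap1 kap2 : psd kap1 -> psd kap2 ->
  energy (fun t s => kap1 t s + kap2 t s) = energy kap1 + energy kap2.
Proof.
move=> P1 P2; have c1 := kint_cts P1; have c2 := kint_cts P2.
rewrite /energy /ip -pintD; try by apply: pin_cts; exact: ctsM.
apply: eq_pint => t _; rewrite -mulrDr; congr (_ * _).
have d1 := @psd_ctsr _ t P1; have d2 := @psd_ctsr _ t P2.
rewrite /kint -pintD; try by apply: pin_cts; exact: ctsM.
by apply: eq_pint => s _; rewrite mulrDl.
Qed.

Lemma energyZ kap c : psd kap -> energy (fun t s => c * kap t s) = c * energy kap.
Proof.
move=> P; have c1 := kint_cts P.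
rewrite /energy /ip -pintZ; last by apply: pin_cts; exact: ctsM.
apply: eq_pint => t _; rewrite mulrCA; congr (_ * _).
have d1 := @psd_ctsr _ t P.
rewrite /kint -pintZ; last by apply: pin_cts; exact: ctsM.
by apply: eq_pint => s _; rewrite mulrA.
Qed.

End PsdKernel.

Section LogKernel.
Context {R : realType}.
Local Notation der f t d := (is_derive (t : R) (1 : R) (f : R -> R) (d : R)).
Implicit Types (kap : R -> R -> R) (f g psi : R -> R) (t s e : R).

(** The remainder is a function of x that vanishes at 0 when z is replaced by z x, with derivative
    z (z x)^n / (1 - z x); the mean value theorem on [0, 1] bounds it. *)
Lemma ln_series (th z : R) n : `|z| <= th -> th < 1 ->
  `|- ln (1 - z) - \sum_(i < n) z ^+ i.+1 / i.+1%:R| <= th ^+ n / (1 - th).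
Proof.
move=> zth th1.
have th0 : 0 <= th by exact: le_trans (normr_ge0 _) zth.
pose F x : R := - ln (1 - z * x) - \sum_(i < n) (z * x) ^+ i.+1 / i.+1%:R.
pose f x : R := z * (z * x) ^+ n / (1 - z * x).
have zx x : 0 <= x <= 1 -> `|z * x| <= th.
  move=> /andP[x0 x1]; rewrite normrM (ger0_norm x0); apply: le_trans zth.
  by rewrite ler_piMr.
have zx1 x : 0 <= x <= 1 -> 0 < 1 - z * x.
  move=> /zx h; have := le_trans (ler_norm _) h; lra.
have dpow i x : der (fun x => (z * x) ^+ i.+1 / i.+1%:R) x (z * (z * x) ^+ i).
  have d0 : der (fun x => z * x) x z by apply: (der_eq (derZ z (der_id x))); rewrite mulr1.
  have dp : der (fun x => (z * x) ^+ i.+1) x (i.+1%:R * (z * x) ^+ i * z).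
    elim: i => [|i IH].
      by under eq_fun do rewrite expr1; apply: (der_eq d0); rewrite expr0 mulr1 mul1r.
    under eq_fun do rewrite exprS; apply: (der_eq (derM d0 IH)).
    by rewrite exprS -[in RHS]natr1; ring.
  have := derZ (i.+1%:R^-1) dp => d1.
  under eq_fun do rewrite mulrC.
  apply: (der_eq d1); rewrite !mulrA mulVf ?mul1r 1?mulrC//; by rewrite pnatr_eq0.
have dsum x : der (fun x => \sum_(i < n) (z * x) ^+ i.+1 / i.+1%:R) x (\sum_(i < n) z * (z * x) ^+ i).
  elim: n @F @f => [|m IH] F f.
    by under eq_fun do rewrite big_ord0; rewrite big_ord0; exact: der_cst.
  under eq_fun do rewrite big_ord_recr; rewrite big_ord_recr/=.
  by apply: derD => //; exact: dpow.
have dF x : 0 <= x <= 1 -> der F x (f x).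
  move=> x01; have p := zx1 x x01.
  have d0 : der (fun x => 1 - z * x) x (0 - z * 1).
    exact: (derB (der_cst 1 x) (derZ z (der_id x))).
  have hl := @der_ln R (fun x => 1 - z * x) x _ p d0.
  have h2 := derB (derN hl) (dsum x).
  apply: (der_eq h2).
  rewrite /f -mulr_sumr; have E := subrX1 (z * x) n.
  have pN : 1 - z * x != 0 by rewrite gt_eqF.
  have -> : \sum_(i < n) (z * x) ^+ i = (1 - (z * x) ^+ n) / (1 - z * x).
    by apply: (mulfI pN); rewrite [RHS]mulrC divfK//; apply: oppr_inj; rewrite -mulNr !opprB E.
  by field.
have cF : {within `[0, 1], continuous F}.
  apply: continuous_in_subspaceT => x; rewrite inE/= in_itv/= => x01.
  exact: der_cts (dF x x01).
have dF' : forall x : R, x \in `]0%R, 1%R[ -> der F x (f x).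
  by move=> x; rewrite in_itv/= => /andP[a b]; apply: dF; rewrite !ltW.
have [c c01] := MVT ltr01 dF' cF.
have F1 : F 1 = - ln (1 - z) - \sum_(i < n) z ^+ i.+1 / i.+1%:R by rewrite /F mulr1.
have F0 : F 0 = 0.
  by rewrite /F mulr0 subr0 ln1 oppr0 big1 ?subr0// => i _; rewrite exprS !mul0r.
rewrite F0 !subr0 mulr1 F1 => ->.
have {}c01 : 0 <= c <= 1 by move: c01; rewrite in_itv/= => /andP[a b]; rewrite !ltW.
have zc := zx c c01; have p := zx1 c c01.
rewrite /f normrM normfV (gtr0_norm p) normrM normrX.
apply: ler_pM; rewrite ?invr_ge0 ?(ltW p) ?mulr_ge0 ?exprn_ge0//.
  rewrite -[leRHS]mul1r; apply: ler_pM; rewrite ?exprn_ge0//; first by apply: le_trans zth (ltW th1).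
  by rewrite lerXn2r ?nnegrE.
by rewrite lef_pV2 ?posrE ?subr_gt0//; have := le_trans (ler_norm _) zc; lra.
Qed.

(** The coefficients of - ln (1 - z) remain nonnegative when its term of degree k + 1 is removed.
    *)
Lemma psd_log_part kap th k : th < 1 -> (forall t s, `|kap t s| <= th) -> psd kap ->
  psd (fun t s => - ln (1 - kap t s) - k.+1%:R^-1 * kap t s ^+ k.+1).
Proof.
move=> th1 b P; apply: psd_lim => e e0.
have th0 : 0 <= th by apply: le_trans (normr_ge0 _) (b 0 0).
have [||n hn] := @exists_expr_lt R th (e * (1 - th)); [by rewrite th0|by rewrite mulr_gt0// subr_gt0|].
pose m := maxn n k.+1.
pose c (i : nat) : R := if (i == 0%N) || (i == k.+1) then 0 else i%:R^-1.
exists (fun t s => \sum_(i < m.+1) c i * kap t s ^+ i).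
  by apply: psd_poly b P => i; rewrite /c; case: ifP => // _; rewrite invr_ge0.
move=> t s; have := @ln_series th (kap t s) m (b t s) th1.
move: (kap t s) => z.
have -> : \sum_(i < m.+1) c i * z ^+ i =
    \sum_(i < m) z ^+ i.+1 / i.+1%:R - k.+1%:R^-1 * z ^+ k.+1.
  rewrite big_ord_recl /c/= mul0r add0r.
  have km : (k < m)%N by rewrite /m leq_max ltnSn orbT.
  rewrite [in RHS](bigD1 (Ordinal km))//= [in LHS](bigD1 (Ordinal km))//=.
  rewrite [_ / k.+1%:R]mulrC addrAC subrr add0r /bump/= add1n eqxx mul0r add0r.
  apply: eq_bigr => i ik; rewrite /bump/= add1n eqSS [_ / _]mulrC.
  by rewrite ifN//; apply: contra ik => /eqP ik; apply/eqP/val_inj.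
move=> h; have -> : - ln (1 - z) - k.+1%:R^-1 * z ^+ k.+1 -
   (\sum_(i < m) z ^+ i.+1 / i.+1%:R - k.+1%:R^-1 * z ^+ k.+1) =
   - ln (1 - z) - \sum_(i < m) z ^+ i.+1 / i.+1%:R by ring.
apply: le_trans h _; rewrite ler_pdivrMr ?subr_gt0//; apply: le_trans (ltW hn).
by rewrite ler_wiXn2l// ?(ltW th1)// leq_max leqnn.
Qed.

Lemma psd_log kap th : th < 1 -> (forall t s, `|kap t s| <= th) -> psd kap ->
  psd (fun t s => - ln (1 - kap t s)).
Proof.
move=> th1 b P; apply: psd_eq (psdD (psd_log_part 0 th1 b P) P) => t s.
by rewrite invr1 mul1r expr1 subrK.
Qed.

End LogKernel.

(** * Positivity of the logarithmic energy *)

Section Energy.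
Context {R : realType}.
Local Notation mu := (@lebesgue_measure R).
Implicit Types (kap : R -> R -> R) (f g psi : R -> R) (t s e : R).

Lemma sin_half_diff_neq0 t s : period t -> period s -> s <> t -> s <> 0 -> s <> 2 * pi ->
  2 * sin ((s - t) / 2) != 0 :> R.
Proof.
rewrite /period/= !in_itv/= => /andP[t0 t2] /andP[s0 s2] /eqP; rewrite -subr_eq0 => st /eqP sN0 /eqP sN2.
have {}s0 : 0 < s by rewrite lt_neqAle eq_sym sN0.
have {}s2 : s < 2 * pi by rewrite lt_neqAle sN2.
have [st0|st0] := ltP 0 (s - t).
  by rewrite gt_eqF// sin_half_gt0// st0/=; lra.
have := @sin_half_gt0 R (t - s).
have -> : (t - s) / 2 = - ((s - t) / 2) by lra.
rewrite sinN mulrN => h1; rewrite -oppr_eq0 gt_eqF// h1//.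
have h2 : s - t < 0 by rewrite lt_neqAle st.
apply/andP; split; first by rewrite subr_gt0 -subr_lt0.
by rewrite ltrBlDr (le_lt_trans t2)// ltrDl.
Qed.

(** From 1 + v^4 <= (1 + v)^4 and ln (1 + v) <= v. *)
Lemma ln1D_le (v : R) : 0 <= v -> ln (1 + v ^+ 4) <= 4 * v.
Proof.
move=> v0; have h1 : 0 < 1 + v by lra.
have h4 : 0 <= v ^+ 4 by rewrite exprn_ge0.
apply: le_trans (_ : ln ((1 + v) ^+ 4) <= _).
  rewrite ler_ln ?posrE ?exprn_gt0//; last by lra.
  have : 0 <= v ^+ 2 by rewrite sqr_ge0.
  have : 0 <= v ^+ 3 by rewrite exprn_ge0.
  have -> : (1 + v) ^+ 4 = 1 + 4 * v + 6 * v ^+ 2 + 4 * v ^+ 3 + v ^+ 4 by ring.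
  lra.
have := ln_le1B h1; rewrite lnXn// => h.
by rewrite -(mulr_natl (ln (1 + v)) 4) ler_wpM2l//; lra.
Qed.

Lemma pint_norm_le_ae f g : pin f -> pin g -> (forall t, period t -> 0 <= g t) ->
  {ae mu, forall t, period t -> `|f t| <= g t} -> `|pint f| <= pint g.
Proof.
move=> pf pg g0 fg; apply: le_trans (pint_normr pf) _.
have pnf := pin_norm pf.
rewrite /pint /Rintegral; apply: fine_le; [exact: integrable_fin_num|exact: integrable_fin_num|].
apply: ae_ge0_le_integral => //.
- by apply/measurable_EFinP; exact: pin_meas.
- by apply/measurable_EFinP; exact: pin_meas.
Qed.

Lemma pint_eq_ae f g : pin f -> pin g -> {ae mu, forall t, period t -> f t = g t} -> pint f = pint g.
Proof.
move=> pf pg fg; apply/eqP; rewrite -subr_eq0 -normr_le0 -pintB//.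
rewrite -(mul0r (2 * pi)) -(@pint_cst R 0); apply: pint_norm_le_ae => //; [exact: pinB|exact: pin_cst|].
case: fg => N [mN N0 sub]; exists N; split => // t /= h; apply: sub => /= hh; apply: h => Pt.
by rewrite hh// subrr normr0.
Qed.

Lemma ae_countable (A : set R) (P : R -> Prop) : countable A ->
  (forall t, period t -> ~ A t -> P t) -> {ae mu, forall t, period t -> P t}.
Proof.
move=> cA H; exists A; split => //; [exact: countable_measurable|exact: countable_lebesgue_measure0|].
by move=> t /= h; apply: contrapT => At; apply: h => Pt; exact: H.
Qed.

Variables (x1 x2 psi : R -> R) (q0 c : R).
Hypotheses (c1 : continuous x1) (c2 : continuous x2) (cpsi : continuous psi).
Hypotheses (psi0 : pint psi = 0) (q00 : 0 < q0).

Let rho t s : R := (x1 t - x1 s) ^+ 2 + (x2 t - x2 s) ^+ 2.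

Hypothesis rhoD : forall t s, period t -> period s -> q0 * (2 * sin ((s - t) / 2)) ^+ 2 <= rho t s.
Hypothesis lpin : forall t, period t -> pin (fun s => ln (rho t s) * psi s).
Hypothesis lconst : forall t, period t -> pint (fun s => ln (rho t s) * psi s) = c.

Let rho_ge0 t s : 0 <= rho t s. Proof. by rewrite addr_ge0 ?sqr_ge0. Qed.

Let rho_cts t : continuous (rho t).
Proof. by apply: ctsD; apply: ctsX; apply: ctsB => //; exact: cst_continuous. Qed.

(** The error ln (1 + d^4 / rho) is at most 4 d / rho^(1/4), and the lower bound on rho leaves the
    integrable majorant (2 sin ((s - t) / 2))^(-1/2). Regularizing by d^4 makes the estimate linear
    in d. *)
Lemma log_regularized : exists C : R, forall d t, 0 < d -> period t ->
  `|pint (fun s => ln (d ^+ 4 + rho t s) * psi s) - c| <= C * d.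
Proof.
have [M M0 HM] := cts_bounded cpsi.
pose r0 := Num.sqrt (Num.sqrt q0).
have r00 : 0 < r0 by rewrite !sqrtr_gt0.
have r04 : r0 ^+ 4 = q0 by rewrite (exprM _ 2 2) !sqr_sqrtr ?sqrtr_ge0// ltW.
pose h (u : R) : R := (Num.sqrt `|2 * sin (u / 2)|)^-1.
have hm : measurable_fun setT h.
  apply: (measurableT_comp measurable_rsqrt); apply: continuous_measurable_fun.
  apply: cts_norm; apply: ctsZ.
  by have := @cts_sinM R 2^-1; under eq_fun do rewrite mulrC.
have hper u : h (u + 2 * pi) = h u by rewrite /h sin_half2pi mulrN normrN.
exists (4 * M / r0 * pint h) => d t d0 Pt.
have ce : continuous (fun s => ln (d ^+ 4 + rho t s) * psi s).
  apply: ctsM => // s; apply: (@continuous_comp _ _ _ (fun s => d ^+ 4 + rho t s) (@ln R)).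
    have h0 : continuous (fun s => d ^+ 4 + rho t s) by apply: ctsD => //; exact: cst_continuous.
    exact: h0.
  by apply: continuous_ln; rewrite ltr_pwDl// exprn_gt0.
rewrite -(lconst Pt) -pintB//; [|exact: pin_cts|exact: lpin].
have ph : pin (fun s => h (s - t)) by apply: pin_periodic => //; exact: pin_rsqrt_sin.
rewrite -(pint_periodic Pt hm hper pin_rsqrt_sin).
have -> : 4 * M / r0 * pint (fun s => h (s - t)) * d = (4 * M / r0 * d) * pint (fun s => h (s - t)).
  by rewrite mulrAC.
rewrite -pintZ//; apply: pint_norm_le_ae.
- by apply: pinB; [exact: pin_cts|exact: lpin].
- exact: pinZ.
- by move=> s _; rewrite !mulr_ge0 ?invr_ge0 ?sqrtr_ge0 ?(ltW M0) ?(ltW d0) ?(ltW r00).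
(* Besides s = t, the end points are excluded: both are singular when t is one of them. *)
apply: (@ae_countable ([set t] `|` ([set 0] `|` [set 2 * pi]))).
  by apply: finite_set_countable; rewrite !finite_setU; split; [|split]; exact: finite_set1.
move=> s Ps nA; rewrite -mulrBl normrM.
have D0 : 0 < `|2 * sin ((s - t) / 2)|.
  rewrite normr_gt0; apply: sin_half_diff_neq0 => // st; apply: nA; [by left|by right; left|by right; right].
set D := `|2 * sin ((s - t) / 2)| in D0.
have rD : q0 * D ^+ 2 <= rho t s by rewrite /D real_normK ?num_real//; exact: rhoD.
have r0' : 0 < rho t s by apply: lt_le_trans rD; rewrite mulr_gt0// exprn_gt0.
pose v := d / (r0 * Num.sqrt D).
have sD0 : 0 < Num.sqrt D by rewrite sqrtr_gt0.
have v0 : 0 < v by rewrite divr_gt0// mulr_gt0.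
have v4 : v ^+ 4 = d ^+ 4 / (q0 * D ^+ 2).
  by rewrite /v expr_div_n exprMn r04 (exprM (Num.sqrt D) 2 2) sqr_sqrtr// ltW.
have E : ln (d ^+ 4 + rho t s) - ln (rho t s) = ln (1 + d ^+ 4 / rho t s).
  rewrite -ln_div ?posrE//; last by rewrite ltr_pwDl// exprn_gt0.
  by rewrite mulrDl divff ?gt_eqF// addrC.
have d4 : 0 <= d ^+ 4 / rho t s by rewrite divr_ge0// exprn_ge0// ltW.
have L0 : 0 <= ln (1 + d ^+ 4 / rho t s) by rewrite ln_ge0// lerDl.
rewrite E (ger0_norm L0).
have L1 : ln (1 + d ^+ 4 / rho t s) <= 4 * v.
  apply: le_trans (ln1D_le (ltW v0)); rewrite ler_ln ?posrE.
  - rewrite lerD2l v4 ler_wpM2l ?exprn_ge0 ?(ltW d0)//.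
    by rewrite lef_pV2 ?posrE// mulr_gt0// exprn_gt0.
  - by rewrite ltr_wpDr.
  - by rewrite ltr_wpDr// exprn_ge0// ltW.
apply: le_trans (ler_pM L0 (normr_ge0 _) L1 (HM s Ps)) _.
rewrite /v /h -/D.
have rN : r0 != 0 by rewrite gt_eqF.
have sN : Num.sqrt D != 0 by rewrite gt_eqF.
rewrite le_eqVlt; apply/orP; left; apply/eqP.
by rewrite invfM; ring.
Qed.

Variable B : R.
Hypotheses (b1 : forall t, `|x1 t| <= B) (b2 : forall t, `|x2 t| <= B).

Let B0 : 0 <= B. Proof. exact: le_trans (normr_ge0 _) (b1 0). Qed.
Let r2 t : R := x1 t ^+ 2 + x2 t ^+ 2.
Let w t : R := 1 + r2 t.
Let W : R := 1 + 2 * B ^+ 2.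
Let r2_ge0 t : 0 <= r2 t. Proof. by rewrite addr_ge0 ?sqr_ge0. Qed.
Let w_gt0 t : 0 < w t. Proof. by rewrite ltr_wpDr ?r2_ge0. Qed.
Let w_ge0 t : 0 <= w t. Proof. exact: ltW. Qed.
Let w_ge1 t : 1 <= w t. Proof. by rewrite lerDl. Qed.
Let w_leW t : w t <= W.
Proof.
rewrite lerD2l mulr_natl mulr2n.
by apply: lerD; rewrite -real_normK ?num_real// ler_sqr ?nnegrE.
Qed.
Let cr2 : continuous r2. Proof. by apply: ctsD; exact: ctsX. Qed.
Let cw : continuous w. Proof. by apply: ctsD => //; exact: cst_continuous. Qed.
Let cwV : continuous (fun t => (w t)^-1).
Proof. by move=> t; apply: continuousV; [rewrite gt_eqF|exact: cw]. Qed.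

(** With w = 1 + |x|^2, one has 1 + |x_t - x_s|^2 = w_t w_s (1 - z_ts) for a positive semidefinite
    kernel z of rank three, bounded by th < 1. *)
Let z t s : R := 2 * (x1 t / w t * (x1 s / w s)) + 2 * (x2 t / w t * (x2 s / w s))
  + r2 t / w t * (r2 s / w s).

Let zE t s : 1 - z t s = (1 + rho t s) / (w t * w s).
Proof.
have a := w_gt0 t; have b := w_gt0 s.
rewrite /z /rho; have E u : r2 u = x1 u ^+ 2 + x2 u ^+ 2 by [].
have Ew u : w u = 1 + (x1 u ^+ 2 + x2 u ^+ 2) by [].
rewrite !E; move: a b; rewrite !Ew; move: (x1 t) (x2 t) (x1 s) (x2 s) => X Y X' Y' a b.
by field; rewrite !gt_eqF.
Qed.

Let th : R := 1 - (W * W)^-1.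
Let W_ge1 : 1 <= W. Proof. exact: le_trans (w_ge1 0) (w_leW 0). Qed.
Let th_lt1 : th < 1.
Proof. by have := W_ge1 => h; rewrite /th gtrBl invr_gt0 mulr_gt0//; lra. Qed.

Let ww_le t s : w t * w s <= W * W.
Proof. by apply: ler_pM => //; exact: ltW. Qed.

Let z_le t s : `|z t s| <= th.
Proof.
have a := w_gt0 t; have b := w_gt0 s; have ab := mulr_gt0 a b.
have hW : (W * W)^-1 <= (w t * w s)^-1.
  by rewrite lef_pV2 ?posrE// mulr_gt0// (lt_le_trans _ (w_leW 0)).
have h1 : (w t * w s)^-1 <= 1 - z t s.
  by rewrite zE -[leLHS]mul1r ler_wpM2r ?invr_ge0 ?(ltW ab)// lerDl.
have h2 : (w t * w s)^-1 <= 1 + z t s.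
  have -> : 1 + z t s = 2 - (1 + rho t s) / (w t * w s) by rewrite -zE; ring.
  have E : (w t * w s)^-1 + (1 + rho t s) / (w t * w s) = (2 + rho t s) / (w t * w s).
    by rewrite -[X in X + _]mul1r -mulrDl; congr (_ / _); ring.
  rewrite lerBrDr E.
  rewrite ler_pdivrMr//.
  rewrite /w /r2 /rho; have := mulr_ge0 (r2_ge0 t) (r2_ge0 s); rewrite /r2.
  have := sqr_ge0 (x1 t + x1 s); have := sqr_ge0 (x2 t + x2 s).
  move: (x1 t) (x2 t) (x1 s) (x2 s) => X Y X' Y'; nra.
rewrite ler_norml /th; apply/andP; split; lra.
Qed.

Let psd_z : psd z.
Proof.
apply: psdD; [apply: psdD|]; rewrite ?/z.
- by apply: (psdZ _ (psd_rank1 (g := fun t => x1 t / w t) _)) => //; exact: ctsM.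
- by apply: (psdZ _ (psd_rank1 (g := fun t => x2 t / w t) _)) => //; exact: ctsM.
- by apply: (psd_rank1 (g := fun t => r2 t / w t)); exact: ctsM.
Qed.

Let kap t s : R := (1 + rho t s)^-1.

Let rho1 t s : 0 < 1 + rho t s. Proof. by rewrite ltr_wpDr. Qed.

Let kap_le1 t s : `|kap t s| <= 1.
Proof.
rewrite ger0_norm ?invr_ge0 ?(ltW (rho1 t s))//.
by rewrite invf_le1// lerDl.
Qed.

Let psd_kap : psd kap.
Proof.
apply: (@psd_eq _ (fun t s => ((w t)^-1 * (w s)^-1) * (1 - z t s)^-1)) => [t s|].
  by rewrite zE invf_div -invfM mulrA mulVf ?mul1r// mulf_neq0 ?gt_eqF.
apply: (@psdM _ _ _ 1 (W * W)).
- move=> t s; rewrite ger0_norm; last by rewrite mulr_ge0// invr_ge0; exact: w_ge0.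
  by rewrite -invfM invf_le1 ?mulr_gt0// -[leLHS]mulr1; apply: ler_pM => //; exact: ler01.
- move=> t s; rewrite zE invf_div mulrC normrM; have := kap_le1 t s; rewrite /kap => h.
  rewrite -[leRHS]mul1r; apply: ler_pM => //.
  by rewrite ger0_norm// mulr_ge0.
- exact: psd_rank1.
- exact: psd_geom th_lt1 z_le psd_z.
Qed.

(** Put e = d^4. Up to a function of t alone and one of s alone, which a density of mean zero does
    not see, - ln (e + rho) is - ln (1 - z) - ln (1 - K) with K = (1 - e) / (1 + rho). Both terms
    are positive semidefinite, and the logarithmic series of the second one contains K^(k+1) /
    (k+1), whose energy is therefore at most that of - ln (e + rho). The latter is O(d), because
    the potential differs from a constant by O(d). *)
Let energy_pow_le k : exists C : R, forall d, 0 < d <= 2^-1 -> energy psi (fun t s => kap t s ^+ k.+1) <= C * d.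
Proof.
have [C HC] := log_regularized.
have [M M0 HM] := cts_bounded cpsi.
exists ((k.+1%:R^-1 * 2^-1 ^+ k.+1)^-1 * (C * M * (2 * pi))) => d /andP[d0 d2].
have d4 : 0 < d ^+ 4 <= 2^-1.
  rewrite exprn_gt0//=; apply: (le_trans _ d2); rewrite exprS ler_piMr ?(ltW d0)//.
  by rewrite -(expr1n R 3) lerXn2r ?nnegrE ?(ltW d0)//; lra.
move: d4; set e := d ^+ 4 => /andP[e0 e2].
pose thk := 1 - e.
have thk1 : thk < 1 by rewrite /thk; lra.
have thk0 : 2^-1 <= thk by rewrite /thk; lra.
have thk00 : 0 <= thk by apply: le_trans thk0; rewrite invr_ge0.
pose K t s := thk * kap t s.
have psdK : psd K := psdZ thk00 psd_kap.
have Kb t s : `|K t s| <= thk.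
  by rewrite /K normrM ger0_norm// ler_piMr.
have P1 := psd_log th_lt1 z_le psd_z.
have P2 := psd_log_part k thk1 Kb psdK.
have PX := psdX k.+1 Kb psdK.
have ck : 0 <= k.+1%:R^-1 :> R by rewrite invr_ge0.
have P3 := psdZ ck PX.
pose T t s := - ln (1 - z t s) + ((- ln (1 - K t s) - k.+1%:R^-1 * K t s ^+ k.+1) + k.+1%:R^-1 * K t s ^+ k.+1).
have PT : psd T by apply: psdD => //; exact: psdD.
have ET : energy psi T = energy psi (fun t s => - ln (1 - z t s)) +
   (energy psi (fun t s => - ln (1 - K t s) - k.+1%:R^-1 * K t s ^+ k.+1) +
    k.+1%:R^-1 * energy psi (fun t s => K t s ^+ k.+1)).
  rewrite (energyD cpsi P1 (psdD P2 P3)) (energyD cpsi P2 P3); congr (_ + (_ + _)).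
  exact: energyZ.
have EK : energy psi (fun t s => K t s ^+ k.+1) = thk ^+ k.+1 * energy psi (fun t s => kap t s ^+ k.+1).
  rewrite -(energyZ cpsi _ (psdX k.+1 kap_le1 psd_kap)) /energy /K.
  by apply: eq_pint => t _; congr (_ * _); apply: eq_pint => s _; rewrite exprMn.
have TE t s : T t s = - ln (e + rho t s) + ln (w t) + ln (w s).
  rewrite /T subrK zE /K /kap.
  have -> : 1 - thk * (1 + rho t s)^-1 = (e + rho t s) / (1 + rho t s).
    have rN : 1 + rho t s != 0 by rewrite gt_eqF.
    by rewrite /thk; move: rN; move: (rho t s) => r rN; field.
  have er : 0 < e + rho t s by rewrite ltr_pwDl.
  rewrite !ln_div ?posrE ?mulr_gt0// lnM ?posrE//; ring.
have clw : continuous (fun s => ln (w s)).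
  move=> s; apply: (@continuous_comp _ _ _ w (@ln R)); first exact: cw.
  exact: continuous_ln.
have cle t : continuous (fun s => ln (e + rho t s)).
  move=> s; apply: (@continuous_comp _ _ _ (fun s => e + rho t s) (@ln R)).
    have h0 : continuous (fun s => e + rho t s) by apply: ctsD => //; exact: cst_continuous.
    exact: h0.
  by apply: continuous_ln; rewrite ltr_pwDl.
have kT t : kint psi T t = - pint (fun s => ln (e + rho t s) * psi s) + pint (fun s => ln (w s) * psi s).
  have p1 : pin (fun s => ln (e + rho t s) * psi s) by apply: pin_cts; exact: ctsM.
  have p2 : pin (fun s => ln (w s) * psi s) by apply: pin_cts; exact: ctsM.
  have p3 : pin (fun s => ln (w t) * psi s) by apply: pin_cts; exact: ctsZ.
  have -> : - pint (fun s => ln (e + rho t s) * psi s) + pint (fun s => ln (w s) * psi s) =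
     (pint (fun s => ln (w s) * psi s) - pint (fun s => ln (e + rho t s) * psi s)) +
       pint (fun s => ln (w t) * psi s).
    by rewrite pintZ ?psi0 ?mulr0 ?addr0 1?addrC//; exact: pin_cts.
  rewrite -pintB// -pintD//; last exact: pinB.
  by apply: eq_pint => s _; rewrite TE; ring.
(* The constant m can be subtracted from the potential since psi has mean zero. *)
pose m := - c + pint (fun s => ln (w s) * psi s).
have Eb : energy psi T <= C * M * (2 * pi) * d.
  have ckT := kint_cts cpsi PT.
  have -> : energy psi T = pint (fun t => psi t * (kint psi T t - m)).
    have p1 : pin (fun t => psi t * kint psi T t) by apply: pin_cts; exact: ctsM.
    have p2 : pin (fun t => m * psi t) by apply: pin_cts; exact: ctsZ.
    rewrite -[LHS]subr0 -[X in _ - X](mulr0 m) -{1}psi0 -pintZ; last exact: pin_cts.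
    by rewrite -pintB//; apply: eq_pint => t _; ring.
  apply: le_trans (ler_norm _) _.
  have -> : C * M * (2 * pi) * d = M * (C * d) * (2 * pi) by ring.
  apply: pint_bound.
    by apply: pin_cts; apply: ctsM => //; apply: ctsB => //; exact: cst_continuous.
  move=> t Pt; rewrite normrM; apply: ler_pM => //; first exact: HM.
  have := HC d t d0 Pt; rewrite -/e kT -normrN; congr (`|_| <= _); rewrite /m; ring.
have J1 := energy_ge0 cpsi P1; have J2 := energy_ge0 cpsi P2.
have J3 := energy_ge0 cpsi (psdX k.+1 kap_le1 psd_kap).
have cc : 0 < k.+1%:R^-1 * 2^-1 ^+ k.+1 :> R by rewrite mulr_gt0 ?invr_gt0// exprn_gt0// invr_gt0.
rewrite -[leRHS]mulrA ler_pdivlMl//; apply: le_trans Eb; rewrite ET EK mulrA.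
have h : 2^-1 ^+ k.+1 <= thk ^+ k.+1 by rewrite lerXn2r ?nnegrE ?invr_ge0.
have h' := ler_wpM2r J3 (ler_wpM2l ck h).
by apply: (le_trans h'); rewrite addrA lerDr; exact: (addr_ge0 J1 J2).
Qed.

(** The energies of the kernels (1 + rho)^-(k+1) vanish, and so do their potentials by the Cauchy-
    Schwarz inequality; at t0 these potentials are integrals of psi against the powers of a
    function that peaks at t0. *)
Lemma log_energy_injective_bounded t0 : 0 < t0 < 2 * pi -> psi t0 = 0.
Proof.
move=> t02.
have Pt0 : period t0 by move: t02 => /andP[a b]; rewrite /period/= in_itv/= !ltW.
have kz k : kint psi (fun t s => kap t s ^+ k.+1) t0 = 0.
  have P := psdX k.+1 kap_le1 psd_kap.
  have J0 : energy psi (fun t s => kap t s ^+ k.+1) = 0.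
    apply: le_anti; rewrite (energy_ge0 cpsi P) andbT.
    have [C HC] := energy_pow_le k.
    apply: (@le_of_linear_slack _ _ _ (`|C| * 2^-1)) => e /andP[e0 e1].
    rewrite add0r; have h : 0 < e / 2 <= 2^-1 by apply/andP; split; lra.
    apply: le_trans (HC _ h) _; rewrite (_ : `|C| / 2 * e = `|C| * (e / 2)); last by ring.
    by rewrite ler_wpM2r ?ler_norm//; lra.
  have := energy_cs cpsi t0 P; rewrite J0 mulr0 => h.
  by apply/eqP; rewrite -sqrf_eq0 eq_le h sqr_ge0.
apply: (@peak_orthogonal R (kap t0) psi t0) => //.
- exact: psd_ctsr psd_kap.
- by move=> s _; rewrite invr_ge0 ltW.
- by rewrite /kap /rho !subrr expr0n/= !addr0 invr1.
- move=> s Ps st; rewrite invf_lt1// ltrDl; apply: lt_le_trans (rhoD Pt0 Ps).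
  rewrite mulr_gt0// exprn_even_gt0//=.
  move: t02 Ps; rewrite /period/= in_itv/= => /andP[t0' t2] /andP[s0 s2].
  case: (ltrgtP t0 s) => h; last by rewrite h eqxx in st.
    by rewrite gt_eqF// sin_half_gt0//; apply/andP; split; lra.
  have := @sin_half_gt0 R (t0 - s).
  have -> : (t0 - s) / 2 = - ((s - t0) / 2) by lra.
  rewrite sinN mulrN => h1; rewrite -oppr_eq0 gt_eqF// h1//; apply/andP; split; lra.
- case=> [|n]; last exact: kz.
  by under eq_pint do rewrite expr0 mul1r.
Qed.

End Energy.

Section EnergyInj.
Context {R : realType}.

(** This retraction onto the period makes continuous coordinates bounded without changing them on
    the period. *)
Let cl (t : R) : R := Num.max 0 (Num.min (2 * pi) t).

Let cl_cts : continuous cl.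
Proof.
move=> y; apply: (@continuous_max _ _ (fun=> 0) (fun y : R => Num.min (2 * pi) y)); first exact: cst_continuous.
by apply: (@continuous_min _ _ (fun=> 2 * pi) id); [exact: cst_continuous|exact: cvg_id].
Qed.

Let cl_period t : period (cl t).
Proof.
by rewrite /period/= in_itv/= /cl le_max lexx/= ge_max ge_min lexx (ltW twopi_gt0).
Qed.

Let cl_id t : period t -> cl t = t.
Proof.
by rewrite /period/= in_itv/= /cl => /andP[t0 t2]; rewrite (min_idPr t2) (max_idPr t0).
Qed.

(** The logarithmic energy is positive definite on the densities of mean zero, and it vanishes at
    a density with constant potential. *)
Lemma log_energy_injective (x1 x2 psi : R -> R) (q0 c : R) :
  let rho t s := (x1 t - x1 s) ^+ 2 + (x2 t - x2 s) ^+ 2 in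
  continuous x1 -> continuous x2 -> continuous psi -> pint psi = 0 -> 0 < q0 ->
  (forall t s, period t -> period s -> q0 * (2 * sin ((s - t) / 2)) ^+ 2 <= rho t s) ->
  (forall t, period t -> pin (fun s => ln (rho t s) * psi s)) ->
  (forall t, period t -> pint (fun s => ln (rho t s) * psi s) = c) ->
  forall t0, 0 < t0 < 2 * pi -> psi t0 = 0.
Proof.
move=> rho c1 c2 cpsi psi0 q00 rhoD lpin lconst t0 t02.
have b (x : R -> R) : continuous x -> exists B : R, forall t, `|x (cl t)| <= B.
  by move=> cx; have [B _ HB] := cts_bounded cx; exists B => t; exact: HB.
have [B1 H1] := b _ c1; have [B2 H2] := b _ c2.
apply: (@log_energy_injective_bounded R (x1 \o cl) (x2 \o cl) psi q0 c _ _ cpsi psi0 q00 _ _ _ (Num.max B1 B2)) => //.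
- exact: cts_comp.
- exact: cts_comp.
- by move=> t s Pt Ps /=; rewrite !cl_id//; exact: rhoD.
- by move=> t Pt; apply: eq_pin (lpin t Pt) => s Ps /=; rewrite !cl_id.
- by move=> t Pt; rewrite -(lconst t Pt); apply: eq_pint => s Ps /=; rewrite !cl_id.
- by move=> t /=; rewrite le_max H1.
- by move=> t /=; rewrite le_max H2 orbT.
Qed.

End EnergyInj.

(** * Analytic functions are smooth *)

Section Analytic.
Context {R : realType}.
Local Notation der f t d := (is_derive (t : R) (1 : R) (f : R -> R) (d : R)).
Implicit Types (f g : R -> R) (t : R).

Lemma arith_geom_sum (th : R) n : 0 <= th < 1 ->
  \sum_(i < n) i.+1%:R * th ^+ i <= ((1 - th) ^+ 2)^-1.
Proof.
move=> /andP[t0 t1]; have p : 0 < 1 - th by lra.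
rewrite -[leRHS]mulr1 ler_pdivlMl ?exprn_gt0//.
have -> : (1 - th) ^+ 2 * (\sum_(i < n) i.+1%:R * th ^+ i) = 1 - n.+1%:R * th ^+ n + n%:R * th ^+ n.+1.
  elim: n => [|n IH]; first by rewrite big_ord0; ring.
  by rewrite big_ord_recr/= mulrDr IH !exprS -!natr1; ring.
have h : n%:R * th ^+ n.+1 <= n.+1%:R * th ^+ n.
  rewrite exprS mulrA; apply: ler_wpM2r; first by rewrite exprn_ge0.
  by apply: le_trans (_ : n%:R * 1 <= _); [rewrite ler_wpM2l// ltW|rewrite mulr1 ler_nat].
by move: h; move: (n%:R * _) (n.+1%:R * _) => Y X h; lra.
Qed.

Definition conv_radius (a : nat -> R) (r : R) : Prop := forall z, `|z| < r -> cvgn (pseries a z).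

(** With K between |z| and r, the differentiated terms are dominated by (i + 1) th^i for th = |z|
    / K. *)
Lemma conv_radius_diffs a r : conv_radius a r -> conv_radius (pseries_diffs a) r.
Proof.
move=> H z zr; pose K := (`|z| + r) / 2.
have z0 := normr_ge0 z.
have [zK Kr] : `|z| < K /\ K < r by rewrite /K; split; lra.
have K0 : 0 < K by lra.
have cK : cvgn (pseries a K) by apply: H; rewrite gtr0_norm.
have [M [_ /(_ _ (ltr_pwDr ltr01 (ler_norm M)))]] := cvg_series_bounded cK.
move=> /= HM; pose M1 := `|M| + 1.
pose th := `|z| / K.
have th01 : 0 <= th < 1 by rewrite /th divr_ge0 ?(ltW K0)//= ltr_pdivrMr// mul1r.
pose b i : R := M1 / K * (i.+1%:R * th ^+ i).
have MK : 0 <= M1 / K by rewrite divr_ge0 ?(ltW K0)//; rewrite /M1; have := normr_ge0 M; lra.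
have pb : psum b (M1 / K * ((1 - th) ^+ 2)^-1).
  split=> [i|n]; first by apply: mulr_ge0 => //; apply: mulr_ge0 => //; apply: exprn_ge0; case/andP: th01.
  by rewrite -mulr_sumr ler_wpM2l// arith_geom_sum.
have Fb i : `|pseries_diffs a i * z ^+ i| <= b i.
  have := HM i.+1 I; rewrite /pseries_diffs /b /th exprS => h.
  rewrite !normrM normrX ger0_norm// expr_div_n.
  have Ki : 0 < K ^+ i by rewrite exprn_gt0.
  have h' : `|a i.+1| * (K * K ^+ i) <= M1.
    by apply: le_trans h; rewrite normrM (ger0_norm (ltW (mulr_gt0 K0 Ki))).
  have -> : M1 / K * (i.+1%:R * (`|z| ^+ i / K ^+ i)) = i.+1%:R * (M1 / (K * K ^+ i)) * `|z| ^+ i.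
    have gen (m k X Y n : R) : m / k * (n * (Y / X)) = n * (m / (k * X)) * Y by rewrite invfM; ring.
    exact: gen.
  rewrite ler_wpM2r ?exprn_ge0// ler_wpM2l// ler_pdivlMr// mulr_gt0//.
apply: normed_cvg; apply: (series_le_cvg (v_ := b)) => [i|i|i|]; [exact: normr_ge0|exact: pb.1|exact: Fb|].
have -> : series b = fun m : nat => \sum_(i < m) b i.
  by apply/funext => m; rewrite /series/= big_mkord.
exact: psum_cvg pb.
Qed.

Lemma real_analytic_der f : real_analytic f ->
  exists f1, real_analytic f1 /\ forall t, der f t (f1 t).
Proof.
move=> H; exists (derive1 f).
have key t0 a r t : (forall t, `|t - t0| < r -> pseries a (t - t0) @ \oo --> f t) ->
    `|t - t0| < r -> der f t (limn (pseries (pseries_diffs a) (t - t0))).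
  move=> Ha tr.
  have C0 : conv_radius a r.
    move=> z zr; apply/cvg_ex; exists (f (z + t0)).
    by have := Ha (z + t0); rewrite addrK; apply.
  have C1 := conv_radius_diffs C0; have C2 := conv_radius_diffs C1.
  pose K := (`|t - t0| + r) / 2; have z0 := normr_ge0 (t - t0).
  have [zK Kr] : `|t - t0| < K /\ K < r by rewrite /K; split; lra.
  have K0 : 0 < K by lra.
  have Kn : `|K| < r by rewrite gtr0_norm.
  have zKn : `|t - t0| < `|K| by rewrite (gtr0_norm K0).
  have d := pseries_snd_diffs (C0 _ Kn) (C1 _ Kn) (C2 _ Kn) zKn.
  have d' : der (fun x => limn (pseries a (x - t0))) t (limn (pseries (pseries_diffs a) (t - t0))).
    exact: (@der_shift _ (fun x => limn (pseries a x)) t (- t0) _ d).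
  apply: (near_eq_is_derive _ d').
  apply/nbhs_ballP; exists (r - `|t - t0|) => /=; first by rewrite subr_gt0.
  move=> u; rewrite /ball/= distrC => ut; apply: cvg_lim => //; apply: Ha.
  have -> : u - t0 = (u - t) + (t - t0) by ring.
  by apply: le_lt_trans (ler_normD _ _) _; lra.
split.
- move=> t0; have [a [r [r0 Ha]]] := H t0.
  exists (pseries_diffs a), r; split => // t tr.
  have d := key _ _ _ _ Ha tr.
  have -> : derive1 f t = limn (pseries (pseries_diffs a) (t - t0)).
    by rewrite derive1E; case: d.
  apply: (conv_radius_diffs _ tr) => z zr; apply/cvg_ex; exists (f (z + t0)).
  by have := Ha (z + t0); rewrite addrK; apply.
- move=> t; have [a [r [r0 Ha]]] := H t.
  have tt : `|t - t| < r by rewrite subrr normr0.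
  have d := key _ _ _ _ Ha tt.
  by apply: (der_eq d); rewrite derive1E; case: d.
Qed.

Lemma der_periodic f f1 T : (forall t, f (t + T) = f t) -> (forall t, der f t (f1 t)) ->
  forall t, f1 (t + T) = f1 t.
Proof.
move=> fT df t; apply: (@der_unique _ f t) => //.
have := @der_shift _ f t T _ (df (t + T)).
by under eq_fun do rewrite fT.
Qed.

End Analytic.

(** * Decay of the Fourier coefficients *)

Section RapidDecay.
Context {R : realType}.
Local Notation der f t d := (is_derive (t : R) (1 : R) (f : R -> R) (d : R)).
Implicit Types (f g : R -> R) (t : R).

Lemma frq_ge1 (i : nat) : (0 < i)%N -> 1 <= frq i :> R.
Proof. by move=> i0; rewrite /frq ler1n uphalf_gt0. Qed.

Lemma frq_lb (i : nat) : i%:R <= 2 * frq i :> R.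
Proof. by rewrite /frq -natrM ler_nat mul2n -{1}(odd_double_half i) uphalf_half doubleD leq_add2r -addnn leq_addr. Qed.


Lemma frq_succ (i : nat) : (0 < i)%N -> i.+1%:R <= 3 * frq i :> R.
Proof.
move=> i0; have := frq_ge1 i0; have := frq_lb i; rewrite -[i.+1%:R]natr1.
by move: (frq i : R) (i%:R : R) => F I; lra.
Qed.

Lemma ebas_ip_le i g M : continuous g -> (forall t, period t -> `|g t| <= M) ->
  `|ip (ebas i) g| <= M * (2 * pi).
Proof.
move=> cg Hg; apply: pint_bound; first by apply: pin_cts; apply: ctsM => //; exact: ebas_cts.
move=> t Pt; rewrite normrM -[leRHS]mul1r; apply: ler_pM => //; [exact: ebas_le1|exact: Hg].
Qed.

(** Two integrations by parts gain the factor frq i ^ 2, which is at least (i + 1)^2 / 9 for i >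
    0. *)
Lemma parts_decay i g g1 g2 (K : R) p : (forall t, der g t (g1 t)) -> (forall t, der g1 t (g2 t)) ->
  continuous g2 -> g (2 * pi) = g 0 -> g1 (2 * pi) = g1 0 ->
  `|ip (ebas i) g| <= K -> `|ip (ebas i) g2| * i.+1%:R ^+ p <= K ->
  `|ip (ebas i) g| * i.+1%:R ^+ p.+2 <= 9 * K.
Proof.
move=> d1 d2 c2 p0 p1 h0 h2.
have K0 : 0 <= K by exact: le_trans (normr_ge0 _) h0.
have [E0|i0] := posnP i.
  by move: h0; rewrite E0 expr1n mulr1 => h0; apply: (le_trans h0); lra.
have := ip_by_parts2 i d1 d2 c2 p0 p1 => E; move: h2; rewrite E.
rewrite normrM normrN (ger0_norm (sqr_ge0 (frq i))).
have f0 := frq_ge1 i0; have f1 := frq_succ i0.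
rewrite [_ ^+ p.+2](exprD _ 2 p) /=.
have h3 : i.+1%:R ^+ 2 <= 9 * frq i ^+ 2 :> R.
  have -> : 9 * frq i ^+ 2 = (3 * frq i) ^+ 2 :> R by ring.
  by rewrite ler_sqr ?nnegrE ?mulr_ge0// (le_trans ler01).
have h4 : 0 <= `|ip (ebas i) g| * i.+1%:R ^+ p by rewrite mulr_ge0// exprn_ge0.
have := ler_wpM2l h4 h3; move: (_ ^+ p) (_ ^+ 2) (frq i ^+ 2) => X Y Z; nra.
Qed.

(** The 2 pi-periodic functions of class C^n. *)
Fixpoint Cper n f : Prop := [/\ continuous f, forall t, f (t + 2 * pi) = f t &
  match n with 0 => True | m.+1 => exists2 f1, Cper m f1 & forall t, der f t (f1 t) end].

Lemma Cper_cts n f : Cper n f -> continuous f. Proof. by case: n => [|n] []. Qed.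
Lemma Cper_per n f : Cper n f -> forall t, f (t + 2 * pi) = f t. Proof. by case: n => [|n] []. Qed.

Lemma Cper_rapid m f : Cper m.*2 f -> exists C : R, forall i, `|ip (ebas i) f| * i.+1%:R ^+ m.*2 <= C.
Proof.
elim: m f => [|m IH] f.
  move=> /Cper_cts cf; have [M _ HM] := cts_bounded cf.
  by exists (M * (2 * pi)) => i; rewrite mulr1; exact: ebas_ip_le.
rewrite doubleS => -[cf pf [f1 Cf1 df]]; case: Cf1 => [c1 p1 [f2 Cf2 df1]].
have [C HC] := IH _ Cf2; have [M _ HM] := cts_bounded cf.
exists (9 * Num.max C (M * (2 * pi))) => i.
apply: (parts_decay df df1 (Cper_cts Cf2)).
- by rewrite -(pf 0) add0r.
- by rewrite -(p1 0) add0r.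
- by apply: le_trans (ebas_ip_le i cf HM) _; rewrite le_max lexx orbT.
- by apply: le_trans (HC i) _; rewrite le_max lexx.
Qed.

Lemma analytic_Cper n f : real_analytic f -> (forall t, f (t + 2 * pi) = f t) -> Cper n f.
Proof.
elim: n f => [|n IH] f af pf; have [f1 [af1 df]] := real_analytic_der af.
  by split => //; exact: ders_cts df.
split => //; first exact: ders_cts df.
exists f1 => //; apply: IH => //; exact: der_periodic pf df.
Qed.

End RapidDecay.

(** * Differentiation under integrals and sums *)

Section Quadratic.
Context {R : realType}.
Local Notation der f t d := (is_derive (t : R) (1 : R) (f : R -> R) (d : R)).
Implicit Types (f g : R -> R) (t h d M : R).

(** A quadratic bound on the remainder, unlike differentiability, passes through integrals and
    sums termwise; this gives the two differentiation rules below. *)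
Lemma der_of_quadratic_remainder f t d M : (forall h, `|f (t + h) - f t - h * d| <= M * h ^+ 2) -> der f t d.
Proof.
move=> H.
suff hfxs : h^-1 *: (f (h + t) - f t) @[h --> 0^'] --> d.
  have F : derive1 f t = d by apply: cvg_lim hfxs.
  have Df : derivable f t 1.
    move: hfxs; rewrite /derivable [X in X @ 0^'](_ : _ =
        (fun h => h^-1 *: (f (h%:A + t) - f t))) /=; last first.
      by apply/funext => i //=; rewrite [i%:A]mulr1.
    by move=> /(cvg_lim _) -> //.
  by constructor; [exact: Df|rewrite -derive1E].
apply/cvgrPdist_le => e e0.
have M0 : 0 < `|M| + 1 by rewrite ltr_wpDl.
have d0 : 0 < e / (`|M| + 1) by rewrite divr_gt0.
apply/nbhs_ballP; exists (e / (`|M| + 1)) => //= h; rewrite /ball/= sub0r normrN => hd hN.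
have h0 : 0 < `|h| by rewrite normr_gt0.
rewrite distrC; have -> : h^-1 *: (f (h + t) - f t) - d = h^-1 * (f (t + h) - f t - h * d).
  by rewrite [h + t]addrC mulrBr mulKf.
rewrite normrM normfV ler_pdivrMl//; apply: le_trans (H h) _.
apply: le_trans (_ : (`|M| + 1) * h ^+ 2 <= _).
  by rewrite ler_wpM2r ?sqr_ge0//; have := ler_norm M; lra.
rewrite -real_normK ?num_real// expr2 mulrCA ler_wpM2l//.
by move: hd; rewrite ltr_pdivlMr// mulrC => /ltW.
Qed.

Lemma mvt_abs f f1 a b M : (forall t, der f t (f1 t)) ->
  (forall t, `|t - a| <= `|b - a| -> `|f1 t| <= M) -> `|f b - f a| <= M * `|b - a|.
Proof.
move=> df H; have cf := ders_cts df.
have [ab|ba|->] := ltgtP a b; last by rewrite !subrr normr0 mulr0.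
- have [c cI ->] := MVT ab (fun x _ => df x) (continuous_subspaceT cf).
  rewrite normrM ler_wpM2r// H//; move: cI; rewrite in_itv/= => /andP[c1 c2].
  by rewrite !ger0_norm; lra.
- have [c cI E] := MVT ba (fun x _ => df x) (continuous_subspaceT cf).
  rewrite (distrC (f b)) E (distrC b) normrM ler_wpM2r// H//.
  move: cI; rewrite in_itv/= => /andP[c1 c2].
  by rewrite !ler0_norm; lra.
Qed.

Lemma taylor2 f f1 f2 t h M : (forall t, der f t (f1 t)) -> (forall t, der f1 t (f2 t)) ->
  (forall t, `|f2 t| <= M) -> `|f (t + h) - f t - h * f1 t| <= M * h ^+ 2.
Proof.
move=> d1 d2 H.
have M0 : 0 <= M by exact: le_trans (normr_ge0 _) (H 0).
pose g x := f x - f1 t * x.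
have dg x : der g x (f1 x - f1 t).
  by apply: (der_eq (derB (d1 x) (derZ (f1 t) (der_id x)))); rewrite mulr1.
have := @mvt_abs g _ t (t + h) (M * `|h|) dg.
rewrite /g (_ : t + h - t = h); last by ring.
rewrite (_ : f (t + h) - f1 t * (t + h) - (f t - f1 t * t) = f (t + h) - f t - h * f1 t); last by ring.
rewrite -mulrA -expr2 real_normK ?num_real//; apply => u uh.
by apply: le_trans (@mvt_abs f1 f2 t u M d2 (fun x _ => H x)) _; rewrite ler_wpM2l.
Qed.

Lemma der_pint (F F1 F2 : R -> R -> R) (e : R -> R) t M :
  (forall t s, der (F^~ s) t (F1 t s)) -> (forall t s, der (F1^~ s) t (F2 t s)) ->
  (forall t s, `|F2 t s| <= M) -> (forall t, continuous (F t)) -> (forall t, continuous (F1 t)) ->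
  continuous e -> der (fun t => ip (F t) e) t (ip (F1 t) e).
Proof.
move=> d1 d2 H cF cF1 ce.
have [E E0 HE] := cts_bounded ce.
have M0 : 0 <= M by exact: le_trans (normr_ge0 _) (H 0 0).
apply: (der_of_quadratic_remainder (M := M * E * (2 * pi))) => h.
have p u : pin (fun s => F u s * e s) by apply: pin_cts; exact: ctsM.
have p1 : pin (fun s => h * (F1 t s * e s)) by apply: pinZ; apply: pin_cts; exact: ctsM.
have -> : ip (F (t + h)) e - ip (F t) e - h * ip (F1 t) e =
    pint (fun s => (F (t + h) s - F t s - h * F1 t s) * e s).
  rewrite /ip -pintZ; last by apply: pin_cts; exact: ctsM.
  rewrite -pintB// -pintB//; last exact: pinB.
  by apply: eq_pint => s _; ring.
have -> : M * E * (2 * pi) * h ^+ 2 = M * h ^+ 2 * E * (2 * pi) by ring.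
apply: pint_bound.
  by apply: pin_cts; apply: ctsM => //; apply: ctsB; [exact: ctsB|exact: ctsZ].
move=> s Ps; rewrite normrM; apply: ler_pM => //; last exact: HE.
exact: (@taylor2 (F^~ s) (F1^~ s) (F2^~ s) t h M).
Qed.

Lemma cvg_le_abs (u : nat -> R) (l c : R) : u @ \oo --> l -> (forall n, `|u n| <= c) -> `|l| <= c.
Proof.
by move=> ul uc; rewrite -[l]subr0; apply: (cvg_dist_le (n := 0%N) ul) => m _; rewrite subr0.
Qed.

Lemma der_series (f f1 f2 : nat -> R -> R) (G G1 : R -> R) b B t :
  (forall i t, der (f i) t (f1 i t)) -> (forall i t, der (f1 i) t (f2 i t)) ->
  psum b B -> (forall i t, `|f2 i t| <= b i) ->
  (forall t, (fun n => \sum_(i < n) f i t) @ \oo --> G t) ->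
  (forall t, (fun n => \sum_(i < n) f1 i t) @ \oo --> G1 t) ->
  der G t (G1 t).
Proof.
move=> d1 d2 pb H cG cG1; apply: (der_of_quadratic_remainder (M := B)) => h.
have c0 : (fun n => \sum_(i < n) f i (t + h) - \sum_(i < n) f i t - h * \sum_(i < n) f1 i t) @ \oo -->
   G (t + h) - G t - h * G1 t.
  by apply: cvgB; [exact: cvgB|apply: cvgM => //; exact: cvg_cst].
apply: (cvg_le_abs c0) => n; rewrite mulr_sumr -!sumrB.
apply: le_trans (ler_norm_sum _ _ _) _.
apply: le_trans (_ : \sum_(i < n) b i * h ^+ 2 <= _).
  by apply: ler_sum => i _; exact: taylor2.
by rewrite -mulr_suml ler_wpM2r ?sqr_ge0// pb.2.
Qed.

End Quadratic.

(** * Smooth functions of two variables *)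

Section SmoothClass.
Context {R : realType}.
Local Notation der f t d := (is_derive (t : R) (1 : R) (f : R -> R) (d : R)).
Implicit Types (F G : R -> R -> R) (t s : R).

(** The functions of two variables with bounded partial derivatives up to the order n. *)
Fixpoint sm n F : Prop := (exists M : R, forall t s, `|F t s| <= M) /\
  match n with 0 => True | m.+1 => exists F1 F2, [/\ sm m F1, sm m F2,
    forall t s, der (F^~ s) t (F1 t s) & forall t s, der (F t) s (F2 t s)] end.

Lemma sm_bnd n F : sm n F -> exists M : R, forall t s, `|F t s| <= M.
Proof. by case: n => [|n] []. Qed.

Lemma sm_le n F : sm n.+1 F -> sm n F.
Proof.
elim: n F => [|n IH] F [b [F1 [F2 [s1 s2 d1 d2]]]]; first by split.
by split => //; exists F1, F2; split => //; exact: IH.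
Qed.

Lemma sm_ext n F G : (forall t s, F t s = G t s) -> sm n F -> sm n G.
Proof.
by move=> E; have -> : G = F by apply/funext => t; apply/funext => s; rewrite E.
Qed.

Lemma sm_cst n (c : R) : sm n (fun _ _ => c).
Proof.
elim: n c => [|n IH] c; first by split => //; exists `|c|.
split; first by exists `|c|.
by exists (fun _ _ => 0), (fun _ _ => 0); split => // t s; exact: der_cst.
Qed.

Lemma smD n F G : sm n F -> sm n G -> sm n (fun t s => F t s + G t s).
Proof.
have bD F' G' : (exists M : R, forall t s, `|F' t s| <= M) -> (exists M : R, forall t s, `|G' t s| <= M) ->
    exists M : R, forall t s, `|F' t s + G' t s| <= M.
  move=> [M1 H1] [M2 H2]; exists (M1 + M2) => t s.
  by apply: le_trans (ler_normD _ _) _; exact: lerD.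
elim: n F G => [|n IH] F G; first by move=> [b1 _] [b2 _]; split => //; exact: bD.
move=> [b1 [F1 [F2 [s1 s2 d1 d2]]]] [b1' [G1 [G2 [s1' s2' d1' d2']]]]; split; first exact: bD.
exists (fun t s => F1 t s + G1 t s), (fun t s => F2 t s + G2 t s).
by split; [exact: IH|exact: IH|move=> t s; exact: derD|move=> t s; exact: derD].
Qed.

Lemma smM n F G : sm n F -> sm n G -> sm n (fun t s => F t s * G t s).
Proof.
have bM F' G' : (exists M : R, forall t s, `|F' t s| <= M) -> (exists M : R, forall t s, `|G' t s| <= M) ->
    exists M : R, forall t s, `|F' t s * G' t s| <= M.
  move=> [M1 H1] [M2 H2]; exists (M1 * M2) => t s.
  by rewrite normrM; apply: ler_pM.
elim: n F G => [|n IH] F G; first by move=> [b1 _] [b2 _]; split => //; exact: bM.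
move=> sF sG; have sF' := sm_le sF; have sG' := sm_le sG.
case: sF => [b1 [F1 [F2 [s1 s2 d1 d2]]]]; case: sG => [b1' [G1 [G2 [s1' s2' d1' d2']]]].
split; first exact: bM.
exists (fun t s => F1 t s * G t s + F t s * G1 t s), (fun t s => F2 t s * G t s + F t s * G2 t s).
split; [by apply: smD; exact: IH|by apply: smD; exact: IH|move=> t s; exact: derM|].
by move=> t s; exact: derM.
Qed.

Lemma smZ n (c : R) F : sm n F -> sm n (fun t s => c * F t s).
Proof. by apply: smM; exact: sm_cst. Qed.

Lemma sm_inv n F (c : R) : 0 < c -> (forall t s, c <= F t s) -> sm n F -> sm n (fun t s => (F t s)^-1).
Proof.
move=> c0 cF; have F0 t s : F t s != 0 by rewrite gt_eqF// (lt_le_trans c0).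
have b : exists M : R, forall t s, `|(F t s)^-1| <= M.
  exists c^-1 => t s; have f0 : 0 < F t s by exact: lt_le_trans (cF t s).
  by rewrite gtr0_norm ?invr_gt0// lef_pV2.
elim: n => [|n IH] //= sF; have sF' := sm_le sF; have I := IH sF'.
case: sF => [b1 [F1 [F2 [s1 s2 d1 d2]]]]; split => //.
have S G : sm n G -> sm n (fun t s => - G t s * (F t s)^-1 ^+ 2).
  move=> sG; apply: (@sm_ext _ (fun t s => (-1 * G t s) * ((F t s)^-1 * (F t s)^-1))).
    by move=> t s; rewrite mulN1r expr2.
  by apply: smM; [exact: smZ|exact: smM].
exists (fun t s => - F1 t s * (F t s)^-1 ^+ 2), (fun t s => - F2 t s * (F t s)^-1 ^+ 2).
split; [exact: S|exact: S|move=> t s; exact: (@derV R (F^~ s))|].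
by move=> t s; exact: (@derV R (F t)).
Qed.

Lemma sm_ln n F (c : R) : 0 < c -> (forall t s, c <= F t s) -> sm n F -> sm n (fun t s => ln (F t s)).
Proof.
move=> c0 cF sF; have F0 t s : 0 < F t s by exact: lt_le_trans (cF t s).
have b : exists M : R, forall t s, `|ln (F t s)| <= M.
  have [M HM] := sm_bnd sF; exists (`|ln c| + `|ln M|) => t s.
  have FM : F t s <= M by exact: le_trans (ler_norm _) (HM t s).
  have M0 : 0 < M by exact: lt_le_trans FM.
  have l1 : ln c <= ln (F t s) by rewrite ler_ln ?posrE.
  have l2 : ln (F t s) <= ln M by rewrite ler_ln ?posrE.
  rewrite ler_norml; have := ler_norm (ln M); have := ler_norm (- ln c); rewrite normrN.
  have := normr_ge0 (ln M); have := normr_ge0 (ln c).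
  by move=> *; apply/andP; split; lra.
case: n sF => [|n] // sF; have I := sm_inv c0 cF (sm_le sF).
case: sF => [b1 [F1 [F2 [s1 s2 d1 d2]]]]; split => //.
exists (fun t s => F1 t s * (F t s)^-1), (fun t s => F2 t s * (F t s)^-1).
split; [exact: smM|exact: smM|move=> t s; exact: (@der_ln R (F^~ s))|].
by move=> t s; exact: (@der_ln R (F t)).
Qed.

Lemma sm_lip n F : sm n.+1 F -> exists L : R, 0 < L /\ forall t s t' s',
  `|F t s - F t' s'| <= L * (`|t - t'| + `|s - s'|).
Proof.
move=> [b [F1 [F2 [/sm_bnd[M1 H1] /sm_bnd[M2 H2] d1 d2]]]].
have M10 : 0 <= M1 by exact: le_trans (normr_ge0 _) (H1 0 0).
have M20 : 0 <= M2 by exact: le_trans (normr_ge0 _) (H2 0 0).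
exists (M1 + M2 + 1); split; first by lra.
move=> t s t' s'.
have -> : F t s - F t' s' = (F t s - F t' s) + (F t' s - F t' s') by ring.
apply: le_trans (ler_normD _ _) _.
have h1 := @mvt_abs R (F^~ s) (F1^~ s) t' t M1 (fun t => d1 t s) (fun x _ => H1 x s).
have h2 := @mvt_abs R (F t') (F2 t') s' s M2 (d2 t') (fun x _ => H2 t' x).
have := normr_ge0 (t - t'); have := normr_ge0 (s - s'); nra.
Qed.

End SmoothClass.
(** * Difference quotients of periodic functions *)

Section TrigSeries.
Context {R : realType}.
Local Notation der f t d := (is_derive (t : R) (1 : R) (f : R -> R) (d : R)).
Implicit Types (F G : R -> R -> R) (t s : R) (A ph : nat -> R) (sg : nat -> nat -> R).

Lemma weierstrass_mtest_cvg (T : Type) (F : nat -> T -> R) b B : psum b B ->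
  (forall i (t : T), `|F i t| <= b i) ->
  exists G : T -> R, forall t : T, (fun n => \sum_(i < n) F i t) @ \oo --> G t.
Proof.
move=> pb Fb; have [G HG] := weierstrass_mtest pb Fb; exists G => t.
apply/cvgrPdist_lt => e e0; have [N HN] := tail_small pb e0.
by exists N => // n /= Nn; apply: le_lt_trans (HG t n) (HN n Nn).
Qed.

Definition rapid A : Prop := forall m, exists C : R, forall i, `|A i| * i.+1%:R ^+ m <= C.

Lemma rapid_summable A m : rapid A -> exists b B, psum b B /\ forall i, `|A i| * i.+1%:R ^+ m <= b i.
Proof.
move=> /(_ m.+2) [C HC].
have C0 : 0 <= C by apply: le_trans (HC 0%N); rewrite mulr_ge0// exprn_ge0.
exists (fun i => C * (i.+1%:R ^+ 2)^-1), (C * 2); split; first exact: psumZ C0 psum_inv2.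
move=> i; rewrite ler_pdivlMr ?exprn_gt0// -mulrA -exprD addn2; exact: HC.
Qed.

Lemma dec_rapid A : (forall m, exists C : R, forall i, `|A i| * i.+1%:R ^+ m.*2 <= C) -> rapid A.
Proof.
move=> H m; have [C HC] := H m; exists C => i; apply: le_trans (HC i).
by rewrite ler_wpM2l// ler_weXn2l ?ler1n// -addnn leq_addr.
Qed.

(** The general form of a harmonic of a difference quotient and, with other weights sg and phases
    ph, of its partial derivatives. *)
Definition tterm A sg ph i t s : R := A i *
  \sum_(j < uphalf i) sg i j * sin ((j%:R + 2^-1) * t + ((uphalf i)%:R - j%:R - 2^-1) * s + ph i).

(** Polynomial growth of the weights: each partial derivative multiplies them by a frequency of
    size at most i + 1. *)
Definition tame p sg : Prop := forall i j, (j < uphalf i)%N -> `|sg i j| <= i.+1%:R ^+ p.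

Lemma sin_abs1 (x : R) : `|sin x| <= 1.
Proof. by rewrite ler_norml sin_geN1 sin_le1. Qed.

Lemma uphalf_le i : (uphalf i <= i.+1)%N.
Proof. by rewrite uphalfE -{2}(odd_double_half i.+1) -addnn addnA leq_addl. Qed.

Lemma tterm_le A sg ph p i t s : tame p sg -> `|tterm A sg ph i t s| <= `|A i| * i.+1%:R ^+ p.+1.
Proof.
move=> H; rewrite normrM ler_wpM2l//; apply: le_trans (ler_norm_sum _ _ _) _.
apply: le_trans (_ : \sum_(j < uphalf i) i.+1%:R ^+ p <= _).
  apply: ler_sum => j _; rewrite normrM -[leRHS]mulr1.
  by apply: ler_pM => //; [exact: H|exact: sin_abs1].
rewrite sumr_const card_ord -[leLHS]mulr_natl exprS ler_wpM2r ?exprn_ge0// ler_nat.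
exact: uphalf_le.
Qed.

Let cos_shift (x y : R) : cos (x + y) = sin (x + (y + pi / 2)).
Proof. by rewrite addrA sinDpihalf. Qed.

Lemma der_sum k (f : nat -> R -> R) (d : nat -> R) t : (forall j, der (f j) t (d j)) ->
  der (fun x => \sum_(j < k) f j x) t (\sum_(j < k) d j).
Proof.
move=> H; elim: k => [|k IH].
  by under eq_fun do rewrite big_ord0; rewrite big_ord0; exact: der_cst.
under eq_fun do rewrite big_ord_recr; rewrite big_ord_recr/=; exact: (derD IH (H k)).
Qed.

Lemma tterm_der1 A sg ph i t s :
  der (fun t => tterm A sg ph i t s) t
    (tterm A (fun i j => sg i j * (j%:R + 2^-1)) (fun i => ph i + pi / 2) i t s).
Proof.
apply: derZ; move: ((uphalf i)%:R : R) => K.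
apply: (@der_sum _ (fun j t => sg i j * sin ((j%:R + 2^-1) * t + (K - j%:R - 2^-1) * s + ph i))
  (fun j => sg i j * (j%:R + 2^-1) * sin ((j%:R + 2^-1) * t + (K - j%:R - 2^-1) * s + (ph i + pi / 2)))).
move=> k; rewrite -mulrA; apply: derZ.
have h : der (fun t : R => (k%:R + 2^-1) * t + (K - k%:R - 2^-1) * s + ph i) t (k%:R + 2^-1).
  have h1 := derD (derZ (k%:R + 2^-1) (der_id t)) (der_cst ((K - k%:R - 2^-1) * s) t).
  have h2 := derD h1 (der_cst (ph i) t); apply: (der_eq h2); by rewrite !addr0 mulr1.
have hc := @der_comp R sin _ t _ _ (is_derive_sin _) h.
by apply: (der_eq hc); rewrite cos_shift; exact: mulrC.
Qed.

Lemma tterm_der2 A sg ph i t s :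
  der (tterm A sg ph i t) s
    (tterm A (fun i j => sg i j * ((uphalf i)%:R - j%:R - 2^-1)) (fun i => ph i + pi / 2) i t s).
Proof.
apply: derZ; move: ((uphalf i)%:R : R) => K.
apply: (@der_sum _ (fun j s => sg i j * sin ((j%:R + 2^-1) * t + (K - j%:R - 2^-1) * s + ph i))
  (fun j => sg i j * (K - j%:R - 2^-1) * sin ((j%:R + 2^-1) * t + (K - j%:R - 2^-1) * s + (ph i + pi / 2)))).
move=> k; rewrite -mulrA; apply: derZ.
have h : der (fun s : R => (k%:R + 2^-1) * t + (K - k%:R - 2^-1) * s + ph i) s (K - k%:R - 2^-1).
  have h1 := derD (der_cst ((k%:R + 2^-1) * t) s) (derZ (K - k%:R - 2^-1) (der_id s)).
  have h2 := derD h1 (der_cst (ph i) s); apply: (der_eq h2); by rewrite addr0 add0r mulr1.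
have hc := @der_comp R sin _ s _ _ (is_derive_sin _) h.
by apply: (der_eq hc); rewrite cos_shift; exact: mulrC.
Qed.

Lemma tame_mul p sg (w : nat -> nat -> R) : tame p sg ->
  (forall i j, (j < uphalf i)%N -> `|w i j| <= i.+1%:R) -> tame p.+1 (fun i j => sg i j * w i j).
Proof.
move=> H Hw i j ij; rewrite normrM exprSr; apply: ler_pM => //; [exact: H|exact: Hw].
Qed.

Let freq_le (i j : nat) : (j < uphalf i)%N ->
  `|j%:R + 2^-1 : R| <= i.+1%:R /\ `|(uphalf i)%:R - j%:R - 2^-1 : R| <= i.+1%:R.
Proof.
move=> ij; have h1 : (j.+1%:R : R) <= (uphalf i)%:R by rewrite ler_nat.
have h2 : (uphalf i)%:R <= (i.+1%:R : R).
  by rewrite ler_nat uphalf_le.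
have h3 : (0 : R) <= j%:R by [].
move: h1 h2 h3; rewrite -[j.+1%:R]natr1; move: (j%:R : R) ((uphalf i)%:R : R) (i.+1%:R : R) => J K I.
move=> h1 h2 h3; rewrite !ger0_norm; [split|..]; lra.
Qed.

(** Differentiation keeps the form of the series and raises the growth of the weights by one
    degree, which rapidly decreasing coefficients absorb. *)
Lemma sm_series n A : rapid A -> forall p sg ph G, tame p sg ->
  (forall t s, (fun m => \sum_(i < m) tterm A sg ph i t s) @ \oo --> G t s) -> sm n G.
Proof.
move=> rA.
have ex p sg ph : tame p sg -> exists G,
    forall t s, (fun m => \sum_(i < m) tterm A sg ph i t s) @ \oo --> G t s.
  move=> H; have [b [B [pb Hb]]] := rapid_summable p.+1 rA.
  have [|G HG] := @weierstrass_mtest_cvg (R * R) (fun i x => tterm A sg ph i x.1 x.2) b B pb.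
    by move=> i x; apply: le_trans (tterm_le _ _ _ _ _ H) (Hb i).
  by exists (fun t s => G (t, s)) => t s; exact: (HG (t, s)).
have bnd p sg ph G : tame p sg ->
    (forall t s, (fun m => \sum_(i < m) tterm A sg ph i t s) @ \oo --> G t s) ->
    exists M : R, forall t s, `|G t s| <= M.
  move=> H HG; have [b [B [pb Hb]]] := rapid_summable p.+1 rA.
  exists B => t s; apply: (cvg_le_abs (HG t s)) => m.
  apply: le_trans (ler_norm_sum _ _ _) _; apply: le_trans (pb.2 m).
  by apply: ler_sum => i _; apply: le_trans (tterm_le _ _ _ _ _ H) (Hb i).
have fl1 i j (ij : (j < uphalf i)%N) := (freq_le ij).1.
have fl2 i j (ij : (j < uphalf i)%N) := (freq_le ij).2.
elim: n => [|n IH] p sg ph G H HG; first by split => //; exact: bnd H HG.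
split; first exact: bnd H HG.
have H1 := tame_mul H fl1; have H2 := tame_mul H fl2.
have H11 := tame_mul H1 fl1; have H22 := tame_mul H2 fl2.
have [G1 HG1] := ex _ _ (fun i => ph i + pi / 2) H1.
have [G2 HG2] := ex _ _ (fun i => ph i + pi / 2) H2.
have [b [B [pb Hb]]] := rapid_summable p.+3 rA.
exists G1, G2; split; [exact: IH H1 HG1|exact: IH H2 HG2| |].
- move=> t s.
  apply: (@der_series R (fun i t => tterm A sg ph i t s)
    (fun i t => tterm A (fun i j => sg i j * (j%:R + 2^-1)) (fun i => ph i + pi / 2) i t s)
    (fun i t => tterm A (fun i j => sg i j * (j%:R + 2^-1) * (j%:R + 2^-1)) (fun i => ph i + pi / 2 + pi / 2) i t s)
    (G^~ s) (G1^~ s) b B) => //.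
  + by move=> i u; exact: tterm_der1.
  + by move=> i u; exact: tterm_der1.
  + by move=> i u; apply: le_trans (tterm_le _ _ _ _ _ H11) (Hb i).
- move=> t s.
  apply: (@der_series R (fun i s => tterm A sg ph i t s)
    (fun i s => tterm A (fun i j => sg i j * ((uphalf i)%:R - j%:R - 2^-1)) (fun i => ph i + pi / 2) i t s)
    (fun i s => tterm A (fun i j => sg i j * ((uphalf i)%:R - j%:R - 2^-1) * ((uphalf i)%:R - j%:R - 2^-1)) (fun i => ph i + pi / 2 + pi / 2) i t s)
    (G t) (G2 t) b B) => //.
  + by move=> i u; exact: tterm_der2.
  + by move=> i u; exact: tterm_der2.
  + by move=> i u; apply: le_trans (tterm_le _ _ _ _ _ H22) (Hb i).
Qed.

(** By telescoping: the units of the frequency k are moved from s to t one at a time, and each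
    move changes the argument of the cosine by t - s. *)
Lemma cos_diff_quotient (k : nat) (t s c : R) : cos (k%:R * t + c) - cos (k%:R * s + c) =
  2 * sin ((s - t) / 2) * \sum_(j < k) sin ((j%:R + 2^-1) * t + (k%:R - j%:R - 2^-1) * s + c).
Proof.
pose u j := cos (j%:R * t + (k%:R - j%:R) * s + c).
have -> : 2 * sin ((s - t) / 2) * \sum_(j < k) sin ((j%:R + 2^-1) * t + (k%:R - j%:R - 2^-1) * s + c) =
    \sum_(j < k) (u j.+1 - u j).
  rewrite mulr_sumr; apply: eq_bigr => j _; rewrite /u.
  set y := (j%:R + 2^-1) * t + (k%:R - j%:R - 2^-1) * s + c; set x := (s - t) / 2.
  have -> : j.+1%:R * t + (k%:R - j.+1%:R) * s + c = y - x by rewrite /y /x -[j.+1%:R]natr1; field.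
  have -> : j%:R * t + (k%:R - j%:R) * s + c = y + x by rewrite /y /x; field.
  by clearbody x y; rewrite cosB cosD; ring.
have -> : \sum_(j < k) (u j.+1 - u j) = u k - u 0%N.
  rewrite -(big_mkord xpredT (fun j => u j.+1 - u j)) telescope_sumr//.
by rewrite /u subrr mul0r addr0 mul0r add0r subr0.
Qed.

End TrigSeries.

Section Quotient.
Context {R : realType}.
Local Notation der f t d := (is_derive (t : R) (1 : R) (f : R -> R) (d : R)).
Implicit Types (f g : R -> R) (t s : R).

Lemma per_nat (T : Type) (f : R -> T) (n : nat) t : (forall x, f (x + 2 * pi) = f x) ->
  f (t + n%:R * (2 * pi)) = f t.
Proof.
move=> pf; elim: n => [|n IH]; first by rewrite mul0r addr0.
by rewrite -[n.+1%:R]natr1 mulrDl mul1r addrA pf.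
Qed.

Lemma floor_reduce (P t : R) : 0 < P -> 0 <= t - (Num.floor (t / P))%:~R * P < P.
Proof.
move=> P0; have := floor_itv (t / P); rewrite ler_pdivlMr// ltr_pdivrMr// rmorphD/= mulrDl mul1r.
by move=> /andP[h1 h2]; rewrite subr_ge0 h1/= ltrBlDl.
Qed.

Lemma per_reduce t : exists t', 0 <= t' < 2 * pi /\
  forall (T : Type) (f : R -> T), (forall x, f (x + 2 * pi) = f x) -> f t = f t'.
Proof.
have p0 := @twopi_gt0 R.
pose k := Num.floor (t / (2 * pi)).
exists (t - k%:~R * (2 * pi)); split; first exact: floor_reduce.
move=> T f pf; case: k => n.
- by rewrite -{1}[t](subrK (n%:R * (2 * pi))) per_nat.
- by rewrite NegzE mulrNz mulNr opprK per_nat.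
Qed.

Lemma ebas_periodic i t : ebas i (t + 2 * pi) = ebas i t :> R.
Proof.
rewrite /ebas mulrDr sinD cosD /frq cos_nat2pi sin_nat2pi.
by case: ifP => _; congr (_ * _); ring.
Qed.

Definition phase0 (i : nat) : R := if odd i then - (pi / 2) else 0.

Lemma ebas_phase i t : ebas i t = ecoef i * cos (frq i * t + phase0 i).
Proof.
rewrite /ebas /phase0; case: ifP => _; last by rewrite addr0.
by rewrite cosBpihalf.
Qed.

Lemma Cper_rapid_coef f : (forall n, Cper n f) -> rapid (fun i => ip (ebas i) f).
Proof. by move=> H; apply: dec_rapid => m; exact: Cper_rapid. Qed.

Lemma unif_series (F : nat -> R -> R) b B : psum b B -> (forall i, continuous (F i)) ->
  (forall i (t : R), `|F i t| <= b i) -> exists G : R -> R, [/\ continuous G,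
    forall t n, `|G t - \sum_(i < n) F i t| <= tail b n &
    forall j, (fun n => \sum_(i < n) ip (F i) (ebas j)) @ \oo --> ip G (ebas j)].
Proof.
move=> pb cF bd; have [G HG] := weierstrass_mtest pb bd.
have cS n : continuous (fun t => \sum_(i < n) F i t) by exact: cts_sum.
have cG : continuous G.
  apply: cts_of_unif_approx => e e0; have [N HN] := tail_small pb e0.
  exists (fun t => \sum_(i < N) F i t) => // t.
  by apply: le_trans (HG t N) _; apply: ltW; exact: HN.
exists G; split => // j; apply/cvgrPdist_lt => e e0.
have p2 := @twopi_gt0 R.
have e1 : 0 < e / 2 / (2 * pi) by rewrite !divr_gt0.
have [N HN] := tail_small pb e1; exists N => // n /= Nn.
rewrite -ip_suml; [|by move=> i _; exact: sqint_cts|exact: ebas_sqint].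
rewrite /ip -pintB; [|by apply: pin_cts; apply: ctsM => //; exact: ebas_cts ..].
apply: (@le_lt_trans _ _ (e / 2)); last by rewrite ltr_pdivrMr// ltr_pMr// ltr1n.
rewrite -[leRHS](@divfK _ (2 * pi)) ?gt_eqF//; apply: pint_bound.
  by apply: pin_cts; apply: ctsB; apply: ctsM => //; exact: ebas_cts.
move=> t _; rewrite -mulrBl normrM -[leRHS]mulr1; apply: ler_pM => //; last exact: ebas_le1.
by apply: le_trans (HG t n) _; apply: ltW; exact: HN.
Qed.

Lemma sum_ip_ebas (c : nat -> R) j n : (j < n)%N ->
  \sum_(i < n) ip (fun t => c i * ebas i t) (ebas j) = c j.
Proof.
move=> jn; rewrite -(ip_suml (n := n) (F := fun i t => c i * ebas i t)).
- by rewrite ip_comb_ebas jn.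
- by move=> i _; apply: sqintZ; exact: ebas_sqint.
- exact: ebas_sqint.
Qed.

Lemma unif_ebas_series (c : nat -> R) b B : psum b B -> (forall i, `|c i| <= b i) ->
  exists G : R -> R, [/\ continuous G,
    forall t n, `|G t - \sum_(i < n) c i * ebas i t| <= tail b n & forall j, ip G (ebas j) = c j].
Proof.
move=> pb Hb.
have [||G [cG HG H]] := @unif_series (fun i t => c i * ebas i t) _ _ pb.
- by move=> i; apply: ctsZ; exact: ebas_cts.
- move=> i t; apply: le_trans (Hb i); rewrite normrM ler_piMr//; exact: ebas_le1.
exists G; split => // j; apply/eqP; rewrite -subr_eq0 -normr_le0.
apply: (cvg_dist_le (n := j.+1) (H j)) => n jn; by rewrite sum_ip_ebas// subrr normr0.
Qed.

(** The series converges uniformly, and completeness identifies its sum on the period. *)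
Lemma fourier_series f : (forall n, Cper n f) ->
  forall t, (fun n => \sum_(i < n) ip (ebas i) f * ebas i t) @ \oo --> f t.
Proof.
move=> H; have rA := Cper_rapid_coef H.
have [b [B [pb Hb]]] := rapid_summable 0 rA.
have cf := Cper_cts (H 0%N); have pf := Cper_per (H 0%N).
have [|G [cG HG ipG']] := @unif_ebas_series (fun i => ip (ebas i) f) _ _ pb.
  by move=> i; have := Hb i; rewrite mulr1.
have ipG j : ip G (ebas j) = ip f (ebas j) by rewrite ipG' ipC.
have fG : forall t, period t -> f t = G t.
  move=> t Pt; apply/eqP; rewrite -subr_eq0; apply/eqP.
  apply: (@ebas_complete R (fun t => f t - G t)) => //; first exact: ctsB.
  move=> i; rewrite ipBl; [by rewrite ipG subrr|exact: sqint_cts|exact: sqint_cts|exact: ebas_sqint].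
have cvG t : (fun n => \sum_(i < n) ip (ebas i) f * ebas i t) @ \oo --> G t.
  apply/cvgrPdist_lt => e e0; have [N HN] := tail_small pb e0.
  by exists N => // n /= Nn; apply: le_lt_trans (HG t n) (HN n Nn).
move=> t; have [t' [t01 red]] := per_reduce t.
rewrite (red _ f pf) (red _ (fun t => (fun n => \sum_(i < n) ip (ebas i) f * ebas i t))); last first.
  by move=> x; apply/funext => n; apply: eq_bigr => i _; rewrite ebas_periodic.
by rewrite fG//; move: t01; rewrite /period/= in_itv/= => /andP[-> /ltW].
Qed.

(** Every harmonic of f is divided separately, and the quotients are summed. *)
Lemma diff_quotient f : (forall n, Cper n f) -> exists D : R -> R -> R, (forall n, sm n D) /\
  forall t s, f t - f s = 2 * sin ((s - t) / 2) * D t s.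
Proof.
move=> H; have rA := Cper_rapid_coef H; have cv := fourier_series H.
pose A i : R := ip (ebas i) f * ecoef i.
have rA' : rapid A.
  move=> m; have [C HC] := rA m; exists C => i; apply: le_trans (HC i).
  rewrite normrM ler_wpM2r ?exprn_ge0// ler_piMr// ger0_norm ?(ltW (ecoef_gt0 i))//.
  exact: ecoef_le1.
pose sg (i j : nat) : R := 1.
have tsg : tame 0 sg by move=> i j _; rewrite /sg normr1.
have [b [B [pb Hb]]] := rapid_summable 1 rA'.
have [|G HG] := @weierstrass_mtest_cvg R (R * R) (fun i x => tterm A sg phase0 i x.1 x.2) b B pb.
  by move=> i x; apply: le_trans (tterm_le _ _ _ _ _ tsg) (Hb i).
exists (fun t s => G (t, s)); split.
  move=> n; apply: (sm_series n rA' tsg (ph := phase0)) => t s; exact: (HG (t, s)).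
move=> t s.
have c1 : (fun n => \sum_(i < n) ip (ebas i) f * ebas i t - \sum_(i < n) ip (ebas i) f * ebas i s) @ \oo --> f t - f s.
  exact: cvgB.
have c2 : (fun n => 2 * sin ((s - t) / 2) * \sum_(i < n) tterm A sg phase0 i t s) @ \oo -->
    2 * sin ((s - t) / 2) * G (t, s).
  by apply: cvgM; [exact: cvg_cst|exact: (HG (t, s))].
apply: (@cvg_unique _ (@norm_hausdorff _ R) _ _ _ _ c1); rewrite (_ : (fun n => _) =
   (fun n => 2 * sin ((s - t) / 2) * \sum_(i < n) tterm A sg phase0 i t s)) //.
apply/funext => n; rewrite -sumrB mulr_sumr; apply: eq_bigr => i _.
rewrite !ebas_phase -mulrBr -mulrBr cos_diff_quotient /tterm /A.
under [in RHS]eq_bigr do rewrite /sg mul1r.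
rewrite mulrA; move: (\sum_(_ < _) _) => Z; ring.
Qed.

End Quotient.

(** * The logarithmic kernel of the curve *)

Section Curve.
Context {R : realType}.
Local Notation der f t d := (is_derive (t : R) (1 : R) (f : R -> R) (d : R)).
Variable gamma : R -> R * R.
Hypothesis hgamma : regular_analytic_parametrization gamma.

Let g1 : R -> R := fst \o gamma.
Let g2 : R -> R := snd \o gamma.

Let pg t : gamma (t + 2 * pi) = gamma t. Proof. exact: param_periodic. Qed.
Let C1 n : Cper n g1.
Proof. by apply: analytic_Cper; [exact: param_analytic1|move=> t; rewrite /g1/= pg]. Qed.
Let C2 n : Cper n g2.
Proof. by apply: analytic_Cper; [exact: param_analytic2|move=> t; rewrite /g2/= pg]. Qed.

Let v1 := derive1 g1.
Let v2 := derive1 g2.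

Let Cper_der (g : R -> R) : (forall n, Cper n g) -> (forall t, der g t (derive1 g t)) /\ forall n, Cper n (derive1 g).
Proof.
move=> H.
have K n : Cper n (derive1 g) /\ forall t, der g t (derive1 g t).
  have [_ _ [h Ch dh]] := H n.+1.
  have -> : derive1 g = h by apply/funext => t; rewrite derive1E; case: (dh t).
  by split.
by split; [exact: (K 0%N).2|move=> n; exact: (K n).1].
Qed.

Definition speed (t : R) : R := enorm (velocity gamma t).

Let speed2 t : v1 t ^+ 2 + v2 t ^+ 2 = speed t ^+ 2.
Proof. by rewrite /speed /enorm sqr_sqrtr// addr_ge0 ?sqr_ge0. Qed.

Lemma speed_gt0 t : 0 < speed t. Proof. exact: param_regular. Qed.

Lemma speed_Cper : Cper 2 speed.
Proof.
have [d1 K1] := Cper_der C1; have [d2 K2] := Cper_der C2.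
have [e1 L1] := Cper_der K1; have [e2 L2] := Cper_der K2.
have [f1 M1] := Cper_der L1; have [f2 M2] := Cper_der L2.
rewrite -/v1 in d1 K1 e1 L1 f1 M1; rewrite -/v2 in d2 K2 e2 L2 f2 M2.
set w1 := derive1 v1 in e1 L1 f1 M1; set w2 := derive1 v2 in e2 L2 f2 M2.
set z1 := derive1 w1 in f1 M1; set z2 := derive1 w2 in f2 M2.
have c1 := Cper_cts (K1 0%N); have c2 := Cper_cts (K2 0%N).
have cw1 := Cper_cts (L1 0%N); have cw2 := Cper_cts (L2 0%N).
have cz1 := Cper_cts (M1 0%N); have cz2 := Cper_cts (M2 0%N).
have sN t : speed t != 0 by rewrite gt_eqF// speed_gt0.
pose p t := v1 t * v1 t + v2 t * v2 t.
have pE t : p t = speed t ^+ 2 by rewrite -speed2 /p -!expr2.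
have p0 t : 0 < p t by rewrite pE exprn_gt0// speed_gt0.
have sE : speed = fun t => Num.sqrt (p t).
  by apply/funext => t; rewrite pE sqrtr_sqr gtr0_norm// speed_gt0.
have dp t : der p t (w1 t * v1 t + v1 t * w1 t + (w2 t * v2 t + v2 t * w2 t)).
  exact: (derD (derM (e1 t) (e1 t)) (derM (e2 t) (e2 t))).
pose s1 t := (v1 t * w1 t + v2 t * w2 t) * (speed t)^-1.
have ds t : der speed t (s1 t).
  have h := @der_sqrt R p t _ (p0 t) (dp t); rewrite {1}sE; apply: (der_eq h).
  have -> : Num.sqrt (p t) = speed t by rewrite sE.
  by rewrite /s1; have := sN t; move: (speed t) => S SN; field.
pose s2 t := (w1 t * w1 t + v1 t * z1 t + (w2 t * w2 t + v2 t * z2 t)) * (speed t)^-1 +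
  (v1 t * w1 t + v2 t * w2 t) * (- s1 t * (speed t)^-1 ^+ 2).
have ds1 t : der s1 t (s2 t).
  have h1 := derD (derM (e1 t) (f1 t)) (derM (e2 t) (f2 t)).
  exact: (derM h1 (@derV R speed t _ (sN t) (ds t))).
have cs := ders_cts ds; have cs1 := ders_cts ds1.
have cV : continuous (fun t => (speed t)^-1).
  by move=> t; apply: continuousV; [exact: sN|exact: cs].
have cs2 : continuous s2.
  apply: ctsD; apply: ctsM => //.
  - by apply: ctsD; apply: ctsD; exact: ctsM.
  - by apply: ctsD; exact: ctsM.
  - apply: ctsM; last exact: ctsX.
    by have := @ctsZ R (-1) _ cs1; under eq_fun do rewrite mulN1r.
have pers t : speed (t + 2 * pi) = speed t.
  rewrite sE /p; have := Cper_per (K1 0%N) t; have := Cper_per (K2 0%N) t.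
  by move=> -> ->.
have pers1 := der_periodic pers ds; have pers2 := der_periodic pers1 ds1.
by split => //; exists s1 => //; split => //; exists s2.
Qed.

Definition curve_rho (t s : R) : R := (g1 t - g1 s) ^+ 2 + (g2 t - g2 s) ^+ 2.

(** The squared distance of the curve points is q(t,s) (2 sin ((s - t) / 2))^2, where q is the sum
    of the squares of the difference quotients of the coordinates. Off the diagonal q is positive
    by injectivity of the parametrization, and on the diagonal it is the squared speed; by
    compactness q >= q0 > 0, so that b = (ln q) / 2 is smooth. *)
Lemma log_kernel_split : exists (b : R -> R -> R) (q0 : R), [/\ 0 < q0,
  forall n, sm n b,
  (forall t s, b (t + 2 * pi) s = b t s) /\ (forall t s, b t (s + 2 * pi) = b t s),
  (forall t s, 2 * sin ((s - t) / 2) != 0 -> logdist gamma t s = lnsin (s - t) + b t s) /\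
  (forall t s, 2 * sin ((s - t) / 2) = 0 -> logdist gamma t s = 0) &
  forall t s, q0 * (2 * sin ((s - t) / 2)) ^+ 2 <= curve_rho t s].
Proof.
have [d1 _] := Cper_der C1; have [d2 _] := Cper_der C2.
have [D1 [sD1 E1]] := diff_quotient C1; have [D2 [sD2 E2]] := diff_quotient C2.
pose q t s := D1 t s * D1 t s + D2 t s * D2 t s.
have sq n : sm n q by apply: smD; exact: smM.
have rhoq t s : curve_rho t s = q t s * (2 * sin ((s - t) / 2)) ^+ 2.
  by rewrite /curve_rho E1 E2 /q; ring.
(* Where sin ((s - t) / 2) = 0, the derivative in s of the factorization of g t - g s shows that
   the quotient is the derivative of g up to sign. *)
have diag (g : R -> R) (D : R -> R -> R) t s : (forall n, sm n D) -> (forall t, der g t (derive1 g t)) ->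
    (forall t s, g t - g s = 2 * sin ((s - t) / 2) * D t s) -> sin ((s - t) / 2) = 0 ->
    D t s * D t s = derive1 g s ^+ 2.
  move=> sD dg E s0.
  have [_ [F1 [F2 [_ _ _ dD]]]] := sD 1%N.
  have l1 : der (fun x => g t - g x) s (0 - derive1 g s) by exact: (derB (der_cst (g t) s) (dg s)).
  have l2 : der (fun x => 2 * sin ((x - t) / 2)) s (cos ((s - t) / 2)).
    have h0 : der (fun x => (x - t) / 2) s (2^-1).
      have -> : (fun x : R => (x - t) / 2) = (fun x => 2^-1 * (x - t)) by apply/funext => x; rewrite mulrC.
      by apply: (der_eq (derZ 2^-1 (derB (der_id s) (der_cst t s)))); rewrite subr0 mulr1.
    have h1 := @der_comp R sin _ s _ _ (is_derive_sin _) h0.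
    by apply: (der_eq (derZ 2 h1)); rewrite mulrCA mulfV// mulr1.
  have l3 := derM l2 (dD t s).
  have l3' : der (fun x => g t - g x) s (cos ((s - t) / 2) * D t s).
    have -> : (fun x => g t - g x) = (fun x => 2 * sin ((x - t) / 2) * D t x) by apply/funext => x.
    by apply: (der_eq l3); rewrite s0 mulr0 mul0r addr0.
  have := der_unique l1 l3'; rewrite sub0r => h.
  have := cos2Dsin2 ((s - t) / 2); rewrite s0 expr0n/= addr0 => c1.
  have -> : D t s * D t s = cos ((s - t) / 2) ^+ 2 * (D t s * D t s) by rewrite c1 mul1r.
  have -> : cos ((s - t) / 2) ^+ 2 * (D t s * D t s) = (cos ((s - t) / 2) * D t s) ^+ 2 by ring.
  by rewrite -h sqrrN.
have qdiag t s : sin ((s - t) / 2) = 0 -> q t s = speed s ^+ 2.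
  by move=> s0; rewrite -speed2 /q (diag g1)// (diag g2).
have sper (t s : R) : (sin ((s + 2 * pi - t) / 2)) = - sin ((s - t) / 2).
  by rewrite addrAC sin_half2pi.
have sper' (t s : R) : (sin ((s - (t + 2 * pi)) / 2)) = - sin ((s - t) / 2).
  have -> : (s - (t + 2 * pi)) / 2 = - ((t + 2 * pi - s) / 2) by rewrite -mulNr opprB.
  by rewrite sinN sper opprK -sinN -mulNr opprB.
have qpos t s : 0 < q t s.
  have q0 : 0 <= q t s by rewrite /q -!expr2 addr_ge0 ?sqr_ge0.
  have [s0|s0] := eqVneq (sin ((s - t) / 2)) 0; first by rewrite qdiag// exprn_gt0// speed_gt0.
  rewrite lt_neqAle q0 andbT eq_sym; apply/negP => /eqP qz.
  have rz : curve_rho t s = 0 by rewrite rhoq qz mul0r.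
  have gE : gamma t = gamma s.
    move: rz; rewrite /curve_rho => /eqP; rewrite paddr_eq0 ?sqr_ge0// !sqrf_eq0 !subr_eq0.
    by move=> /andP[/eqP h1 /eqP h2]; apply: injective_projections.
  have [t' [t01 redt]] := per_reduce t; have [s' [s01 reds]] := per_reduce s.
  have ts : t' = s'.
    apply: (param_injective hgamma); rewrite ?inE ?in_itv//=.
    by rewrite -(redt _ gamma pg) -(reds _ gamma pg).
  have : sin ((s - t) / 2) ^+ 2 = 0.
    rewrite (redt _ (fun t => sin ((s - t) / 2) ^+ 2)); last by move=> x; rewrite sper' sqrrN.
    rewrite (reds _ (fun s => sin ((s - t') / 2) ^+ 2)); last by move=> x; rewrite sper sqrrN.
    by rewrite ts subrr mul0r sin0 expr0n.
  by move=> /eqP; rewrite sqrf_eq0; apply/negP.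
have speedper t : speed (t + 2 * pi) = speed t by have := Cper_per speed_Cper t.
have rhoper1 t s : curve_rho (t + 2 * pi) s = curve_rho t s by rewrite /curve_rho /g1 /g2/= pg.
have rhoper2 t s : curve_rho t (s + 2 * pi) = curve_rho t s by rewrite /curve_rho /g1 /g2/= pg.
have qper1 t s : q (t + 2 * pi) s = q t s.
  have [s0|s0] := eqVneq (sin ((s - t) / 2)) 0; first by rewrite !qdiag// sper' s0 oppr0.
  have := rhoq (t + 2 * pi) s; rewrite rhoper1 rhoq sper' mulrN sqrrN.
  by move=> /mulIf h; symmetry; apply: h; rewrite sqrf_eq0 mulf_neq0.
have qper2 t s : q t (s + 2 * pi) = q t s.
  have [s0|s0] := eqVneq (sin ((s - t) / 2)) 0; first by rewrite !qdiag ?speedper// sper s0 oppr0.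
  have := rhoq t (s + 2 * pi); rewrite rhoper2 rhoq sper mulrN sqrrN.
  by move=> /mulIf h; symmetry; apply: h; rewrite sqrf_eq0 mulf_neq0.
(* The minimum of q over s is a continuous function of t by the Lipschitz bound, so it attains its
   own minimum. *)
have [q0 [q00 qlb]] : exists q0, 0 < q0 /\ forall t s, q0 <= q t s.
  have [L [L0 Hlip]] := sm_lip (sq 1%N).
  have cq t : continuous (q t).
    move=> s; apply: eps_cts => e e0; exists (e / L); first by rewrite divr_gt0.
    move=> s'; rewrite ltr_pdivlMr// => h; apply: le_trans (Hlip _ _ _ _) _.
    by rewrite subrr normr0 add0r mulrC ltW.
  have /choice [m Hm] t : exists m, period m /\ forall s, period s -> q t m <= q t s.
    have [c cI Hc] := EVT_min (ltW (@twopi_gt0 R)) (continuous_subspaceT (cq t)).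
    by exists c; split => // s Ps; apply: Hc.
  have cm : continuous (fun t => q t (m t)).
    move=> t; apply: eps_cts => e e0; exists (e / L); first by rewrite divr_gt0.
    move=> t'; rewrite ltr_pdivlMr// mulrC => /ltW h.
    have h1 := Hlip t' (m t) t (m t); have h2 := Hlip t' (m t') t (m t').
    move: h1 h2; rewrite !subrr !normr0 !addr0 !ler_norml => /andP[a1 a2] /andP[a3 a4].
    have b1 := (Hm t).2 (m t') (Hm t').1; have b2 := (Hm t').2 (m t) (Hm t).1.
    apply/andP; split; lra.
  have [c cI Hc] := EVT_min (ltW (@twopi_gt0 R)) (continuous_subspaceT cm).
  exists (q c (m c)); split => // t s.
  have [t' [t01 redt]] := per_reduce t; have [s' [s01 reds]] := per_reduce s.
  have sub (x : R) : 0 <= x < 2 * pi -> period x.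
    by rewrite /period/= in_itv/= => /andP[-> /ltW].
  rewrite (redt _ (q^~ s)); last by move=> x; exact: qper1.
  rewrite (reds _ (q t')); last by move=> x; exact: qper2.
  apply: (le_trans (Hc t' (sub _ t01))); exact: ((Hm t').2 _ (sub _ s01)).
exists (fun t s => 2^-1 * ln (q t s)), q0; split => //.
- by move=> n; apply: smZ; exact: (sm_ln q00).
- by split => t s; rewrite ?qper1 ?qper2.
- split=> t s s0; last first.
    have -> : logdist gamma t s = ln (Num.sqrt (curve_rho t s)) by [].
    by rewrite rhoq s0 expr0n/= mulr0 sqrtr0 ln0.
  rewrite /logdist /lnsin.
  have -> : enorm (gamma t - gamma s) = Num.sqrt (q t s) * `|2 * sin ((s - t) / 2)|.
    have -> : enorm (gamma t - gamma s) = Num.sqrt (curve_rho t s) by [].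
    by rewrite rhoq sqrtrM ?(ltW (qpos _ _))// sqrtr_sqr.
  rewrite lnM ?posrE ?sqrtr_gt0 ?normr_gt0// addrC; congr (_ + _).
  by rewrite -{2}(sqr_sqrtr (ltW (qpos t s))) lnXn ?sqrtr_gt0//; move: (ln _) => l; lra.
- by move=> t s; rewrite rhoq ler_wpM2r ?sqr_ge0.
Qed.

End Curve.

(** * Operators that are almost diagonal in the trigonometric basis *)

Section PointwiseParseval.
Context {R : realType}.
Implicit Types (f g : R -> R) (t : R).

Lemma ip_proj_sub f g n : sqint f -> sqint g ->
  ip (fun t => f t - \sum_(i < n) ip f (ebas i) * ebas i t)
     (fun t => g t - \sum_(i < n) ip g (ebas i) * ebas i t) =
  ip f g - \sum_(i < n) ip f (ebas i) * ip g (ebas i).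
Proof.
move=> sf sg; have s1 := sqint_comb n (fun i => ip f (ebas i)).
have s2 := sqint_comb n (fun i => ip g (ebas i)).
have e1 : ip f (fun t => g t - \sum_(i < n) ip g (ebas i) * ebas i t) =
    ip f g - \sum_(i < n) ip f (ebas i) * ip g (ebas i).
  rewrite ipC ipBl// (ipC g); congr (_ - _).
  transitivity (ip f (fun t => \sum_(i < n) ip g (ebas i) * ebas i t)); first exact: ipC.
  rewrite (ip_comb n (fun i => ip g (ebas i)) sf).
  by apply: eq_bigr => i _; rewrite mulrC.
rewrite ipBl//; last exact: sqintB.
rewrite e1 -[RHS]subr0; congr (_ - _).
rewrite ipC (ip_comb n (fun i => ip f (ebas i)) (sqintB sg s2)); apply: big1 => i _.
rewrite (ipBl sg s2 (@ebas_sqint R i)).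
by rewrite (ip_comb_ebas n (fun i => ip g (ebas i))) ltn_ord subrr mulr0.
Qed.

Lemma parseval_nsq f n : sqint f ->
  nsq (fun t => f t - \sum_(i < n) ip f (ebas i) * ebas i t) =
  nsq f - \sum_(i < n) ip f (ebas i) ^+ 2.
Proof. by move=> sf; rewrite (nsq_sub_comb n (fun i => ip f (ebas i)) sf) [X in _ + X]big1 ?addr0// => i _; rewrite subrr expr0n. Qed.

(** The Cauchy-Schwarz inequality for the two remainders. *)
Lemma parseval_ip f g : sqint f -> sqint g ->
  (fun n => \sum_(i < n) ip f (ebas i) * ip g (ebas i)) @ \oo --> ip f g.
Proof.
move=> sf sg; apply/cvgrPdist_le => e e0.
have Q0 : 0 < nsq g + 1 by rewrite ltr_wpDl// nsq_ge0.
have e1 : 0 < e ^+ 2 / (nsq g + 1) by rewrite divr_gt0// exprn_gt0.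
have [N HN] := parseval sf e1; exists N => // n /= Nn.
have s1 := sqintB sf (sqint_comb n (fun i => ip f (ebas i))).
have s2 := sqintB sg (sqint_comb n (fun i => ip g (ebas i))).
rewrite -ip_proj_sub// -ler_sqr ?nnegrE ?(ltW e0)// real_normK ?num_real//.
apply: le_trans (cauchy_schwarz s1 s2) _; rewrite !parseval_nsq//.
have b0 : 0 <= nsq f - \sum_(i < n) ip f (ebas i) ^+ 2 by rewrite subr_ge0 bessel.
have b1 : nsq g - \sum_(i < n) ip g (ebas i) ^+ 2 <= nsq g + 1.
  have : 0 <= \sum_(i < n) ip g (ebas i) ^+ 2 by apply: sumr_ge0 => i _; exact: sqr_ge0.
  lra.
have b2 : 0 <= nsq g - \sum_(i < n) ip g (ebas i) ^+ 2 by rewrite subr_ge0 bessel.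
have -> : e ^+ 2 = e ^+ 2 / (nsq g + 1) * (nsq g + 1) by rewrite divfK ?gt_eqF.
by apply: ler_pM => //; apply: ltW; exact: HN.
Qed.

(** The factor 2 of |a + b|^2 <= 2 |a|^2 + 2 |b|^2 spares the passage to the limit in the norm. *)
Lemma nsq_uniform_lim (G : R -> R) (S : nat -> R -> R) (M : R) : continuous G ->
  (forall n, sqint (S n)) -> (forall n, nsq (S n) <= M) ->
  (forall e : R, 0 < e -> exists n, forall t, period t -> `|G t - S n t| <= e) -> nsq G <= 2 * M.
Proof.
move=> cG sS HM H; have sG := sqint_cts cG.
apply: (@le_of_linear_slack _ _ _ (2 * (2 * pi))) => e /andP[e0 e1].
have [n Hn] := H e e0.
have E : nsq G = nsq (fun t => S n t + (G t - S n t)).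
  by apply: eq_pint => t _; rewrite addrC subrK.
rewrite E; apply: le_trans (nsqD_le (sS n) (sqintB sG (sS n))) _.
have h : nsq (fun t => G t - S n t) <= (2 * pi) * e.
  rewrite nsqE mulrC; apply: le_trans (ler_norm _) _; apply: pint_bound.
    exact: (sqintB sG (sS n)).2.
  move=> t Pt; rewrite ger0_norm ?sqr_ge0// -real_normK ?num_real//.
  have := Hn t Pt; have := normr_ge0 (G t - S n t); nra.
have := HM n; rewrite -mulrA; lra.
Qed.

End PointwiseParseval.

Section Operator.
Context {R : realType}.
Implicit Types (f g psi : R -> R) (t : R).
Variables (k : R -> R -> R) (al : nat -> R) (r : nat -> R -> R) (c0 C : R).

Definition kop psi t : R := ip (k t) psi.

Let kap i t : R := al i * ebas i t + r i t.

Hypothesis c00 : 0 < c0.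
Hypothesis C0 : 0 < C.
Hypothesis ksq : forall t, period t -> sqint (k t).
Hypothesis kbas : forall i t, period t -> kop (ebas i) t = kap i t.
Hypothesis al_ge : forall i, c0 / i.+1%:R <= al i.
Hypothesis al_le : forall i, al i <= C / i.+1%:R.
Hypothesis r_cts : forall i, continuous (r i).
Hypothesis r_le : forall i t, `|r i t| <= C / i.+1%:R ^+ 2.
Hypothesis r_ip : forall l i, `|ip (r i) (ebas l)| <= C / (l.+1%:R ^+ 3 * i.+1%:R ^+ 2).
Hypothesis k_inj : forall psi, continuous psi -> (forall t, period t -> kop psi t = 0) ->
  forall t, 0 < t < 2 * pi -> psi t = 0.

Let al_gt0 i : 0 < al i.
Proof. by apply: lt_le_trans (al_ge i); rewrite divr_gt0. Qed.

Let kap_cts i : continuous (kap i).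
Proof. by apply: ctsD => //; apply: ctsZ; exact: ebas_cts. Qed.

Let kap_le i t : `|kap i t| <= 2 * C / i.+1%:R.
Proof.
apply: le_trans (ler_normD _ _) _; rewrite -mulrA mulr2n mulrDl mul1r; apply: lerD.
  rewrite normrM (gtr0_norm (al_gt0 i)) -[leRHS]mulr1; apply: ler_pM => //; first exact: ltW.
  exact: ebas_le1.
apply: le_trans (r_le i t) _; rewrite ler_wpM2l ?(ltW C0)// lef_pV2 ?posrE ?exprn_gt0//.
by rewrite expr2 ler_peMr// ler1n.
Qed.

(** The Cauchy-Schwarz inequality makes the expansion of the operator absolutely convergent. *)
Let weighted_psum (x : nat -> R) (Q : R) : (forall n, \sum_(i < n) x i ^+ 2 <= Q) ->
  psum (fun i => `|x i| * (2 * C / i.+1%:R)) (2 * C * Num.sqrt (Q * 2)).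
Proof.
move=> xQ; have Q0 : 0 <= Q by have := xQ 0%N; rewrite big_ord0.
split=> [i|n]; first by rewrite mulr_ge0// divr_ge0// mulr_ge0// ltW.
have -> : \sum_(i < n) `|x i| * (2 * C / i.+1%:R) = 2 * C * \sum_(i < n) `|x i| * i.+1%:R^-1.
  by rewrite mulr_sumr; apply: eq_bigr => i _; rewrite mulrCA.
rewrite ler_wpM2l ?mulr_ge0 ?(ltW C0)//.
have S0 : 0 <= \sum_(i < n) `|x i| * i.+1%:R^-1 by apply: sumr_ge0 => i _; rewrite mulr_ge0.
rewrite -(ger0_norm S0) -sqrtr_sqr ler_wsqrtr//.
apply: le_trans (cs_sum _ _ _) _; apply: ler_pM.
- by apply: sumr_ge0 => i _; exact: sqr_ge0.
- by apply: sumr_ge0 => i _; exact: sqr_ge0.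
- by under eq_bigr do rewrite real_normK ?num_real//.
- by under eq_bigr do rewrite exprVn; exact: (@psum_inv2 R).2.
Qed.

(** At a fixed t the operator is an inner product in s, which the Parseval identity expands; so
    the image is known through a uniformly convergent series, without exchanging integrals. *)
Lemma kop_series psi : sqint psi -> exists G : R -> R, exists b, exists B, [/\ continuous G, psum b B,
  forall t, period t -> kop psi t = G t,
  forall t n, `|G t - \sum_(i < n) ip psi (ebas i) * kap i t| <= tail b n &
  forall j, (fun n => \sum_(i < n) ip (fun t => ip psi (ebas i) * kap i t) (ebas j)) @ \oo --> ip G (ebas j)].
Proof.
move=> spsi.
have pb := @weighted_psum (fun i => ip psi (ebas i)) _ (fun n => bessel n spsi).
have [||G [cG HG H]] := @unif_series R (fun i t => ip psi (ebas i) * kap i t) _ _ pb.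
- by move=> i; exact: ctsZ.
- by move=> i t; rewrite normrM ler_wpM2l.
exists G; eexists; eexists; split; [exact: cG|exact: pb| |exact: HG|exact: H].
move=> t Pt.
have c1 := parseval_ip (ksq Pt) spsi.
have c2 : (fun n => \sum_(i < n) ip psi (ebas i) * kap i t) @ \oo --> G t.
  apply/cvgrPdist_lt => e e0; have [N HN] := tail_small pb e0.
  by exists N => // n /= Nn; apply: le_lt_trans (HG t n) (HN n Nn).
apply: (@cvg_unique _ (@norm_hausdorff _ R) _ _ _ _ c1); rewrite (_ : (fun n => _) =
   (fun n => \sum_(i < n) ip psi (ebas i) * kap i t)) //.
by apply/funext => n; apply: eq_bigr => i _; rewrite mulrC -kbas.
Qed.

Lemma sqint_kop psi : sqint psi -> sqint (kop psi).
Proof.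
move=> /kop_series[G [b [B [cG pb KG _ _]]]].
have [mG pG] := sqint_cts cG; split.
  by apply: (eq_measurable_fun G) => // t; rewrite inE => Pt; rewrite KG.
by apply: eq_pin pG => t Pt; rewrite KG.
Qed.

(** The diagonal part multiplies the modes from m on by at most C / (m + 1). In the remaining part
    one factor 1 / (i + 1) of the decay of r i gives the same gain, and the other one makes the
    series converge. *)
Lemma kop_high : exists2 A : R, 0 < A & forall psi m, sqint psi ->
  (forall i, (i < m)%N -> ip psi (ebas i) = 0) ->
  nsq (kop psi) <= A / m.+1%:R ^+ 2 * nsq psi.
Proof.
pose A := 2 * (2 * C ^+ 2 + 2 * (2 * pi * (C ^+ 2 * 2))).
have p0 := @twopi_gt0 R.
exists A.
  by rewrite /A mulr_gt0// addr_gt0// !mulr_gt0 ?exprn_gt0// pi_gt0.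
move=> psi m spsi x0.
have [G [b [B [cG pb KG HG _]]]] := kop_series spsi.
have -> : nsq (kop psi) = nsq G by apply: eq_pint => t Pt; rewrite KG.
set x := fun i => ip psi (ebas i) in x0 HG *.
have xQ n : \sum_(i < n) x i ^+ 2 <= nsq psi by exact: bessel.
have Q0 := nsq_ge0 psi.
have mm : 0 < (m.+1%:R : R) ^+ 2 by rewrite exprn_gt0.
have -> : A / m.+1%:R ^+ 2 * nsq psi =
   2 * ((2 * C ^+ 2 + 2 * (2 * pi * (C ^+ 2 * 2))) / m.+1%:R ^+ 2 * nsq psi).
  by rewrite /A -!mulrA.
pose S1 n t := \sum_(i < n) (x i * al i) * ebas i t.
pose S2 n t := \sum_(i < n) x i * r i t.
have sS1 n : sqint (S1 n) by exact: sqint_comb n (fun i => x i * al i).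
have cS2 n : continuous (S2 n).
  by apply: (@cts_sum _ n (fun i t => x i * r i t)) => i _; exact: ctsZ.
have sS2 n : sqint (S2 n) := sqint_cts (@cS2 n).
have sqm i : x i != 0 -> (i.+1%:R : R)^-1 <= m.+1%:R^-1.
  move=> xN; rewrite lef_pV2 ?posrE// ler_nat ltnS leqNgt; apply/negP => im.
  by rewrite /x x0// eqxx in xN.
apply: (nsq_uniform_lim (S := fun n t => S1 n t + S2 n t)) => //.
- by move=> n; exact: sqintD.
- move=> n; apply: le_trans (nsqD_le (sS1 n) (sS2 n)) _.
  have h1 : nsq (S1 n) <= C ^+ 2 / m.+1%:R ^+ 2 * nsq psi.
    rewrite /S1 (nsq_comb n (fun i => x i * al i)); apply: le_trans (_ : \sum_(i < n) C ^+ 2 / m.+1%:R ^+ 2 * x i ^+ 2 <= _).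
      apply: ler_sum => i _; have [->|xN] := eqVneq (x i) 0; first by rewrite mul0r expr0n/= mulr0.
      rewrite exprMn mulrC ler_wpM2r ?sqr_ge0// -expr_div_n ler_sqr ?nnegrE ?divr_ge0 ?(ltW C0) ?(ltW (al_gt0 i))//.
      by apply: le_trans (al_le i) _; rewrite ler_wpM2l ?(ltW C0)// sqm.
    by rewrite -mulr_sumr ler_wpM2l// divr_ge0 ?sqr_ge0// ltW.
  suff h2 : nsq (S2 n) <= nsq psi * (C ^+ 2 * m.+1%:R ^- 2 * 2) * (2 * pi).
    move: h1 h2; move: (pi : R) (m.+1%:R ^- 2 : R) (nsq psi) (nsq (S1 n)) (nsq (S2 n)) (C ^+ 2) => P M Q X Y D h1 h2.
    have -> : (2 * D + 2 * (2 * P * (D * 2))) * M * Q = 2 * (D * M * Q) + 2 * (Q * (D * M * 2) * (2 * P)) by ring.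
    lra.
  rewrite nsqE; apply: le_trans (ler_norm _) _; apply: pint_bound; first exact: (sS2 n).2.
  move=> t Pt; rewrite ger0_norm ?sqr_ge0//.
  (* Only the modes with x i != 0, hence i >= m, may enter the sum of the squares of the r i. *)
  pose r' i := if x i == 0 then 0 else r i t.
  have -> : S2 n t = \sum_(i < n) x i * r' i.
    by apply: eq_bigr => i _; rewrite /r'; case: eqP => [->|//]; rewrite !mul0r.
  apply: le_trans (cs_sum _ _ _) _; apply: ler_pM => //.
  + by apply: sumr_ge0 => i _; exact: sqr_ge0.
  + by apply: sumr_ge0 => i _; exact: sqr_ge0.
  + apply: le_trans (_ : \sum_(i < n) C ^+ 2 * m.+1%:R ^- 2 * (i.+1%:R ^+ 2)^-1 <= _).
      apply: ler_sum => i _; rewrite /r'; case: eqP => [_|/eqP xN].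
        by rewrite expr0n/= divr_ge0 ?divr_ge0 ?sqr_ge0 ?exprn_ge0.
      rewrite -exprVn -exprVn -!exprMn -[leLHS]real_normK ?num_real//.
      rewrite ler_sqr ?nnegrE ?mulr_ge0 ?(ltW C0)//; apply: le_trans (r_le i t) _.
      by rewrite expr2 invfM mulrA ler_wpM2r// ler_wpM2l ?(ltW C0)// sqm.
    rewrite -mulr_sumr ler_wpM2l ?mulr_ge0 ?sqr_ge0 ?invr_ge0 ?exprn_ge0 ?(ltW C0)//.
    exact: (@psum_inv2 R).2.
- move=> e e0; have [N HN] := tail_small pb e0; exists N => t Pt.
  have -> : S1 N t + S2 N t = \sum_(i < N) x i * kap i t.
    by rewrite -big_split/=; apply: eq_bigr => i _; rewrite /kap; ring.
  by apply: le_trans (HG t N) _; apply: ltW; exact: HN.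
Qed.

(** The matrix of the operator is (I + Nmx) multiplied by the diagonal matrix of the al i. *)
Let Nmx l i : R := ip (r i) (ebas l) / al i.

Let Nmx_le l i : `|Nmx l i| <= (C / c0) / (l.+1%:R ^+ 3 * i.+1%:R).
Proof.
rewrite /Nmx normrM normfV (gtr0_norm (al_gt0 i)).
apply: le_trans (_ : C / (l.+1%:R ^+ 3 * i.+1%:R ^+ 2) * (i.+1%:R / c0) <= _).
  apply: ler_pM => //; first by rewrite invr_ge0 ltW.
  by rewrite -invf_div lef_pV2 ?posrE// divr_gt0.
have i0 : (i.+1%:R : R) != 0 by rewrite pnatr_eq0.
have l0 : (l.+1%:R : R) != 0 by rewrite pnatr_eq0.
have cN : c0 != 0 by rewrite gt_eqF.
rewrite le_eqVlt; apply/orP; left; apply/eqP.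
by move: i0 l0; move: (i.+1%:R : R) (l.+1%:R : R) => I L i0 l0; field; rewrite i0 l0 cN.
Qed.

Let Nmx_le1 l i : `|Nmx l i| <= (C / c0) / (l.+1%:R * i.+1%:R).
Proof.
apply: le_trans (Nmx_le l i) _; rewrite ler_wpM2l//.
  by rewrite mulr_ge0 ?invr_ge0 ?(ltW C0) ?(ltW c00).
rewrite lef_pV2 ?posrE ?mulr_gt0 ?exprn_gt0// ler_wpM2r//.
by rewrite exprS ler_peMr// exprn_ege1// ler1n.
Qed.

Let rowsum l (a : nat -> R) n : (forall n, \sum_(i < n) a i ^+ 2 <= 1) ->
  `|\sum_(i < n) Nmx l i * a i| <= C / c0 * 2 / l.+1%:R ^+ 3.
Proof.
move=> a1; have c1 : 0 <= C / c0 by rewrite divr_ge0 ?ltW.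
have h : (\sum_(i < n) Nmx l i * a i) ^+ 2 <= (C / c0 * 2 / l.+1%:R ^+ 3) ^+ 2.
  apply: le_trans (cs_sum _ _ _) _; rewrite -[leRHS]mulr1; apply: ler_pM => //.
  - by apply: sumr_ge0 => i _; exact: sqr_ge0.
  - by apply: sumr_ge0 => i _; exact: sqr_ge0.
  apply: le_trans (_ : \sum_(i < n) (C / c0 / l.+1%:R ^+ 3) ^+ 2 * (i.+1%:R ^+ 2)^-1 <= _).
    apply: ler_sum => i _; rewrite -expr_div_n -[leLHS]real_normK ?num_real//.
    rewrite ler_sqr ?nnegrE ?mulr_ge0 ?invr_ge0 ?exprn_ge0 ?(ltW c00) ?(ltW C0)//.
    by apply: le_trans (Nmx_le l i) _; rewrite invfM mulrA.
  have [_ /(_ n) h2] := @psum_inv2 R.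
  rewrite -mulr_sumr (mulrAC (C / c0) 2) [X in _ <= X]exprMn ler_wpM2l ?sqr_ge0//.
  by apply: le_trans h2 _; rewrite expr2; lra.
by apply: sqr_le_abs h; rewrite !mulr_ge0 ?invr_ge0 ?exprn_ge0 ?(ltW c00) ?(ltW C0).
Qed.

(** A null vector a = - Nmx a inherits the decay of the rows of Nmx, so that the a i / al i are
    summable and are the coefficients of a continuous function, which the operator maps to 0. *)
Let Nmx_inj (a : nat -> R) : (forall n, \sum_(i < n) a i ^+ 2 <= 1) ->
  (forall l, (fun n => a l + \sum_(i < n) Nmx l i * a i) @ \oo --> (0 : R)) ->
  forall i, a i = 0.
Proof.
move=> a1 Ha.
have c1 : 0 <= C / c0 by rewrite divr_ge0 ?ltW.
have a3 l : `|a l| <= C / c0 * 2 / l.+1%:R ^+ 3.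
  have h := cvg_dist_le (a := a l) (n := 0%N) (c := C / c0 * 2 / l.+1%:R ^+ 3) (Ha l).
  by rewrite -normrN -[- _]sub0r; apply: h => m _; rewrite addrAC subrr add0r; exact: rowsum.
pose c i := a i / al i.
pose D := C / c0 * 2 / c0.
have D0 : 0 <= D by rewrite !mulr_ge0 ?invr_ge0 ?(ltW C0) ?(ltW c00).
have cb i : `|c i| <= D * (i.+1%:R ^+ 2)^-1.
  rewrite /c normrM normfV (gtr0_norm (al_gt0 i)).
  apply: le_trans (_ : C / c0 * 2 / i.+1%:R ^+ 3 * (i.+1%:R / c0) <= _).
    apply: ler_pM => //; first by rewrite invr_ge0 ltW.
    by rewrite -invf_div lef_pV2 ?posrE// divr_gt0.
  have i0 : (i.+1%:R : R) != 0 by rewrite pnatr_eq0.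
  have cN : c0 != 0 by rewrite gt_eqF.
  rewrite le_eqVlt; apply/orP; left; apply/eqP; rewrite /D.
  by move: i0; move: (i.+1%:R : R) => I i0; field; rewrite i0 cN.
have [psi [cpsi _ psic]] := unif_ebas_series (psumZ D0 (@psum_inv2 R)) cb.
have spsi := sqint_cts cpsi.
have [G [b [B [cG pb KG HG Hip]]]] := kop_series spsi.
have G0 : forall t, period t -> G t = 0.
  apply: ebas_complete => // j; apply/eqP; rewrite -normr_le0; apply/ler_addgt0Pr => e e0; rewrite add0r.
  have /cvgrPdist_le/(_ e e0)[M _ HM0] := Ha j.
  have HM n : (M <= n)%N -> `|a j + \sum_(i < n) Nmx j i * a i| <= e.
    by move=> Mn; have := HM0 n Mn; rewrite /= sub0r normrN.
  rewrite -[ip G _]subr0; apply: (cvg_dist_le (n := maxn M j.+1) (Hip j)) => n; rewrite geq_max => /andP[Mn jn].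
  rewrite subr0; have -> : \sum_(i < n) ip (fun t => ip psi (ebas i) * kap i t) (ebas j) =
      a j + \sum_(i < n) Nmx j i * a i.
    have aE : a j = \sum_(i < n) ip (fun t => a i * ebas i t) (ebas j) by rewrite sum_ip_ebas.
    rewrite aE -big_split/=; apply: eq_bigr => i _; rewrite psic.
    have si := @ebas_sqint R i; have sj := @ebas_sqint R j; have sr := sqint_cts (@r_cts i).
    have aN : al i != 0 by rewrite gt_eqF.
    rewrite ipZl//; last exact: (sqint_cts (@kap_cts i)).
    rewrite /kap ipDl//; last exact: sqintZ.
    rewrite (ipZl (al i) si sj) (ipZl (a i) si sj) /c /Nmx; field; exact: aN.
  exact: HM.
have psi0 : forall t, 0 < t < 2 * pi -> psi t = 0.
  by apply: k_inj => // t Pt; rewrite KG// G0.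
move=> i; have : c i = 0.
  rewrite -psic /ip; rewrite (@pint_eq_ae _ _ (fun=> 0)).
  - by rewrite pint_cst mul0r.
  - by apply: pin_cts; apply: ctsM => //; exact: ebas_cts.
  - exact: pin_cst.
  - apply: (@ae_countable _ ([set 0] `|` [set 2 * pi])).
      by apply: finite_set_countable; rewrite finite_setU; split; exact: finite_set1.
    move=> t; rewrite /period/= in_itv/= => /andP[t0 t2] nA; rewrite psi0 ?mul0r//.
    apply/andP; split; rewrite lt_neqAle ?t0 ?t2 andbT.
      by rewrite eq_sym; apply/eqP => h; apply: nA; left.
    by apply/eqP => h; apply: nA; right.
by move=> /eqP; rewrite mulf_eq0 invr_eq0 (gt_eqF (al_gt0 i)) orbF => /eqP.
Qed.

Lemma kop_comb (n : nat) (c : nat -> R) t : period t ->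
  kop (fun t => \sum_(i < n) c i * ebas i t) t = \sum_(i < n) c i * kap i t.
Proof.
move=> Pt; rewrite /kop ip_comb; last exact: ksq.
by apply: eq_bigr => i _; rewrite -kbas.
Qed.

(** The Fredholm bound controls the vector of the al i * c i by the image, and c i is at most n /
    c0 times al i * c i for i < n. *)
Lemma kop_low : exists2 A : R, 0 < A & forall (n : nat) (c : nat -> R), (0 < n)%N ->
  nsq (fun t => \sum_(i < n) c i * ebas i t) <=
  A * n%:R ^+ 2 * nsq (kop (fun t => \sum_(i < n) c i * ebas i t)).
Proof.
have [A A0 HA] := fredholm_bounded_below (ltW (divr_gt0 C0 c00)) Nmx_le1 Nmx_inj.
exists (A / c0 ^+ 2); first by rewrite divr_gt0// exprn_gt0.
move=> n c n0; set psi := fun t => _; rewrite nsq_comb.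
have spsi : sqint psi by exact: sqint_comb.
have sK := sqint_kop spsi.
have [L HL] := HA n (fun i => al i * c i).
have nN : (0 : R) < n%:R by rewrite ltr0n.
have h1 : \sum_(i < n) c i ^+ 2 <= (n%:R / c0) ^+ 2 * \sum_(i < n) (al i * c i) ^+ 2.
  rewrite mulr_sumr; apply: ler_sum => i _; rewrite -(exprMn _ (n%:R / c0)) mulrA exprMn -[leLHS]mul1r ler_wpM2r ?sqr_ge0//.
  apply: exprn_ege1.
  have := al_ge i; rewrite ler_pdivrMr// => h.
  rewrite mulrAC ler_pdivlMr// mul1r; apply: le_trans h _.
  by rewrite mulrC ler_wpM2r ?(ltW (al_gt0 i))// ler_nat.
apply: le_trans h1 _.
have -> : A / c0 ^+ 2 * n%:R ^+ 2 * nsq (kop psi) = (n%:R / c0) ^+ 2 * (A * nsq (kop psi)).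
  by rewrite expr_div_n; move: (c0 ^+ 2)^-1 (n%:R ^+ 2) => X Y; ring.
rewrite ler_wpM2l ?sqr_ge0//; apply: le_trans HL _; rewrite ler_wpM2l ?(ltW A0)//.
apply: le_trans (bessel L sK); apply: ler_sum => l _; rewrite le_eqVlt; apply/orP; left; apply/eqP.
congr (_ ^+ 2).
have -> : ip (kop psi) (ebas l) = \sum_(i < n) ip (fun t => c i * kap i t) (ebas l).
  rewrite -(ip_suml (n := n) (F := fun i t => c i * kap i t)).
  - by apply: eq_pint => t Pt; rewrite kop_comb.
  - by move=> i _; apply: sqintZ; exact: sqint_cts.
  - exact: ebas_sqint.
have aE : (if (l < n)%N then al l * c l else 0) = \sum_(i < n) ip (fun t => (al i * c i) * ebas i t) (ebas l).
  rewrite -(ip_suml (n := n) (F := fun i t => (al i * c i) * ebas i t)).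
  - by rewrite (ip_comb_ebas n (fun i => al i * c i)).
  - by move=> i _; apply: sqintZ; exact: ebas_sqint.
  - exact: ebas_sqint.
rewrite aE -big_split/=; apply: eq_bigr => i _.
have si := @ebas_sqint R i; have sl := @ebas_sqint R l; have sr := sqint_cts (@r_cts i).
have aN : al i != 0 by rewrite gt_eqF.
rewrite ipZl// [in RHS]ipZl//; last exact: (sqint_cts (@kap_cts i)).
rewrite /kap ipDl//; last exact: sqintZ.
rewrite (ipZl (al i) si sl) /Nmx; field; exact: aN.
Qed.

End Operator.

(** * Fourier coefficients of smooth kernels *)

Section SmoothKernel.
Context {R : realType}.
Local Notation der f t d := (is_derive (t : R) (1 : R) (f : R -> R) (d : R)).
Implicit Types (F : R -> R -> R) (e : R -> R) (t s : R).

Definition biper F : Prop := (forall t s, F (t + 2 * pi) s = F t s) /\ (forall t s, F t (s + 2 * pi) = F t s).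

Lemma smS n F : sm n.+1 F -> (exists M : R, forall t s, `|F t s| <= M) /\
  exists F1 F2, [/\ sm n F1, sm n F2,
    forall t s, der (F^~ s) t (F1 t s) & forall t s, der (F t) s (F2 t s)].
Proof. by []. Qed.

Lemma sm_ctsr n F t : sm n.+1 F -> continuous (F t).
Proof. by move=> [_ [F1 [F2 [_ _ _ d2]]]]; exact: ders_cts (d2 t). Qed.

Lemma decay_row F : sm 3 F -> biper F ->
  exists2 C : R, 0 < C & forall t i, `|ip (F t) (ebas i)| * i.+1%:R ^+ 2 <= C.
Proof.
move=> sF [_ pF]; have [[M HM] [F1 [F2 [_ sF2 _ d2]]]] := smS sF.
have [_ [F21 [F22 [_ sF22 _ d22]]]] := smS sF2.
have [M2 HM2] := sm_bnd sF22.
have p2 := @twopi_gt0 R.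
pose K := (`|M| + `|M2|) * (2 * pi).
have K0 : 0 <= K by rewrite mulr_ge0 ?addr_ge0// ltW.
have bM t s : `|F t s| <= `|M| + `|M2|.
  by apply: le_trans (HM t s) _; apply: le_trans (ler_norm M) _; rewrite lerDl.
have bM2 t s : `|F22 t s| <= `|M| + `|M2|.
  by apply: le_trans (HM2 t s) _; apply: le_trans (ler_norm M2) _; rewrite lerDr.
exists (9 * K + 1) => [|t i]; first by lra.
rewrite ipC; apply: le_trans (_ : 9 * K <= _); last by lra.
have perF2 := der_periodic (pF t) (d2 t).
apply: (@parts_decay R i (F t) (F2 t) (F22 t) K 0 (d2 t) (d22 t)).
- exact: sm_ctsr sF22.
- by rewrite -(pF t 0) add0r.
- by rewrite -(perF2 0) add0r.
- by apply: ebas_ip_le => //; exact: sm_ctsr sF.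
- by rewrite mulr1; apply: ebas_ip_le => //; exact: sm_ctsr sF22.
Qed.

Lemma sm_dert n F : sm n.+3 F -> biper F -> exists F1, [/\ sm n.+2 F1, biper F1 &
  forall e, continuous e -> forall t, der (fun t => ip (F t) e) t (ip (F1 t) e)].
Proof.
move=> sF [p1 p2]; have [_ [F1 [F2 [sF1 _ d1 _]]]] := smS sF.
have [_ [F11 [F12 [sF11 _ d11 _]]]] := smS sF1.
have [M HM] := sm_bnd sF11.
exists F1; split => //.
- split=> t s; first exact: (der_periodic (fun t => p1 t s) (d1^~ s)).
  apply: (@der_unique R (F^~ s) t) => //.
  have -> : F^~ s = F^~ (s + 2 * pi) by apply/funext => x; rewrite p2.
  exact: d1.
- have cF u : continuous (F u) by exact: sm_ctsr sF.
  have cF1 u : continuous (F1 u) by exact: sm_ctsr sF1.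
  by move=> e ce t; exact: (@der_pint R F F1 F11 e t M d1 d11 HM cF cF1 ce).
Qed.

(** Two integrations by parts in s and four in t. *)
Lemma decay_matrix F : (forall n, sm n F) -> biper F ->
  exists2 C : R, 0 < C & forall l i,
    `|ip (fun t => ip (F t) (ebas i)) (ebas l)| * (l.+1%:R ^+ 4 * i.+1%:R ^+ 2) <= C.
Proof.
move=> sF pF.
have [F1 [s1 p1 d1]] := sm_dert (sF 9%N) pF.
have [F2 [s2 p2 d2]] := sm_dert s1 p1.
have [F3 [s3 p3 d3]] := sm_dert s2 p2.
have [F4 [s4 p4 d4]] := sm_dert s3 p3.
(* The fifth derivative serves only to show that the fourth one is continuous. *)
have [F5 [s5 p5 d5]] := sm_dert s4 p4.
have sle := @sm_le R.
have [A0 A0p H0] := decay_row (sF 3%N) pF.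
have [A2 A2p H2] := decay_row (sle _ _ (sle _ _ (sle _ _ (sle _ _ s2)))) p2.
have [A4 A4p H4] := decay_row (sle _ _ (sle _ _ s4)) p4.
pose A := A0 + A2 + A4; have tp := @twopi_gt0 R.
have [a0 a2 a4] : [/\ A0 <= A, A2 <= A & A4 <= A] by rewrite /A; split; lra.
exists (81 * (A * (2 * pi))); first by rewrite !mulr_gt0 ?pi_gt0// /A; lra.
move=> l i; have i2 : 0 < (i.+1%:R : R) ^+ 2 by rewrite exprn_gt0.
rewrite mulrA -ler_pdivlMr//.
have -> : 81 * (A * (2 * pi)) / i.+1%:R ^+ 2 = 9 * (9 * (A / i.+1%:R ^+ 2 * (2 * pi))) by ring.
set K := A / i.+1%:R ^+ 2 * (2 * pi).
have K0 : 0 <= K by rewrite mulr_ge0 ?ltW// divr_gt0// /A; lra.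
have ce := @ebas_cts R i.
have bd (F' : R -> R -> R) (A' : R) (h' : R -> R) : A' <= A ->
    (forall t i, `|ip (F' t) (ebas i)| * i.+1%:R ^+ 2 <= A') ->
    (forall t, der (fun t => ip (F' t) (ebas i)) t (h' t)) ->
    `|ip (ebas l) (fun t => ip (F' t) (ebas i))| <= K.
  move=> AA H d; apply: ebas_ip_le; first exact: ders_cts d.
  move=> t _; rewrite ler_pdivlMr//; apply: le_trans (H t i) AA.
have e0 := bd _ _ _ _ H0 (d1 _ ce); have e2 := bd _ _ _ _ H2 (d3 _ ce).
have e4 := bd _ _ _ _ H4 (d5 _ ce).
have per (F' F'' : R -> R -> R) : biper F' ->
    ip (F' (2 * pi)) (ebas i) = ip (F' 0) (ebas i).
  by move=> [p _]; congr (ip _ _); apply/funext => s; rewrite -(p 0 s) add0r.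
rewrite ipC; apply: (@parts_decay R l _ _ _ (9 * K) 2 (d1 _ ce) (d2 _ ce)).
- exact: ders_cts (d3 _ ce).
- exact: per.
- exact: per.
- by apply: (le_trans (e0 a0)); rewrite ler_peMl// ler1n.
- apply: (@parts_decay R l _ _ _ K 0 (d3 _ ce) (d4 _ ce)).
  + exact: ders_cts (d5 _ ce).
  + exact: per.
  + exact: per.
  + exact: e2.
  + by rewrite mulr1; exact: e4.
Qed.

End SmoothKernel.

(** * The modified Symm operator *)

Section SymmOperator.
Context {R : realType}.
Local Notation mu := (@lebesgue_measure R).
Local Notation der f t d := (is_derive (t : R) (1 : R) (f : R -> R) (d : R)).
Variable gamma : R -> R * R.
Hypothesis hgamma : regular_analytic_parametrization gamma.
Variables (b : R -> R -> R) (q0 : R).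
Hypothesis q00 : 0 < q0.
Hypothesis sb : forall n, sm n b.
Hypothesis pb : biper b.
Hypothesis blog : forall t s, 2 * sin ((s - t) / 2) != 0 -> logdist gamma t s = lnsin (s - t) + b t s.
Hypothesis blog0 : forall t s, 2 * sin ((s - t) / 2) = 0 -> logdist gamma t s = 0.
Hypothesis rhoD : forall t s, q0 * (2 * sin ((s - t) / 2)) ^+ 2 <= curve_rho gamma t s.
Implicit Types (f psi : R -> R) (t s : R).

Let v : R -> R := speed gamma.
Let L : R := curve_length gamma.

Let cv : continuous v. Proof. exact: Cper_cts (speed_Cper hgamma). Qed.
Let sv : sqint v. Proof. exact: sqint_cts. Qed.

Let L_gt0 : 0 < L.
Proof.
have [c cI Hc] := EVT_min (ltW (@twopi_gt0 R)) (continuous_subspaceT cv).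
apply: lt_le_trans (_ : v c * (2 * pi) <= _); first by rewrite mulr_gt0 ?twopi_gt0// speed_gt0.
rewrite -pint_cst; apply: pint_le; [exact: pin_cst|exact: pin_cts|].
by move=> t Pt; exact: Hc.
Qed.

Let g1c : continuous (fst \o gamma).
Proof.
apply: (@Cper_cts _ 0); apply: analytic_Cper; first exact: param_analytic1.
by move=> t /=; rewrite param_periodic.
Qed.
Let g2c : continuous (snd \o gamma).
Proof.
apply: (@Cper_cts _ 0); apply: analytic_Cper; first exact: param_analytic2.
by move=> t /=; rewrite param_periodic.
Qed.

Let logdistE t s : logdist gamma t s = 2^-1 * ln (curve_rho gamma t s).
Proof.
have -> : logdist gamma t s = ln (Num.sqrt (curve_rho gamma t s)) by [].
have r0 : 0 <= curve_rho gamma t s by rewrite addr_ge0 ?sqr_ge0.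
have [r00|r00] := eqVneq (curve_rho gamma t s) 0; first by rewrite r00 sqrtr0 !ln0// mulr0.
have r1 : 0 < curve_rho gamma t s by rewrite lt_neqAle eq_sym r00.
by rewrite -{2}(sqr_sqrtr r0) lnXn ?sqrtr_gt0//; move: (ln _) => l; lra.
Qed.

Let logdist_meas t : measurable_fun setT (logdist gamma t).
Proof.
have -> : logdist gamma t = (fun s => 2^-1 * ln (curve_rho gamma t s)).
  by apply/funext => s; rewrite logdistE.
apply: measurable_funM; first exact: measurable_cst.
apply: (measurableT_comp (@measurable_ln R)); apply: continuous_measurable_fun.
by apply: ctsD; apply: ctsX; apply: ctsB => //; exact: cst_continuous.
Qed.

Let bcts t : continuous (b t). Proof. exact: sm_ctsr (sb 1). Qed.

Let logdist_le t s : `|logdist gamma t s| <= `|lnsin (s - t)| + `|b t s|.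
Proof.
have [s0|s0] := eqVneq (2 * sin ((s - t) / 2)) 0.
  by rewrite blog0// normr0 addr_ge0.
by rewrite blog// ler_normD.
Qed.

Let logdist_sqint t : period t -> sqint (logdist gamma t).
Proof.
move=> Pt; have sl := lnsin_shift_sqint Pt; have sbt := sqint_cts (@bcts t).
apply: (@sqint_pin_sqr _ _ (fun s => 2 * lnsin (s - t) ^+ 2 + 2 * b t s ^+ 2)).
- exact: measurable_funTS (logdist_meas t).
- by apply: pinD; apply: pinZ; [exact: sl.2|exact: sbt.2].
move=> s _; have := logdist_le t s.
rewrite -(real_normK (num_real (logdist _ _ _))) -(real_normK (num_real (lnsin _))) -(real_normK (num_real (b _ _))).
have := normr_ge0 (logdist gamma t s); move: `|logdist _ _ _| `|lnsin _| `|b _ _| => x y z x0 xyz.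
have := sqr_ge0 (y - z); nra.
Qed.

Let logdist_ip t f : period t -> sqint f ->
  ip (logdist gamma t) f = ip (fun s => lnsin (s - t)) f + ip (b t) f.
Proof.
move=> Pt sf; have sl := lnsin_shift_sqint Pt; have sbt := sqint_cts (@bcts t).
rewrite -ipDl//; apply: pint_eq_ae.
- by apply: sqint_mul => //; exact: logdist_sqint.
- by apply: sqint_mul => //; exact: sqintD.
apply: (@ae_countable _ ([set t] `|` ([set 0] `|` [set 2 * pi]))).
  by apply: finite_set_countable; rewrite !finite_setU; split; [|split]; exact: finite_set1.
move=> s Ps nA; rewrite blog//; apply: sin_half_diff_neq0 => // st; apply: nA.
- by left.
- by right; left.
- by right; right.
Qed.

(** On the basis function i, the single layer operator S acts by the eigenvalue aS i of its
    convolution part and the function be i from its smooth part. *)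
Let aS (i : nat) : R := - (2 * pi)^-1 * lnsin_coef i.
Let be (i : nat) t : R := - (2 * pi)^-1 * ip (b t) (ebas i).
Let slc (i : nat) t : R := aS i * ebas i t + be i t.
Let S f t : R := - (2 * pi)^-1 * ip (logdist gamma t) f.

Let S_ebas i t : period t -> S (ebas i) t = slc i t.
Proof.
move=> Pt; rewrite /S (logdist_ip Pt (@ebas_sqint R i)).
by rewrite lnsin_ebas// /slc /aS /be; ring.
Qed.

Let aS_pos i : (0 < i)%N -> aS i = (2 * frq i)^-1.
Proof.
move=> i0; rewrite /aS /lnsin_coef gtn_eqF//; have f0 : frq i != 0 :> R by rewrite gt_eqF// (lt_le_trans ltr01)// frq_ge1.
have p0 : pi != 0 :> R by rewrite gt_eqF// pi_gt0.
by move: p0 f0; move: (pi : R) (frq i : R) => P f p0 f0; field; rewrite p0 f0.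
Qed.

Let aS_le : exists2 A : R, 0 < A & forall i, `|aS i| <= A / i.+1%:R.
Proof.
exists (`|aS 0| + 2); first by rewrite ltr_wpDl.
move=> i; have [->|i0] := posnP i; first by rewrite divr1 lerDl.
have f1 : 0 < frq i :> R by rewrite (lt_le_trans ltr01)// frq_ge1.
rewrite aS_pos// gtr0_norm ?invr_gt0 ?mulr_gt0//.
rewrite ler_pdivlMr// mulrC ler_pdivrMr ?mulr_gt0//.
have := frq_succ i0 (R := R); have := normr_ge0 (aS 0).
move: `|aS 0| (frq i : R) f1 (i.+1%:R : R) => x f f1 I x0 h; nra.
Qed.

Let norm_half_pi : `|- (2 * pi)^-1| = (2 * pi)^-1 :> R.
Proof. by rewrite normrN gtr0_norm ?invr_gt0 ?twopi_gt0. Qed.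

Let half_pi_le1 : (2 * pi)^-1 <= 1 :> R.
Proof. by rewrite invf_le1 ?twopi_gt0//; have := @pi_ge2 R; move: (pi : R) => P; lra. Qed.

Let be_le : exists2 C : R, 0 < C & forall i t, `|be i t| <= C / i.+1%:R ^+ 2.
Proof.
have [C C0 HC] := decay_row (sb 3) pb; exists C => // i t.
have i2 : 0 < (i.+1%:R : R) ^+ 2 by rewrite exprn_gt0.
rewrite ler_pdivlMr//; apply: le_trans (HC t i); rewrite ler_wpM2r ?(ltW i2)//.
by rewrite /be normrM norm_half_pi ler_piMl.
Qed.

Let be_der i : exists h, forall t, der (be i) t (h t).
Proof.
have [F1 [_ _ d]] := sm_dert (sb 3) pb.
exists (fun t => - (2 * pi)^-1 * ip (F1 t) (ebas i)) => t.
by apply: derZ; apply: d; exact: ebas_cts.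
Qed.

Let be_cts i : continuous (be i).
Proof. by have [h dh] := be_der i; exact: ders_cts dh. Qed.

Let be_ip : exists2 C : R, 0 < C & forall l i,
  `|ip (be i) (ebas l)| <= C / (l.+1%:R ^+ 3 * i.+1%:R ^+ 2).
Proof.
have [C C0 HC] := decay_matrix sb pb; exists C => // l i.
have i2 : 0 < (i.+1%:R : R) ^+ 2 by rewrite exprn_gt0.
have l3 : 0 < (l.+1%:R : R) ^+ 3 by rewrite exprn_gt0.
have cF : continuous (fun t => ip (b t) (ebas i)).
  have [F1 [_ _ d]] := sm_dert (sb 3) pb; exact: ders_cts (d _ (@ebas_cts R i)).
rewrite /be ipZl; [|exact: sqint_cts|exact: ebas_sqint].
rewrite ler_pdivlMr ?mulr_gt0//; apply: le_trans (HC l i).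
rewrite normrM norm_half_pi.
apply: ler_pM; rewrite ?mulr_ge0 ?invr_ge0 ?(ltW (@twopi_gt0 R)) ?(ltW i2) ?(ltW l3)//.
  by rewrite ler_piMl.
by rewrite ler_wpM2r ?(ltW i2)// [leRHS]exprS ler_peMl ?(ltW l3)// ler1n.
Qed.

Let slc_cts i : continuous (slc i).
Proof. by apply: ctsD => //; apply: ctsZ; exact: ebas_cts. Qed.

Let ip_slc i l : ip (slc i) (ebas l) = aS i * (i == l)%:R + ip (be i) (ebas l).
Proof.
have sl := @ebas_sqint R l; have si := @ebas_sqint R i; have sbe := sqint_cts (@be_cts i).
by rewrite /slc ipDl ?(ipZl (aS i) si sl) ?ebas_orth//; exact: sqintZ.
Qed.

(** The normalization of the kernel involves the potential of the arc length density, so its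
    Fourier coefficients have to decay like those of a smooth function. *)
Let potential : exists G : R -> R, [/\ continuous G, exists M : R, forall t, `|G t| <= M,
  forall t, period t -> S v t = G t &
  exists2 C : R, 0 < C & forall l, `|ip G (ebas l)| <= C / l.+1%:R ^+ 3].
Proof.
have [A A0 HA] := aS_le; have [B B0 HB] := be_le; have [D D0 HD] := be_ip.
have [Cv HCv] := Cper_rapid (m := 1) (speed_Cper hgamma).
have vi i : `|ip v (ebas i)| <= Cv * (i.+1%:R ^+ 2)^-1.
  by rewrite ler_pdivlMr ?exprn_gt0// ipC; exact: HCv.
have Cv0 : 0 <= Cv by have := vi 0%N; rewrite expr1n invr1 mulr1; exact: le_trans (normr_ge0 _).
have sle i t : `|slc i t| <= A + B.
  apply: le_trans (ler_normD _ _) _; apply: lerD.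
    rewrite normrM -[leRHS]mulr1; apply: ler_pM => //; last exact: ebas_le1.
    by apply: le_trans (HA i) _; rewrite ler_pdivrMr// ler_peMr ?(ltW A0)// ler1n.
  by apply: le_trans (HB i t) _; rewrite ler_pdivrMr ?exprn_gt0// ler_peMr ?(ltW B0)// exprn_ege1// ler1n.
have AB0 : 0 <= A + B by rewrite addr_ge0// ltW.
have pbv := psumZ (mulr_ge0 Cv0 AB0) (@psum_inv2 R).
have [||G [cG HG Hip]] := @unif_series R (fun i t => ip v (ebas i) * slc i t) _ _ pbv.
- by move=> i; exact: ctsZ.
- move=> i t; rewrite normrM mulrAC; apply: ler_pM => //; exact: vi.
exists G; split => //.
- by exists (tail (fun i => Cv * (A + B) * (i.+1%:R ^+ 2)^-1) 0) => t; have := HG t 0%N; rewrite big_ord0 subr0.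
- move=> t Pt.
  have c0 := parseval_ip (logdist_sqint Pt) sv.
  have c1 : (fun n => - (2 * pi)^-1 * \sum_(i < n) ip (logdist gamma t) (ebas i) * ip v (ebas i)) @ \oo --> S v t.
    by apply: cvgM; [exact: cvg_cst|exact: c0].
  have c2 : (fun n => \sum_(i < n) ip v (ebas i) * slc i t) @ \oo --> G t.
    apply/cvgrPdist_lt => e e0; have [N HN] := tail_small pbv e0.
    by exists N => // n /= Nn; apply: le_lt_trans (HG t n) (HN n Nn).
  apply: (@cvg_unique _ (@norm_hausdorff _ R) _ _ _ _ c1); rewrite (_ : (fun n => _) =
     (fun n => \sum_(i < n) ip v (ebas i) * slc i t)) //.
  apply/funext => n /=; rewrite mulr_sumr; apply: eq_bigr => i _.
  by rewrite -S_ebas// /S; ring.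
- exists (A * Cv + Cv * D * 2 + 1).
    by rewrite ltr_wpDl// addr_ge0 ?mulr_ge0 ?(ltW A0) ?(ltW D0).
  move=> l; have l3 : 0 < (l.+1%:R : R) ^+ 3 by rewrite exprn_gt0.
  apply: (@le_trans _ _ ((A * Cv + Cv * D * 2) / l.+1%:R ^+ 3)); last first.
    by rewrite ler_wpM2r ?invr_ge0 ?(ltW l3)//; lra.
  rewrite -[ip G _]subr0; apply: (cvg_dist_le (n := 0%N) (Hip l)) => n _; rewrite subr0.
  have -> : \sum_(i < n) ip (fun t => ip v (ebas i) * slc i t) (ebas l) =
     \sum_(i < n) (ip v (ebas i) * aS i) * (i == l :> nat)%:R +
     \sum_(i < n) ip v (ebas i) * ip (be i) (ebas l).
    rewrite -big_split/=; apply: eq_bigr => i _.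
    rewrite ipZl; [by rewrite ip_slc; ring|exact: sqint_cts|exact: ebas_sqint].
  apply: le_trans (ler_normD _ _) _; rewrite mulrDl; apply: lerD.
    have -> : \sum_(i < n) (ip v (ebas i) * aS i) * (i == l :> nat)%:R =
        if (l < n)%N then ip v (ebas l) * aS l else 0.
      case: ifPn => ln.
        rewrite (bigD1 (Ordinal ln))//= eqxx mulr1 big1 ?addr0// => i il.
        by rewrite (_ : (i == l :> nat) = false) ?mulr0//; apply: negbTE; exact: il.
      apply: big1 => i _; rewrite (_ : (i == l :> nat) = false) ?mulr0//.
      by apply/negbTE; apply: contra ln => /eqP <-.
    case: ifP => _; last by rewrite normr0 divr_ge0 ?mulr_ge0 ?(ltW A0) ?(ltW l3).
    rewrite normrM; apply: le_trans (ler_pM (normr_ge0 _) (normr_ge0 _) (vi l) (HA l)) _.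
    have -> : l.+1%:R ^+ 3 = l.+1%:R ^+ 2 * l.+1%:R :> R by rewrite exprSr.
    have key (c a x y : R) : c / x * (a / y) = a * c / (x * y) by rewrite invfM; ring.
    by rewrite key.
  apply: le_trans (ler_norm_sum _ _ _) _.
  apply: le_trans (_ : \sum_(i < n) Cv * D / l.+1%:R ^+ 3 * (i.+1%:R ^+ 2)^-1 <= _).
    apply: ler_sum => i _; rewrite normrM.
    apply: le_trans (ler_pM (normr_ge0 _) (normr_ge0 _) (vi i) (HD l i)) _.
    rewrite (invfM (l.+1%:R ^+ 3)); have : (i.+1%:R ^+ 2)^-1 <= 1 :> R by rewrite invf_le1 ?exprn_gt0// exprn_ege1// ler1n.
    have : 0 <= (i.+1%:R ^+ 2)^-1 :> R by rewrite invr_ge0 exprn_ge0.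
    have : 0 <= Cv * D / l.+1%:R ^+ 3 by rewrite divr_ge0 ?mulr_ge0 ?(ltW D0) ?(ltW l3).
    have -> u w : Cv * u * (D * (w * u)) = Cv * D * w * u * u by ring.
    move: (Cv * D * _) ((_ ^+ 2)^-1) => x u x0 u0 u1.
    by rewrite -[leRHS]mulr1 ler_wpM2l// mulr_ge0.
  have [_ /(_ n) h2] := @psum_inv2 R.
  have h0 : 0 <= Cv * D / l.+1%:R ^+ 3 by rewrite divr_ge0 ?mulr_ge0 ?(ltW D0) ?(ltW l3).
  by rewrite -mulr_sumr [leRHS]mulrAC ler_wpM2l.
Qed.

Let sq : R := Num.sqrt (2 * pi).

Let sq_gt0 : 0 < sq. Proof. by rewrite sqrtr_gt0 twopi_gt0. Qed.

Let ebas0 t : sq * ebas 0 t = 1.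
Proof. by rewrite /ebas /= /frq /= mul0r cos0 mulr1 /ecoef /= mulfV// gt_eqF. Qed.

Let pint_ip0 f : pin f -> pint f = sq * ip (ebas 0) f.
Proof.
move=> pf; rewrite -pintZ; last by apply: pin_mulc => //; exact: ebas_cts.
by apply: eq_pint => t _; rewrite mulrA ebas0 mul1r.
Qed.

Let pint_v : pint v = L. Proof. by []. Qed.

Let S_cst psi : continuous psi -> pint psi = 0 -> forall c, (forall t, period t -> S psi t = c) ->
  forall t, 0 < t < 2 * pi -> psi t = 0.
Proof.
move=> cpsi p0 c Sc.
have lE t s : ln (curve_rho gamma t s) * psi s = 2 * (logdist gamma t s * psi s).
  by rewrite logdistE; lra.
have lpin t : period t -> pin (fun s => logdist gamma t s * psi s).
  by move=> Pt; apply: sqint_mul; [exact: logdist_sqint|exact: sqint_cts].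
apply: (@log_energy_injective R (fst \o gamma) (snd \o gamma) psi q0 (- (4 * pi) * c)) => //.
- move=> t Pt; apply: (eq_pin (f := fun s => 2 * (logdist gamma t s * psi s))).
    by move=> s _; rewrite -lE.
  by apply: pinZ; exact: lpin.
- move=> t Pt; under eq_pint do rewrite lE.
  rewrite pintZ; last exact: lpin.
  have := Sc t Pt; rewrite /S /ip => <-.
  have P0 : pi != 0 :> R by rewrite gt_eqF// pi_gt0.
  by move: P0; move: (pi : R) (pint _) => P I P0; field.
Qed.

(** The kernel is -1/(2 pi) logdist plus a function W of t alone, so that the operator is S plus a
    term of rank one, which concerns only the mode 0. For the injectivity, a density psi with image
    0 is corrected by m times the speed to have mean zero; its potential is then the constant - m,
    so it vanishes, and then m = 0. *)
Lemma symm_operator_bounds :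
  let K := kop (symm_kernel gamma) in
  [/\ forall t, period t -> sqint (symm_kernel gamma t),
      forall psi, sqint psi -> sqint (K psi),
      exists2 A : R, 0 < A & forall psi m, sqint psi ->
        (forall i, (i < m)%N -> ip psi (ebas i) = 0) ->
        nsq (K psi) <= A / m.+1%:R ^+ 2 * nsq psi &
      exists2 A : R, 0 < A & forall (n : nat) (c : nat -> R), (0 < n)%N ->
        nsq (fun t => \sum_(i < n) c i * ebas i t) <=
        A * n%:R ^+ 2 * nsq (K (fun t => \sum_(i < n) c i * ebas i t))].
Proof.
have [G [cG [M HM] SG [C C0 HC]]] := potential.
have [B B0 HB] := be_le; have [D D0 HD] := be_ip.
pose k := symm_kernel gamma.
pose W t : R := L^-1 * (sq * ebas 0 t - G t).
have cW : continuous W.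
  by apply: ctsZ; apply: ctsB => //; apply: ctsZ; exact: ebas_cts.
have kE t s : period t -> k t s = - (2 * pi)^-1 * logdist gamma t s + W t.
  move=> Pt; rewrite /k /symm_kernel /W ebas0 -SG// /S -/L.
  have -> : \int[mu]_(sigma in period) (logdist gamma t sigma * enorm (velocity gamma sigma)) =
    ip (logdist gamma t) v by [].
  by ring.
have ksq t : period t -> sqint (k t).
  move=> Pt; have -> : k t = (fun s => - (2 * pi)^-1 * logdist gamma t s + W t).
    by apply/funext => s; exact: kE.
  by apply: sqintD; [apply: sqintZ; exact: logdist_sqint|apply: sqint_cts; exact: cst_continuous].
have kip t f : period t -> sqint f -> kop k f t = S f t + W t * pint f.
  move=> Pt sf; rewrite /kop /S.
  have -> : k t = (fun s => - (2 * pi)^-1 * logdist gamma t s + W t).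
    by apply/funext => s; exact: kE.
  have sc : sqint (fun=> W t : R) by apply: sqint_cts; exact: cst_continuous.
  have sl := logdist_sqint Pt.
  rewrite ipDl//; last exact: sqintZ.
  rewrite (ipZl _ sl sf); congr (_ + _).
  by rewrite /ip pintZ//; exact: sqint_pin.
(* Any positive value would do for the mode 0, since r 0 absorbs the difference. *)
pose al i : R := if i == 0%N then 1 else aS i.
pose r i t : R := if i == 0%N then slc 0 t + sq * W t - ebas 0 t else be i t.
have pe i : pint (ebas i) = sq * (0%N == i)%:R :> R.
  by rewrite pint_ip0 ?ebas_orth//; apply: pin_cts; exact: ebas_cts.
have kbas i t : period t -> kop k (ebas i) t = al i * ebas i t + r i t.
  move=> Pt; rewrite (kip _ _ Pt (@ebas_sqint R i)).
  rewrite S_ebas// pe /al /r eq_sym; case: eqP => [->|_]; last by rewrite !mulr0 addr0.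
  by rewrite mulr1; ring.
have al_ge i : 1 / i.+1%:R <= al i.
  rewrite /al; case: eqP => [->|/eqP i0]; first by rewrite divr1.
  rewrite -lt0n in i0; have f1 : 0 < frq i :> R by rewrite (lt_le_trans ltr01)// frq_ge1.
  rewrite aS_pos// mul1r lef_pV2 ?posrE ?mulr_gt0// -natrM ler_nat mul2n uphalfE.
  by rewrite -[leqRHS]odd_double_half leq_addl.
have M0 : 0 <= M by exact: le_trans (normr_ge0 _) (HM 0).
pose CW : R := L^-1 * (1 + M).
have CW0 : 0 <= CW by rewrite mulr_ge0 ?invr_ge0 ?(ltW L_gt0) ?addr_ge0.
have Wle t : `|W t| <= CW.
  rewrite /W ebas0 normrM gtr0_norm ?invr_gt0// ler_wpM2l ?invr_ge0 ?(ltW L_gt0)//.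
  by apply: le_trans (ler_normB _ _) _; rewrite normr1 lerD2l.
pose X1 : R := `|aS 0| + B + sq * CW + 1.
pose X2 : R := `|aS 0| + D + sq * L^-1 * (sq + C) + 1.
have [X10 X20] : 0 <= X1 /\ 0 <= X2.
  by split; rewrite !addr_ge0 ?mulr_ge0 ?addr_ge0 ?invr_ge0 ?(ltW sq_gt0) ?(ltW L_gt0) ?(ltW B0) ?(ltW D0) ?(ltW C0).
pose C' : R := 2 + B + D + X1 + X2.
have [hC0 hC2 hCB hCD [hC1 hC3]] : [/\ 0 < C', 2 <= C', B <= C', D <= C' & X1 <= C' /\ X2 <= C'].
  by rewrite /C'; split; [lra..|split; lra].
have al_le i : al i <= C' / i.+1%:R.
  rewrite /al; case: eqP => [->|/eqP i0]; first by rewrite divr1; lra.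
  rewrite -lt0n in i0; have f1 : 0 < frq i :> R by rewrite (lt_le_trans ltr01)// frq_ge1.
  rewrite aS_pos// ler_pdivlMr// mulrC ler_pdivrMr ?mulr_gt0//.
  apply: le_trans (frq_succ i0) _; rewrite mulrA ler_wpM2r ?(ltW f1)//; lra.
have r_cts i : continuous (r i).
  have [->|i0] := eqVneq i 0%N; last first.
    by have -> : r i = be i by apply/funext => t; rewrite /r (negbTE i0).
  have -> : r 0%N = (fun t => slc 0 t + sq * W t - ebas 0 t) by [].
  apply: ctsB; last exact: ebas_cts.
  by apply: ctsD; [exact: slc_cts|exact: ctsZ].
have r_le i t : `|r i t| <= C' / i.+1%:R ^+ 2.
  rewrite /r; case: eqP => [->|_]; last first.
    by apply: le_trans (HB i t) _; rewrite ler_wpM2r ?invr_ge0 ?exprn_ge0.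
  rewrite expr1n divr1; apply: le_trans hC1; apply: le_trans (ler_normB _ _) _.
  apply: lerD; last exact: ebas_le1.
  apply: le_trans (ler_normD _ _) _; apply: lerD; last by rewrite normrM gtr0_norm// ler_wpM2l// ltW.
  apply: le_trans (ler_normD _ _) _; apply: lerD.
    by rewrite normrM ler_piMr// ebas_le1.
  by have := HB 0%N t; rewrite expr1n divr1.
have r_ip l i : `|ip (r i) (ebas l)| <= C' / (l.+1%:R ^+ 3 * i.+1%:R ^+ 2).
  have l3 : 0 < (l.+1%:R : R) ^+ 3 by rewrite exprn_gt0.
  have [i0|i0] := eqVneq i 0%N; last first.
    have -> : r i = be i by apply/funext => t; rewrite /r (negbTE i0).
    apply: le_trans (HD l i) _; rewrite ler_wpM2r// invr_ge0 mulr_ge0 ?(ltW l3) ?exprn_ge0//.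
  rewrite i0 expr1n mulr1.
  have sl := @ebas_sqint R l; have s0 := @ebas_sqint R 0; have sG := sqint_cts cG.
  have ss := sqint_cts (@slc_cts 0); have sW := sqint_cts cW.
  have -> : ip (r 0%N) (ebas l) = aS 0 * (0%N == l)%:R + ip (be 0%N) (ebas l) +
      sq * (L^-1 * (sq * (0%N == l)%:R - ip G (ebas l))) - (0%N == l)%:R.
    have -> : r 0%N = (fun t => slc 0 t + sq * W t - ebas 0 t) by [].
    rewrite (ipBl (sqintD ss (sqintZ sq sW)) s0 sl) (ipDl ss (sqintZ sq sW) sl) (ipZl sq sW sl).
    rewrite /W (ipZl _ (sqintB (sqintZ sq s0) sG) sl) (ipBl (sqintZ sq s0) sG sl) (ipZl sq s0 sl).
    by rewrite ebas_orth ip_slc.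
  have d1 : (0%N == l)%:R <= (l.+1%:R ^+ 3)^-1 :> R.
    by case: eqP => [<-|_]; rewrite ?expr1n ?invr1// invr_ge0 ltW.
  have d0 : 0 <= (0%N == l)%:R :> R by [].
  have := HD l 0%N; rewrite expr1n mulr1; have := HC l.
  move: d1 d0; move: ((0%N == l)%:R : R) (ip G (ebas l)) (ip (be 0%N) (ebas l)) => d g bb d1 d0.
  move: l3; rewrite -invr_gt0; move: (l.+1%:R ^+ 3)^-1 d1 => y d1 y0 hg hb.
  apply: le_trans (_ : X2 * y <= _); last by rewrite ler_wpM2r// ltW.
  apply: le_trans (ler_normB _ _) _; rewrite /X2 mulrDl mul1r; apply: lerD; last by rewrite ger0_norm.
  apply: le_trans (ler_normD _ _) _; rewrite mulrDl; apply: lerD.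
    apply: le_trans (ler_normD _ _) _; rewrite mulrDl; apply: lerD => //.
    by rewrite normrM (ger0_norm d0) ler_wpM2l.
  rewrite !normrM (gtr0_norm sq_gt0) (@gtr0_norm _ L^-1) ?invr_gt0// mulrA -!(mulrA (sq * _)).
  rewrite ler_wpM2l ?mulr_ge0 ?invr_ge0 ?(ltW sq_gt0) ?(ltW L_gt0)//.
  apply: le_trans (ler_normB _ _) _; rewrite mulrDl; apply: lerD => //.
  by rewrite normrM (gtr0_norm sq_gt0) (ger0_norm d0) ler_wpM2l// ltW.
have k_inj psi : continuous psi -> (forall t, period t -> kop k psi t = 0) ->
    forall t, 0 < t < 2 * pi -> psi t = 0.
  move=> cpsi K0; have spsi := sqint_cts cpsi.
  pose m := pint psi / L; pose psi0 t := psi t - m * v t.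
  have LN : L != 0 by rewrite gt_eqF.
  have c0 : continuous psi0 by apply: ctsB => //; exact: ctsZ.
  have smv : sqint (fun t => m * v t) by exact: sqintZ.
  have p0 : pint psi0 = 0.
    rewrite /psi0 pintB ?pintZ; [by rewrite pint_v /m divfK// subrr|exact: pin_cts..|].
    by apply: pin_cts; exact: ctsZ.
  have S0 t : period t -> S psi0 t = - m.
    move=> Pt; have := K0 t Pt; rewrite kip//.
    have -> : S psi0 t = S psi t - m * S v t.
      rewrite /S /psi0 ipC (ipBl spsi smv (logdist_sqint Pt)) (ipZl m sv (logdist_sqint Pt)).
      by rewrite (ipC psi) (ipC v); ring.
    rewrite SG// /W ebas0 /m => h.
    have -> : S psi t = - (L^-1 * (1 - G t) * pint psi) by lra.
    by ring.
  have z0 := S_cst c0 p0 S0.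
  have m0 : m = 0.
    have P0 : period (0 : R) by rewrite /period/= in_itv/= lexx (ltW (@twopi_gt0 R)).
    have := S0 0 P0; rewrite /S /ip (@pint_eq_ae _ _ (fun=> 0)).
    - by rewrite pint_cst mul0r mulr0 => /eqP; rewrite eq_sym oppr_eq0 => /eqP.
    - by apply: sqint_mul; [exact: logdist_sqint|exact: sqint_cts].
    - exact: pin_cst.
    - apply: (@ae_countable _ ([set 0] `|` [set 2 * pi])).
        by apply: finite_set_countable; rewrite finite_setU; split; exact: finite_set1.
      move=> t; rewrite /period/= in_itv/= => /andP[t0 t2] nA; rewrite z0 ?mulr0//.
      apply/andP; split; rewrite lt_neqAle ?t0 ?t2 andbT.
        by rewrite eq_sym; apply/eqP => h; apply: nA; left.
      by apply/eqP => h; apply: nA; right.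
  by move=> t t02; have := z0 t t02; rewrite /psi0 m0 mul0r subr0.
split => //.
- by move=> psi spsi; exact: (sqint_kop ltr01 hC0 ksq kbas al_ge al_le r_cts r_le spsi).
- exact: (kop_high ltr01 hC0 ksq kbas al_ge al_le r_cts r_le).
- exact: (kop_low ltr01 hC0 ksq kbas al_ge al_le r_cts r_le r_ip k_inj).
Qed.

End SymmOperator.

(** * Reduction of complex functions to real ones *)

Section ComplexParts.
Context {R : realType}.
Local Notation C := R[i].
Local Notation mu := (@lebesgue_measure R).
Implicit Types (f g : R -> C) (t : R) (z w : C).

Definition fRe f t : R := complex.Re (f t).
Definition fIm f t : R := complex.Im (f t).

Lemma ReM z w : complex.Re (z * w) = complex.Re z * complex.Re w - complex.Im z * complex.Im w.
Proof. by case: z => a b; case: w. Qed.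

Lemma ImM z w : complex.Im (z * w) = complex.Re z * complex.Im w + complex.Im z * complex.Re w.
Proof. by case: z => a b; case: w. Qed.

Lemma modulus_sqr z : modulus z ^+ 2 = complex.Re z ^+ 2 + complex.Im z ^+ 2.
Proof. by case: z => a b; rewrite /modulus/= sqr_sqrtr// addr_ge0 ?sqr_ge0. Qed.

Lemma L2_sqint f : L2 f -> sqint (fRe f) /\ sqint (fIm f).
Proof.
move=> [mR mI fin].
have mR2 : pmeas (fun t => fRe f t ^+ 2) by exact: measurable_funX.
have mI2 : pmeas (fun t => fIm f t ^+ 2) by exact: measurable_funX.
have E t : modulus (f t) ^+ 2 = fRe f t ^+ 2 + fIm f t ^+ 2 by rewrite modulus_sqr.
have pm : pin (fun t => fRe f t ^+ 2 + fIm f t ^+ 2).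
  apply: pinE; first exact: measurable_funD.
  apply: le_lt_trans fin; rewrite le_eqVlt; apply/orP; left; apply/eqP.
  by apply: eq_integral => t _; rewrite E ger0_norm// addr_ge0 ?sqr_ge0.
split; split => //; apply: pin_le pm => // t _; rewrite ger0_norm ?sqr_ge0//.
  by rewrite lerDl sqr_ge0.
by rewrite lerDr sqr_ge0.
Qed.

Lemma L2norm_sqr f : sqint (fRe f) -> sqint (fIm f) ->
  L2norm f ^+ 2 = nsq (fRe f) + nsq (fIm f).
Proof.
move=> sR sI; rewrite /L2norm sqr_sqrtr; last by apply: pint_ge0 => t _; exact: sqr_ge0.
rewrite !nsqE -pintD; [|exact: sR.2|exact: sI.2].
by apply: eq_pint => t _; rewrite modulus_sqr.
Qed.

Lemma Re_inner f g : sqint (fRe f) -> sqint (fIm f) -> sqint (fRe g) -> sqint (fIm g) ->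
  complex.Re (inner f g) = ip (fRe f) (fRe g) + ip (fIm f) (fIm g).
Proof.
move=> sf sf' sg sg'; rewrite /inner /Cintegral /=.
rewrite /ip -pintD; [|exact: sqint_mul..].
apply: eq_pint => t _; rewrite ReM /fRe /fIm; case: (g t) => a b /=; ring.
Qed.

Lemma S0_parts gamma f t :
  S0 gamma f t = Complex (kop (symm_kernel gamma) (fRe f) t) (kop (symm_kernel gamma) (fIm f) t).
Proof.
rewrite /S0 /Cintegral /kop /ip; congr Complex; apply: eq_pint => s _; rewrite ?ReM ?ImM/=.
  by rewrite mul0r subr0.
by rewrite mul0r addr0.
Qed.

End ComplexParts.

Section TrigSpace.
Context {R : realType}.
Local Notation C := R[i].
Implicit Types (f g : R -> R) (F G : R -> C) (t : R) (n : nat).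

Definition rspan (N : nat) f : Prop := exists c : nat -> R, forall t, f t = \sum_(i < N) c i * ebas i t.

Lemma rspanD N f g : rspan N f -> rspan N g -> rspan N (fun t => f t + g t).
Proof.
move=> [c Hc] [d Hd]; exists (fun i => c i + d i) => t; rewrite Hc Hd -big_split/=.
by apply: eq_bigr => i _; rewrite mulrDl.
Qed.

Lemma rspanZ N f (a : R) : rspan N f -> rspan N (fun t => a * f t).
Proof.
move=> [c Hc]; exists (fun i => a * c i) => t; rewrite Hc mulr_sumr.
by apply: eq_bigr => i _; rewrite mulrA.
Qed.

Lemma rspan0 N : rspan N (fun=> 0).
Proof. by exists (fun=> 0) => t; rewrite big1// => i _; rewrite mul0r. Qed.

Lemma rspan_ebas N i : (i < N)%N -> rspan N (ebas i).
Proof.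
move=> iN; exists (fun j => (j == i)%:R) => t.
rewrite (bigD1 (Ordinal iN))//= eqxx mul1r big1 ?addr0// => j ji.
by rewrite (_ : (j == i :> nat) = false) ?mul0r//; apply: negbTE; exact: ji.
Qed.

Lemma rspan_sum N m (F : nat -> R -> R) : (forall j, (j < m)%N -> rspan N (F j)) ->
  rspan N (fun t => \sum_(j < m) F j t).
Proof.
elim: m => [|m IH] H; first by under eq_fun do rewrite big_ord0; exact: rspan0.
under eq_fun do rewrite big_ord_recr; apply: rspanD; last exact: H.
by apply: IH => j jm; apply: H; exact: ltnW.
Qed.

Lemma frq_even m : frq m.*2 = m%:R :> R. Proof. by rewrite /frq uphalf_double. Qed.
Lemma frq_odd m : frq m.*2.+1 = m.+1%:R :> R. Proof. by rewrite /frq uphalfE -doubleS doubleK. Qed.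

Lemma ebas_cos m t : ebas m.*2 t = ecoef m.*2 * cos (m%:R * t) :> R.
Proof. by rewrite /ebas odd_double frq_even. Qed.

Lemma ebas_sin m t : ebas m.*2.+1 t = ecoef m.*2.+1 * sin (m.+1%:R * t) :> R.
Proof. by rewrite /ebas /= odd_double frq_odd. Qed.

Lemma ecoefN0 i : ecoef i != 0 :> R. Proof. by rewrite gt_eqF// ecoef_gt0. Qed.

Lemma rspan_harmonic n m : (m <= n)%N ->
  rspan (2 * n).+1 (fun t => cos (m%:R * t)) /\ rspan (2 * n).+1 (fun t => sin (m%:R * t)).
Proof.
move=> mn; split.
- have -> : (fun t => cos (m%:R * t)) = (fun t : R => (ecoef m.*2)^-1 * ebas m.*2 t).
    by apply/funext => t; rewrite ebas_cos mulKf// ecoefN0.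
  by apply: rspanZ; apply: rspan_ebas; rewrite mul2n ltnS leq_double.
- case: m mn => [|m] mn.
    by under eq_fun do rewrite mul0r sin0; exact: rspan0.
  have -> : (fun t => sin (m.+1%:R * t)) = (fun t : R => (ecoef m.*2.+1)^-1 * ebas m.*2.+1 t).
    by apply/funext => t; rewrite ebas_sin mulKf// ecoefN0.
  by apply: rspanZ; apply: rspan_ebas; rewrite mul2n ltnS ltn_double.
Qed.

Lemma harmonic_of_shifted_index (j n : nat) : exists m, [/\ (m <= maxn n (j - n))%N &
  (forall t : R, cos ((j%:Z - n%:Z)%:~R * t) = cos (m%:R * t)) /\
  ((forall t : R, sin ((j%:Z - n%:Z)%:~R * t) = sin (m%:R * t)) \/
   (forall t : R, sin ((j%:Z - n%:Z)%:~R * t) = - sin (m%:R * t)))].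
Proof.
have [nj|/ltnW jn] := leqP n j.
- exists (j - n)%N; split; first by rewrite leq_maxr.
  by rewrite subzn//; split; [|left].
- exists (n - j)%N; split; first by rewrite leq_max leq_subr.
  rewrite -opprB subzn// rmorphN/=; split; [|right].
  + by move=> t; rewrite mulNr cosN.
  + by move=> t; rewrite mulNr sinN.
Qed.

Lemma trig_space_parts n F : trig_space n F -> rspan (2 * n).+1 (fRe F) /\ rspan (2 * n).+1 (fIm F).
Proof.
move=> [c Hc].
have ReS m (a : nat -> C) : complex.Re (\sum_(j < m) a j) = \sum_(j < m) complex.Re (a j).
  by elim: m => [|m IH]; rewrite ?big_ord0// !big_ord_recr/= -IH; case: (\sum_(_ < _) _) => ? ?; case: (a m).
have ImS m (a : nat -> C) : complex.Im (\sum_(j < m) a j) = \sum_(j < m) complex.Im (a j).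
  by elim: m => [|m IH]; rewrite ?big_ord0// !big_ord_recr/= -IH; case: (\sum_(_ < _) _) => ? ?; case: (a m).
have H j : (j < (2 * n).+1)%N -> rspan (2 * n).+1 (fun t => cos ((j%:Z - n%:Z)%:~R * t)) /\
    rspan (2 * n).+1 (fun t => sin ((j%:Z - n%:Z)%:~R * t)).
  move=> jn; have [m [mn [hc hs]]] := harmonic_of_shifted_index j n.
  have {}mn : (m <= n)%N.
    by apply: leq_trans mn _; rewrite geq_max leqnn leq_subLR addnn -mul2n -ltnS.
  have [h1 h2] := rspan_harmonic mn; split.
    by under eq_fun do rewrite hc.
  case: hs => hs; first by under eq_fun do rewrite hs.
  by under eq_fun do rewrite hs -mulN1r; exact: rspanZ.
split.
- have -> : fRe F = fun t => \sum_(j < (2 * n).+1)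
    (complex.Re (c (j%:Z - n%:Z)) * cos ((j%:Z - n%:Z)%:~R * t) +
     (- complex.Im (c (j%:Z - n%:Z))) * sin ((j%:Z - n%:Z)%:~R * t)).
    apply/funext => t; rewrite /fRe Hc (ReS _ (fun j => c (j%:Z - n%:Z) * cexp (j%:Z - n%:Z) t)).
    by apply: eq_bigr => j _; rewrite ReM/= mulNr.
  apply: (rspan_sum (F := fun j t => complex.Re (c (j%:Z - n%:Z)) * cos ((j%:Z - n%:Z)%:~R * t) +
     (- complex.Im (c (j%:Z - n%:Z))) * sin ((j%:Z - n%:Z)%:~R * t))).
  by move=> j /H[h1 h2]; apply: rspanD; exact: rspanZ.
- have -> : fIm F = fun t => \sum_(j < (2 * n).+1)
    (complex.Im (c (j%:Z - n%:Z)) * cos ((j%:Z - n%:Z)%:~R * t) +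
     complex.Re (c (j%:Z - n%:Z)) * sin ((j%:Z - n%:Z)%:~R * t)).
    apply/funext => t; rewrite /fIm Hc (ImS _ (fun j => c (j%:Z - n%:Z) * cexp (j%:Z - n%:Z) t)).
    by apply: eq_bigr => j _; rewrite ImM/= addrC.
  apply: (rspan_sum (F := fun j t => complex.Im (c (j%:Z - n%:Z)) * cos ((j%:Z - n%:Z)%:~R * t) +
     complex.Re (c (j%:Z - n%:Z)) * sin ((j%:Z - n%:Z)%:~R * t))).
  by move=> j /H[h1 h2]; apply: rspanD; exact: rspanZ.
Qed.

Lemma trig_spaceD n F G : trig_space n F -> trig_space n G -> trig_space n (fun t => F t + G t).
Proof.
move=> [c Hc] [d Hd]; exists (fun k => c k + d k) => t; rewrite Hc Hd -big_split/=.
by apply: eq_bigr => i _; rewrite mulrDl.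
Qed.

Lemma trig_spaceZ n F (a : C) : trig_space n F -> trig_space n (fun t => a * F t).
Proof.
move=> [c Hc]; exists (fun k => a * c k) => t; rewrite Hc mulr_sumr.
by apply: eq_bigr => i _; rewrite mulrA.
Qed.

Lemma trig_space_cexp n (k : int) : - n%:Z <= k <= n%:Z -> trig_space n (cexp k : R -> C).
Proof.
move=> /andP[k1 k2]; exists (fun l => (l == k)%:R) => t.
have k3 : 0 <= k + n%:Z by rewrite -lerBlDr sub0r.
have [j jE] : exists j : nat, k + n%:Z = j%:Z by move: k3; case: (k + n%:Z) => [j _|//]; exists j.
have jn : (j < (2 * n).+1)%N.
  by rewrite ltnS -lez_nat -jE mul2n -addnn PoszD lerD2r.
have kE : k = j%:Z - n%:Z by rewrite -jE addrK.
rewrite (bigD1 (Ordinal jn))//= -kE eqxx mul1r big1 ?addr0// => i ij.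
rewrite (_ : (i%:Z - n%:Z == k) = false) ?mul0r//; apply/negbTE; apply: contra ij.
by rewrite kE (inj_eq (addIr _)) => /eqP[h]; apply/eqP/val_inj.
Qed.

Lemma trig_space_ebas n i : (i < (2 * n).+1)%N -> trig_space n (fun t => Complex (ebas i t) 0 : C).
Proof.
move=> iN; have : (uphalf i <= n)%N.
  by rewrite leq_uphalf_double -mul2n.
move=> un; set k := (uphalf i)%:Z.
have k1 : trig_space n (cexp k : R -> C).
  by apply: trig_space_cexp; rewrite /k lez_nat un andbT; apply: (@le_trans _ _ 0) => //; rewrite oppr_le0.
have k2 : trig_space n (cexp (- k) : R -> C).
  by apply: trig_space_cexp; rewrite lerN2 /k lez_nat un/=; apply: (@le_trans _ _ 0) => //; rewrite oppr_le0.
pose a : R := ecoef i / 2.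
have := trig_spaceD (trig_spaceZ (if odd i then Complex 0 (- a) else Complex a 0) k1)
  (trig_spaceZ (if odd i then Complex 0 a else Complex a 0) k2).
congr (trig_space n _); apply/funext => t; rewrite /ebas /cexp /frq rmorphN/= mulNr cosN sinN.
have -> : ((k%:~R : R) = (uphalf i)%:R) by [].
apply/eqP; rewrite eq_complex; case: (odd i) => /=; rewrite /a; apply/andP; split; apply/eqP; by field.
Qed.

Lemma trig_space_real n f : rspan (2 * n).+1 f ->
  trig_space n (fun t => Complex (f t) 0 : C) /\ trig_space n (fun t => Complex 0 (f t) : C).
Proof.
move=> [c Hc].
have H : trig_space n (fun t => Complex (f t) 0 : C).
  have -> : (fun t => Complex (f t) 0 : C) = (fun t => \sum_(i < (2 * n).+1) Complex (c i) 0 * Complex (ebas i t) 0).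
    apply/funext => t; rewrite Hc; elim: ((2 * n).+1) => [|m IH]; first by rewrite !big_ord0.
    rewrite !big_ord_recr/= -IH; apply/eqP; rewrite eq_complex/=; apply/andP; split; apply/eqP; ring.
  have K m : (m <= (2 * n).+1)%N -> trig_space n (fun t => \sum_(i < m) Complex (c i) 0 * Complex (ebas i t) 0 : C).
    elim: m => [|m IH] mn.
      by exists (fun=> 0) => t; rewrite big_ord0 big1// => j _; rewrite mul0r.
    under eq_fun do rewrite big_ord_recr; apply: trig_spaceD; first by apply: IH; exact: ltnW.
    by apply: trig_spaceZ; exact: trig_space_ebas.
  exact: K.
split => //; have := trig_spaceZ (Complex 0 1) H; congr (trig_space n _); apply/funext => t.
by apply/eqP; rewrite eq_complex/=; apply/andP; split; apply/eqP; ring.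
Qed.

End TrigSpace.

(** * Fourier tails in Sobolev spaces *)

Section SobolevTail.
Context {R : realType}.
Local Notation C := R[i].
Implicit Types (f : R -> C) (t : R).

Let q f (i : nat) : R := ip (fRe f) (ebas i) ^+ 2 + ip (fIm f) (ebas i) ^+ 2.

Lemma modulus_divr (z : C) (r : R) : modulus (z / r%:C%C) ^+ 2 = modulus z ^+ 2 / r ^+ 2.
Proof.
rewrite -fmorphV !modulus_sqr ReM ImM /=; case: z => a b /=.
by rewrite !mulr0 subr0 add0r !exprMn exprVn mulrDl.
Qed.

(** The energy of the two real modes of one frequency is, up to normalization, that of the two
    complex modes. *)
Lemma fourier_pair f m : sqint (fRe f) -> sqint (fIm f) ->
  modulus (fourier f m.+1%:Z) ^+ 2 + modulus (fourier f (- m.+1%:Z)) ^+ 2 =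
  (2 * pi)^-1 * (q f m.*2.+1 + q f m.*2.+2).
Proof.
move=> sR sI; pose cs t : R := cos (m.+1%:R * t); pose sn t : R := sin (m.+1%:R * t).
have scs : sqint cs by apply: sqint_cts; exact: cts_cosM.
have ssn : sqint sn by apply: sqint_cts; exact: cts_sinM.
have sp0 : 0 < Num.sqrt pi :> R by rewrite sqrtr_gt0 pi_gt0.
have ec : (fun t => cs t) = (fun t => Num.sqrt pi * ebas m.*2.+2 t).
  apply/funext => t; rewrite -doubleS ebas_cos /ecoef doubleS/= mulVKf// gt_eqF//.
have es : (fun t => sn t) = (fun t => Num.sqrt pi * ebas m.*2.+1 t).
  by apply/funext => t; rewrite ebas_sin /ecoef /= mulVKf// gt_eqF.
have ipc g : sqint g -> ip g cs = Num.sqrt pi * ip g (ebas m.*2.+2).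
  by move=> sg; rewrite -[cs]/(fun t => cs t) ec ipC (ipZl _ (@ebas_sqint R _) sg) ipC.
have ips g : sqint g -> ip g sn = Num.sqrt pi * ip g (ebas m.*2.+1).
  by move=> sg; rewrite -[sn]/(fun t => sn t) es ipC (ipZl _ (@ebas_sqint R _) sg) ipC.
have pRc := sqint_mul sR scs; have pRs := sqint_mul sR ssn.
have pIc := sqint_mul sI scs; have pIs := sqint_mul sI ssn.
have m1 : modulus (fourier f m.+1%:Z) ^+ 2 =
    ((ip (fRe f) cs + ip (fIm f) sn) ^+ 2 + (ip (fIm f) cs - ip (fRe f) sn) ^+ 2) / (2 * pi) ^+ 2.
  rewrite /fourier modulus_divr modulus_sqr /Cintegral /=; congr ((_ ^+ 2 + _ ^+ 2) / _).
    rewrite /ip -pintD//; apply: eq_pint => t _; rewrite ReM /cexp /= rmorphN/= mulNr cosN sinN.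
    by rewrite /fRe /fIm /cs /sn mulrN opprK.
  rewrite /ip -pintB//; apply: eq_pint => t _; rewrite ImM /cexp /= rmorphN/= mulNr cosN sinN.
  by rewrite /fRe /fIm /cs /sn mulrN addrC.
have m2 : modulus (fourier f (- m.+1%:Z)) ^+ 2 =
    ((ip (fRe f) cs - ip (fIm f) sn) ^+ 2 + (ip (fIm f) cs + ip (fRe f) sn) ^+ 2) / (2 * pi) ^+ 2.
  rewrite /fourier modulus_divr modulus_sqr /Cintegral /= opprK; congr ((_ ^+ 2 + _ ^+ 2) / _).
    by rewrite /ip -pintB//; apply: eq_pint => t _; rewrite ReM /cexp /=.
  by rewrite /ip -pintD//; apply: eq_pint => t _; rewrite ImM /cexp /= addrC.
rewrite m1 m2 !ipc// !ips// /q.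
have P0 : pi != 0 :> R by rewrite gt_eqF// pi_gt0.
have := sqr_sqrtr (ltW (pi_gt0 R)); move: P0.
set a := ip (fRe f) (ebas m.*2.+2); set b := ip (fIm f) (ebas m.*2.+1).
set c := ip (fIm f) (ebas m.*2.+2); set d := ip (fRe f) (ebas m.*2.+1).
set s := Num.sqrt pi; clearbody a b c d s; move: (pi : R) => P P0 sP.
have -> : ((s * a + s * b) ^+ 2 + (s * c - s * d) ^+ 2) / (2 * P) ^+ 2 +
   ((s * a - s * b) ^+ 2 + (s * c + s * d) ^+ 2) / (2 * P) ^+ 2 =
   2 * s ^+ 2 * (a ^+ 2 + b ^+ 2 + c ^+ 2 + d ^+ 2) / (2 * P) ^+ 2 by ring.
rewrite sP; by field.
Qed.

Lemma sobolev_partial (r : R) f (n N : nat) : (sobolev_sum r f < +oo)%E ->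
  \sum_(n <= m < N) ((1 + m.+1%:R ^+ 2) `^ r *
    (modulus (fourier f m.+1%:Z) ^+ 2 + modulus (fourier f (- m.+1%:Z)) ^+ 2)) <=
  fine (sobolev_sum r f).
Proof.
move=> fin.
pose w (k : int) : R := (1 + (k%:~R) ^+ 2) `^ r * (modulus (fourier f k)) ^+ 2.
have w0 k : 0 <= w k by rewrite mulr_ge0 ?powR_ge0 ?sqr_ge0.
pose s : seq int := [seq m.+1%:Z | m <- index_iota n N] ++ [seq - m.+1%:Z | m <- index_iota n N].
have us : uniq s.
  rewrite cat_uniq !map_inj_uniq ?iota_uniq/= ?andbT//.
  - by apply/hasPn => k /mapP[m _ ->]; apply/negP => /mapP[m' _].
  - by move=> x y /oppr_inj [].
  - by move=> x y [].
have fin' : (sobolev_sum r f \is a fin_num).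
  by rewrite ge0_fin_numE//; apply: esum_ge0 => k _; rewrite lee_fin; exact: w0.
rewrite -lee_fin fineK//; apply: esum_ge; exists [set` s].
  by split => //; exact: finite_seq.
rewrite -fsbig_seq//= sumEFin lee_fin big_cat/= !big_map -big_split/=.
rewrite le_eqVlt; apply/orP; left; apply/eqP; apply: eq_bigr => m _.
by rewrite /w rmorphN/= sqrrN mulrDr.
Qed.

(** For frequencies k > n, the weight (1 + k^2)^r is at least n^(2r). *)
Lemma sobolev_tail (r : R) f (n : nat) : 0 <= r -> (0 < n)%N -> sqint (fRe f) -> sqint (fIm f) ->
  (sobolev_sum r f < +oo)%E ->
  (nsq (fRe f) - \sum_(i < (2 * n).+1) ip (fRe f) (ebas i) ^+ 2) +
  (nsq (fIm f) - \sum_(i < (2 * n).+1) ip (fIm f) (ebas i) ^+ 2) <=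
  2 * pi * (((n%:R `^ r)^-1) ^+ 2 * fine (sobolev_sum r f)).
Proof.
move=> r0 n0 sR sI fin; set S := fine _.
have nr0 : 0 < (n%:R : R) `^ r by rewrite powR_gt0// ltr0n.
have part N : (n <= N)%N -> \sum_(i < N.*2.+1) q f i - \sum_(i < n.*2.+1) q f i <=
    2 * pi * (((n%:R `^ r)^-1) ^+ 2 * S).
  move=> nN.
  have -> : \sum_(i < N.*2.+1) q f i - \sum_(i < n.*2.+1) q f i =
      \sum_(n <= m < N) (q f m.*2.+1 + q f m.*2.+2).
    elim: N nN => [|N IH]; first by rewrite leqn0 => /eqP->; rewrite subrr big_geq.
    rewrite leq_eqVlt => /predU1P[->|nN]; first by rewrite subrr big_geq.
    rewrite big_nat_recr//= -IH// doubleS !big_ord_recr/=; ring.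
  apply: le_trans (_ : \sum_(n <= m < N) 2 * pi * (((n%:R `^ r)^-1) ^+ 2 * ((1 + m.+1%:R ^+ 2) `^ r *
    (modulus (fourier f m.+1%:Z) ^+ 2 + modulus (fourier f (- m.+1%:Z)) ^+ 2))) <= _).
    apply: ler_sum_nat => m /andP[nm _]; rewrite fourier_pair//.
    set Q := q f _ + q f _.
    have Q0 : 0 <= Q by rewrite /Q /q !addr_ge0// sqr_ge0.
    have E : Q = 2 * pi * ((2 * pi)^-1 * Q) by rewrite mulVKf// gt_eqF// twopi_gt0.
    rewrite {1}E ler_wpM2l ?(ltW (@twopi_gt0 R))// mulrA ler_peMl ?mulr_ge0 ?invr_ge0 ?(ltW (@twopi_gt0 R))//.
    rewrite exprVn ler_pdivlMl ?exprn_gt0// mulr1.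
    rewrite expr2 -powRM ?ler0n//; apply: ge0_ler_powR; rewrite ?nnegrE ?mulr_ge0 ?addr_ge0 ?sqr_ge0//.
    rewrite -expr2; apply: le_trans (_ : m.+1%:R ^+ 2 <= _); last by rewrite lerDr.
    by rewrite lerXn2r ?nnegrE// ler_nat ltnW.
  rewrite -!mulr_sumr ler_wpM2l ?(ltW (@twopi_gt0 R))// ler_wpM2l ?sqr_ge0//.
  exact: sobolev_partial.
apply/ler_addgt0Pr => e e0; have e2 : 0 < e / 2 by rewrite divr_gt0.
have [N1 H1] := parseval sR e2; have [N2 H2] := parseval sI e2.
pose N := (n + N1 + N2)%N.
have nN : (n <= N)%N by rewrite /N -addnA leq_addr.
have NN : (N <= N.*2.+1)%N by rewrite -addnn -addSn leq_addl.
have h1 := H1 N.*2.+1 (leq_trans (_ : N1 <= N)%N NN); have h2 := H2 N.*2.+1 (leq_trans (_ : N2 <= N)%N NN).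
have {}h1 := h1 (leq_trans (leq_addl _ _) (leq_addr _ _)).
have {}h2 := h2 (leq_addl _ _).
have := part N nN; rewrite /q !big_split/= mul2n; lra.
Qed.

End SobolevTail.

(** * The error of the least squares method *)

Section RealLeastSquares.
Context {R : realType}.
Implicit Types (f x g : R -> R).
Variables (k : R -> R -> R) (A B : R).
Hypothesis A0 : 0 < A.
Hypothesis B0 : 0 < B.
Hypothesis ksq : forall t, period t -> sqint (k t).
Hypothesis kopsq : forall psi, sqint psi -> sqint (kop k psi).
Hypothesis high : forall psi m, sqint psi -> (forall i, (i < m)%N -> ip psi (ebas i) = 0) ->
  nsq (kop k psi) <= A / m.+1%:R ^+ 2 * nsq psi.
Hypothesis low : forall (n : nat) (c : nat -> R), (0 < n)%N ->
  nsq (fun t => \sum_(i < n) c i * ebas i t) <=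
  B * n%:R ^+ 2 * nsq (kop k (fun t => \sum_(i < n) c i * ebas i t)).

Lemma eq_nsq f g : (forall t, period t -> f t = g t) -> nsq f = nsq g.
Proof. by move=> H; apply: eq_pint => t Pt; rewrite H. Qed.

Lemma kopB f g t : period t -> sqint f -> sqint g ->
  kop k (fun t => f t - g t) t = kop k f t - kop k g t.
Proof.
by move=> Pt sf sg; rewrite /kop ipC (ipBl sf sg (ksq Pt)) (ipC f) (ipC g).
Qed.

(** Let p be the projection of x and u the difference between the least squares solution and p. By
    the normal equations K u is a projection of gd - K p, which consists of the data error and of K
    (x - p), of the order of |x - p| / n. The lower bound of K on trigonometric polynomials bounds
    u at the cost of a factor n. *)
Lemma real_least_squares x gd (c : nat -> R) (n : nat) : (0 < n)%N -> sqint x -> sqint gd ->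
  (forall d : nat -> R, ip (fun t => gd t - kop k (fun t => \sum_(i < (2 * n).+1) c i * ebas i t) t)
    (kop k (fun t => \sum_(i < (2 * n).+1) d i * ebas i t)) = 0) ->
  nsq (fun t => x t - \sum_(i < (2 * n).+1) c i * ebas i t) <=
  (2 + 4 * A * B) * (nsq x - \sum_(i < (2 * n).+1) ip x (ebas i) ^+ 2) +
  36 * B * (n%:R ^+ 2 * nsq (fun t => gd t - kop k x t)).
Proof.
set N := (2 * n).+1 => n0 sx sg orth.
pose xn t := \sum_(i < N) c i * ebas i t.
pose p t := \sum_(i < N) ip x (ebas i) * ebas i t.
pose u t := \sum_(i < N) (c i - ip x (ebas i)) * ebas i t.
have sxn : sqint xn by exact: sqint_comb.
have sp : sqint p := sqint_comb N (fun i => ip x (ebas i)).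
have su : sqint u := sqint_comb N (fun i => c i - ip x (ebas i)).
have uE t : u t = xn t - p t.
  by rewrite /u /xn /p -sumrB; apply: eq_bigr => i _; rewrite mulrBl.
have skx := kopsq sx; have skp := kopsq sp; have skxn := kopsq sxn; have sku := kopsq su.
have sxp := sqintB sx sp.
have skxp := kopsq sxp.
have tail : nsq (fun t => x t - p t) = nsq x - \sum_(i < N) ip x (ebas i) ^+ 2 by exact: parseval_nsq.
set T := nsq x - _ in tail *.
have T0 : 0 <= T by rewrite -tail nsq_ge0.
set E := nsq (fun t => gd t - kop k x t).
have E0 : 0 <= E by exact: nsq_ge0.
have Ku t : period t -> kop k u t = kop k xn t - kop k p t.
  move=> Pt; rewrite -kopB//; congr (kop k _ t); apply/funext => s; exact: uE.
(* The normal equations replace the residual gd - K p by K u when it is tested with K u. *)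
have h1 : nsq (kop k u) <= nsq (fun t => gd t - kop k p t).
  have e1 : nsq (kop k u) = ip (fun t => gd t - kop k p t) (kop k u).
    have o := orth (fun i => c i - ip x (ebas i)); rewrite -/xn -/u in o.
    have -> : nsq (kop k u) = ip (fun t => (gd t - kop k p t) - (gd t - kop k xn t)) (kop k u).
      by apply: eq_pint => t Pt; rewrite {1}Ku//; congr (_ * _); ring.
    by rewrite (ipBl (sqintB sg skp) (sqintB sg skxn) sku) o subr0.
  have := cauchy_schwarz (sqintB sg skp) sku; rewrite -e1.
  have := nsq_ge0 (kop k u); have := nsq_ge0 (fun t => gd t - kop k p t).
  move: (nsq (kop k u)) (nsq _) => a b b0 a0 h.
  have [->//|aN] := eqVneq a 0; have a1 : 0 < a by rewrite lt_neqAle eq_sym aN.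
  by move: h; rewrite expr2 ler_pM2r.
have h2 : nsq (fun t => gd t - kop k p t) <= 2 * E + 2 * (A / (2 * n).+2%:R ^+ 2 * T).
  rewrite (@eq_nsq _ (fun t => (gd t - kop k x t) + kop k (fun t => x t - p t) t)); last first.
    by move=> t Pt; rewrite kopB//; ring.
  apply: le_trans (nsqD_le (sqintB sg skx) skxp) _; rewrite lerD2l ler_wpM2l// -tail.
  apply: high => // i iN; rewrite (ipBl sx sp (@ebas_sqint R i)).
  by rewrite (ip_comb_ebas N (fun i => ip x (ebas i))) iN subrr.
have h3 : nsq u <= B * N%:R ^+ 2 * nsq (kop k u) := @low N (fun i => c i - ip x (ebas i)) isT.
have h4 : nsq (fun t => x t - xn t) <= 2 * T + 2 * nsq u.
  rewrite (@eq_nsq _ (fun t => (x t - p t) + (-1) * u t)); last first.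
    by move=> t _; rewrite uE; ring.
  apply: le_trans (nsqD_le sxp (sqintZ (-1) su)) _.
  by rewrite tail nsqZ// sqrrN expr1n mul1r.
have N3 : (N%:R : R) ^+ 2 <= 9 * n%:R ^+ 2.
  have -> : 9 * n%:R ^+ 2 = (3 * n%:R) ^+ 2 :> R by ring.
  rewrite ler_sqr ?nnegrE ?mulr_ge0// /N -natrM ler_nat.
  by rewrite -[3%N]/(2 + 1)%N mulnDl mul1n -addn1 leq_add2l.
have NN : (N%:R : R) ^+ 2 * ((2 * n).+2%:R ^+ 2)^-1 <= 1.
  by rewrite ler_pdivrMr ?exprn_gt0// mul1r ler_sqr ?nnegrE// ler_nat.
have N0 : 0 <= (N%:R : R) ^+ 2 by rewrite exprn_ge0.
apply: le_trans h4 _.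
have h5 : nsq u <= B * N%:R ^+ 2 * (2 * E + 2 * (A / (2 * n).+2%:R ^+ 2 * T)).
  apply: le_trans h3 _; rewrite ler_wpM2l ?mulr_ge0 ?(ltW B0)//; exact: le_trans h1 h2.
move: N3 NN N0 h5; move: (N%:R ^+ 2 : R) (n%:R ^+ 2 : R) (((2 * n).+2%:R ^+ 2)^-1 : R) (nsq u) => a b d U N3 NN N0 h5.
have k1 : B * (a * E) <= B * (9 * b * E) := ler_wpM2l (ltW B0) (ler_wpM2r E0 N3).
have k2 : A * B * T * (a * d) <= A * B * T * 1 by rewrite ler_wpM2l// !mulr_ge0// ltW.
have e5 : B * a * (2 * E + 2 * (A * d * T)) = 2 * (B * (a * E)) + 2 * (A * B * T * (a * d)) by ring.
rewrite e5 in h5.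
have -> : (2 + 4 * A * B) * T + 36 * B * (b * E) = 2 * T + 4 * (A * B * T * 1) + 4 * (B * (9 * b * E)) by ring.
lra.
Qed.

End RealLeastSquares.

Section MainTheorem.
Context {R : realType}.
Local Notation mu := (@lebesgue_measure R).

Lemma kop0 (k : R -> R -> R) : kop k (fun=> 0) = fun=> 0.
Proof.
by apply/funext => t; rewrite /kop /ip; under eq_pint do rewrite mulr0; rewrite pint_cst mul0r.
Qed.

Lemma ip0r (f : R -> R) : ip f (fun=> 0) = 0.
Proof. by rewrite /ip; under eq_pint do rewrite mulr0; rewrite pint_cst mul0r. Qed.

Lemma nsq_eq_ae (f g : R -> R) : sqint f -> sqint g -> {ae mu, forall t, period t -> f t = g t} ->
  nsq f = nsq g.
Proof.
move=> sf sg fg; apply: pint_eq_ae; [exact: sqint_mul|exact: sqint_mul|].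
case: fg => N [mN N0 sub]; exists N; split => // t /= h; apply: sub => /= hh; apply: h => Pt.
by rewrite hh.
Qed.

Lemma le_of_sqr_le (D1 D2 z x y : R) : 0 <= D1 -> 0 <= D2 -> 0 <= z -> 0 <= x -> 0 <= y ->
  z ^+ 2 <= D1 * x ^+ 2 + D2 * y ^+ 2 -> z <= (D1 + D2 + 1) * (y + x).
Proof.
move=> D10 D20 z0 x0 y0 h; set c := D1 + D2 + 1.
have c1 : 1 <= c by rewrite /c; lra.
have c0 : 0 <= c by lra.
have cc : c <= c ^+ 2 by rewrite expr2 ler_peMl.
have D1c : D1 <= c ^+ 2 by apply: le_trans cc; rewrite /c; lra.
have D2c : D2 <= c ^+ 2 by apply: le_trans cc; rewrite /c; lra.
rewrite -ler_sqr ?nnegrE//; last by rewrite mulr_ge0 ?addr_ge0.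
apply: le_trans h _.
have e1 : D1 * x ^+ 2 <= c ^+ 2 * x ^+ 2 by rewrite ler_wpM2r ?sqr_ge0.
have e2 : D2 * y ^+ 2 <= c ^+ 2 * y ^+ 2 by rewrite ler_wpM2r ?sqr_ge0.
have e3 : 0 <= c ^+ 2 * (x * y) by rewrite !mulr_ge0 ?sqr_ge0.
have -> : (c * (y + x)) ^+ 2 =
    c ^+ 2 * x ^+ 2 + c ^+ 2 * y ^+ 2 + 2 * (c ^+ 2 * (x * y)) by ring.
apply: le_trans (lerD e1 e2) _; rewrite lerDl.
by rewrite mulr_ge0.
Qed.

(** The kernel is real, so the real and imaginary parts solve two real least squares problems;
    testing with real and with purely imaginary trigonometric polynomials separates the normal
    equations. *)
Lemma least_squares_error (gamma : R -> R * R) (r : R) :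
  regular_analytic_parametrization gamma -> 0 <= r ->
  exists c : R, 0 < c /\
    forall (g Psi : R -> R[i]) (delta : R) (gdelta : R -> R[i]) (n : nat) (Psin : R -> R[i]),
      L2 g -> Sobolev r Psi -> L2eq (S0 gamma Psi) g -> 0 <= delta -> L2 gdelta ->
      L2norm (fun t => gdelta t - g t) <= delta -> (1 <= n)%N ->
      least_squares_solution gamma n gdelta Psin ->
      L2norm (fun t => Psi t - Psin t)
        <= c * (n%:R * delta + (n%:R `^ r)^-1 * Sobolev_norm r Psi).
Proof.
move=> hgamma r0.
have [b [q0 [q00 sb pb [blog blog0] rhoD]]] := log_kernel_split hgamma.
have [ksq kopsq [A A0 high] [B B0 low]] := symm_operator_bounds hgamma q00 sb pb blog blog0 rhoD.
pose D1 : R := (2 + 4 * A * B) * (2 * pi); pose D2 : R := 36 * B.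
have D10 : 0 <= D1.
  by rewrite mulr_ge0 ?(ltW (@twopi_gt0 R))// addr_ge0// !mulr_ge0 ?(ltW A0) ?(ltW B0).
have D20 : 0 <= D2 by rewrite mulr_ge0 ?(ltW B0).
pose c : R := D1 + D2 + 1; have c1 : 1 <= c by rewrite /c; lra.
exists c; split; first by lra.
move=> g Psi delta gd n Psin L2g [L2P Sfin] SP delta0 L2gd gdd n1 [tP orth].
have [sPr sPi] := L2_sqint L2P; have [sgr sgi] := L2_sqint L2g; have [sdr sdi] := L2_sqint L2gd.
have [[cr Hr] [ci Hi]] := trig_space_parts tP.
set k := symm_kernel gamma in ksq kopsq high low.
have fr : fRe Psin = fun t => \sum_(i < (2 * n).+1) cr i * ebas i t by apply/funext.
have fi : fIm Psin = fun t => \sum_(i < (2 * n).+1) ci i * ebas i t by apply/funext.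
have snr : sqint (fRe Psin) by rewrite fr; exact: sqint_comb.
have sni : sqint (fIm Psin) by rewrite fi; exact: sqint_comb.
have S0r f : fRe (S0 gamma f) = kop k (fRe f) by apply/funext => t; rewrite /fRe S0_parts.
have S0i f : fIm (S0 gamma f) = kop k (fIm f) by apply/funext => t; rewrite /fIm S0_parts.
have z0 : sqint (fun=> 0 : R) by apply: sqint_cts; exact: cst_continuous.
have or (d : nat -> R) : ip (fun t => fRe gd t - kop k (fun t => \sum_(i < (2 * n).+1) cr i * ebas i t) t)
    (kop k (fun t => \sum_(i < (2 * n).+1) d i * ebas i t)) = 0.
  set p := fun t => \sum_(i < (2 * n).+1) d i * ebas i t.
  have sp : sqint p by exact: sqint_comb.
  have [tp _] : trig_space n (fun t => Complex (p t) 0) /\ trig_space n (fun t => Complex 0 (p t)).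
    by apply: trig_space_real; exists d.
  have := orth _ tp => /(congr1 (@complex.Re R)).
  have kp := kopsq _ sp; have kz := kopsq _ z0; have kn := kopsq _ snr; have kn' := kopsq _ sni.
  rewrite !Re_inner ?S0r ?S0i// !kop0 !ip0r !addr0 => h.
  by rewrite -fr (ipBl sdr kn kp) h subrr.
have oi (d : nat -> R) : ip (fun t => fIm gd t - kop k (fun t => \sum_(i < (2 * n).+1) ci i * ebas i t) t)
    (kop k (fun t => \sum_(i < (2 * n).+1) d i * ebas i t)) = 0.
  set p := fun t => \sum_(i < (2 * n).+1) d i * ebas i t.
  have sp : sqint p by exact: sqint_comb.
  have [_ tp] : trig_space n (fun t => Complex (p t) 0) /\ trig_space n (fun t => Complex 0 (p t)).
    by apply: trig_space_real; exists d.
  have := orth _ tp => /(congr1 (@complex.Re R)).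
  have kp := kopsq _ sp; have kz := kopsq _ z0; have kn := kopsq _ snr; have kn' := kopsq _ sni.
  rewrite !Re_inner ?S0r ?S0i// !kop0 !ip0r !add0r => h.
  by rewrite -fi (ipBl sdi kn' kp) h subrr.
have er := real_least_squares A0 B0 ksq kopsq high low n1 sPr sdr or.
have ei := real_least_squares A0 B0 ksq kopsq high low n1 sPi sdi oi.
have er0 : (fun t => fRe Psi t - \sum_(i < (2 * n).+1) cr i * ebas i t) = (fun t => fRe Psi t - fRe Psin t).
  by rewrite fr.
have ei0 : (fun t => fIm Psi t - \sum_(i < (2 * n).+1) ci i * ebas i t) = (fun t => fIm Psi t - fIm Psin t).
  by rewrite fi.
rewrite er0 in er; rewrite ei0 in ei.
have subRe (f h : R -> R[i]) t : fRe (fun t => f t - h t) t = fRe f t - fRe h t.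
  by rewrite /fRe; case: (f t) => ? ?; case: (h t).
have subIm (f h : R -> R[i]) t : fIm (fun t => f t - h t) t = fIm f t - fIm h t.
  by rewrite /fIm; case: (f t) => ? ?; case: (h t).
have subReE (f h : R -> R[i]) : fRe (fun t => f t - h t) = fun t => fRe f t - fRe h t by apply/funext.
have subImE (f h : R -> R[i]) : fIm (fun t => f t - h t) = fun t => fIm f t - fIm h t by apply/funext.
have data : nsq (fun t => fRe gd t - kop k (fRe Psi) t) + nsq (fun t => fIm gd t - kop k (fIm Psi) t) <= delta ^+ 2.
  have -> : nsq (fun t => fRe gd t - kop k (fRe Psi) t) = nsq (fun t => fRe gd t - fRe g t).
    apply: nsq_eq_ae; [exact: sqintB sdr (kopsq _ sPr)|exact: sqintB|].
    case: SP => Z [mZ Z0 sub]; exists Z; split => // t /= h; apply: sub => /= hh; apply: h => Pt.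
    by rewrite -S0r /fRe hh.
  have -> : nsq (fun t => fIm gd t - kop k (fIm Psi) t) = nsq (fun t => fIm gd t - fIm g t).
    apply: nsq_eq_ae; [exact: sqintB sdi (kopsq _ sPi)|exact: sqintB|].
    case: SP => Z [mZ Z0 sub]; exists Z; split => // t /= h; apply: sub => /= hh; apply: h => Pt.
    by rewrite -S0i /fIm hh.
  rewrite -subReE -subImE -L2norm_sqr ?subReE ?subImE; [|exact: sqintB..].
  by rewrite lerXn2r ?nnegrE// sqrtr_ge0.
have tail := sobolev_tail r0 n1 sPr sPi Sfin.
set Sob := fine (sobolev_sum r Psi) in tail.
have Sob0 : 0 <= Sob.
  apply: fine_ge0; apply: esum_ge0 => j _; rewrite lee_fin.
  by rewrite mulr_ge0 ?powR_ge0 ?sqr_ge0.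
have SobE : Sobolev_norm r Psi ^+ 2 = Sob by rewrite sqr_sqrtr.
have Sn0 : 0 <= Sobolev_norm r Psi by exact: sqrtr_ge0.
have total : L2norm (fun t => Psi t - Psin t) ^+ 2 <=
    D1 * (((n%:R `^ r)^-1) ^+ 2 * Sob) + D2 * (n%:R ^+ 2 * delta ^+ 2).
  rewrite L2norm_sqr ?subReE ?subImE; [|exact: sqintB..].
  apply: le_trans (lerD er ei) _.
  have AB0 : 0 <= 2 + 4 * A * B by rewrite addr_ge0// !mulr_ge0 ?(ltW A0) ?(ltW B0).
  have m1 := ler_wpM2l AB0 tail.
  have nn0 : 0 <= (n%:R : R) ^+ 2 by rewrite exprn_ge0.
  have m2 := ler_wpM2l D20 (ler_wpM2l nn0 data).
  have collect (Q Q' m p T1 T2 E1 E2 x y : R) :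
      Q * (T1 + T2) <= Q * (p * x) -> Q' * (m * (E1 + E2)) <= Q' * y ->
      Q * T1 + Q' * (m * E1) + (Q * T2 + Q' * (m * E2)) <= (Q * p) * x + Q' * y.
    by move=> q1 q2; rewrite -mulrA addrACA -!mulrDr; exact: lerD.
  exact: collect m1 m2.
have nr0 : 0 <= (n%:R `^ r)^-1 :> R by rewrite invr_ge0 powR_ge0.
have L0 : 0 <= L2norm (fun t => Psi t - Psin t) by exact: sqrtr_ge0.
rewrite -SobE -!exprMn in total.
have x0 : 0 <= (n%:R `^ r)^-1 * Sobolev_norm r Psi by exact: mulr_ge0.
have y0 : 0 <= n%:R * delta by exact: mulr_ge0.
exact: (le_of_sqr_le D10 D20 L0 x0 y0 total).
Qed.

End MainTheorem.

Unset Implicit Arguments.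

Theorem mainTheorem3 (R : realType) (Omega : set (R * R)) (gamma : R -> R * R)
  (hOmega : bounded_simply_connected_domain Omega)
  (hgamma : regular_analytic_parametrization gamma)
  (hboundary : boundary Omega = gamma @` `[0, 2 * pi[)
  (r : R) (hr : 0 <= r) :
  exists c : R, 0 < c /\
    forall (g Psi : R -> R[i]) (delta : R) (gdelta : R -> R[i])
           (n : nat) (Psin : R -> R[i]),
      Sobolev (r + 1) g ->
      Sobolev r Psi ->
      L2eq (S0 gamma Psi) g ->
      0 <= delta ->
      L2 gdelta ->
      L2norm (fun t => gdelta t - g t) <= delta ->
      (1 <= n)%N ->
      least_squares_solution gamma n gdelta Psin ->
      L2norm (fun t => Psi t - Psin t)
        <= c * (n%:R * delta + (n%:R `^ r)^-1 * Sobolev_norm r Psi).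
Proof.
have [c [c0 H]] := @least_squares_error R gamma r hgamma hr.
exists c; split => // g Psi delta gdelta n Psin [L2g _].
exact: H.
Qed.
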